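(* Let $(X_t)_{t\ge 0}$ be a regular jump Lévy process in $\mathbf{R}^d$ and let $V$ be a confining $X$-Kato class potential with Feynman--Kac semigroup $\{T_t: t\ge0\}$ (all terms as defined in the context). (1) If there exist a constant $C_{13}=C_{13}(X,V)$ and a radius $R>0$ such that $$\frac{V(x)}{|\log\nu(x)|}\ge C_{13},\qquad |x|\ge R,$$ then $\{T_t: t\ge0\}$ is $t_0$-GSD with $t_0=4/C_{13}$. (2) If $\{T_t: t\ge0\}$ is $t_0$-GSD, then for every $\varepsilon\in(0,1]$ there is $R_\varepsilon>0$ such that $$\frac{\sup_{y\in B(x,\varepsilon)}V(y)}{|\log\nu(x)|}\ge\frac{1}{2t_0},\qquad |x|\ge R_\varepsilon.$$
   Context: Conventions. $(X_t)_{t\ge0}$ is a Lévy process in $\mathbf{R}^d$, $d\ge1$; $\mathbf{P}^x,\mathbf{E}^x$ refer to the process started at $x$. $B(x,r)$ is the open ball; $\mathbf{1}$ is the function identically $1$. $C, C_i$ denote positive constants; $C(X,a,\dots)$ depends only on the process (and the dimension $d$) and on the listed parameters. $f\asymp Cg$ means $C^{-1}g\le f\le Cg$. Regular jump Lévy process: a Lévy process satisfying (A1)--(A3). (A1) $(X_t)$ is symmetric, its Lévy measure is absolutely continuous with a strictly positive density $\nu$, and: (1) for every $0<r\le 1/2$ there is $C_1=C_1(X,r)\ge1$ with $\nu(x)\asymp C_1\nu(y)$ for $r\le|y|\le|x|\le|y|+1$; (2) there is $C_2=C_2(X)\ge1$ with $\nu(x)\le C_2\nu(y)$ for $1/2\le|y|\le|x|$;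 (3) there is $C_3=C_3(X)\ge1$ with $\int_{|z-x|>1/2,\,|z-y|>1/2}\nu(x-z)\nu(z-y)\,dz\le C_3\nu(x-y)$ for $|y-x|\ge1$. (A2) $(X_t)$ is strong Feller, equivalently it has transition densities $p(t,x,y)=p(t,y-x)$ for $t>0$; moreover there are $t_b>0$ and a constant $C(X,t_b)$ with $0<p(t_b,x)\le C(X,t_b)$ for all $x\in\mathbf{R}^d$. (A3) For all $0<p<q<R\le1$, $\sup_{x\in B(0,p)}\sup_{y\in B(0,q)^c}G_{B(0,R)}(x,y)<\infty$, where for a bounded open set $D$, $G_D(x,y)=\int_0^\infty p_D(t,x,y)\,dt$ for $x,y\in D$ (and $0$ otherwise), and $p_D$ is the transition density of the process killed upon exiting $D$. Potentials. A Borel function $V:\mathbf{R}^d\to\mathbf{R}$ belongs to $\mathcal{K}^X$ if $\lim_{t\to0}\sup_x\mathbf{E}^x[\int_0^t|V(X_s)|ds]=0$, and to $\mathcal{K}^X_{\mathrm{loc}}$ if $V\mathbf{1}_B\in\mathcal{K}^X$ for every ball $B$. $V$ is an $X$-Kato class potential if $V_-\in\mathcal{K}^X$ and $V_+\in\mathcal{K}^X_{\mathrm{loc}}$. It is confining if also $V(x)\to\infty$ as $|x|\to\infty$. Feynman--Kac semigroup: $T_tf(x)=\mathbf{E}^x[e^{-\int_0^tV(X_s)ds}f(X_t)]$, $t>0$. Whenever $(X_t)$ is a regular jump Lévy process and $V$ is a confining $X$-Kato class potential, $\{T_t\}$ is a strongly continuous semigroup of symmetric compact operators on $L^2(\mathbf{R}^d)$;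 there is an orthonormal basis $\{\varphi_n\}_{n\ge0}$ of $L^2(\mathbf{R}^d)$ with $T_t\varphi_n=e^{-\lambda_nt}\varphi_n$, where $\lambda_0<\lambda_1\le\lambda_2\le\cdots\to\infty$; each $\varphi_n$ is bounded and continuous, and the ground state $\varphi_0$ is chosen strictly positive. $t_0$-GSD ($t_0$-ground state domination, $t_0>0$): there is a constant $C_{12}=C_{12}(X,V,t_0)$ with $T_{t_0}\mathbf{1}(x)\le C_{12}\varphi_0(x)$ for all $x\in\mathbf{R}^d$ (the semigroup property then extends this to all $t\ge t_0$). *)

(* Defs.v *)
From HB Require Import structures.
From mathcomp Require Import all_boot all_order all_algebra.
From mathcomp Require Import all_classical all_reals all_analysis.
From mathcomp Require Import measurable_realfun.
Set Implicit Arguments.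
Unset Strict Implicit.
Unset Printing Implicit Defensive.
Import Order.TTheory GRing.Theory Num.Theory.
Import numFieldNormedType.Exports.
Local Open Scope classical_set_scope.
Local Open Scope ring_scope.

(* The space R^d is 'rV[R]_d, with the product sigma-algebra: the one generated
   by the coordinates, as for n.-tuple.  It is the Borel sigma-algebra. *)
Section measurable_rV.
Context (R : realType) (n : nat).

Definition rV_coord (i : 'I_n) (v : 'rV[R]_n) : R := v ord0 i.

Let rV_set0 : g_sigma_preimage rV_coord set0.
Proof. exact: sigma_algebra0. Qed.

Let rV_setC A : g_sigma_preimage rV_coord A -> g_sigma_preimage rV_coord (~` A).
Proof. exact: sigma_algebraC. Qed.

Let rV_bigcup (F : (set 'rV[R]_n)^nat) :
  (forall i, g_sigma_preimage rV_coord (F i)) ->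
  g_sigma_preimage rV_coord (\bigcup_i (F i)).
Proof. exact: sigma_algebra_bigcup. Qed.

Definition rV_display : measure_display. Proof. exact. Qed.

HB.instance Definition _ := @isMeasurable.Build rV_display
  'rV[R]_n (g_sigma_preimage rV_coord) rV_set0 rV_setC rV_bigcup.

Lemma measurable_rV_coord (i : 'I_n) : measurable_fun [set: 'rV[R]_n] (rV_coord i).
Proof.
move=> _ Y mY; rewrite setTI; apply: sub_sigma_algebra => /=.
rewrite -bigcup_seq/=; exists i => /=; first by rewrite mem_index_enum.
by exists Y => //; rewrite setTI.
Qed.

Lemma measurable_fun_rV d (T : measurableType d) (f : T -> 'rV[R]_n) :
  (forall i, measurable_fun [set: T] (rV_coord i \o f)) ->
  measurable_fun [set: T] f.
Proof.
move=> mf; have : g_sigma_preimage (fun i => rV_coord i \o f) `<=` measurable.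
  apply: smallest_sub; first exact: sigma_algebra_measurable.
  rewrite -bigcup_seq; apply: bigcup_sub => i _ A [B mB <-]; exact: mf.
rewrite g_sigma_preimage_comp => mpre _ A mA; apply: mpre.
by exists A.
Qed.

End measurable_rV.

(* Lebesgue measure on R^n, by recursion on n: the image of the product measure
   on R * R^n under (x, v) |-> (x, v_1, ..., v_n). *)
Section lebesgue_rV.
Context (R : realType).
Local Open Scope ereal_scope.

Definition rV_cons n (u : R * 'rV[R]_n) : 'rV[R]_n.+1 :=
  \row_i (if unlift ord0 i is Some j then u.2 ord0 j else u.1).

Definition rV_uncons n (v : 'rV[R]_n.+1) : R * 'rV[R]_n :=
  (v ord0 ord0, \row_j v ord0 (lift ord0 j)).

Lemma rV_consK n : cancel (@rV_cons n) (@rV_uncons n).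
Proof.
move=> [x v]; rewrite /rV_uncons /rV_cons mxE unlift_none; congr pair.
by apply/rowP => j; rewrite !mxE liftK.
Qed.

Lemma measurable_rV_cons n : measurable_fun setT (@rV_cons n).
Proof.
apply: measurable_fun_rV => i; rewrite /rV_coord /comp.
under eq_fun do rewrite mxE.
case: unlift => [j|]; last exact: measurable_fst.
exact: (measurableT_comp (measurable_rV_coord j) measurable_snd).
Qed.

Lemma measurable_rV_uncons n : measurable_fun setT (@rV_uncons n).
Proof.
apply/measurable_fun_pairP; split; first exact: measurable_rV_coord.
apply: measurable_fun_rV => i; rewrite /rV_coord /comp /=.
under eq_fun do rewrite mxE.
exact: measurable_rV_coord.
Qed.

Section step.
Variables (n : nat) (mu : {sigma_finite_measure set 'rV[R]_n -> \bar R}).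

Definition lebesgue_step : set 'rV[R]_n.+1 -> \bar R :=
  pushforward (lebesgue_measure \x mu) (@rV_cons n).

HB.instance Definition _ := Measure.copy lebesgue_step
  (measure_function_pushforward__canonical__measure_function_Measure
     (lebesgue_measure \x mu) (@measurable_rV_cons n)).

Let lebesgue_step_sigma_finite : sigma_finite setT lebesgue_step.
Proof.
have /sigma_finiteP[F [TF ndF Foo]] := sigma_finiteT (@lebesgue_measure R).
have /sigma_finiteP[G [TG ndG Goo]] := sigma_finiteT mu.
exists (fun k => @rV_uncons n @^-1` (F k `*` G k)).
  rewrite -preimage_bigcup; apply/esym; rewrite -subTset => v _.
  have [k _ Fk] : (\bigcup_i F i) (rV_uncons v).1 by rewrite -TF.
  have [l _ Gl] : (\bigcup_i G i) (rV_uncons v).2 by rewrite -TG.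
  exists (maxn k l) => //; split.
    by move: Fk; exact/subsetPset/ndF/leq_maxl.
  by move: Gl; exact/subsetPset/ndG/leq_maxr.
move=> k; have [mF Fk] := Foo k; have [mG Gk] := Goo k; split.
  rewrite -[X in measurable X]setTI; apply: measurable_rV_uncons => //.
  exact: measurableX.
rewrite /lebesgue_step /pushforward -comp_preimage.
rewrite (_ : _ \o _ = id); last by apply/funext => u /=; rewrite rV_consK.
rewrite preimage_id product_measure1E//.
by rewrite lte_mul_pinfty// ge0_fin_numE.
Qed.

HB.instance Definition _ := Measure_isSigmaFinite.Build _ _ _
  lebesgue_step lebesgue_step_sigma_finite.
End step.

Fixpoint lebesgue_rV n : {sigma_finite_measure set 'rV[R]_n -> \bar R} :=
  match n with
  | 0 => \d_(0%R : 'rV[R]_0)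
  | n'.+1 => lebesgue_step (lebesgue_rV n')
  end.

Lemma lebesgue_rV_box n (A : 'I_n -> set R) : (forall i, measurable (A i)) ->
  lebesgue_rV n [set v | forall i, A i (v ord0 i)] =
  \prod_(i < n) lebesgue_measure (A i).
Proof.
elim: n A => [|n IH] A mA /=.
  rewrite big_ord0 /dirac/= indicE mem_set//= => -[//].
rewrite /lebesgue_step /pushforward.
rewrite (_ : _ @^-1` _ = A ord0 `*`
    [set v : 'rV[R]_n | forall i, A (lift ord0 i) (v ord0 i)]); last first.
  apply/seteqP; split => [[x v] /= H|[x v] /= [Hx Hv] i].
    split; first by have := H ord0; rewrite /rV_cons mxE unlift_none.
    by move=> i; have := H (lift ord0 i); rewrite /rV_cons mxE liftK.
  by rewrite /rV_cons mxE; case: unliftP => [j|] ->.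
have mB : measurable [set v : 'rV[R]_n | forall i, A (lift ord0 i) (v ord0 i)].
  rewrite (_ : mkset _ = \big[setI/setT]_(i < n)
     (rV_coord i @^-1` A (lift ord0 i))).
    apply: bigsetI_measurable => i _; rewrite -[X in measurable X]setTI.
    exact: measurable_rV_coord.
  rewrite -bigcap_seq; apply/seteqP; split => v /= H i.
    by move=> _; exact: H.
  by apply: (H i) => /=; rewrite mem_index_enum.
transitivity (lebesgue_measure (A ord0) * lebesgue_rV n
    [set v : 'rV[R]_n | forall i, A (lift ord0 i) (v ord0 i)]).
  exact: (product_measure1E lebesgue_measure (lebesgue_rV n) (mA ord0) mB).
by rewrite [RHS]big_ord_recl; congr (_ * _); exact: IH.
Qed.

End lebesgue_rV.

Section euclidean.
Context {R : realType} {d : nat}.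

Definition dotr (u v : 'rV[R]_d) : R := \sum_i u ord0 i * v ord0 i.

(* The library norm on 'rV[R]_d is the sup norm; lengths and balls here are
   Euclidean. *)
Definition enorm (x : 'rV[R]_d) : R := Num.sqrt (dotr x x).

Definition eball (x : 'rV[R]_d) (r : R) : set 'rV[R]_d :=
  [set y | enorm (y - x) < r].

End euclidean.

Section levy.
Context {R : realType} {d : nat} {disp : measure_display}.
Context {Omega : measurableType disp} (P : probability Omega R).

(* Time is R; only the times t >= 0 matter.  P is the law P^0 of the process
   started at 0, and under P^x the process is (x + X_t). *)
Variable X : R -> Omega -> 'rV[R]_d.

Definition cadlag (g : R -> 'rV[R]_d) : Prop :=
  (forall t, 0 <= t -> g s @[s --> t^'+] --> g t) /\
  (forall t, 0 < t -> cvg (g s @[s --> t^'-])).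

Record levy_process : Prop := LevyProcess {
  levy_measurable : forall t, 0 <= t -> measurable_fun setT (X t);
  levy_start : {ae P, forall w, X 0 w = 0};
  levy_independent : forall (t : nat -> R) (A : nat -> set 'rV[R]_d) (n : nat),
    0 <= t 0%N -> (forall i, t i <= t i.+1) -> (forall i, measurable (A i)) ->
    P (\bigcap_(i in `I_n) [set w | A i (X (t i.+1) w - X (t i) w)]) =
    (\prod_(i < n) P [set w | A i (X (t i.+1) w - X (t i) w)%R])%E;
  levy_stationary : forall (s t : R) (A : set 'rV[R]_d),
    0 <= s -> s <= t -> measurable A ->
    P [set w | A (X t w - X s w)] = P [set w | A (X (t - s) w)];
  levy_cadlag : {ae P, forall w, cadlag (X ^~ w)} }.

Definition symmetric_process : Prop :=
  forall (t : R) (A : set 'rV[R]_d), 0 <= t -> measurable A ->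
  P [set w | A (X t w)] = P [set w | A (- X t w)].

(* N is the Levy measure of X: the jump measure in the Levy-Khintchine formula
     E exp(i <xi, X_t>) = exp(t Psi(xi)),
     Psi(xi) = i <b, xi> - <xi A, xi>/2
               + int (exp(i <xi, z>) - 1 - i <xi, z> 1_{|z| < 1}) N(dz),
   whose real and imaginary parts are written separately. *)
Definition is_levy_measure (N : {measure set 'rV[R]_d -> \bar R}) : Prop :=
  [/\ N [set 0] = 0%E,
      (\int[N]_z (Num.min 1 (enorm z ^+ 2))%:E < +oo)%E &
   exists (b : 'rV[R]_d) (A : 'M[R]_d),
   [/\ A^T = A, (forall xi, 0 <= dotr (xi *m A) xi) &
    forall (t : R) (xi : 'rV[R]_d), 0 <= t ->
    let rePsi := - (dotr (xi *m A) xi / 2)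
                 - Rintegral N setT (fun z => 1 - cos (dotr xi z)) in
    let imPsi := dotr b xi + Rintegral N setT
        (fun z => sin (dotr xi z) - dotr xi z * \1_(eball 0 1) z) in
    Rintegral P setT (fun w => cos (dotr xi (X t w))) =
      expR (t * rePsi) * cos (t * imPsi) /\
    Rintegral P setT (fun w => sin (dotr xi (X t w))) =
      expR (t * rePsi) * sin (t * imPsi)]].

(* nu is only meaningful away from 0. *)
Definition is_levy_density (nu : 'rV[R]_d -> R) : Prop :=
  [/\ measurable_fun setT nu, (forall x, x != 0 -> 0 < nu x) &
   exists2 N : {measure set 'rV[R]_d -> \bar R}, is_levy_measure N &
   forall A, measurable A -> N A = (\int[lebesgue_rV R d]_(z in A) (nu z)%:E)%E].

Record assumption_A1 (nu : 'rV[R]_d -> R) : Prop := AssumptionA1 {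
  A1_symmetric : symmetric_process;
  A1_density : is_levy_density nu;
  A1_comparable : forall r, 0 < r <= 1 / 2 ->
    exists2 C1 : R, 1 <= C1 & forall x y,
    r <= enorm y -> enorm y <= enorm x -> enorm x <= enorm y + 1 ->
    C1^-1 * nu y <= nu x <= C1 * nu y;
  A1_almost_decreasing :
    exists2 C2 : R, 1 <= C2 & forall x y,
    1 / 2 <= enorm y -> enorm y <= enorm x -> nu x <= C2 * nu y;
  A1_direct_jump :
    exists2 C3 : R, 1 <= C3 & forall x y, 1 <= enorm (y - x) ->
    (\int[lebesgue_rV R d]_(z in
        [set z | (1 / 2 < enorm (z - x))%R /\ (1 / 2 < enorm (z - y))%R])
      (nu (x - z) * nu (z - y))%:E <= (C3 * nu (x - y))%:E)%E }.

(* tau_D under P^x *)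
Definition exit_time (D : set 'rV[R]_d) (x : 'rV[R]_d) (w : Omega) : \bar R :=
  ereal_inf [set s%:E | s in [set s : R | 0 <= s /\ ~ D (x + X s w)]].

(* P^x(X_t in A, t < tau_D).  The event is measurable only for the completion of
   P, hence the integral of an indicator rather than P itself: the library
   integral of a nonnegative function is a supremum over the measurable simple
   functions below it, so this is the completed probability. *)
Definition killed_kernel (D : set 'rV[R]_d) (t : R) (x : 'rV[R]_d)
    (A : set 'rV[R]_d) : \bar R :=
  (\int[P]_w (\1_[set w | (t%:E < exit_time D x w)%E /\ A (x + X t w)] w)%:E)%E.

(* p_D, the transition density of the process killed upon exiting D.
   Chapman-Kolmogorov and symmetry at all points select one version of it,
     p_D(2t, x, y) = int_D p_D(t, x, z) p_D(t, y, z) dz,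
   so the pointwise suprema below do not depend on a choice.  The value +oo is
   needed: a density at a small time can be infinite on the diagonal. *)
Record is_killed_density (D : set 'rV[R]_d)
    (p : R -> 'rV[R]_d -> 'rV[R]_d -> \bar R) : Prop := IsKilledDensity {
  killed_measurable :
    measurable_fun [set u : R * 'rV[R]_d * 'rV[R]_d |
                     0 < u.1.1 /\ D u.1.2 /\ D u.2]
                   (fun u => p u.1.1 u.1.2 u.2);
  killed_ge0 : forall t x y, 0 < t -> D x -> D y -> (0 <= p t x y)%E;
  killed_densityE : forall t x A, 0 < t -> D x -> measurable A ->
    killed_kernel D t x A = (\int[lebesgue_rV R d]_(y in A `&` D) p t x y)%E;
  killed_chapman_kolmogorov : forall s t x y, 0 < s -> 0 < t -> D x -> D y ->
    p (s + t) x y = (\int[lebesgue_rV R d]_(z in D) (p s x z * p t z y))%E;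
  killed_symmetric : forall t x y, 0 < t -> D x -> D y -> p t x y = p t y x }.

Definition strong_feller : Prop :=
  forall (t : R) (f : 'rV[R]_d -> R), 0 < t -> measurable_fun setT f ->
  (exists M, forall x, `|f x| <= M) ->
  continuous (fun x : 'rV[R]_d => Rintegral P setT (fun w => f (x + X t w))).

(* With D = setT the exit time is +oo and the killed process is X itself. *)
Definition assumption_A2 : Prop :=
  strong_feller /\
  exists2 p : R -> 'rV[R]_d -> \bar R,
    is_killed_density setT (fun t x y => p t (y - x)) &
  exists (tb C : R), [/\ 0 < tb, 0 < C &
    forall x, (0 < p tb x)%E /\ (p tb x <= C%:E)%E].

Definition green (D : set 'rV[R]_d) (p : R -> 'rV[R]_d -> 'rV[R]_d -> \bar R)
    (x y : 'rV[R]_d) : \bar R :=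
  if (x \in D) && (y \in D) then
    (\int[lebesgue_measure]_(t in [set t : R | (0 < t)%R]) p t x y)%E
  else 0%E.

Definition assumption_A3 : Prop :=
  forall r : R, 0 < r <= 1 ->
  exists2 p, is_killed_density (eball 0 r) p &
  forall a b : R, 0 < a -> a < b -> b < r ->
  (ereal_sup [set green (eball 0 r) p u.1 u.2 |
     u in eball 0 a `*` ~` eball 0 b] < +oo)%E.

Definition regular_jump_levy (nu : 'rV[R]_d -> R) : Prop :=
  [/\ levy_process, assumption_A1 nu, assumption_A2 & assumption_A3].

Definition kato (V : 'rV[R]_d -> R) : Prop :=
  measurable_fun setT V /\
  ereal_sup (range (fun x : 'rV[R]_d =>
    \int[P]_w \int[lebesgue_measure]_(s in `[0%R, t]) (`|V (x + X s w)|)%:E))%E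
  @[t --> 0^'+] --> 0%E.

Definition kato_loc (V : 'rV[R]_d -> R) : Prop :=
  measurable_fun setT V /\
  forall (c : 'rV[R]_d) (r : R), 0 < r -> kato (V \* \1_(eball c r)).

Definition kato_potential (V : 'rV[R]_d -> R) : Prop :=
  [/\ measurable_fun setT V, kato V^\- & kato_loc V^\+].

Definition confining (V : 'rV[R]_d -> R) : Prop :=
  forall M : R, exists r : R, forall x, r <= enorm x -> M <= V x.

Section feynman_kac.
Variable V : 'rV[R]_d -> R.

(* Extended-real valued, hence meaningful (possibly +oo) for every f >= 0. *)
Definition feynman_kac (t : R) (f : 'rV[R]_d -> R) (x : 'rV[R]_d) : \bar R :=
  (\int[P]_w
    (expeR (- \int[lebesgue_measure]_(s in `[0%R, t]) (V (x + X s w))%:E)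
     * (f (x + X t w))%:E))%E.

Definition inner (f g : 'rV[R]_d -> R) : R :=
  Rintegral (lebesgue_rV R d) setT (f \* g).

Record is_eigenbasis (lam : nat -> R) (phi : nat -> 'rV[R]_d -> R) : Prop :=
  IsEigenbasis {
  eigen_L2 : forall n, phi n \in Lfun (lebesgue_rV R d) 2%:E;
  eigen_orthonormal : forall m n, inner (phi m) (phi n) = (m == n)%:R;
  eigen_basis : forall f, f \in Lfun (lebesgue_rV R d) 2%:E ->
    (\int[lebesgue_rV R d]_x
      ((f x - \sum_(k < n) inner f (phi k) * phi k x) ^+ 2)%:E)%E
    @[n --> \oo] --> 0%E;
  eigenE : forall n t x, 0 < t ->
    feynman_kac t (phi n) x = (expR (- lam n * t) * phi n x)%:E;
  eigen_simple : lam 0%N < lam 1%N;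
  eigen_nondecreasing : forall n, lam n <= lam n.+1;
  eigen_infty : lam n @[n --> \oo] --> +oo;
  eigen_bounded : forall n, exists M, forall x, `|phi n x| <= M;
  eigen_continuous : forall n, continuous (phi n);
  eigen_ground_gt0 : forall x, 0 < phi 0%N x }.

(* t0-ground state domination, phi0 being the ground state. *)
Definition gsd (phi0 : 'rV[R]_d -> R) (t0 : R) : Prop :=
  exists2 C : R, 0 < C &
  forall x, (feynman_kac t0 (cst 1%R) x <= (C * phi0 x)%:E)%E.

End feynman_kac.

End levy.

(* Main.v *)
(** Let [w] be the bounded radially decreasing profile of [nu], comparable to [nu]
    away from the origin.  The characteristic function, tested against Gaussians,
    gives E w(x + X_t) <= C w(x) from the direct jump property, and
    P(y + X_h in B(0, r)) >= h (c w(y) - C h) for |y| >= r.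

    (1) Let t0 = 4 / C13 and let B be a large ball, so that exp(- t0 V / 2) <= w
    off B.  On paths that hit B before t0, the eigenfunction equation bounds the
    contribution to T_t0 1(x) by C phi0(x), as phi0 is bounded below on B.  On
    paths that avoid B, the second half of [0, t0] costs C w(X_s) by Jensen's
    inequality, for each s in [0, t0 / 2]; averaging over s along a fine time grid,
    the weight w(X_s) is bounded by the rate of jumps into B just after s, and this
    is a contribution of paths hitting B, hence again at most C phi0(x).

    (2) With w = v^4, phi0 <= C v^3: in the eigenfunction equation at a small time
    h, paths hitting a large ball contribute O(v^3), since that event has
    probability O(w), and the others at most exp(- M h) E phi0(x + X_h) with M as
    large as desired; then iterate.  On the other hand X stays in a small ball up to
    t0 with probability p0 > 0, so T_t0 1(x) >= p0 exp(- t0 sup_B(x, eps) V).  If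
    sup_B(x, eps) V < |log nu(x)| / (2 t0), then p0 nu(x)^(1/2) <= C nu(x)^(3/4),
    which fails for |x| large. *)

From HB Require Import structures.
From mathcomp Require Import all_boot all_order all_algebra.
From mathcomp Require Import all_classical all_reals all_analysis.
From mathcomp Require Import measurable_realfun.
From mathcomp Require Import ring lra.
Require Import Defs.
Set Implicit Arguments.
Unset Strict Implicit.
Unset Printing Implicit Defensive.
Import Order.TTheory GRing.Theory Num.Theory.
Import numFieldNormedType.Exports.
Local Open Scope classical_set_scope.
Local Open Scope ring_scope.

(** * Elementary bounds and Euclidean lengths *)

(** The process is given through its increments and the Levy-Khintchine formula, so that neither a
    jump intensity nor a hitting time is available directly. The intensity is replaced by means of
    Gaussians after a short time [h]; the error is [h] times a multiple of [gauss (b / 2) a + h],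
    and its part of order h^2 does not decay in space. Where that part matters, about 1/h steps are
    summed and [h] tends to 0. Hitting times are replaced by recursions along a grid of step [h],
    which use the Markov property at fixed times only. The density may explode at 0 and need not be
    monotone, whereas [w] is constant on the unit ball and radially nonincreasing. It varies at most
    exponentially with the distance, so that convolution with a Gaussian leaves it comparable to
    itself; this is what connects Gaussian estimates with [w]. The exponent 3/4 in (2) comes from
    Hoelder's inequality: the exponential weight has a bounded fourth moment, so a hitting event of
    probability O(w) contributes O(w^(3/4)), which is still negligible against nu^(1/2) far out. *)

Section real_bounds.
Context {R : realType}.
Implicit Types x y u : R.

Lemma ge0_of_derive (f f' : R -> R) :
  (forall x, is_derive x 1 f (f' x)) -> (forall x, 0 <= x -> 0 <= f' x) ->
  f 0 = 0 -> forall x, 0 <= x -> 0 <= f x.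
Proof.
move=> df f'0 f0 x; rewrite le_eqVlt => /predU1P[<-|x0]; first by rewrite f0.
have [|c /andP[c0 _]] := MVT x0 (fun z _ => df z).
  apply: continuous_subspaceT => z.
  by apply/differentiable_continuous/derivable1_diffP; case: (df z).
rewrite f0 !subr0 => ->; apply: mulr_ge0; last exact: ltW.
by apply: f'0; move: c0; rewrite bnd_simp => /ltW.
Qed.

(** Each Taylor bound from here to [cos_le4] has the preceding one as its derivative, so that
    [ge0_of_derive] climbs from one to the next. *)
Lemma sin_le x : 0 <= x -> sin x <= x.
Proof.
move=> x0; rewrite -subr_ge0; move: x x0.
apply: (@ge0_of_derive (fun x => x - sin x) (fun x => 1 - cos x)) => [x _|].
- by rewrite subr_ge0 cos_le1.
- by rewrite sin0 subrr.
Qed.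

Lemma cos_ge2_ge0 x : 0 <= x -> 1 - x ^+ 2 / 2 <= cos x.
Proof.
move=> x0; rewrite -subr_ge0; move: x x0.
apply: (@ge0_of_derive (fun x => cos x - (1 - x ^+ 2 / 2)) (fun x => x - sin x)).
- by move=> x; apply: is_derive_eq; rewrite /GRing.scale /=; field.
- by move=> x x0; rewrite subr_ge0 sin_le.
- by rewrite cos0; lra.
Qed.

Lemma sin_ge3 x : 0 <= x -> x - x ^+ 3 / 6 <= sin x.
Proof.
move=> x0; rewrite -subr_ge0; move: x x0.
apply: (@ge0_of_derive (fun x => sin x - (x - x ^+ 3 / 6))
  (fun x => cos x - (1 - x ^+ 2 / 2))).
- by move=> x; apply: is_derive_eq; rewrite /GRing.scale /=; field.
- by move=> x x0; rewrite subr_ge0 cos_ge2_ge0.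
- by rewrite sin0; lra.
Qed.

Lemma cos_ge2 x : 1 - x ^+ 2 / 2 <= cos x.
Proof.
by rewrite -cos_norm -(real_normK (num_real x)); exact: cos_ge2_ge0.
Qed.

Lemma cos_le4 x : cos x <= 1 - x ^+ 2 / 2 + x ^+ 4 / 24.
Proof.
wlog x0 : x / 0 <= x.
  move=> H; have [|/ltW x0] := leP 0 x; first exact: H.
  have -> : x ^+ 4 = (- x) ^+ 4 by ring.
  by rewrite -cosN -(sqrrN x) H // oppr_ge0.
rewrite -subr_ge0; move: x x0.
apply: (@ge0_of_derive (fun x => 1 - x ^+ 2 / 2 + x ^+ 4 / 24 - cos x)
  (fun x => sin x - (x - x ^+ 3 / 6))).
- by move=> x; apply: is_derive_eq; rewrite /GRing.scale /=; field.
- by move=> x x0; rewrite subr_ge0 sin_ge3.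
- by rewrite cos0; lra.
Qed.

Lemma expRN_le2 x : 0 <= x -> expR (- x) <= 1 - x + x ^+ 2 / 2.
Proof.
move=> x0; rewrite -subr_ge0; move: x x0.
apply: (@ge0_of_derive (fun x => 1 - x + x ^+ 2 / 2 - expR (- x))
  (fun x => expR (- x) - (1 - x))).
- by move=> x; apply: is_derive_eq; rewrite /GRing.scale /=; field.
- by move=> x x0; rewrite subr_ge0 expR_ge1Dx.
- by rewrite oppr0 expR0; lra.
Qed.

(** Both functions agree to second order at 0. For n arguments of size n^(-1/2) the fourth-order
    errors add up to O(1/n), which makes a product of cosines tend to a Gaussian. *)
Lemma cos_gauss x : `|cos x - expR (- (x ^+ 2 / 2))| <= x ^+ 4.
Proof.
have x2 : 0 <= x ^+ 2 by exact: sqr_ge0.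
have := cos_ge2 x; have := cos_le4 x.
have /expRN_le2 : 0 <= x ^+ 2 / 2 by lra.
have := expR_ge1Dx (- (x ^+ 2 / 2)).
rewrite ler_norml; have -> : x ^+ 4 = x ^+ 2 * x ^+ 2 by ring.
rewrite [X in _ + X / 2]expr2.
by move: (x ^+ 2) x2 => y y0 *; nra.
Qed.

End real_bounds.

Section euclidean_algebra.
Context {R : realType} {d : nat}.
Implicit Types u v w : 'rV[R]_d.

Lemma dotrC u v : dotr u v = dotr v u.
Proof. by apply: eq_bigr => i _; rewrite mulrC. Qed.

Lemma dotrDl u v w : dotr (u + v) w = dotr u w + dotr v w.
Proof. by rewrite -big_split; apply: eq_bigr => i _; rewrite mxE mulrDl. Qed.

Lemma dotrDr u v w : dotr w (u + v) = dotr w u + dotr w v.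
Proof. by rewrite dotrC dotrDl !(dotrC _ w). Qed.

Lemma dotrZl a u v : dotr (a *: u) v = a * dotr u v.
Proof. by rewrite /dotr mulr_sumr; apply: eq_bigr => i _; rewrite mxE mulrA. Qed.

Lemma dotrZr a u v : dotr u (a *: v) = a * dotr u v.
Proof. by rewrite dotrC dotrZl dotrC. Qed.

Lemma dotrNl u v : dotr (- u) v = - dotr u v.
Proof. by rewrite -scaleN1r dotrZl mulN1r. Qed.

Lemma dotrNr u v : dotr u (- v) = - dotr u v.
Proof. by rewrite dotrC dotrNl dotrC. Qed.

Lemma dotr0l u : dotr 0 u = 0.
Proof. by rewrite -(scale0r (0 : 'rV_d)) dotrZl mul0r. Qed.

Lemma dotr_ge0 u : 0 <= dotr u u.
Proof. by apply: sumr_ge0 => i _; rewrite -expr2 sqr_ge0. Qed.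

Lemma enorm_ge0 u : 0 <= enorm u. Proof. exact: sqrtr_ge0. Qed.

Lemma sqr_enorm u : enorm u ^+ 2 = dotr u u.
Proof. by rewrite sqr_sqrtr ?dotr_ge0. Qed.

Lemma enormN u : enorm (- u) = enorm u.
Proof. by rewrite /enorm dotrNl dotrNr opprK. Qed.

Lemma enorm0 : enorm (0 : 'rV[R]_d) = 0.
Proof. by rewrite /enorm dotr0l sqrtr0. Qed.

Lemma enormZ a u : enorm (a *: u) = `|a| * enorm u.
Proof.
by rewrite /enorm dotrZl dotrZr mulrA -expr2 sqrtrM ?sqr_ge0 // sqrtr_sqr.
Qed.

Lemma sqr_dotr_le u v : dotr u v ^+ 2 <= dotr u u * dotr v v.
Proof.
have H (t : R) : 0 <= dotr u u + t * dotr u v *+ 2 + t ^+ 2 * dotr v v.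
  have := dotr_ge0 (u + t *: v).
  rewrite dotrDl !dotrDr !dotrZl !dotrZr (dotrC v u); lra.
have u0 := dotr_ge0 u; have v0 := dotr_ge0 v.
move: v0; rewrite le_eqVlt => /predU1P[v0|v0].
  rewrite -v0 mulr0 in H *; apply: contrapT => /negP; rewrite -ltNge => uv.
  have uvn : dotr u v != 0 by apply: contraTneq uv => ->; rewrite expr0n ltxx.
  (* For a null vector [v] the polynomial in [t] is affine; this [t] would make it negative. *)
  have := H (- (dotr u u + 1) / dotr u v).
  by rewrite divfK //; lra.
have := H (- dotr u v / dotr v v).
have -> : dotr u u + - dotr u v / dotr v v * dotr u v *+ 2
   + (- dotr u v / dotr v v) ^+ 2 * dotr v v =
   (dotr u u * dotr v v - dotr u v ^+ 2) / dotr v v by field; exact: lt0r_neq0.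
by rewrite pmulr_lge0 ?invr_gt0 // subr_ge0.
Qed.

Lemma normr_dotr_le u v : `|dotr u v| <= enorm u * enorm v.
Proof.
rewrite -ler_sqr ?nnegrE ?mulr_ge0 ?enorm_ge0 //.
by rewrite real_normK ?num_real // exprMn !sqr_enorm sqr_dotr_le.
Qed.

Lemma ler_enormD u v : enorm (u + v) <= enorm u + enorm v.
Proof.
rewrite -ler_sqr ?nnegrE ?addr_ge0 ?enorm_ge0 // sqr_enorm dotrDl !dotrDr.
rewrite sqrrD !sqr_enorm (dotrC v u).
by have := normr_dotr_le u v; rewrite ler_norml => /andP[_]; lra.
Qed.

Lemma enormB u v : enorm (u - v) = enorm (v - u).
Proof. by rewrite -enormN opprB. Qed.

Lemma ler_enormB u v : enorm (u - v) <= enorm u + enorm v.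
Proof. by rewrite -(enormN v) ler_enormD. Qed.

Lemma ler_enorm_sub u v : enorm u - enorm v <= enorm (u + v).
Proof. by rewrite lerBlDr -[X in enorm X <= _](addrK v) ler_enormB. Qed.

Lemma coord_le_enorm u i : `|u ord0 i| <= enorm u.
Proof.
rewrite -ler_sqr ?nnegrE ?enorm_ge0 // real_normK ?num_real // sqr_enorm.
rewrite /dotr (bigD1 i) //= -expr2 lerDl; apply: sumr_ge0 => j _.
by rewrite -expr2 sqr_ge0.
Qed.

Lemma enorm_le_sum u : enorm u <= \sum_i `|u ord0 i|.
Proof.
rewrite -ler_sqr ?nnegrE ?enorm_ge0 ?sumr_ge0 // sqr_enorm /dotr expr2 mulr_suml.
apply: ler_sum => i _; rewrite -expr2 -(real_normK (num_real (u ord0 i))) expr2.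
by rewrite ler_wpM2l // (bigD1 i) //= lerDl sumr_ge0.
Qed.

Lemma measurable_dotr (xi : 'rV[R]_d) : measurable_fun setT (dotr xi).
Proof.
rewrite /dotr; apply: measurable_sum => i; apply: measurable_funM => //.
exact: measurable_rV_coord.
Qed.

Lemma measurable_dotrr : measurable_fun setT (fun x : 'rV[R]_d => dotr x x).
Proof.
rewrite /dotr; apply: measurable_sum => i.
by apply: measurable_funM => //; exact: measurable_rV_coord.
Qed.

Lemma measurable_enorm : measurable_fun setT (@enorm R d).
Proof.
apply: (measurableT_comp _ measurable_dotrr).
apply: continuous_measurable_fun; exact: sqrt_continuous.
Qed.

Lemma measurable_rVD d' (T : measurableType d') (f g : T -> 'rV[R]_d) :
  measurable_fun setT f -> measurable_fun setT g ->
  measurable_fun setT (fun t => f t + g t).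
Proof.
move=> mf mg; apply: measurable_fun_rV => i; rewrite /rV_coord /comp.
under eq_fun do rewrite mxE.
by apply: measurable_funD;
  [exact: (measurableT_comp (measurable_rV_coord i) mf)|
   exact: (measurableT_comp (measurable_rV_coord i) mg)].
Qed.

Lemma measurable_rVN d' (T : measurableType d') (f : T -> 'rV[R]_d) :
  measurable_fun setT f -> measurable_fun setT (fun t => - f t).
Proof.
move=> mf; apply: measurable_fun_rV => i; rewrite /rV_coord /comp.
under eq_fun do rewrite mxE.
by apply: measurableT_comp => //;
  exact: (measurableT_comp (measurable_rV_coord i) mf).
Qed.

Lemma measurable_rVB d' (T : measurableType d') (f g : T -> 'rV[R]_d) :
  measurable_fun setT f -> measurable_fun setT g ->
  measurable_fun setT (fun t => f t - g t).
Proof. by move=> mf mg; apply: measurable_rVD => //; exact: measurable_rVN. Qed.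

Lemma measurable_eball (c : 'rV[R]_d) r : measurable (eball c r).
Proof.
have mf : measurable_fun setT (fun y : 'rV[R]_d => enorm (y - c)).
  apply: (measurableT_comp measurable_enorm); exact: measurable_rVB.
rewrite (_ : eball c r = (fun y => enorm (y - c)) @^-1` `]-oo, r[%classic).
  by rewrite -[X in measurable X]setTI; exact: mf.
by apply/seteqP; split => y; rewrite /= in_itv.
Qed.

Lemma cvg_rV (T : Type) (F : set_system T) (FF : Filter F) (f : T -> 'rV[R]_d)
    (v : 'rV[R]_d) :
  f @ F --> v -> forall i, f t ord0 i @[t --> F] --> v ord0 i.
Proof.
move=> fv i; apply: (cvg_comp f (fun M : 'rV[R]_d => M ord0 i) fv).
exact: coord_continuous.
Qed.

Lemma rV_cvg (T : Type) (F : set_system T) (FF : Filter F) (f : T -> 'rV[R]_d)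
    (v : 'rV[R]_d) :
  (forall i, f t ord0 i @[t --> F] --> v ord0 i) -> f @ F --> v.
Proof.
move=> fv; apply/cvg_ballP => e e0.
have : \forall t \near F, forall i, ball (v ord0 i) e (f t ord0 i).
  apply: filter_forall => i; exact: (cvg_ball (fv i)).
apply: filterS => t H; split => // i j; by rewrite (ord1 i).
Qed.

Lemma continuous_enorm : continuous (@enorm R d).
Proof.
have dc : continuous (fun x : 'rV[R]_d => dotr x x).
  rewrite /dotr; apply: continuous_big => [|i _ x]; first exact: add_continuous.
  have xi : (fun y : 'rV[R]_d => y ord0 i) @ x --> (x : 'rV[R]_d) ord0 i.
    exact: (@coord_continuous R 1 d ord0 i).
  by rewrite /continuous_at; apply: (cvgM xi xi).
by move=> v; apply: continuous_comp; [exact: dc|exact: sqrt_continuous].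
Qed.

End euclidean_algebra.

(** * Gaussians *)

Section gauss.
Context {R : realType} {d : nat}.
Implicit Types a z u v xi : 'rV[R]_d.

Definition gauss (b : R) z : R := expR (- (b * dotr z z)).

(** The jump part of the generator has this integrand once it is symmetrised in [z]: the compensator
    cancels, and the integrand is of second order at 0. *)
Definition sdiff (f : 'rV[R]_d -> R) a z : R := (f (a + z) + f (a - z)) / 2 - f a.

Lemma gauss_gt0 b z : 0 < gauss b z. Proof. exact: expR_gt0. Qed.

Lemma gauss_ge0 b z : 0 <= gauss b z. Proof. exact/ltW/gauss_gt0. Qed.

Lemma gauss_le1 b z : 0 <= b -> gauss b z <= 1.
Proof. by move=> b0; rewrite /gauss expR_le1 oppr_le0 mulr_ge0 ?dotr_ge0. Qed.

Lemma gaussD b c z : gauss (b + c) z = gauss b z * gauss c z.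
Proof. by rewrite /gauss -expRD mulrDl opprD. Qed.

Lemma le_gauss b c z : b <= c -> gauss c z <= gauss b z.
Proof. by move=> bc; rewrite ler_expR lerN2 ler_wpM2r // dotr_ge0. Qed.

Lemma measurable_gauss b : measurable_fun setT (gauss b).
Proof.
rewrite /gauss; apply: measurableT_comp => //; apply: measurableT_comp => //.
apply: measurable_funM => //; exact: measurable_dotrr.
Qed.

(** With u = 2 b <a, z> and q = b |z|^2 the second difference equals gauss b a (exp(-q) cosh u - 1).
    The growth of cosh u in [a] is absorbed by half of the Gaussian, hence [b / 2] on the right. *)
Lemma sdiff_gauss_le (b : R) : 0 < b -> exists2 C : R, 0 < C & forall a z,
  enorm z <= 1 -> `|sdiff (gauss b) a z| <= C * dotr z z * gauss (b / 2) a.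
Proof.
move=> b0; exists (b + 16 * b * expR (4 * b)).
  by rewrite addr_gt0 // !mulr_gt0 // expR_gt0.
move=> a z z1.
pose s := enorm a; pose u := 2 * b * dotr a z; pose q := b * dotr z z.
have s0 : 0 <= s := enorm_ge0 a.
have q0 : 0 <= q by rewrite mulr_ge0 ?dotr_ge0 // ltW.
have -> : sdiff (gauss b) a z =
    gauss b a * (expR (- q) * ((expR u + expR (- u)) / 2) - 1).
  rewrite /sdiff /gauss.
  have -> : - (b * dotr (a + z) (a + z)) = - (b * dotr a a) + (- q + - u).
    rewrite dotrDl !dotrDr (dotrC z a) /q /u; ring.
  have -> : - (b * dotr (a - z) (a - z)) = - (b * dotr a a) + (- q + u).
    rewrite dotrDl !dotrDr !dotrNl !dotrNr (dotrC z a) /q /u; ring.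
  by rewrite !expRD; field.
(* With y = exp(x/2), the left side is (y - 1/y)^2 / 2, and y - 1/y <= x y because exp(-x) >= 1 -
   x. *)
have cosh1 (x : R) : 0 <= (expR x + expR (- x)) / 2 - 1 <= x ^+ 2 / 2 * expR `|x|.
  wlog x0 : x / 0 <= x.
    move=> H; have [|/ltW x0] := leP 0 x; first exact: H.
    have := H (- x); rewrite oppr_ge0 opprK normrN sqrrN => /(_ x0).
    by rewrite (addrC (expR (- x))).
  rewrite ger0_norm //; set y := expR (x / 2).
  have y0 : 0 < y by exact: expR_gt0.
  have ex : expR x = y ^+ 2 by rewrite -expRM_natl mulrC divfK.
  have exn : expR (- x) = y^-1 ^+ 2 by rewrite -expRN -expRM_natl mulrN mulrC divfK.
  have yy : y * y^-1 = 1 by rewrite divff // gt_eqF.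
  have H1 : (y ^+ 2 + y^-1 ^+ 2) / 2 - 1 = (y - y^-1) ^+ 2 / 2.
    by rewrite sqrrB yy; field; rewrite gt_eqF.
  rewrite ex exn H1 divr_ge0 ?sqr_ge0 //= [leRHS]mulrAC ler_wpM2r ?invr_ge0 //.
  rewrite -exprMn ler_sqr ?nnegrE.
  - rewrite lerBlDr -lerBlDl; have := expR_ge1Dx (- x); rewrite exn.
    have : y * (1 - x) <= y * y^-1 ^+ 2 -> y - x * y <= y^-1.
      by rewrite [in X in _ <= X]expr2 mulrA yy mul1r; lra.
    by move=> H /(ler_wpM2l (ltW y0)) /H; lra.
  - rewrite subr_ge0 -[_^-1]mul1r ler_pdivrMr // -expr2 -ex -expR0 ler_expR //.
  - by rewrite mulr_ge0 // ltW.
have us : `|u| <= 2 * b * (s * enorm z).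
  rewrite /u normrM ger0_norm ?mulr_ge0 // ?(ltW b0) //.
  by apply: ler_wpM2l; [rewrite mulr_ge0 // ltW|exact: normr_dotr_le].
have us1 : `|u| <= 2 * b * s.
  apply: (le_trans us); apply: ler_wpM2l; first by rewrite mulr_ge0 // ltW.
  by rewrite ler_piMr.
have u2 : u ^+ 2 <= 4 * b ^+ 2 * s ^+ 2 * dotr z z.
  rewrite -(real_normK (num_real u)) -sqr_enorm.
  have -> : 4 * b ^+ 2 * s ^+ 2 * enorm z ^+ 2 = (2 * b * (s * enorm z)) ^+ 2 by ring.
  by rewrite ler_sqr ?nnegrE //; exact: le_trans us.
have B1 : `|expR (- q) * ((expR u + expR (- u)) / 2) - 1| <=
    q + u ^+ 2 / 2 * expR `|u|.
  have /andP[c1 c2] := cosh1 u.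
  have e1 : expR (- q) <= 1 by rewrite expR_le1 oppr_le0.
  have e2 := expR_ge1Dx (- q).
  have e0 := expR_gt0 (- q).
  set c := (_ + _) / 2 in c1 c2 *; set w := _ / 2 * _ in c2 *.
  rewrite ler_norml; apply/andP; split; nra.
have B2 : expR `|u| <= expR (2 * b * s) by rewrite ler_expR.
(* The spare half Gaussian has exponent b s^2 / 2; [B3] spends b s^2 / 4 of it by completing a
   square, and [B4] another b s^2 / 8. *)
have B3 : expR (2 * b * s) <= expR (b * s ^+ 2 / 4 + 4 * b).
  rewrite ler_expR -subr_ge0.
  have -> : b * s ^+ 2 / 4 + 4 * b - 2 * b * s = b * (s / 2 - 2) ^+ 2 by field.
  by rewrite mulr_ge0 ?sqr_ge0 // ltW.
have B4 : s ^+ 2 <= 8 / b * expR (b * s ^+ 2 / 8).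
  have := expR_ge1Dx (b * s ^+ 2 / 8).
  move=> H; rewrite [leLHS](_ : _ = 8 / b * (b * s ^+ 2 / 8)); last first.
    by field; exact: lt0r_neq0.
  by apply: ler_wpM2l; [rewrite divr_ge0 // ltW|lra].
rewrite normrM ger0_norm ?gauss_ge0 //.
have -> : gauss b a = gauss (b / 2) a * expR (- (b * s ^+ 2 / 2)).
  by rewrite {1}(splitr b) gaussD /gauss /s sqr_enorm mulrAC.
rewrite -[leLHS]mulrA [leRHS]mulrC; apply: ler_wpM2l; first exact: gauss_ge0.
have z0 := dotr_ge0 z.
apply: (@le_trans _ _ (expR (- (b * s ^+ 2 / 2)) * (dotr z z *
   (b + 16 * b * expR (b * s ^+ 2 / 8) * expR (b * s ^+ 2 / 4 + 4 * b))))).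
  rewrite ler_wpM2l ?expR_ge0 //; apply: (le_trans B1).
  have -> : dotr z z * (b + 16 * b * expR (b * s ^+ 2 / 8) *
     expR (b * s ^+ 2 / 4 + 4 * b)) = q + (2 * b ^+ 2 * (8 / b * expR (b * s ^+ 2 / 8))
     * dotr z z) * expR (b * s ^+ 2 / 4 + 4 * b).
    by rewrite /q; field; exact: lt0r_neq0.
  rewrite lerD2l; apply: ler_pM; rewrite ?expR_ge0 ?divr_ge0 ?sqr_ge0 //.
    have : 4 * b ^+ 2 * s ^+ 2 * dotr z z <=
      4 * b ^+ 2 * (8 / b * expR (b * s ^+ 2 / 8)) * dotr z z.
      by rewrite ler_wpM2r // ler_wpM2l // mulr_ge0 // sqr_ge0.
    lra.
  exact: le_trans B3.
rewrite mulrCA [leRHS]mulrC; apply: ler_wpM2l => //; rewrite mulrDr.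
apply: lerD.
  by rewrite ler_piMl ?(ltW b0) // expR_le1 oppr_le0 divr_ge0 // mulr_ge0 ?sqr_ge0 // ltW.
have -> : expR (- (b * s ^+ 2 / 2)) * (16 * b * expR (b * s ^+ 2 / 8) *
   expR (b * s ^+ 2 / 4 + 4 * b)) = 16 * b * (expR (- (b * s ^+ 2 / 2)) *
   expR (b * s ^+ 2 / 8) * expR (b * s ^+ 2 / 4 + 4 * b)) by ring.
rewrite ler_wpM2l ?mulr_ge0 ?(ltW b0) // -!expRD ler_expR.
have : 0 <= b * s ^+ 2 by rewrite mulr_ge0 ?sqr_ge0 // ltW.
lra.
Qed.

End gauss.

(** * Averages over random signs *)

Section avg.
Context {R : realType} {d : nat}.
Implicit Types (a z u v xi : 'rV[R]_d) (vs : seq 'rV[R]_d) (F G : 'rV[R]_d -> R).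

(* The expectation of F at a sum of independent uniform random signs times
   the vectors of vs. *)
Fixpoint avg vs F : R :=
  if vs is v :: vs' then
    (avg vs' (fun xi => F (xi + v)) + avg vs' (fun xi => F (xi - v))) / 2
  else F 0.

Lemma eq_avg vs F G : F =1 G -> avg vs F = avg vs G.
Proof. by move=> /funext ->. Qed.

Lemma avgD vs F G : avg vs (fun xi => F xi + G xi) = avg vs F + avg vs G.
Proof. by elim: vs F G => //= v vs IH F G; rewrite !IH; field. Qed.

Lemma avgZ vs c F : avg vs (fun xi => c * F xi) = c * avg vs F.
Proof. by elim: vs F => //= v vs IH F; rewrite !IH; field. Qed.

Lemma avgN vs F : avg vs (fun xi => - F xi) = - avg vs F.
Proof.
by rewrite -mulN1r -avgZ; apply: eq_avg => xi; rewrite mulN1r.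
Qed.

Lemma avg_sum (I : Type) (r : seq I) vs (F : I -> 'rV[R]_d -> R) :
  avg vs (fun xi => \sum_(i <- r) F i xi) = \sum_(i <- r) avg vs (F i).
Proof.
elim: r => [|i r IH].
  rewrite big_nil; under eq_avg do rewrite big_nil.
  by elim: vs => //= v vs ->; rewrite addr0 mul0r.
by rewrite big_cons -IH -avgD; apply: eq_avg => xi; rewrite big_cons.
Qed.

Lemma avg_cst vs c : avg vs (fun=> c) = c.
Proof. by elim: vs => //= v vs ->; field. Qed.

Lemma le_avg vs F G : (forall xi, F xi <= G xi) -> avg vs F <= avg vs G.
Proof.
elim: vs F G => //= v vs IH F G FG.
by rewrite ler_wpM2r ?invr_ge0 // lerD // IH.
Qed.

Lemma normr_avg vs F : `|avg vs F| <= avg vs (fun xi => `|F xi|).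
Proof.
rewrite ler_norml -avgN; apply/andP; split; apply: le_avg => xi.
  by rewrite lerNl -normrN ler_norm.
exact: ler_norm.
Qed.

(** The two signs of a vector cancel the sine terms of the addition formula, so each vector
    contributes one factor. The shift [xi0] carries the induction. *)
Lemma avg_cos_shift vs xi0 a : avg vs (fun xi => cos (dotr (xi + xi0) a)) =
  cos (dotr xi0 a) * \prod_(v <- vs) cos (dotr v a).
Proof.
elim: vs xi0 => [|v vs IH] xi0 /=; first by rewrite add0r big_nil mulr1.
under eq_avg do rewrite -addrA.
under [X in _ + X]eq_avg do rewrite -addrA.
rewrite !IH big_cons dotrDl (dotrDl (- v)) dotrNl !cosD sinN cosN.
by field.
Qed.

Lemma avg_cos vs a : avg vs (fun xi => cos (dotr xi a)) = \prod_(v <- vs) cos (dotr v a).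
Proof.
under eq_avg do rewrite -[X in dotr X _]addr0.
by rewrite avg_cos_shift dotr0l cos0 mul1r.
Qed.

(** The terms of odd degree in each sign cancel, and Cauchy-Schwarz bounds the squared scalar
    product that remains. The induction runs over an arbitrary starting point [xi0]; the 9 is the
    square of the 3 in its bound. *)
Lemma avg_dotr4_le vs : avg vs (fun xi => dotr xi xi ^+ 2) <=
  9 * (\sum_(v <- vs) dotr v v) ^+ 2.
Proof.
suff H xi0 : avg vs (fun xi => dotr (xi + xi0) (xi + xi0) ^+ 2) <=
    (dotr xi0 xi0 + 3 * \sum_(v <- vs) dotr v v) ^+ 2.
  have := H 0; rewrite dotr0l add0r exprMn.
  under eq_avg do rewrite addr0.
  by have -> : 3 ^+ 2 = 9 :> R by ring.
elim: vs xi0 => [|v vs IH] xi0 /=; first by rewrite add0r big_nil mulr0 addr0.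
under eq_avg do rewrite -addrA.
under [X in _ + X]eq_avg do rewrite -addrA.
have := IH (v + xi0); have := IH (- v + xi0).
rewrite big_cons !dotrDl !dotrDr !dotrNl !dotrNr (dotrC v xi0).
set A1 := avg _ _; set A2 := avg _ _.
have := sqr_dotr_le xi0 v; have := dotr_ge0 v; have := dotr_ge0 xi0.
have : 0 <= \sum_(j <- vs) dotr j j by apply: sumr_ge0 => j _; exact: dotr_ge0.
set S := \sum_(j <- vs) _; set p := dotr xi0 xi0; set q := dotr v v.
set r := dotr xi0 v => S0 p0 q0 rpq H1 H2.
apply: (@le_trans _ _ (((q + r + (r + p) + 3 * S) ^+ 2 +
   (- - q + - r + (- r + p) + 3 * S) ^+ 2) / 2)).
  rewrite ler_wpM2r ?invr_ge0 // lerD //.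
have qS : 0 <= q * S by rewrite mulr_ge0.
have qp : 0 <= q * p by rewrite mulr_ge0.
have pS : 0 <= p * S by rewrite mulr_ge0.
have q2 : 0 <= q * q by rewrite mulr_ge0.
rewrite -subr_ge0.
have -> : (p + 3 * (q + S)) ^+ 2 - ((q + r + (r + p) + 3 * S) ^+ 2 +
   (- - q + - r + (- r + p) + 3 * S) ^+ 2) / 2 = 
   4 * (p * q - r ^+ 2) + 8 * (q * q) + 12 * (q * S) by field.
by rewrite !addr_ge0 // mulr_ge0 // subr_ge0.
Qed.

Lemma avg_Rintegral d' (T : measurableType d') (mu : {measure set T -> \bar R})
    vs (F : 'rV[R]_d -> T -> R) :
  (forall xi, mu.-integrable setT (EFin \o F xi)) ->
  mu.-integrable setT (EFin \o (fun x => avg vs (F ^~ x))) /\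
  Rintegral mu setT (fun x => avg vs (F ^~ x)) =
    avg vs (fun xi => Rintegral mu setT (F xi)).
Proof.
elim: vs F => [|v vs IH] F iF /=; first by split => //; exact: iF.
have [i1 e1] := IH (fun xi => F (xi + v)) (fun xi => iF (xi + v)).
have [i2 e2] := IH (fun xi => F (xi - v)) (fun xi => iF (xi - v)).
have i12 : mu.-integrable setT
   (EFin \o (fun x => avg vs (fun xi => F (xi + v) x) + avg vs (fun xi => F (xi - v) x))).
  by rewrite (_ : _ \o _ = (EFin \o (fun x => avg vs (fun xi => F (xi + v) x))) \+
     (EFin \o (fun x => avg vs (fun xi => F (xi - v) x)))); [exact: integrableD|].
split.
  have := integrableZl measurableT 2^-1 i12; apply: eq_integrable => // x _ /=.
  by rewrite mulrC EFinM.
by rewrite RintegralZr // RintegralD // e1 e2.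
Qed.

End avg.

(** * Characteristic functions against Gaussians *)

Section rintegral.
Context {R : realType} d (T : measurableType d) (mu : {measure set T -> \bar R}).
Implicit Types f g : T -> R.

Lemma integrable_le_fun f g : measurable_fun setT f -> (forall x, `|f x| <= g x) ->
  mu.-integrable setT (EFin \o g) -> mu.-integrable setT (EFin \o f).
Proof.
move=> mf fg; apply: le_integrable => //; first exact/measurable_EFinP.
by move=> x _; rewrite /= lee_fin (le_trans (fg x)) // ler_norm.
Qed.

Lemma normr_Rintegral_le f g : measurable_fun setT f -> (forall x, `|f x| <= g x) ->
  mu.-integrable setT (EFin \o g) -> `|Rintegral mu setT f| <= Rintegral mu setT g.
Proof.
move=> mf fg ig; have iff := integrable_le_fun mf fg ig.
apply: (le_trans (le_normr_Rintegral measurableT iff)).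
apply: le_Rintegral => //.
exact: (integrable_norm iff).
Qed.

Lemma cvg_Rintegral (f_ : nat -> T -> R) f g :
  (forall n, measurable_fun setT (f_ n)) ->
  (forall x, f_ n x @[n --> \oo] --> f x) ->
  mu.-integrable setT (EFin \o g) -> (forall n x, `|f_ n x| <= g x) ->
  Rintegral mu setT (f_ n) @[n --> \oo] --> Rintegral mu setT f.
Proof.
move=> mf cf ig fg.
have mff : measurable_fun setT f.
  by apply: (@measurable_fun_cvg _ _ _ _ f_) => // x _; exact: cf.
have cfE x : (EFin \o f_ n) x @[n --> \oo] --> (f x)%:E.
  by apply: cvg_EFin; [exact: nearW|exact: cf].
have [i1 _ c] : [/\ mu.-integrable setT (EFin \o f), _ & _] :=
  dominated_convergence measurableT (fun n => (measurable_EFinP _ _).2 (mf n))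
    ((measurable_EFinP _ _).2 mff) (aeW _ (fun x _ => cfE x)) ig
    (aeW _ (fun x n _ => fg n x)).
apply: fine_cvg; rewrite /Rintegral fineK //.
exact: (integrable_fin_num measurableT i1).
Qed.

End rintegral.

Lemma probability_integrable_bounded {R : realType} d (T : measurableType d)
    (P : probability T R) (f : T -> R) M :
  measurable_fun setT f -> (forall x, `|f x| <= M) -> P.-integrable setT (EFin \o f).
Proof.
move=> mf fM; apply: (integrable_le_fun (g := cst M) mf fM).
exact: finite_measure_integrable_cst.
Qed.

Section levy_symbol.
Context {R : realType} {d : nat}.
Variables (N : {measure set 'rV[R]_d -> \bar R}) (A : 'M[R]_d).
Hypothesis Nfin : (\int[N]_z (Num.min 1 (enorm z ^+ 2))%:E < +oo)%E.
Hypothesis Apsd : forall xi, 0 <= dotr (xi *m A) xi.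
Implicit Types (a z u v xi : 'rV[R]_d) (vs : seq 'rV[R]_d).

Definition trunc2 z : R := Num.min 1 (dotr z z).

Lemma trunc2_ge0 z : 0 <= trunc2 z.
Proof. by rewrite le_min ler01 dotr_ge0. Qed.

Lemma measurable_trunc2 : measurable_fun setT trunc2.
Proof. apply: measurable_minr => //; exact: measurable_dotrr. Qed.

Lemma trunc2_integrable : N.-integrable setT (EFin \o trunc2).
Proof.
apply/integrableP; split; first by apply/measurable_EFinP; exact: measurable_trunc2.
rewrite (eq_integral (fun z => (Num.min 1 (enorm z ^+ 2))%:E)) // => z _ /=.
by rewrite ger0_norm ?trunc2_ge0 // sqr_enorm.
Qed.

(** The real part of the characteristic exponent with its sign changed; for a symmetric process it
    is the whole exponent. *)
Definition psi xi : R :=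
  dotr (xi *m A) xi / 2 + Rintegral N setT (fun z => 1 - cos (dotr xi z)).

Definition mx_sum : R := \sum_i \sum_j `|A i j|.

Definition levy_mass : R := Rintegral N setT trunc2.

Lemma levy_mass_ge0 : 0 <= levy_mass.
Proof. by apply: Rintegral_ge0 => z _; exact: trunc2_ge0. Qed.

Lemma mx_sum_ge0 : 0 <= mx_sum.
Proof. by apply: sumr_ge0 => i _; exact: sumr_ge0. Qed.

Lemma quad_sum xi : dotr (xi *m A) xi =
  \sum_i \sum_j A i j * (xi ord0 i * xi ord0 j).
Proof.
rewrite /dotr exchange_big /=; apply: eq_bigr => j _; rewrite mxE mulr_suml.
by apply: eq_bigr => i _; rewrite mulrCA mulrA.
Qed.

Lemma quad_le xi : dotr (xi *m A) xi <= mx_sum * dotr xi xi.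
Proof.
rewrite quad_sum /mx_sum mulr_suml; apply: ler_sum => i _.
rewrite mulr_suml; apply: ler_sum => j _.
apply: (le_trans (ler_norm _)); rewrite normrM ler_wpM2l // -sqr_enorm expr2 normrM.
by apply: ler_pM => //; exact: coord_le_enorm.
Qed.

Lemma measurable_cos_dotr (f : R -> R) xi : continuous f ->
  measurable_fun setT (fun z => f (dotr xi z)).
Proof.
move=> cf; apply: measurableT_comp; last exact: measurable_dotr.
exact: continuous_measurable_fun.
Qed.

Lemma measurable_1cos c xi :
  measurable_fun setT (fun z => c * (1 - cos (dotr xi z))).
Proof.
apply: (measurable_cos_dotr (f := fun x => c * (1 - cos x))) => x.
apply: cvgM; first exact: cvg_cst.
by apply: cvgB; [exact: cvg_cst|exact: continuous_cos].
Qed.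

Lemma onecos_le xi z : 0 <= 1 - cos (dotr xi z) <= (2 + dotr xi xi) * trunc2 z.
Proof.
rewrite subr_ge0 cos_le1 /= /trunc2; have [z1|z1] := leP 1 (dotr z z).
  by rewrite mulr1; have := cos_geN1 (dotr xi z); have := dotr_ge0 xi; lra.
have := cos_ge2 (dotr xi z); have := sqr_dotr_le xi z.
have := dotr_ge0 xi; have := dotr_ge0 z; nra.
Qed.

Lemma onecos_integrable c xi :
  N.-integrable setT (EFin \o (fun z => c * (1 - cos (dotr xi z)))).
Proof.
apply: (integrable_le_fun (g := fun z => (`|c| * (2 + dotr xi xi)) * trunc2 z)).
- exact: measurable_1cos.
- move=> z; have /andP[h1 h2] := onecos_le xi z.
  by rewrite normrM (ger0_norm h1) -mulrA ler_wpM2l.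
- have := integrableZl measurableT (`|c| * (2 + dotr xi xi)) trunc2_integrable.
  exact: eq_integrable.
Qed.

Lemma psi_ge0 xi : 0 <= psi xi.
Proof.
rewrite addr_ge0 ?divr_ge0 //; apply: Rintegral_ge0 => z _.
by have /andP[] := onecos_le xi z.
Qed.

Definition psi_bound : R := mx_sum + 2 * levy_mass.

Lemma psi_le xi : psi xi <= psi_bound * (1 + dotr xi xi).
Proof.
have h1 := quad_le xi; have h0 := mx_sum_ge0; have h2 := dotr_ge0 xi.
have h4 := levy_mass_ge0.
have h3 : Rintegral N setT (fun z => 1 - cos (dotr xi z)) <=
    (2 + dotr xi xi) * levy_mass.
  rewrite /levy_mass -RintegralZl //; last exact: trunc2_integrable.
  apply: le_Rintegral => //.
  - have := onecos_integrable 1 xi; apply: eq_integrable => // z _ /=.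
    by rewrite mul1r.
  - have := integrableZl measurableT (2 + dotr xi xi) trunc2_integrable.
    exact: eq_integrable.
  - by move=> z _; have /andP[] := onecos_le xi z.
rewrite /psi /psi_bound; nra.
Qed.

Lemma avg_psi2_le vs : avg vs (fun xi => psi xi ^+ 2) <=
  psi_bound ^+ 2 * (2 + 18 * (\sum_(v <- vs) dotr v v) ^+ 2).
Proof.
apply: (@le_trans _ _ (avg vs (fun xi => psi_bound ^+ 2 * (2 + 2 * dotr xi xi ^+ 2)))).
  apply: le_avg => xi; have h := psi_le xi; have h0 := psi_ge0 xi.
  apply: (@le_trans _ _ ((psi_bound * (1 + dotr xi xi)) ^+ 2)).
    by rewrite ler_sqr ?nnegrE // (le_trans h0).
  rewrite exprMn ler_wpM2l ?sqr_ge0 //.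
  have := sqr_ge0 (1 - dotr xi xi); lra.
rewrite avgZ ler_wpM2l ?sqr_ge0 // avgD avg_cst avgZ lerD2l.
have := avg_dotr4_le vs; lra.
Qed.

Definition trig vs a : R := avg vs (fun xi => cos (dotr xi a)).

Lemma sdiff_trig vs a z : sdiff (trig vs) a z =
  - avg vs (fun xi => cos (dotr xi a) * (1 - cos (dotr xi z))).
Proof.
rewrite /sdiff /trig -avgD [_ / 2]mulrC -avgZ -!avgN -avgD; apply: eq_avg => xi.
by rewrite dotrDr dotrDr dotrNr cosD cosB; field.
Qed.

Lemma normr_trig_le vs a : `|trig vs a| <= 1.
Proof.
apply: (le_trans (normr_avg _ _)); rewrite -(avg_cst vs 1).
by apply: le_avg => xi; exact: cos_max.
Qed.

Lemma measurable_trig vs a : measurable_fun setT (fun z => trig vs (a + z)).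
Proof.
rewrite /trig; under eq_fun do rewrite avg_cos.
apply: measurable_prod => v _ /=.
under eq_fun do rewrite dotrDr.
apply: (measurable_cos_dotr (f := fun x => cos (dotr v a + x))) => x.
apply: continuous_comp; last exact: continuous_cos.
by apply: cvgD; [exact: cvg_cst|exact: cvg_id].
Qed.

Section charfun.
Context {disp : measure_display} {Omega : measurableType disp}.
Variable P : probability Omega R.

(** The vanishing mean of the sine expresses that the characteristic function is real. *)
Definition has_charfun (Z : Omega -> 'rV[R]_d) (h : R) : Prop :=
  [/\ measurable_fun setT Z,
    forall xi, Rintegral P setT (fun w => cos (dotr xi (Z w))) = expR (- (h * psi xi)) &
    forall xi, Rintegral P setT (fun w => sin (dotr xi (Z w))) = 0].

(** On a cosine the expectation is multiplication by exp(- h psi), so the difference quotient equals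
    - psi up to h psi^2 / 2. The integral part of [psi] is the integral of [sdiff]; the quadratic
    part is the third term on the left. The average of psi^2 is bounded by the fourth moment of the
    vectors, uniformly in their number. *)
Lemma key_trig vs a Z h S : has_charfun Z h -> 0 < h ->
  \sum_(v <- vs) dotr v v <= S ->
  `|(Rintegral P setT (fun w => trig vs (a + Z w)) - trig vs a) / h
    - Rintegral N setT (sdiff (trig vs) a)
    + avg vs (fun xi => cos (dotr xi a) * (dotr (xi *m A) xi / 2))| <=
  h * (psi_bound ^+ 2 * (1 + 9 * S ^+ 2)).
Proof.
move=> [mZ ccos csin] h0 hS.
have S0 : 0 <= \sum_(v <- vs) dotr v v by apply: sumr_ge0 => v _; exact: dotr_ge0.
have mcomp (f : R -> R) xi : continuous f ->
    measurable_fun setT (fun w => f (dotr xi (Z w))).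
  by move=> cf; exact: (measurableT_comp (measurable_cos_dotr _ cf) mZ).
have icos xi c : P.-integrable setT (EFin \o (fun w => c * cos (dotr xi (Z w)))).
  apply: (@probability_integrable_bounded _ _ _ _ _ `|c|).
    apply: measurable_funM => //; exact/mcomp/continuous_cos.
  by move=> w; rewrite normrM ler_piMr // cos_max.
have isin xi c : P.-integrable setT (EFin \o (fun w => c * sin (dotr xi (Z w)))).
  apply: (@probability_integrable_bounded _ _ _ _ _ `|c|).
    apply: measurable_funM => //; exact/mcomp/continuous_sin.
  by move=> w; rewrite normrM ler_piMr // sin_max.
have i1 c (g : Omega -> R) : P.-integrable setT (EFin \o (fun w => c * g w)) -> 
   P.-integrable setT (EFin \o (fun w => c * g w)) by [].
have E1 : Rintegral P setT (fun w => trig vs (a + Z w)) =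
    avg vs (fun xi => cos (dotr xi a) * expR (- (h * psi xi))).
  pose F xi w := cos (dotr xi a) * cos (dotr xi (Z w)) - sin (dotr xi a) * sin (dotr xi (Z w)).
  have iF xi : P.-integrable setT (EFin \o F xi).
    exact: (integrableB measurableT (icos xi _) (isin xi _)).
  have [_] := avg_Rintegral vs iF.
  rewrite (eq_avg _ (G := fun xi => cos (dotr xi a) * expR (- (h * psi xi)))).
    move=> <-; apply: eq_Rintegral => w _; apply: eq_avg => xi.
    by rewrite dotrDr cosD.
  move=> xi; rewrite /F RintegralB //; try exact: icos; try exact: isin.
  rewrite RintegralZl ?RintegralZl //.
  - by rewrite ccos csin mulr0 subr0.
  - have := isin xi 1; apply: eq_integrable => // w _ /=; by rewrite mul1r.
  - have := icos xi 1; apply: eq_integrable => // w _ /=; by rewrite mul1r.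
have E2 : Rintegral N setT (sdiff (trig vs) a) =
    - avg vs (fun xi => cos (dotr xi a) * Rintegral N setT (fun z => 1 - cos (dotr xi z))).
  pose F xi z := cos (dotr xi a) * (1 - cos (dotr xi z)).
  have [iF2 H] := avg_Rintegral vs (fun xi => onecos_integrable (cos (dotr xi a)) xi).
  have -> : Rintegral N setT (sdiff (trig vs) a) =
      Rintegral N setT (fun z => (-1) * avg vs (fun xi => F xi z)).
    congr (Rintegral N setT _); apply/funext => z.
    by rewrite sdiff_trig mulN1r.
  rewrite RintegralZl // mulN1r H; congr (- _); apply: eq_avg => xi.
  rewrite RintegralZl //.
  have := onecos_integrable 1 xi; apply: eq_integrable => // z _ /=; by rewrite mul1r.
rewrite E1 E2 opprK.
have -> : (avg vs (fun xi => cos (dotr xi a) * expR (- (h * psi xi))) - trig vs a) / h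
    + avg vs (fun xi => cos (dotr xi a) * Rintegral N setT (fun z => 1 - cos (dotr xi z)))
    + avg vs (fun xi => cos (dotr xi a) * (dotr (xi *m A) xi / 2)) =
    avg vs (fun xi => cos (dotr xi a) * ((expR (- (h * psi xi)) - 1) / h + psi xi)).
  rewrite /trig -avgN -avgD mulrC -avgZ -!avgD; apply: eq_avg => xi.
  rewrite /psi; field; exact: lt0r_neq0.
apply: (le_trans (normr_avg _ _)).
apply: (@le_trans _ _ (avg vs (fun xi => h / 2 * psi xi ^+ 2))).
  apply: le_avg => xi; rewrite normrM; apply: (@le_trans _ _ (1 * (h / 2 * psi xi ^+ 2))); last by rewrite mul1r.
  apply: ler_pM => //; first exact: cos_max.
  have p0 := psi_ge0 xi; have hp : 0 <= h * psi xi by rewrite mulr_ge0 // ltW.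
  have := expRN_le2 hp; have := expR_ge1Dx (- (h * psi xi)).
  set e := expR _ => e1 e2.
  have -> : (e - 1) / h + psi xi = (e - 1 + h * psi xi) / h by field; exact: lt0r_neq0.
  have -> : h / 2 * psi xi ^+ 2 = ((h * psi xi) ^+ 2 / 2) / h by field; exact: lt0r_neq0.
  rewrite normrM (ger0_norm (x := h^-1)) ?invr_ge0 ?(ltW h0) //.
  by rewrite ler_wpM2r ?invr_ge0 ?(ltW h0) // ger0_norm; lra.
rewrite avgZ.
have := avg_psi2_le vs.
have S2 : (\sum_(v <- vs) dotr v v) ^+ 2 <= S ^+ 2.
  by rewrite ler_sqr ?nnegrE // (le_trans S0).
have : psi_bound ^+ 2 * (2 + 18 * (\sum_(v <- vs) dotr v v) ^+ 2) <=
    psi_bound ^+ 2 * (2 + 18 * S ^+ 2).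
  by rewrite ler_wpM2l ?sqr_ge0 // lerD2l ler_wpM2l.
set q := avg _ _; move=> H1 H2.
apply: (@le_trans _ _ (h / 2 * (psi_bound ^+ 2 * (2 + 18 * S ^+ 2)))); last by lra.
by apply: ler_wpM2l; [rewrite divr_ge0 // ltW|exact: le_trans H1].
Qed.

End charfun.

(** A second derivative in direction [u] is replaced by a second difference of step [e]: 2 (1 -
    cos(e p)) / e^2 differs from p^2 by at most e^2 p^4 / 12, and the fourth moment bounds the
    average of p^4. *)
Lemma avg_quad_dir vs a u e S : 0 < e -> dotr u u <= 4 ->
  \sum_(v <- vs) dotr v v <= S ->
  `|avg vs (fun xi => cos (dotr xi a) * dotr xi u ^+ 2)| <=
  2 / e ^+ 2 * `|sdiff (trig vs) a (e *: u)| + 12 * e ^+ 2 * S ^+ 2.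
Proof.
move=> e0 u4 hS.
have S0 : 0 <= \sum_(v <- vs) dotr v v by apply: sumr_ge0 => v _; exact: dotr_ge0.
have e2 : 0 < e ^+ 2 by rewrite exprn_gt0.
have en : e != 0 by exact: lt0r_neq0.
pose G xi := cos (dotr xi a) * (dotr xi u ^+ 2 - 2 / e ^+ 2 * (1 - cos (dotr xi (e *: u)))).
have -> : avg vs (fun xi => cos (dotr xi a) * dotr xi u ^+ 2) =
    avg vs G + 2 / e ^+ 2 * (- sdiff (trig vs) a (e *: u)).
  rewrite sdiff_trig opprK -avgZ -avgD; apply: eq_avg => xi; rewrite /G; ring.
apply: (le_trans (ler_normD _ _)); rewrite addrC normrM normrN.
rewrite (ger0_norm (x := 2 / e ^+ 2)) ?divr_ge0 ?(ltW e2) // lerD2l.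
apply: (le_trans (normr_avg _ _)).
apply: (@le_trans _ _ (avg vs (fun xi => (4 / 3 * e ^+ 2) * dotr xi xi ^+ 2))).
  apply: le_avg => xi; rewrite /G normrM.
  apply: (@le_trans _ _ (1 * (4 / 3 * e ^+ 2 * dotr xi xi ^+ 2))); last by rewrite mul1r.
  apply: ler_pM => //; first exact: cos_max.
  have c1 := cos_ge2 (dotr xi (e *: u)); have c2 := cos_le4 (dotr xi (e *: u)).
  have xu : dotr xi u ^+ 4 <= 16 * dotr xi xi ^+ 2.
    have -> : dotr xi u ^+ 4 = (dotr xi u ^+ 2) ^+ 2 by ring.
    have -> : 16 * dotr xi xi ^+ 2 = (4 * dotr xi xi) ^+ 2 by ring.
    rewrite ler_sqr ?nnegrE ?sqr_ge0 ?mulr_ge0 ?dotr_ge0 //.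
    apply: (le_trans (sqr_dotr_le xi u)); rewrite mulrC ler_wpM2r ?dotr_ge0 //.
  rewrite dotrZr in c1 c2 *; set p := dotr xi u in c1 c2 xu *.
  set c := cos _ in c1 c2 *.
  have -> : p ^+ 2 - 2 / e ^+ 2 * (1 - c) = 2 / e ^+ 2 * (c - (1 - (e * p) ^+ 2 / 2)) by field.
  have -> : 4 / 3 * e ^+ 2 * dotr xi xi ^+ 2 = 2 / e ^+ 2 * (e ^+ 4 * (16 * dotr xi xi ^+ 2) / 24) by field.
  rewrite normrM ger0_norm ?divr_ge0 ?(ltW e2) //.
  apply: ler_wpM2l; first by rewrite divr_ge0 // ltW.
  rewrite ger0_norm ?subr_ge0 //.
  have : e ^+ 4 * p ^+ 4 <= e ^+ 4 * (16 * dotr xi xi ^+ 2).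
    by rewrite ler_wpM2l // exprn_ge0 // ltW.
  rewrite -exprMn; lra.
rewrite avgZ.
have S2 : (\sum_(v <- vs) dotr v v) ^+ 2 <= S ^+ 2.
  by rewrite ler_sqr ?nnegrE // (le_trans S0).
have -> : 12 * e ^+ 2 * S ^+ 2 = (4 / 3 * e ^+ 2) * (9 * S ^+ 2) by field.
apply: ler_wpM2l; first by rewrite mulr_ge0 // ltW.
by apply: (le_trans (avg_dotr4_le vs)); rewrite ler_wpM2l.
Qed.

Lemma polarize xi (i j : 'I_d) : xi ord0 i * xi ord0 j =
  (dotr xi (delta_mx ord0 i + delta_mx ord0 j) ^+ 2 -
   dotr xi (delta_mx ord0 i - delta_mx ord0 j) ^+ 2) / 4.
Proof.
have dd k : dotr xi (delta_mx ord0 k) = xi ord0 k.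
  rewrite /dotr (bigD1 k) //= big1 ?addr0 ?mxE ?eqxx ?mulr1 // => l lk.
  by rewrite mxE eqxx (negPf lk) mulr0.
by rewrite !dotrDr dotrNr !dd; field.
Qed.

Lemma dotr_delta2 (i j : 'I_d) (s : R) : s ^+ 2 = 1 ->
  dotr (delta_mx ord0 i + s *: delta_mx ord0 j) (delta_mx ord0 i + s *: delta_mx ord0 j)
  <= 4 :> R.
Proof.
move=> s1.
have dd k l : dotr (delta_mx ord0 k) (delta_mx ord0 l) = (k == l)%:R :> R.
  rewrite /dotr (bigD1 k) //= big1 ?addr0 ?mxE ?eqxx ?mul1r // => m mk.
  by rewrite mxE eqxx (negPf mk) mul0r.
rewrite !dotrDl !dotrDr !dotrZl !dotrZr !dd !eqxx (eq_sym j i).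
have -> : s * (s * true%:R) = 1 by rewrite mulr1 -expr2.
have : `|s| = 1 by apply/eqP; rewrite -sqr_norm_eq1 s1.
by case: (i == j) => /= [|_]; have := ler_norm s; lra.
Qed.

(** Polarisation writes the quadratic form of [A] through squares along the sums and differences of
    two basis vectors, to which [avg_quad_dir] applies. *)
Lemma avg_quad_le vs a e S : 0 < e -> \sum_(v <- vs) dotr v v <= S ->
  `|avg vs (fun xi => cos (dotr xi a) * (dotr (xi *m A) xi / 2))| <=
  \sum_i \sum_j `|A i j| *
   ((`|sdiff (trig vs) a (e *: (delta_mx ord0 i + delta_mx ord0 j))| +
     `|sdiff (trig vs) a (e *: (delta_mx ord0 i - delta_mx ord0 j))|) / e ^+ 2
     + 12 * e ^+ 2 * S ^+ 2).
Proof.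
move=> e0 hS.
have e2 : 0 < e ^+ 2 by rewrite exprn_gt0.
rewrite (eq_avg _ (G := fun xi => \sum_i \sum_j (A i j / 8) *
  (cos (dotr xi a) * dotr xi (delta_mx ord0 i + delta_mx ord0 j) ^+ 2
  - cos (dotr xi a) * dotr xi (delta_mx ord0 i - delta_mx ord0 j) ^+ 2))); last first.
  move=> xi; rewrite quad_sum mulrA mulrC mulrA !mulr_sumr; apply: eq_bigr => i _.
  rewrite mulr_sumr; apply: eq_bigr => j _; rewrite polarize; by field.
rewrite avg_sum; apply: (le_trans (ler_norm_sum _ _ _)); apply: ler_sum => i _.
rewrite avg_sum; apply: (le_trans (ler_norm_sum _ _ _)); apply: ler_sum => j _.
rewrite avgZ avgD avgN normrM normrM (ger0_norm (x := 8^-1)) // -mulrA.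
apply: ler_wpM2l => //.
have := avg_quad_dir a e0 (dotr_delta2 i j (expr1n _ 2)) hS.
rewrite scale1r => H1.
have sq1 : (-1) ^+ 2 = 1 :> R by rewrite sqrrN expr1n.
have := avg_quad_dir a e0 (dotr_delta2 i j sq1) hS.
rewrite scaleN1r => H2.
apply: (@le_trans _ _ (8^-1 * (2 / e ^+ 2 * `|sdiff (trig vs) a (e *: (delta_mx ord0 i + delta_mx ord0 j))| + 12 * e ^+ 2 * S ^+ 2 + (2 / e ^+ 2 * `|sdiff (trig vs) a (e *: (delta_mx ord0 i - delta_mx ord0 j))| + 12 * e ^+ 2 * S ^+ 2)))).
  rewrite ler_wpM2l //; apply: (le_trans (ler_normB _ _)); exact: lerD.
set p := `|_|; set q := `|_|.
have p0 : 0 <= p := normr_ge0 _; have q0 : 0 <= q := normr_ge0 _.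
have S2 : 0 <= e ^+ 2 * S ^+ 2 by rewrite mulr_ge0 ?sqr_ge0.
have : 0 <= (p + q) / e ^+ 2 by rewrite divr_ge0 ?addr_ge0 // ltW.
have -> : 2 / e ^+ 2 * p + 12 * e ^+ 2 * S ^+ 2 + (2 / e ^+ 2 * q + 12 * e ^+ 2 * S ^+ 2)
  = 2 * ((p + q) / e ^+ 2) + 24 * (e ^+ 2 * S ^+ 2) by field; exact: lt0r_neq0.
lra.
Qed.


(** The steps of a random walk, [n.+1] of them on each axis. In the limit it is centred normal with
    variance 2 b per coordinate, and the characteristic function of that law is [gauss b]. *)
Definition gvecs (b : R) (n : nat) : seq 'rV[R]_d :=
  flatten [seq nseq n.+1 (Num.sqrt (2 * b / n.+1%:R) *: delta_mx ord0 j) |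
    j <- enum 'I_d].

Lemma sum_gvecs b n (F : 'rV[R]_d -> R) : \sum_(v <- gvecs b n) F v =
  \sum_j F (Num.sqrt (2 * b / n.+1%:R) *: delta_mx ord0 j) *+ n.+1.
Proof.
rewrite /gvecs big_flatten big_map big_enum; apply: eq_bigr => j _.
by rewrite big_nseq iter_addr_0.
Qed.

Lemma dotr_delta (j : 'I_d) a : dotr (delta_mx ord0 j) a = a ord0 j.
Proof.
rewrite /dotr (bigD1 j) //= big1 ?addr0 ?mxE ?eqxx ?mul1r // => l lk.
by rewrite mxE eqxx (negPf lk) mul0r.
Qed.

(** Telescoping: the factors, and hence the partial products, have modulus at most 1. *)
Lemma normr_prod_sub (f g : 'rV[R]_d -> R) vs :
  (forall v, `|f v| <= 1) -> (forall v, `|g v| <= 1) ->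
  `|\prod_(v <- vs) f v - \prod_(v <- vs) g v| <= \sum_(v <- vs) `|f v - g v|.
Proof.
move=> f1 g1; elim: vs => [|v vs IH]; first by rewrite !big_nil subrr normr0.
rewrite !big_cons.
set p := \prod_(j <- vs) f j in IH *; set q := \prod_(j <- vs) g j in IH *.
have p1 : `|p| <= 1.
  rewrite /p normr_prod; elim: vs {IH p q} => [|u vs IH]; first by rewrite big_nil.
  rewrite big_cons -[leRHS]mulr1; apply: ler_pM => //.
  by apply: prodr_ge0 => w _; exact: normr_ge0.
have -> : f v * p - g v * q = (f v - g v) * p + g v * (p - q) by ring.
apply: (le_trans (ler_normD _ _)); rewrite !normrM; apply: lerD.
  by rewrite ler_piMr.
by apply: le_trans IH; rewrite ler_piMl.
Qed.

Lemma gvecs_norm b n : 0 <= b -> \sum_(v <- gvecs b n) dotr v v = 2 * b * d%:R.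
Proof.
move=> b0; rewrite sum_gvecs (eq_bigr (fun=> 2 * b)); last first.
  move=> j _; rewrite dotrZl dotrZr dotr_delta mxE !eqxx mulr1 -expr2.
  rewrite sqr_sqrtr ?divr_ge0 ?mulr_ge0 // -[LHS]mulr_natr divfK //.
by rewrite sumr_const card_ord mulr_natr.
Qed.

(** [cos_gauss] for each factor, with arguments of order n^(-1/2): on each axis [n.+1] errors of
    order n^(-2) are added. *)
Lemma trig_gvecs_sub b n a : 0 <= b ->
  `|trig (gvecs b n) a - gauss b a| <= (4 * b ^+ 2 * \sum_j a ord0 j ^+ 4) * n.+1%:R^-1.
Proof.
move=> b0; rewrite /trig avg_cos.
set c := Num.sqrt (2 * b / n.+1%:R).
have c2 : c ^+ 2 = 2 * b / n.+1%:R by rewrite sqr_sqrtr ?divr_ge0 ?mulr_ge0.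
have -> : gauss b a = \prod_(v <- gvecs b n) expR (- (dotr v a ^+ 2 / 2)).
  rewrite -(expR_sum _ xpredT) /= sumrN -mulr_suml sum_gvecs /gauss {1}/dotr.
  congr (expR (- _)); rewrite mulr_sumr mulr_suml; apply: eq_bigr => j _.
  rewrite dotrZl dotr_delta -/c -mulr_natr exprMn c2; field.
  by rewrite nat1r pnatr_eq0.
apply: (le_trans (normr_prod_sub _ _ _)) => [v|v|].
- exact: cos_max.
- by rewrite ger0_norm ?expR_ge0 // expR_le1 oppr_le0 divr_ge0 ?sqr_ge0.
apply: (@le_trans _ _ (\sum_(v <- gvecs b n) dotr v a ^+ 4)).
  by apply: ler_sum => v _; exact: cos_gauss.
rewrite sum_gvecs mulr_sumr mulr_suml; apply: ler_sum => j _.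
rewrite dotrZl dotr_delta -/c -mulr_natr exprMn.
have -> : c ^+ 4 = (c ^+ 2) ^+ 2 by ring.
rewrite c2 le_eqVlt; apply/orP; left; apply/eqP; field.
by rewrite nat1r pnatr_eq0.
Qed.

Lemma cvg_of_harmonic (u : nat -> R) l K :
  (forall n, `|u n - l| <= K * n.+1%:R^-1) -> u n @[n --> \oo] --> l.
Proof.
move=> H.
have K0 : K * n.+1%:R^-1 @[n --> \oo] --> (0 : R).
  rewrite -(mulr0 K); apply: cvgM; [exact: cvg_cst|exact: cvg_harmonic].
apply: (@squeeze_cvgr _ _ _ _ (fun n => l - K * n.+1%:R^-1) (fun n => l + K * n.+1%:R^-1)).
- by apply: nearW => n; have := H n; rewrite ler_norml; move: (K * _) => k /andP[h1 h2]; apply/andP; split; lra.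
- by rewrite -[X in _ --> X]subr0; apply: cvgB => //; exact: cvg_cst.
- by rewrite -[X in _ --> X]addr0; apply: cvgD => //; exact: cvg_cst.
Qed.

Lemma cvg_trig_gvecs b a : 0 <= b -> trig (gvecs b n) a @[n --> \oo] --> gauss b a.
Proof. by move=> b0; apply: cvg_of_harmonic => n; exact: trig_gvecs_sub. Qed.

Lemma cvg_sdiff_gvecs b a z : 0 <= b ->
  sdiff (trig (gvecs b n)) a z @[n --> \oo] --> sdiff (gauss b) a z.
Proof.
move=> b0; rewrite /sdiff; apply: cvgB; last exact: cvg_trig_gvecs.
by apply: cvgM; [apply: cvgD; exact: cvg_trig_gvecs|exact: cvg_cst].
Qed.

Lemma measurable_sdiff_trig vs a : measurable_fun setT (sdiff (trig vs) a).
Proof.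
apply: measurable_funB => //; apply: measurable_funM => //; apply: measurable_funD.
  exact: measurable_trig.
apply: (measurableT_comp (measurable_trig vs a)); exact: measurable_rVN.
Qed.

(** The bound depends on the vectors only through [S], so that it dominates along the whole sequence
    [gvecs b n] and the limit passes under [N]. *)
Lemma normr_sdiff_trig_le vs a z S : \sum_(v <- vs) dotr v v <= S ->
  `|sdiff (trig vs) a z| <= (3 + 9 * S ^+ 2) * trunc2 z.
Proof.
move=> hS.
have S0 : 0 <= \sum_(v <- vs) dotr v v by apply: sumr_ge0 => v _; exact: dotr_ge0.
rewrite sdiff_trig normrN; apply: (le_trans (normr_avg _ _)).
apply: (@le_trans _ _ (avg vs (fun xi => trunc2 z * (3 + dotr xi xi ^+ 2)))).
  apply: le_avg => xi; have /andP[h1 h2] := onecos_le xi z.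
  rewrite normrM (ger0_norm h1).
  apply: (@le_trans _ _ (1 * (1 - cos (dotr xi z)))).
    by rewrite ler_wpM2r // cos_max.
  rewrite mul1r (le_trans h2) // mulrC ler_wpM2l ?trunc2_ge0 //.
  have := sqr_ge0 (dotr xi xi - 1); have := sqr_ge0 (dotr xi xi); lra.
rewrite avgZ mulrC ler_wpM2r ?trunc2_ge0 // avgD avg_cst lerD2l.
apply: (le_trans (avg_dotr4_le vs)); rewrite ler_wpM2l //.
by rewrite ler_sqr ?nnegrE // (le_trans S0).
Qed.

(* A Gaussian is a limit of averages of the functions [cos (dotr xi _)], for which
   the estimate can be read off the characteristic function. *)
Lemma key_gauss (b : R) {disp : measure_display} {Omega : measurableType disp}
    (P : probability Omega R) : 0 < b -> exists2 C : R, 0 < C &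
  forall Z h a, 0 < h <= 1 -> has_charfun P Z h ->
  `|(Rintegral P setT (fun w => gauss b (a + Z w)) - gauss b a) / h
    - Rintegral N setT (sdiff (gauss b) a)| <= C * (gauss (b / 2) a + h).
Proof.
move=> b0; have [C1 C10 HC1] := sdiff_gauss_le (d := d) b0.
have b0' := ltW b0.
pose S := 2 * b * d%:R; pose K1 := psi_bound ^+ 2 * (1 + 9 * S ^+ 2).
have K10 : 0 <= K1 by rewrite mulr_ge0 ?sqr_ge0 // addr_ge0 // mulr_ge0 // sqr_ge0.
have S20 : 0 <= S ^+ 2 by exact: sqr_ge0.
exists (K1 + mx_sum * (8 * C1 + 3 * S ^+ 2) + 1).
  have : 0 <= mx_sum * (8 * C1 + 3 * S ^+ 2) by rewrite mulr_ge0 ?mx_sum_ge0 //; lra.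
  lra.
move=> Z h a /andP[h0 h1] hZ.
(* The choice e^2 = h/4 keeps the difference steps within the unit ball, where [sdiff_gauss_le]
   applies; the second differences divided by e^2 become O(gauss (b / 2) a), and the Taylor errors
   O(h). *)
pose e := Num.sqrt h / 2.
have e0 : 0 < e by rewrite divr_gt0 // sqrtr_gt0.
have e2 : e ^+ 2 = h / 4 by rewrite exprMn sqr_sqrtr ?(ltW h0) // exprVn; field.
have ee : e <= 1 / 2.
  have : Num.sqrt h <= Num.sqrt 1 by rewrite ler_sqrt.
  by rewrite sqrtr1 /e; lra.
pose up i j : 'rV[R]_d := e *: (delta_mx ord0 i + delta_mx ord0 j).
pose um i j : 'rV[R]_d := e *: (delta_mx ord0 i - delta_mx ord0 j).
pose rhs (f : 'rV[R]_d -> R) := h * K1 + \sum_i \sum_j `|A i j| *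
   ((`|sdiff f a (up i j)| + `|sdiff f a (um i j)|) / e ^+ 2 + 12 * e ^+ 2 * S ^+ 2).
(* The inequality is carried to the limit before any decay in [a] is used, because the trigonometric
   averages have none. *)
apply: (@le_trans _ _ (rhs (gauss b))).
  pose lhs (f : 'rV[R]_d -> R) := `|(Rintegral P setT (fun w => f (a + Z w)) - f a) / h
    - Rintegral N setT (sdiff f a)|.
  have Hn n : lhs (trig (gvecs b n)) <= rhs (trig (gvecs b n)).
    have hS : \sum_(v <- gvecs b n) dotr v v <= S by rewrite gvecs_norm.
    have k1 := key_trig a hZ h0 hS; have k2 := avg_quad_le a e0 hS.
    move: k1 k2; rewrite /lhs /rhs -/K1.
    set q := avg _ _; set x := _ - Rintegral _ _ _ => k1 k2.
    have -> : x = (x + q) - q by rewrite addrK.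
    by apply: (le_trans (ler_normB _ _)); apply: lerD.
  have cl : lhs (trig (gvecs b n)) @[n --> \oo] --> lhs (gauss b).
    apply: cvg_norm; apply: cvgB.
      apply: cvgM; last exact: cvg_cst.
      apply: cvgB; last exact: cvg_trig_gvecs.
      apply: (cvg_Rintegral (g := cst 1)).
      - move=> n; case: hZ => mZ _ _; exact: (measurableT_comp (measurable_trig _ a) mZ).
      - by move=> w; exact: cvg_trig_gvecs.
      - exact: finite_measure_integrable_cst.
      - by move=> n w; exact: normr_trig_le.
    apply: (cvg_Rintegral (g := fun z => (3 + 9 * S ^+ 2) * trunc2 z)).
    - by move=> n; exact: measurable_sdiff_trig.
    - by move=> z; exact: cvg_sdiff_gvecs.
    - have := integrableZl measurableT (3 + 9 * S ^+ 2) trunc2_integrable.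
      exact: eq_integrable.
    - by move=> n z; apply: normr_sdiff_trig_le; rewrite gvecs_norm.
  have cr : rhs (trig (gvecs b n)) @[n --> \oo] --> rhs (gauss b).
    apply: cvgD; first exact: cvg_cst.
    apply: cvg_big => [|i _]; first exact: add_continuous.
    apply: cvg_big => [|j _]; first exact: add_continuous.
    apply: cvgM; first exact: cvg_cst.
    apply: cvgD; last exact: cvg_cst.
    apply: cvgM; last exact: cvg_cst.
    by apply: cvgD; apply: cvg_norm; exact: cvg_sdiff_gvecs.
  by apply: (ler_cvg_to cl cr); exact: nearW.
have bnd s i j : s ^+ 2 = 1 ->
    `|sdiff (gauss b) a (e *: (delta_mx ord0 i + s *: delta_mx ord0 j))| <=
    4 * C1 * e ^+ 2 * gauss (b / 2) a.
  move=> s1; have u4 := dotr_delta2 i j s1.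
  set u := _ + _ in u4 *.
  have uu : dotr (e *: u) (e *: u) <= 4 * e ^+ 2.
    by rewrite dotrZl dotrZr mulrA -expr2 mulrC ler_wpM2r // sqr_ge0.
  apply: (le_trans (HC1 _ _ _)).
    rewrite -sqrtr1 /enorm ler_sqrt // (le_trans uu) // e2; lra.
  rewrite ler_wpM2r ?gauss_ge0 //.
  have -> : 4 * C1 * e ^+ 2 = C1 * (4 * e ^+ 2) by ring.
  by rewrite ler_wpM2l // ltW.
have g0 := gauss_gt0 (b / 2) a.
have H2 : \sum_i \sum_j `|A i j| *
   ((`|sdiff (gauss b) a (up i j)| + `|sdiff (gauss b) a (um i j)|) / e ^+ 2
     + 12 * e ^+ 2 * S ^+ 2) <= mx_sum * (8 * C1 * gauss (b / 2) a + 3 * h * S ^+ 2).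
  rewrite /mx_sum mulr_suml; apply: ler_sum => i _.
  rewrite mulr_suml; apply: ler_sum => j _; apply: ler_wpM2l => //.
  have := bnd 1 i j (expr1n _ 2); rewrite scale1r => b1.
  have sq1 : (-1) ^+ 2 = 1 :> R by rewrite sqrrN expr1n.
  have := bnd _ i j sq1; rewrite scaleN1r => b2.
  have -> : 12 * e ^+ 2 * S ^+ 2 = 3 * h * S ^+ 2 by rewrite e2; field.
  rewrite lerD2r.
  rewrite ler_pdivrMr ?exprn_gt0 //.
  have -> : 8 * C1 * gauss (b / 2) a * e ^+ 2 =
    4 * C1 * e ^+ 2 * gauss (b / 2) a + 4 * C1 * e ^+ 2 * gauss (b / 2) a by ring.
  rewrite /up /um; apply: lerD; [exact: b1|exact: b2].
have m0 := mx_sum_ge0.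
rewrite /rhs; apply: (@le_trans _ _ (h * K1 + mx_sum * (8 * C1 * gauss (b / 2) a + 3 * h * S ^+ 2))).
  by rewrite lerD2l.
have arith (k m c s g x : R) : 0 <= m * (8 * c) * x -> 0 <= m * (3 * s) * g ->
    0 <= k * g -> 0 <= g -> 0 <= x ->
    x * k + m * (8 * c * g + 3 * x * s) <= (k + m * (8 * c + 3 * s) + 1) * (g + x).
  by clear; move=> *; lra.
have h0' := ltW h0; have g0' := ltW g0; have C10' := ltW C10.
apply: arith => //; last exact: mulr_ge0.
  by apply: mulr_ge0 => //; apply: mulr_ge0 => //; exact: mulr_ge0.
by apply: mulr_ge0 => //; apply: mulr_ge0 => //; exact: mulr_ge0.
Qed.

End levy_symbol.

(** * Integrals against a density, and Gaussian integrals *)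

Section density.
Context d (T : measurableType d) (R : realType).
Variables (mu N : {measure set T -> \bar R}) (g : T -> R) (E : set T).
Hypotheses (mE : measurable E) (mg : measurable_fun setT g).
Hypothesis g0 : forall x, E x -> 0 <= g x.
Hypothesis NE : forall A, measurable A -> N A = (\int[mu]_(x in A) (g x)%:E)%E.
Local Open Scope ereal_scope.

Import HBNNSimple.

(** Restriction to [E] is what allows a density with no sign prescribed outside of it, such as [nu]
    at the origin. The proof approximates [f] by simple functions from below. *)
Lemma integral_density (f : T -> \bar R) : (forall x, 0 <= f x) ->
  measurable_fun setT f ->
  \int[N]_(x in E) f x = \int[mu]_(x in E) (f x * (g x)%:E).
Proof.
move=> f0 mfT; have mf : measurable_fun E f by exact: measurable_funTS.
have mgE : measurable_fun E (EFin \o g) by apply/measurable_funTS/measurable_EFinP.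
pose h := nnsfun_approx mE mf.
have -> : \int[N]_(x in E) f x = lim (\int[N]_(x in E) (EFin \o h n) x @[n --> \oo]).
  have fE x : E x -> f x = lim ((EFin \o h n) x @[n --> \oo]).
    by move=> Ex; apply/esym/cvg_lim => //; exact: cvg_nnsfun_approx.
  under eq_integral => x /[!inE] /fE -> //.
  apply: monotone_convergence => //.
  - move=> n; apply/measurable_EFinP.
    by apply: (measurable_funS measurableT) => //; exact/measurable_funP.
  - by move=> n x Ex //=; rewrite lee_fin.
  - by move=> x Ex a b ab; rewrite lee_fin; exact/lefP/nd_nnsfun_approx.
have -> : \int[mu]_(x in E) (f x * (g x)%:E) =
    lim (\int[mu]_(x in E) ((EFin \o h n) x * (g x)%:E) @[n --> \oo]).
  have fg x : E x -> f x * (g x)%:E = lim (((EFin \o h n) x * (g x)%:E) @[n --> \oo]).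
    by move=> Ex; apply/esym/cvg_lim => //; apply: cvgeZr => //;
      exact: cvg_nnsfun_approx.
  under eq_integral => x /[!inE] /fg -> //.
  apply: monotone_convergence => [//| | |].
  - by move=> n; apply/emeasurable_funM => //; apply/measurable_funTS/measurable_EFinP.
  - by move=> n x Ex /=; rewrite mule_ge0 ?lee_fin ?g0.
  - by move=> x Ex a b ab/=; rewrite lee_wpmul2r ?lee_fin ?g0//; exact/lefP/nd_nnsfun_approx.
suff suf n : \int[mu]_(x in E) ((EFin \o h n) x * (g x)%:E) =
    \int[N]_(x in E) (EFin \o h n) x.
  by under [in RHS]eq_fun do rewrite suf.
transitivity (\int[N]_(x in E)
   (\sum_(y \in range (h n)) (y * \1_(h n @^-1` [set y]) x)%:E)); last first.
  by apply: eq_integral => t tE; rewrite /= fimfunE -fsumEFin.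
have indich m r : measurable_fun E (fun x => (r * \1_(h m @^-1` [set r]) x)%:E).
  by apply: (measurable_comp measurableT) => //; exact: measurable_funM.
rewrite ge0_integral_fsum//; last by move=> m y Ey; exact: nnfun_muleindic_ge0.
transitivity (\int[mu]_(x in E) (\sum_(y \in range (h n))
    (y * \1_(h n @^-1` [set y]) x)%:E * (g x)%:E)).
  under [RHS]eq_integral => x xE.
    rewrite -ge0_mule_fsuml => [|y]; last exact: nnfun_muleindic_ge0.
    rewrite fsumEFin // -(fimfunE _ x); over.
  by [].
rewrite ge0_integral_fsum//; last 2 first.
  - by move=> y; apply: emeasurable_funM.
  - by move=> m y Ey; apply: mule_ge0; [exact: nnfun_muleindic_ge0|rewrite lee_fin g0].
apply: eq_fsbigr => r rhn.
under [RHS]eq_integral do rewrite EFinM.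
rewrite integralZl_indic_nnsfun => //.
under eq_integral do rewrite EFinM -muleA.
move: rhn => /set_mem[t _ <-].
rewrite ge0_integralZl//.
- under eq_integral do rewrite muleC.
  rewrite (eq_integral ((EFin \o g) \_ (h n @^-1` [set h n t]))); last first.
    by move=> x xE; rewrite epatch_indic.
  by rewrite -integral_mkcondr -NE ?integral_indic// 1?setIC //; exact: measurableI.
- apply: emeasurable_funM => //; first exact/measurable_EFinP/measurable_funTS.
- by move=> x Ex; rewrite mule_ge0 ?lee_fin ?g0 // indicE.
- by rewrite lee_fin fun_ge0.
Qed.

End density.

Section gauss_integral.
Context {R : realType}.
Local Open Scope ereal_scope.

(** Up to its peak value the integrand is the normal density with variance 1/(2 b), whose integral
    does not depend on the centre. *)
Lemma integral_gauss1 (b : R) : (0 < b)%R -> exists2 G : R, (0 < G)%R &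
  forall s : R, \int[lebesgue_measure]_t (expR (- (b * (s - t) ^+ 2)))%:E = G%:E.
Proof.
move=> b0; pose sg := Num.sqrt (2 * b)^-1.
have sg2 : (sg ^+ 2 = (2 * b)^-1)%R.
  by rewrite sqr_sqrtr // invr_ge0 mulr_ge0 // ltW.
have sg0 : sg != 0%R by rewrite gt_eqF // sqrtr_gt0 invr_gt0 mulr_gt0.
exists (normal_peak sg)^-1%R; first by rewrite invr_gt0 normal_peak_gt0.
move=> s; have := integral_normal_pdf s sg.
rewrite normal_pdfE //.
under eq_integral do rewrite EFinM.
rewrite ge0_integralZl //; last 3 first.
- by apply/measurable_EFinP; exact: measurable_normal_fun.
- by move=> x _; rewrite lee_fin normal_fun_ge0.
- by rewrite lee_fin normal_peak_ge0.
have -> : normal_fun s sg = (fun t => expR (- (b * (s - t) ^+ 2)))%R.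
  apply/funext => t; rewrite /normal_fun sg2 -mulr_natr; congr expR.
  have -> : ((2 * b)^-1 * 2 = b^-1 :> R)%R.
    by rewrite invfM mulrAC mulVf ?mul1r // pnatr_eq0.
  by rewrite invrK; ring.
have p0 := normal_peak_gt0 sg0.
set I := integral _ _ _ => H.
have pe : (normal_peak sg)^-1%:E * (normal_peak sg)%:E = 1.
  by rewrite -EFinM mulVf // gt_eqF.
by rewrite -[LHS]mul1e -pe -muleA H mule1.
Qed.

(** The recursion follows the construction of [lebesgue_rV]: the first coordinate is split off and
    the Gaussian factorises. *)
Lemma integral_gauss (d : nat) (b : R) : (0 < b)%R -> exists2 G : R, (0 < G)%R &
  forall x : 'rV[R]_d, \int[lebesgue_rV R d]_y (gauss b (x - y))%:E = G%:E.
Proof.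
move=> b0; have [G1 G10 HG1] := integral_gauss1 b0.
elim: d => [|n [G G0 HG]].
  exists 1%R => // x; rewrite integral_dirac //; last first.
    apply/measurable_EFinP; apply: (measurableT_comp (measurable_gauss b)).
    by apply: measurable_rVB => //; exact: measurable_id.
  rewrite diracT mul1e /gauss /dotr big_ord0 mulr0 oppr0 expR0 //.
exists (G1 * G)%R; first by rewrite mulr_gt0.
move=> x; pose x' : 'rV[R]_n := \row_j x ord0 (lift ord0 j).
have mgx k (z : 'rV[R]_k) : measurable_fun setT (fun y : 'rV[R]_k => (gauss b (z - y))%:E).
  apply/measurable_EFinP; apply: (measurableT_comp (measurable_gauss b)).
  by apply: measurable_rVB => //; exact: measurable_id.
transitivity (\int[pushforward (lebesgue_measure \x lebesgue_rV R n) (@rV_cons R n)]_y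
   (gauss b (x - y))%:E) => //.
rewrite ge0_integral_pushforward //; last 3 first.
- exact: measurable_rV_cons.
- exact: mgx.
- by move=> y _; rewrite lee_fin gauss_ge0.
have gE (t : R) (v : 'rV[R]_n) : gauss b (x - rV_cons (t, v)) =
    (expR (- (b * (x ord0 ord0 - t) ^+ 2)) * gauss b (x' - v))%R.
  rewrite /gauss -expRD; congr expR; rewrite -opprD -mulrDr; congr (- (b * _))%R.
  rewrite /dotr big_ord_recl; congr (_ + _)%R.
    by rewrite !mxE unlift_none.
  by apply: eq_bigr => i _; rewrite !mxE liftK.
rewrite preimage_setT fubini_tonelli1 //; last 2 first.
- exact: (measurableT_comp (mgx _ x) (@measurable_rV_cons R n)).
- by move=> y; rewrite lee_fin gauss_ge0.
transitivity (\int[lebesgue_measure]_(t in [set: R])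
    ((expR (- (b * (x ord0 ord0 - t) ^+ 2)))%:E * G%:E)).
  apply: eq_integral => t _; rewrite /fubini_F /=.
  under eq_integral do rewrite gE EFinM.
  rewrite ge0_integralZl //; [by rewrite HG|exact: mgx|].
  by move=> y _; rewrite lee_fin gauss_ge0.
rewrite ge0_integralZr // ?HG1 ?EFinM //; last by rewrite lee_fin ltW.
- apply/measurable_EFinP; apply: measurableT_comp => //; apply: measurableT_comp => //.
  apply: measurable_funM => //; apply: measurable_funX; exact: measurable_funB.
Qed.

End gauss_integral.

(** * The radial profile of the density of the Levy measure *)

Section profile.
Context {R : realType} {d : nat}.
Hypothesis hd : (0 < d)%N.
Variables (nu : 'rV[R]_d -> R) (N : {measure set 'rV[R]_d -> \bar R}).
Hypothesis mnu : measurable_fun setT nu.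
Hypothesis nu_gt0 : forall x, x != 0 -> 0 < nu x.
Hypothesis Nfin : (\int[N]_z (Num.min 1 (enorm z ^+ 2))%:E < +oo)%E.
Hypothesis NE : forall A, measurable A ->
  N A = (\int[lebesgue_rV R d]_(z in A) (nu z)%:E)%E.
Variables C1 C2 C3 : R.
Hypotheses (C1_ge1 : 1 <= C1) (C2_ge1 : 1 <= C2) (C3_ge1 : 1 <= C3).
Hypothesis nu_comp : forall x y, 1 / 2 <= enorm y -> enorm y <= enorm x ->
  enorm x <= enorm y + 1 -> C1^-1 * nu y <= nu x <= C1 * nu y.
Hypothesis nu_decr : forall x y, 1 / 2 <= enorm y -> enorm y <= enorm x ->
  nu x <= C2 * nu y.
Hypothesis nu_jump : forall x y, 1 <= enorm (y - x) ->
    (\int[lebesgue_rV R d]_(z in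
        [set z | (1 / 2 < enorm (z - x))%R /\ (1 / 2 < enorm (z - y))%R])
      (nu (x - z) * nu (z - y))%:E <= (C3 * nu (x - y))%:E)%E.
Implicit Types (x y z : 'rV[R]_d) (r : R).

Let leb := lebesgue_rV R d.

Let C1_gt0 : 0 < C1 := lt_le_trans ltr01 C1_ge1.
Let C2_gt0 : 0 < C2 := lt_le_trans ltr01 C2_ge1.
Let C3_gt0 : 0 < C3 := lt_le_trans ltr01 C3_ge1.

Definition bigjump : set 'rV[R]_d := [set z | 1 / 2 < enorm z].

Lemma measurable_bigjump : measurable bigjump.
Proof.
rewrite (_ : bigjump = @enorm R d @^-1` `]1 / 2, +oo[%classic).
  by rewrite -[X in measurable X]setTI; exact: measurable_enorm.
by apply/seteqP; split => y; rewrite /= in_itv /= andbT.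
Qed.

Lemma nu_gt0_enorm x : 0 < enorm x -> 0 < nu x.
Proof. by move=> x0; apply: nu_gt0; apply: contraTneq x0 => ->; rewrite enorm0 ltxx. Qed.

Lemma exists_enorm r : 0 <= r -> exists x : 'rV[R]_d, enorm x = r.
Proof.
move=> r0; exists (r *: delta_mx ord0 (Ordinal hd)).
by rewrite enormZ ger0_norm // /enorm dotr_delta mxE !eqxx sqrtr1 mulr1.
Qed.

Definition tailsup r : R := sup [set nu y | y in [set y | r <= enorm y]].

(** The cap at radius 1 gives boundedness although [nu] may explode at 0, and the supremum over the
    tail gives monotonicity in the length. Comparability holds as nu <= profile from radius 1 on and
    profile <= C2 nu from radius 1/2 on. *)
Definition profile x : R := tailsup (Num.max 1 (enorm x)).

Lemma le_tailsup r y : 1 / 2 <= r -> r <= enorm y -> nu y <= tailsup r.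
Proof.
move=> r1 ry; apply: sup_upper_bound; last by exists y.
split; first by exists (nu y), y.
have [x xr] : exists x : 'rV[R]_d, enorm x = r by apply: exists_enorm; lra.
exists (C2 * nu x) => _ [z /= rz <-]; apply: nu_decr; by rewrite xr.
Qed.

Lemma tailsup_le r y : 1 / 2 <= enorm y -> enorm y <= r -> tailsup r <= C2 * nu y.
Proof.
move=> y1 yr; apply: ge_sup.
  have [x xr] : exists x : 'rV[R]_d, enorm x = r by apply: exists_enorm; lra.
  by exists (nu x), x => //=; rewrite xr.
by move=> _ [z /= rz <-]; apply: nu_decr => //; exact: le_trans rz.
Qed.

Lemma tailsup_gt0 r : 1 / 2 <= r -> 0 < tailsup r.
Proof.
move=> r1; have [x xr] : exists x : 'rV[R]_d, enorm x = r by apply: exists_enorm; lra.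
by apply: (@lt_le_trans _ _ (nu x)); [apply: nu_gt0_enorm; lra|apply: le_tailsup; rewrite ?xr].
Qed.

Lemma tailsup_nincr r s : 1 / 2 <= r -> r <= s -> tailsup s <= tailsup r.
Proof.
move=> r1 rs; apply: ge_sup.
  have [x xr] : exists x : 'rV[R]_d, enorm x = s by apply: exists_enorm; lra.
  by exists (nu x), x => //=; rewrite xr.
by move=> _ [z /= sz <-]; apply: le_tailsup => //; exact: le_trans sz.
Qed.

Definition shiftc : R := locked (C1 * C2).

Lemma shiftc_ge1 : 1 <= shiftc.
Proof. by rewrite /shiftc -lock mulr_ege1. Qed.

(** Almost monotonicity, with [C2], bounds the tail supremum by one value at radius [r];
    comparability at distance 1, with [C1], moves that value to radius r + 1. *)
Lemma tailsup_step r : 1 / 2 <= r -> tailsup r <= shiftc * tailsup (r + 1).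
Proof.
move=> r1.
have [x xr] : exists x : 'rV[R]_d, enorm x = r by apply: exists_enorm; lra.
have [y yr] : exists y : 'rV[R]_d, enorm y = r + 1 by apply: exists_enorm; lra.
have /andP[h _] : C1^-1 * nu x <= nu y <= C1 * nu x by apply: nu_comp; lra.
have h2 : tailsup r <= C2 * nu x by apply: tailsup_le; lra.
have h3 : nu y <= tailsup (r + 1) by apply: le_tailsup; lra.
apply: (le_trans h2); rewrite /shiftc -lock mulrAC [leRHS]mulrC.
apply: ler_wpM2l; first exact: ltW.
rewrite -ler_pdivrMl //; exact: le_trans h3.
Qed.

Lemma tailsup_steps k r : 1 / 2 <= r -> tailsup r <= shiftc ^+ k * tailsup (r + k%:R).
Proof.
have L1 := shiftc_ge1.
elim: k r => [|k IH] r r1; first by rewrite expr0 mul1r addr0.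
apply: (le_trans (tailsup_step r1)); rewrite exprS -mulrA.
apply: ler_wpM2l; first lra.
apply: (le_trans (IH _ _)); first lra.
by rewrite -addrA nat1r.
Qed.

Lemma max1_ge x : 1 / 2 <= Num.max 1 (enorm x).
Proof. by rewrite le_max; apply/orP; left; lra. Qed.

Lemma profile_gt0 x : 0 < profile x. Proof. exact/tailsup_gt0/max1_ge. Qed.

Lemma profile_ge0 x : 0 <= profile x. Proof. exact/ltW/profile_gt0. Qed.

Lemma profile_le x : profile x <= tailsup 1.
Proof. by apply: tailsup_nincr; [lra|rewrite le_max lexx]. Qed.

Lemma profileN x : profile (- x) = profile x.
Proof. by rewrite /profile enormN. Qed.

Lemma profile_nincr x y : enorm x <= enorm y -> profile y <= profile x.
Proof.
move=> xy; apply: tailsup_nincr; first exact: max1_ge.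
by rewrite ge_max !le_max lexx xy orbT.
Qed.

Lemma measurable_profile : measurable_fun setT profile.
Proof.
apply: (measurableT_comp (f := fun r => tailsup (Num.max 1 r))); last exact: measurable_enorm.
apply: nonincreasing_measurable => // r s rs; apply: tailsup_nincr.
  by rewrite le_max; apply/orP; left; lra.
by rewrite ge_max !le_max lexx rs orbT.
Qed.

Lemma profile_shift_nat k x z : enorm z <= k%:R ->
  profile x <= shiftc ^+ k * profile (x + z).
Proof.
move=> zk; apply: (le_trans (tailsup_steps k (max1_ge x))).
apply: ler_wpM2l; first by rewrite exprn_ge0 //; have := shiftc_ge1; lra.
apply: tailsup_nincr; first exact: max1_ge.
have k0 : 0 <= k%:R :> R by [].
have := ler_enormD x z; rewrite ge_max => xz; apply/andP; split.
  by apply: (@le_trans _ _ (1 + k%:R)); [lra|rewrite lerD2r le_max lexx].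
apply: (@le_trans _ _ (enorm x + k%:R)); first by lra.
by rewrite lerD2r le_max lexx orbT.
Qed.

Lemma profile_shift1 x z : enorm z <= 1 -> profile x <= shiftc * profile (x + z).
Proof. by move=> z1; have := @profile_shift_nat 1 x z; rewrite expr1; apply. Qed.

Definition rate : R := ln shiftc.

Lemma rate_ge0 : 0 <= rate. Proof. exact/ln_ge0/shiftc_ge1. Qed.

(** A Harnack chain of unit steps: the truncation of |z| plus one step are enough, each costing the
    factor [shiftc]. *)
Lemma profile_shift x z : profile x <= shiftc * expR (rate * enorm z) * profile (x + z).
Proof.
have L1 := shiftc_ge1; have L0 : 0 < shiftc by lra.
pose k := (Num.truncn (enorm z)).+1.
have /andP[h1 h2] : (Num.truncn (enorm z))%:R <= enorm z < k%:R.
  exact/truncn_itv/enorm_ge0.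
apply: (le_trans (profile_shift_nat x (ltW h2))).
apply: ler_wpM2r; first exact: profile_ge0.
rewrite /k exprS; apply: ler_wpM2l; first lra.
rewrite -{1}(lnK (x := shiftc)) ?posrE // -expRM_natr ler_expR.
by apply: ler_wpM2l => //; exact: rate_ge0.
Qed.

Lemma nu_le_profile z : 1 <= enorm z -> nu z <= profile z.
Proof. by move=> z1; apply: le_tailsup; [exact: max1_ge|rewrite ge_max z1 /=]. Qed.

Lemma profile_le_nu z : 1 / 2 <= enorm z -> profile z <= C2 * nu z.
Proof. by move=> z1; apply: tailsup_le => //; rewrite le_max lexx orbT. Qed.

(** Completing the square. [gcst] below is the resulting price for letting half of a Gaussian
    exponent absorb the exponential growth of the profile. *)
Lemma exp_rate_gauss b (s : R) : 0 < b ->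
  rate * s <= b / 2 * s ^+ 2 + rate ^+ 2 / (2 * b).
Proof.
move=> b0; rewrite -subr_ge0.
have -> : b / 2 * s ^+ 2 + rate ^+ 2 / (2 * b) - rate * s =
   b / 2 * (s - rate / b) ^+ 2 by field; exact: lt0r_neq0.
by rewrite mulr_ge0 ?sqr_ge0 // divr_ge0 // ltW.
Qed.

Definition gcst b : R := expR (rate ^+ 2 / (2 * b)).

Lemma gauss_exp_le b (u : 'rV[R]_d) : 0 < b -> gauss b u * expR (rate * enorm u) <= gcst b * gauss (b / 2) u.
Proof.
move=> b0; rewrite /gauss /gcst -!expRD ler_expR.
have := exp_rate_gauss (enorm u) b0; rewrite sqr_enorm; lra.
Qed.

Lemma gauss_exp_ge b (u : 'rV[R]_d) : 0 < b -> 
  gauss (b + b / 2) u <= gcst b * (gauss b u * expR (- (rate * enorm u))).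
Proof.
move=> b0; rewrite /gauss /gcst -!expRD ler_expR.
have := exp_rate_gauss (enorm u) b0; rewrite sqr_enorm; lra.
Qed.

(** Compared with its value at 0 the profile decays at most exponentially, more slowly than any
    Gaussian. *)
Lemma gauss_le_profile b : 0 < b -> exists2 C : R, 0 < C & forall y,
  gauss b y <= C * profile y.
Proof.
move=> b0; have p0 := profile_gt0 0.
have L1 := shiftc_ge1; have L0 : 0 < shiftc by lra.
exists (gcst b * shiftc / profile 0).
  by rewrite divr_gt0 // mulr_gt0 // expR_gt0.
move=> y; have h := profile_shift 0 y; rewrite add0r in h.
have g1 : gauss b y * expR (rate * enorm y) <= gcst b.
  apply: (le_trans (gauss_exp_le y b0)); rewrite ler_piMr ?expR_ge0 //.
  by rewrite gauss_le1 // divr_ge0 // ltW.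
rewrite mulrAC ler_pdivlMr //.
apply: (@le_trans _ _ (gauss b y * (shiftc * expR (rate * enorm y) * profile y))).
  by apply: ler_wpM2l => //; exact: gauss_ge0.
have -> : gauss b y * (shiftc * expR (rate * enorm y) * profile y) =
   (gauss b y * expR (rate * enorm y)) * (shiftc * profile y) by ring.
rewrite -[leRHS]mulrA; apply: ler_wpM2r => //.
by rewrite mulr_ge0 ?profile_ge0 // ltW.
Qed.

Local Open Scope ereal_scope.

Lemma bigjump_le z : bigjump z -> (1 <= 4 * trunc2 z)%R.
Proof.
rewrite /bigjump /trunc2 /= -sqr_enorm => z1.
have : (1 / 4 <= Num.min 1 (enorm z ^+ 2))%R.
  rewrite le_min; apply/andP; split; first by lra.
  have -> : (1 / 4 = (1 / 2) ^+ 2 :> R)%R by field.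
  by rewrite ler_sqr ?nnegrE ?enorm_ge0 ?ltW //; lra.
lra.
Qed.

Lemma N_bigjump : N bigjump <= (4 * levy_mass N)%:E.
Proof.
have tI := trunc2_integrable Nfin.
have -> : N bigjump = \int[N]_(z in bigjump) 1.
  by rewrite integral_cst ?mul1e //; exact: measurable_bigjump.
apply: (@le_trans _ _ (\int[N]_(z in bigjump) (4 * trunc2 z)%:E)).
  apply: ge0_le_integral => //.
  - exact: measurable_bigjump.
  - apply/measurable_EFinP/measurable_funTS/measurable_funM => //; exact: measurable_trunc2.
  - by move=> z zb; rewrite lee_fin bigjump_le.
apply: (@le_trans _ _ (\int[N]_z (4 * trunc2 z)%:E)).
  apply: ge0_subset_integral => //; first exact: measurable_bigjump.
  - apply/measurable_EFinP/measurable_funM => //; exact: measurable_trunc2.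
  - by move=> z _; rewrite lee_fin mulr_ge0 // trunc2_ge0.
under eq_integral do rewrite EFinM.
rewrite ge0_integralZl //; last 2 first.
- apply/measurable_EFinP; exact: measurable_trunc2.
- by move=> z _; rewrite lee_fin trunc2_ge0.
by rewrite EFinM /levy_mass /Rintegral fineK //; exact: integrable_fin_num tI.
Qed.

Lemma measurable_gauss_sub b x :
  measurable_fun setT (fun y : 'rV[R]_d => gauss b (x - y)).
Proof.
apply: (measurableT_comp (measurable_gauss b)).
by apply: measurable_rVB => //; exact: measurable_id.
Qed.

(** Lets a Gaussian, whose integral is known for every centre, stand in for the indicator of a
    ball. *)
Lemma ball_le_gauss x y : (enorm (x - y) <= 1 -> 1 <= expR 1 * gauss 1 (x - y))%R.
Proof.
move=> xy; rewrite /gauss mul1r -expRD -[leLHS]expR0 ler_expR -sqr_enorm subr_ge0.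
by rewrite expr_le1 ?enorm_ge0.
Qed.

(** Beyond radius 1/2 the profile is at most C2 nu, and the Levy measure is finite there; within
    that radius it is bounded and a Gaussian majorises the ball. *)
Lemma profile_integrable : exists2 I : R, (0 < I)%R &
  \int[leb]_y (profile y)%:E <= I%:E.
Proof.
have [G G0 HG] := integral_gauss d (@ltr01 R).
have t1 : (0 < tailsup 1)%R by apply: tailsup_gt0; lra.
have m0 := levy_mass_ge0 N.
exists (tailsup 1 * expR 1 * G + C2 * (4 * levy_mass N))%R.
  by rewrite ltr_wpDr ?mulr_gt0 ?expR_gt0 // !mulr_ge0 // ltW.
pose g y : \bar R := (tailsup 1 * expR 1)%:E * (gauss 1 (0 - y))%:E.
pose h y : \bar R := (C2 * nu y)%:E.
have nub y : bigjump y -> (0 < nu y)%R.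
  by move=> yb; apply: nu_gt0_enorm; move: yb; rewrite /bigjump /=; lra.
have mh : measurable_fun setT (h \_ bigjump).
  apply/(measurable_restrictT _ measurable_bigjump).
  by apply/measurable_funTS/measurable_EFinP/measurable_funM.
have mg : measurable_fun setT g.
  by apply: measurable_funeM; apply/measurable_EFinP; exact: measurable_gauss_sub.
have g0 y : 0 <= g y.
  by rewrite /g -EFinM lee_fin !mulr_ge0 ?expR_ge0 ?gauss_ge0 // ltW.
have h0 y : 0 <= (h \_ bigjump) y.
  apply: erestrict_ge0 => z zb; by rewrite lee_fin mulr_ge0 ?(ltW (nub _ zb)) // ltW.
apply: (@le_trans _ _ (\int[leb]_y (g y + (h \_ bigjump) y))).
  apply: ge0_le_integral => //.
  - by move=> y _; rewrite lee_fin profile_ge0.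
  - by apply/measurable_EFinP; exact: measurable_profile.
  - exact: emeasurable_funD.
  move=> y _; have [yb|yb] := pselect (bigjump y).
    rewrite /restrict mem_set //; apply: (@le_trans _ _ (h y)); last by rewrite leeDr.
    by rewrite lee_fin profile_le_nu // ltW.
  rewrite /restrict memNset // adde0 /g -EFinM lee_fin -mulrA.
  rewrite (le_trans (profile_le y)) // ler_peMr ?(ltW t1) // ball_le_gauss //.
  by move: yb; rewrite /bigjump /= sub0r enormN => /negP; rewrite -leNgt; lra.
rewrite ge0_integralD // EFinD; apply: leeD.
  rewrite /g ge0_integralZl //; last 3 first.
  - by apply/measurable_EFinP; exact: measurable_gauss_sub.
  - by move=> y _; rewrite lee_fin gauss_ge0.
  - by rewrite lee_fin mulr_ge0 ?expR_ge0 // ltW.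
  by rewrite HG EFinM.
rewrite -integral_mkcond /h; under eq_integral do rewrite EFinM.
rewrite ge0_integralZl //; last 4 first.
- exact: measurable_bigjump.
- by apply/measurable_funTS/measurable_EFinP.
- by move=> y yb; rewrite lee_fin ltW ?nub.
- by rewrite lee_fin ltW.
rewrite -NE ?EFinM; last exact: measurable_bigjump.
by apply: lee_wpmul2l; [rewrite lee_fin ltW|exact: N_bigjump].
Qed.

(** By [profile_shift] the values at [x] and [y] differ by at most a factor exponential in |x - y|,
    which the Gaussian absorbs with exponent b/2 left for the upper bound and 3b/2 for the lower
    one. *)
Lemma profile_conv b : (0 < b)%R -> exists c C : R, [/\ (0 < c)%R, (0 < C)%R & forall x,
  (c * profile x)%:E <= \int[leb]_y (profile y * gauss b (x - y))%:E <= (C * profile x)%:E].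
Proof.
move=> b0; have L1 := shiftc_ge1; have L0 : (0 < shiftc)%R by lra.
have [G1 G10 HG1] := integral_gauss d (divr_gt0 b0 (ltr0n _ 2)).
have [G2 G20 HG2] := integral_gauss d (addr_gt0 b0 (divr_gt0 b0 (ltr0n _ 2))).
have q0 : (0 < gcst b)%R by exact: expR_gt0.
exists ((shiftc * gcst b)^-1 * G2)%R, (shiftc * gcst b * G1)%R.
have sg0 : (0 < shiftc * gcst b)%R by exact: mulr_gt0.
split; [by apply: mulr_gt0 => //; rewrite invr_gt0|exact: mulr_gt0|move=> x].
have mpg : measurable_fun setT (fun y => (profile y * gauss b (x - y))%:E).
  by apply/measurable_EFinP/measurable_funM;
    [exact: measurable_profile|exact: measurable_gauss_sub].
have key b' : measurable_fun setT (fun y : 'rV[R]_d => (gauss b' (x - y))%:E).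
  by apply/measurable_EFinP; exact: measurable_gauss_sub.
have px := profile_gt0 x.
apply/andP; split.
  rewrite mulrAC EFinM -(HG2 x) -ge0_integralZl //; last 2 first.
  - by move=> y _; rewrite lee_fin gauss_ge0.
  - by rewrite lee_fin mulr_ge0 ?invr_ge0 ?mulr_ge0 // ltW.
  apply: ge0_le_integral => //.
  - move=> y _; rewrite -EFinM lee_fin mulr_ge0 ?gauss_ge0 //.
    by rewrite mulr_ge0 ?invr_ge0 ?mulr_ge0 // ltW.
  - exact: measurable_funeM.
  move=> y _; rewrite -EFinM lee_fin.
  have h1 := gauss_exp_ge (x - y) b0.
  have h2 := profile_shift x (y - x).
  have e : (x + (y - x) = y)%R by rewrite addrC subrK.
  rewrite e enormB in h2.
  rewrite -mulrA ler_pdivrMl ?mulr_gt0 //.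
  set s := enorm (x - y) in h1 h2.
  apply: (@le_trans _ _ ((shiftc * expR (rate * s) * profile y) *
    (gcst b * (gauss b (x - y) * expR (- (rate * s)))))%R).
    apply: ler_pM => //; [exact: ltW|exact: gauss_ge0].
  rewrite le_eqVlt; apply/orP; left; apply/eqP.
  have : (expR (rate * s) * expR (- (rate * s)) = 1)%R by rewrite expRxMexpNx_1.
  move: (expR (rate * s)) (expR (- (rate * s))) => e1 e2 e12.
  transitivity (shiftc * profile y * gcst b * gauss b (x - y) * (e1 * e2))%R; first by ring.
  rewrite e12; ring.
rewrite mulrAC EFinM -(HG1 x) -ge0_integralZl //; last 2 first.
- by move=> y _; rewrite lee_fin gauss_ge0.
- by rewrite lee_fin mulr_ge0 ?mulr_ge0 // ltW.
apply: ge0_le_integral => //.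
- by move=> y _; rewrite lee_fin mulr_ge0 ?profile_ge0 ?gauss_ge0.
- exact: measurable_funeM.
move=> y _; rewrite -EFinM lee_fin.
have h1 := gauss_exp_le (x - y) b0.
have h2 := profile_shift y (x - y).
have e : (y + (x - y) = x)%R by rewrite addrC subrK.
rewrite e in h2.
apply: (@le_trans _ _ (shiftc * expR (rate * enorm (x - y)) * profile x * gauss b (x - y))%R).
  by apply: ler_wpM2r => //; exact: gauss_ge0.
have -> : (shiftc * expR (rate * enorm (x - y)) * profile x * gauss b (x - y) =
  shiftc * profile x * (gauss b (x - y) * expR (rate * enorm (x - y))))%R by ring.
have -> : (shiftc * gcst b * profile x * gauss (b / 2) (x - y) =
  shiftc * profile x * (gcst b * gauss (b / 2) (x - y)))%R by ring.
by apply: ler_wpM2l => //; rewrite mulr_ge0 // ltW.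
Qed.

(** For |x| >= 2 this is the direct jump property for the points -x and 0, with the profile in place
    of the density; for |x| < 2 the left side is bounded and the profile at [x] is bounded below. *)
Lemma profile_jump : exists2 C : R, (0 < C)%R & forall x,
  \int[N]_(z in bigjump) (profile (x + z))%:E <= (C * profile x)%:E.
Proof.
have [G G0 HG] := integral_gauss d (@ltr01 R).
have L1 := shiftc_ge1; have L0 : (0 < shiftc)%R by lra.
have t1 : (0 < tailsup 1)%R by apply: tailsup_gt0; lra.
have t2 : (0 < tailsup 2)%R by apply: tailsup_gt0; lra.
have m0 := levy_mass_ge0 N.
have mb := measurable_bigjump.
have c20 := C2_gt0.
pose Ca := (tailsup 1 * (4 * levy_mass N) / tailsup 2)%R.
pose Cb := (C2 * C3 + tailsup 1 * shiftc * expR 1 * G)%R.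
have Ca0 : (0 <= Ca)%R by rewrite divr_ge0 ?mulr_ge0 ?(ltW t1) ?(ltW t2).
have Cb0 : (0 < Cb)%R.
  by rewrite ltr_wpDr ?mulr_gt0 ?mulr_ge0 ?expR_ge0 ?(ltW t1) ?(ltW L0) ?(ltW G0).
exists (Ca + Cb)%R; first by lra.
move=> x; have px := profile_gt0 x.
have mpx : measurable_fun setT (fun z => (profile (x + z))%:E).
  apply/measurable_EFinP; apply: (measurableT_comp measurable_profile).
  by apply: measurable_rVD => //; exact: measurable_id.
have [x2|x2] := leP 2%R (enorm x); last first.
  apply: (@le_trans _ _ (Ca * profile x)%:E); last first.
    by rewrite lee_fin; nra.
  apply: (@le_trans _ _ (\int[N]_(z in bigjump) (tailsup 1)%:E)).
    apply: ge0_le_integral => //.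
    - by move=> z _; rewrite lee_fin profile_ge0.
    - exact: measurable_funTS.
    - by move=> z _; rewrite lee_fin profile_le.
  rewrite integral_cst // /Ca mulrAC -mulrA EFinM.
  apply: (@le_trans _ _ ((tailsup 1)%:E * (4 * levy_mass N)%:E)).
    by apply: lee_wpmul2l; [rewrite lee_fin ltW|exact: N_bigjump].
  rewrite -!EFinM lee_fin ler_peMr ?mulr_ge0 ?(ltW t1) // ler_pdivlMr // mul1r.
  by apply: tailsup_nincr; [exact: max1_ge|rewrite ge_max; apply/andP; split; lra].
have nub y : (1 / 2 < enorm y -> 0 < nu y)%R by move=> yb; apply: nu_gt0_enorm; lra.
rewrite (integral_density mb mnu _ NE) //; last 2 first.
- by move=> z zb; exact/ltW/nub.
- by move=> z; rewrite lee_fin profile_ge0.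
(* Where z is further than 1/2 from -x, the profile at x + z is at most C2 nu(-x - z) and the direct
   jump integral appears. Near -x the profile is bounded by a constant, [nu z] by a multiple of the
   profile at [x], and a Gaussian majorises the ball. *)
pose A : set 'rV[R]_d := [set z | 1 / 2 < enorm (z - - x)]%R.
have mA : measurable A.
  rewrite (_ : A = (fun z => z - - x)%R @^-1` bigjump) //.
  rewrite -[X in measurable X]setTI.
  by apply: measurable_rVB => //; exact: measurable_id.
pose f z : \bar R := (C2 * (nu (- x - z) * nu (z - 0)))%:E.
pose g z : \bar R := (tailsup 1 * (shiftc * profile x) * expR 1)%:E * (gauss 1 (- x - z))%:E.
have mnx : measurable_fun setT (fun z => nu (- x - z)%R * nu (z - 0)%R)%R.
  apply: measurable_funM; apply: (measurableT_comp mnu).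
    by apply: measurable_rVB => //; exact: measurable_id.
  by apply: measurable_rVB => //; exact: measurable_id.
have mf : measurable_fun setT f by apply/measurable_EFinP/measurable_funM.
have mfA : measurable_fun bigjump (f \_ A).
  apply/measurable_funTS/(measurable_restrictT _ mA); exact: measurable_funTS.
have mg : measurable_fun setT g.
  by apply: measurable_funeM; apply/measurable_EFinP; exact: measurable_gauss_sub.
have c0 : (0 <= tailsup 1 * (shiftc * profile x) * expR 1)%R.
  by rewrite !mulr_ge0 ?expR_ge0 ?(ltW t1) ?(ltW L0) ?(ltW px).
have g0 z : 0 <= g z by rewrite /g -EFinM lee_fin mulr_ge0 // gauss_ge0.
have AxE z : enorm (- x - z) = enorm (z - - x).
  by rewrite enormB.
have f0 z : bigjump z -> 0 <= (f \_ A) z.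
  move=> zb; rewrite /restrict; case: ifPn => // /set_mem zA.
  rewrite lee_fin mulr_ge0 ?(ltW c20) // mulr_ge0 // ltW // nub ?subr0 //.
  by rewrite AxE.
apply: (@le_trans _ _ (\int[leb]_(z in bigjump) ((f \_ A) z + g z))).
  apply: ge0_le_integral => //.
  - by move=> z zb; rewrite -EFinM lee_fin mulr_ge0 ?profile_ge0 // ltW // nub.
  - apply: emeasurable_funM; apply: measurable_funTS => //; exact/measurable_EFinP.
  - by apply: emeasurable_funD => //; exact: measurable_funTS.
  move=> z zb; have nz0 := ltW (nub _ zb).
  have [zA|zA] := pselect (A z).
    apply: (@le_trans _ _ (f z)); last by rewrite /restrict mem_set // leeDl.
    rewrite /f -EFinM lee_fin subr0 mulrA; apply: ler_wpM2r => //.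
    rewrite -profileN opprD; apply: profile_le_nu.
    by rewrite AxE ltW.
  rewrite /restrict memNset // add0e /g -!EFinM lee_fin.
  have xz : (enorm (x + z) <= 1 / 2)%R.
    by move: zA; rewrite /A /= opprK addrC => /negP; rewrite -leNgt.
  have z1 : (1 <= enorm z)%R.
    have := ler_enormB (x + z) z; rewrite addrK; lra.
  have h1 : (nu z <= shiftc * profile x)%R.
    apply: (le_trans (nu_le_profile z1)).
    have := @profile_shift1 z (- (x + z)); rewrite enormN opprD addrCA subrr addr0 profileN.
    by apply; lra.
  apply: (@le_trans _ _ (tailsup 1 * (shiftc * profile x) * 1)%R).
    rewrite mulr1; apply: ler_pM => //; [exact: profile_ge0|exact: profile_le].
  rewrite -[leRHS]mulrA; apply: ler_wpM2l.
    by rewrite mulr_ge0 ?mulr_ge0 ?(ltW t1) ?(ltW L0) ?(ltW px).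
  by apply: ball_le_gauss; rewrite -opprD enormN; lra.
rewrite ge0_integralD //; last exact: measurable_funTS.
apply: (@le_trans _ _ (Cb * profile x)%:E); last by rewrite lee_fin; nra.
rewrite /Cb mulrDl EFinD; apply: leeD.
  rewrite -integral_mkcondr.
  have -> : bigjump `&` A =
      [set z | (1 / 2 < enorm (z - - x))%R /\ (1 / 2 < enorm (z - 0))%R].
    by apply/seteqP; split => z; rewrite /bigjump /A /= subr0 => -[].
  rewrite /f; under eq_integral do rewrite EFinM.
  have mD : measurable [set z : 'rV[R]_d | (1 / 2 < enorm (z - - x))%R /\ (1 / 2 < enorm (z - 0))%R].
    rewrite (_ : mkset _ = A `&` bigjump); first exact: measurableI.
    by apply/seteqP; split => z; rewrite /bigjump /A /= subr0 => -[].
  rewrite ge0_integralZl //; last 3 first.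
  - by apply/measurable_funTS/measurable_EFinP.
  - move=> z [z1 z2]; rewrite lee_fin mulr_ge0 // ltW // nub //.
    by rewrite AxE.
  - by rewrite lee_fin ltW.
  rewrite -mulrA EFinM; apply: lee_wpmul2l; first by rewrite lee_fin ltW.
  apply: (@le_trans _ _ (C3 * nu (- x - 0))%:E).
    by apply: nu_jump; rewrite sub0r opprK; lra.
  rewrite lee_fin subr0 -(profileN x); apply: ler_wpM2l; first exact: ltW.
  by apply: nu_le_profile; rewrite enormN; lra.
apply: (@le_trans _ _ (\int[leb]_z g z)).
  by apply: ge0_subset_integral.
rewrite /g ge0_integralZl //; last 2 first.
- by apply/measurable_EFinP; exact: measurable_gauss_sub.
- by move=> z _; rewrite lee_fin gauss_ge0.
rewrite HG -EFinM lee_fin le_eqVlt; apply/orP; left; apply/eqP; ring.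
Qed.

(** Jumps landing near [y] suffice: there [nu] dominates the profile at [y] up to a factor
    exponential in the distance, which raises the Gaussian exponent to 3b/2. Restriction to |z| >= 1
    loses at most half of the Gaussian mass once [y] is far from the origin. *)
Lemma gauss_jump_ge b : (0 < b)%R -> exists c r : R, [/\ (0 < c)%R, (0 < r)%R & forall y,
  (r <= enorm y)%R -> (c * profile y)%:E <= \int[N]_(z in bigjump) (gauss b (y - z))%:E].
Proof.
move=> b0; have L1 := shiftc_ge1; have L0 : (0 < shiftc)%R by lra.
pose b1 := (b + b / 2)%R; pose b2 := (b1 / 2)%R.
have b10 : (0 < b1)%R by rewrite /b1; lra.
have b20 : (0 < b2)%R by rewrite /b2; lra.
have [G1 G10 HG1] := integral_gauss d b10.
have [G2 G20 HG2] := integral_gauss d b20.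
have q0 : (0 < gcst b)%R by exact: expR_gt0.
have c20 := C2_gt0.
have mb := measurable_bigjump.
(* [t] is chosen so that exp (- b2 t^2) G2 <= G1 / 2. *)
pose t := (2 * G2 / G1 / b2)%R.
have t0 : (0 <= t)%R by rewrite !divr_ge0 ?mulr_ge0 ?ltW.
pose k := (C2 * shiftc * gcst b)^-1%R.
have k0 : (0 < k)%R by rewrite invr_gt0 !mulr_gt0.
exists (k * (G1 / 2))%R, (t + 2)%R; split; rewrite ?mulr_gt0 ?divr_gt0 //; first lra.
move=> y yr; have py := profile_gt0 y.
rewrite (integral_density mb mnu _ NE) //; last 3 first.
- by move=> z zb; rewrite ltW // nu_gt0_enorm //; move: zb; rewrite /bigjump /=; lra.
- by move=> z; rewrite lee_fin gauss_ge0.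
- by apply/measurable_EFinP; exact: measurable_gauss_sub.
pose B : set 'rV[R]_d := [set z | 1 <= enorm z]%R.
have mB : measurable B.
  rewrite (_ : B = @enorm R d @^-1` `[1%R, +oo[%classic).
    by rewrite -[X in measurable X]setTI; exact: measurable_enorm.
  by apply/seteqP; split => z; rewrite /B /= in_itv /= andbT.
have Bb : B `<=` bigjump by move=> z; rewrite /B /bigjump /=; lra.
have mg b' : measurable_fun setT (fun z : 'rV[R]_d => (gauss b' (y - z))%:E).
  by apply/measurable_EFinP; exact: measurable_gauss_sub.
have nb0 z : bigjump z -> (0 <= nu z)%R.
  by move=> zb; rewrite ltW // nu_gt0_enorm //; move: zb; rewrite /bigjump /=; lra.
have mgn : measurable_fun setT (fun z => (gauss b (y - z))%:E * (nu z)%:E).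
  apply: emeasurable_funM => //; exact/measurable_EFinP.
apply: (@le_trans _ _ (\int[leb]_(z in B) ((gauss b (y - z))%:E * (nu z)%:E))); last first.
  apply: ge0_subset_integral => //; first exact: measurable_funTS.
  by move=> z zb; rewrite -EFinM lee_fin mulr_ge0 ?gauss_ge0 // nb0.
apply: (@le_trans _ _ (\int[leb]_(z in B) ((k * profile y)%:E * (gauss b1 (y - z))%:E))); last first.
  apply: ge0_le_integral => //.
  - by move=> z _; rewrite -EFinM lee_fin !mulr_ge0 ?gauss_ge0 ?(ltW k0) ?(ltW py).
  - by apply: measurable_funTS; apply: measurable_funeM.
  - exact: measurable_funTS.
  move=> z zB; rewrite -!EFinM lee_fin.
  have h1 := gauss_exp_ge (y - z) b0.
  have h2 := profile_shift y (z - y).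
  have e : (y + (z - y) = z)%R by rewrite addrC subrK.
  rewrite e enormB in h2.
  have h3 : (profile z <= C2 * nu z)%R by apply: profile_le_nu; apply/ltW/Bb.
  set s := enorm (y - z) in h1 h2.
  have e12 : (expR (rate * s) * expR (- (rate * s)) = 1)%R by rewrite expRxMexpNx_1.
  have ck : (0 < C2 * shiftc * gcst b)%R by apply: mulr_gt0 => //; exact: mulr_gt0.
  rewrite /k -[leLHS]mulrA ler_pdivrMl //.
  apply: (@le_trans _ _ ((shiftc * expR (rate * s) * (C2 * nu z)) *
    (gcst b * (gauss b (y - z) * expR (- (rate * s)))))%R).
    apply: ler_pM => //; [exact: ltW|exact: gauss_ge0|].
    apply: (le_trans h2); apply: ler_wpM2l => //.
    by rewrite mulr_ge0 ?expR_ge0 // ltW.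
  rewrite le_eqVlt; apply/orP; left; apply/eqP.
  move: (expR (rate * s)) (expR (- (rate * s))) e12 => e1 e2 e12.
  transitivity (C2 * shiftc * gcst b * (gauss b (y - z) * nu z) * (e1 * e2))%R; first by ring.
  rewrite e12; ring.
rewrite ge0_integralZl //; last 3 first.
- exact: measurable_funTS.
- by move=> z _; rewrite lee_fin gauss_ge0.
- by rewrite lee_fin mulr_ge0 // ltW.
rewrite -mulrA [(G1 / 2 * _)%R]mulrC mulrA EFinM.
apply: lee_wpmul2l; first by rewrite lee_fin mulr_ge0 // ltW.
have : G1%:E <= \int[leb]_(z in B) (gauss b1 (y - z))%:E + (G1 / 2)%:E.
  rewrite -[leLHS](HG1 y).
  pose dl := (G1 / 2 / G2)%R.
  have dl0 : (0 < dl)%R by rewrite !divr_gt0.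
  have -> : (G1 / 2)%:E = \int[leb]_z (dl%:E * (gauss b2 (y - z))%:E).
    rewrite ge0_integralZl ?HG2 //; last 2 first.
    - by move=> z _; rewrite lee_fin gauss_ge0.
    - by rewrite lee_fin ltW.
    by rewrite -EFinM /dl divfK // gt_eqF.
  rewrite [X in _ <= X + _]integral_mkcond -ge0_integralD //; last 4 first.
  - by move=> z _; apply: erestrict_ge0 => u _; rewrite lee_fin gauss_ge0.
  - by apply/(measurable_restrictT _ mB); exact: measurable_funTS.
  - by move=> z _; rewrite -EFinM lee_fin mulr_ge0 ?gauss_ge0 // ltW.
  - exact: measurable_funeM.
  apply: ge0_le_integral => //.
  - by move=> z _; rewrite lee_fin gauss_ge0.
  - apply: emeasurable_funD; last exact: measurable_funeM.
    by apply/(measurable_restrictT _ mB); exact: measurable_funTS.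
  move=> z _; rewrite /restrict; case: ifPn => zB.
    by rewrite leeDl // -EFinM lee_fin mulr_ge0 ?gauss_ge0 // ltW.
  rewrite add0e -EFinM lee_fin /b1 -/b1 {1}(splitr b1) gaussD.
  apply: ler_wpM2r; first exact: gauss_ge0.
  have z1 : (enorm z < 1)%R.
    by rewrite ltNge; apply/negP => z1; move: zB; rewrite mem_set.
  have yz : (t + 1 <= enorm (y - z))%R.
    have := ler_enorm_sub y (- z); rewrite enormN; lra.
  have yz2 : (t <= dotr (y - z) (y - z))%R.
    rewrite -sqr_enorm; nra.
  rewrite /gauss -/b2.
  apply: (@le_trans _ _ (expR (- (b2 * t)))%R).
    by rewrite ler_expR lerN2 ler_pM2l.
  have -> : (b2 * t = 2 * G2 / G1)%R by rewrite /t mulrC divfK // gt_eqF.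
  rewrite expRN; have -> : (dl = (2 * G2 / G1)^-1)%R.
    by rewrite /dl; field; rewrite !gt_eqF.
  rewrite lef_pV2 ?posrE ?expR_gt0 ?divr_gt0 ?mulr_gt0 //.
  by have := expR_ge1Dx (2 * G2 / G1); lra.
case: (integral _ _ _) => [i| |] //; first by rewrite -EFinD !lee_fin; lra.
by move=> _; rewrite leey.
Qed.

(** An integrable radially nonincreasing function is compared with its smallest value on the cube of
    side |x| / d with a corner at the origin, which lies in the ball of radius |x|. Since that side
    is at least 1, it is bounded by the volume. *)
Lemma profile_decay : exists2 C : R, (0 < C)%R & forall x,
  (d%:R <= enorm x)%R -> (profile x * enorm x <= C)%R.
Proof.
have [I I0 HI] := profile_integrable.
have d0 : (0 < d%:R :> R)%R by rewrite ltr0n.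
exists (I * d%:R)%R; first by rewrite mulr_gt0.
move=> x xd; have px := profile_gt0 x.
pose q := (enorm x / d%:R)%R.
have q1 : (1 <= q)%R by rewrite /q ler_pdivlMr // mul1r.
pose box : set 'rV[R]_d := [set v | forall i, `[0%R, q]%classic (v ord0 i)].
have vol : leb box = (q ^+ d)%:E.
  rewrite /leb (lebesgue_rV_box (A := fun=> `[0%R, q]%classic)) //.
  under eq_bigr => i _ do rewrite lebesgue_measure_itv /= lte_fin (lt_le_trans ltr01 q1) oppr0 adde0.
  by rewrite prodEFin prodr_const card_ord.
have mbox : measurable box.
  rewrite (_ : box = \big[setI/setT]_(i < d) (@rV_coord R d i @^-1` `[0%R, q]%classic)).
    apply: bigsetI_measurable => i _; rewrite -[X in measurable X]setTI.
    exact: measurable_rV_coord.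
  rewrite -bigcap_seq; apply/seteqP; split => v /= H i.
    by move=> _; exact: H.
  by apply: (H i) => /=; rewrite mem_index_enum.
have H : (profile x * q ^+ d)%:E <= I%:E.
  apply: (le_trans _ HI).
  have -> : (profile x * q ^+ d)%:E = \int[leb]_(y in box) cst (profile x)%:E y.
    by rewrite EFinM -vol integral_cst.
  apply: (@le_trans _ _ (\int[leb]_(y in box) (profile y)%:E)); last first.
    apply: ge0_subset_integral => //.
    - by apply/measurable_EFinP; exact: measurable_profile.
    - by move=> y _; rewrite lee_fin profile_ge0.
  apply: ge0_le_integral => //.
  - by move=> y _; rewrite lee_fin profile_ge0.
  - by apply/measurable_EFinP/measurable_funTS; exact: measurable_profile.
  move=> y yb; rewrite lee_fin; apply: profile_nincr.
  apply: (le_trans (enorm_le_sum y)).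
  apply: (@le_trans _ _ (\sum_(i < d) q)%R).
    apply: ler_sum => i _; have := yb i; rewrite /= in_itv /= => /andP[h1 h2].
    by rewrite ger0_norm.
  by rewrite sumr_const card_ord -mulr_natr /q divfK // gt_eqF.
move: H; rewrite lee_fin => H.
have qd : (q <= q ^+ d)%R.
  by rewrite -(prednK hd) exprS ler_peMr ?(le_trans ler01 q1) // exprn_ege1.
have : (profile x * q <= I)%R.
  by apply: le_trans H; apply: ler_wpM2l => //; exact: ltW.
by rewrite /q mulrA ler_pdivrMr.
Qed.

End profile.

(** * Path space and the Markov property *)

Section cpath.
Context {R : realType} {d : nat}.
Implicit Types (B : set 'rV[R]_d) (t s : R).

(** Of the left limits only the boundedness on compact time intervals is kept; right continuity is
    what makes dyadic times decisive. *)
Definition is_cpath (p : R -> 'rV[R]_d) : Prop :=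
  [/\ p 0 = 0, (forall t, 0 <= t -> p s @[s --> t^'+] --> p t) &
      forall t, exists M, forall s, 0 <= s -> s <= t -> enorm (p s) <= M].

Record cpath := Cpath { cpath_fun :> R -> 'rV[R]_d; cpathP : is_cpath cpath_fun }.

Lemma is_cpath0 : is_cpath (cst 0).
Proof.
split => // [t _|t]; first exact: cvg_cst.
by exists 0 => s _ _; rewrite enorm0.
Qed.

HB.instance Definition _ := gen_eqMixin cpath.
HB.instance Definition _ := gen_choiceMixin cpath.
HB.instance Definition _ := isPointed.Build cpath (Cpath is_cpath0).

Definition cpath_events : set (set cpath) :=
  [set A : set cpath | exists (t : R) B, [/\ 0 <= t, measurable B &
    A = [set p : cpath | B (p t)]]].

Let cpath_set0 : <<s cpath_events >> set0.
Proof. exact: sigma_algebra0. Qed.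

Let cpath_setC A : <<s cpath_events >> A -> <<s cpath_events >> (~` A).
Proof. exact: sigma_algebraC. Qed.

Let cpath_bigcup (F : (set cpath)^nat) : (forall i, <<s cpath_events >> (F i)) ->
  <<s cpath_events >> (\bigcup_i (F i)).
Proof. exact: sigma_algebra_bigcup. Qed.

Definition cpath_display : measure_display. Proof. exact. Qed.

HB.instance Definition _ := @isMeasurable.Build cpath_display
  cpath <<s cpath_events >> cpath_set0 cpath_setC cpath_bigcup.

Lemma cpath0 (p : cpath) : p 0 = 0. Proof. by case: p => ? []. Qed.

Lemma cpath_rcont (p : cpath) t : 0 <= t -> p s @[s --> t^'+] --> p t.
Proof. by case: p => ? [? H ?]; exact: H. Qed.

Lemma cpath_bounded (p : cpath) t : exists M, forall s, 0 <= s -> s <= t -> enorm (p s) <= M.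
Proof. by case: p => ? [? ? H]; exact: H. Qed.

Lemma measurable_eval t : 0 <= t -> measurable_fun setT (fun p : cpath => p t).
Proof.
move=> t0 _ B mB; rewrite setTI; apply: sub_sigma_algebra.
by exists t, B.
Qed.

Lemma measurable_to_cpath d' (T : measurableType d') (f : T -> cpath) :
  (forall t, 0 <= t -> measurable_fun setT (fun w => f w t)) -> measurable_fun setT f.
Proof.
move=> mf; apply: (@measurability _ _ _ _ _ _ cpath_events) => //.
move=> _ [_ [t [B [t0 mB ->]]] <-]; rewrite setTI.
by have := mf t t0 measurableT _ mB; rewrite setTI.
Qed.

Definition grid (tau : R) (n k : nat) : R := tau * k%:R / 2 ^+ n.

(** The first grid point strictly after [t]. Strictness matters, as right continuity speaks of times
    greater than [t]. *)
Definition dyup (tau : R) (n : nat) (t : R) : R :=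
  grid tau n (Num.truncn (t / tau * 2 ^+ n)).+1.

Lemma grid_ge0 tau n k : 0 <= tau -> 0 <= grid tau n k.
Proof. by move=> t0; rewrite /grid !mulr_ge0 ?invr_ge0 ?exprn_ge0. Qed.

Lemma gridS tau n k : grid tau n k = grid tau n.+1 k.*2.
Proof.
rewrite /grid exprS -muln2 natrM invfM; field.
by rewrite expf_eq0 pnatr_eq0 andbF.
Qed.

Lemma grid0 tau n : grid tau n 0 = 0. Proof. by rewrite /grid mulr0 mul0r. Qed.

Lemma dyup_itv tau n t : 0 < tau -> 0 <= t -> t < dyup tau n t <= t + tau / 2 ^+ n.
Proof.
move=> tau0 t0; have p0 : 0 < 2 ^+ n :> R by rewrite exprn_gt0.
have x0 : 0 <= t / tau * 2 ^+ n by rewrite mulr_ge0 ?divr_ge0 // ltW.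
have /andP[h1 h2] := truncn_itv x0.
have e : t = tau * (t / tau * 2 ^+ n) / 2 ^+ n.
  by rewrite mulrA mulfK ?gt_eqF // mulrCA divff ?gt_eqF // mulr1.
rewrite /dyup /grid; apply/andP; split.
  by rewrite {1}e ltr_pM2r ?invr_gt0 // ltr_pM2l.
rewrite -natr1 mulrDr mulrDl mulr1 lerD2r {2}e ler_pM2r ?invr_gt0 // ler_pM2l //.
Qed.

Lemma dyup_cvg tau t : 0 < tau -> 0 <= t -> dyup tau n t @[n --> \oo] --> t.
Proof.
move=> tau0 t0.
apply: (@squeeze_cvgr _ _ _ _ (cst t) (fun n => t + tau / 2 ^+ n)).
- by apply: nearW => n; have /andP[h ->] := dyup_itv n tau0 t0; rewrite ltW.
- exact: cvg_cst.
- rewrite -[X in _ --> X]addr0 -(mulr0 tau); apply: cvgD; first exact: cvg_cst.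
  apply: cvgM; first exact: cvg_cst.
  have : (2^-1 : R) ^+ n @[n --> \oo] --> 0.
    by apply: cvg_expr; rewrite ger0_norm //; lra.
  by under eq_fun do rewrite exprVn.
Qed.

Lemma cvg_right_seq (p : R -> 'rV[R]_d) (u : nat -> R) t :
  p s @[s --> t^'+] --> p t -> (forall n, t < u n) -> u n @[n --> \oo] --> t ->
  forall i, p (u n) ord0 i @[n --> \oo] --> p t ord0 i.
Proof.
move=> pt tu ut i.
have /cvg_at_rightP H : p s ord0 i @[s --> t^'+] --> p t ord0 i by exact: cvg_rV pt i.
exact: (H u (conj tu ut)).
Qed.

Lemma cpath_dyup_cvg (p : cpath) tau t i : 0 < tau -> 0 <= t ->
  p (dyup tau n t) ord0 i @[n --> \oo] --> p t ord0 i.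
Proof.
move=> tau0 t0; apply: cvg_right_seq; first exact: cpath_rcont.
- by move=> n; have /andP[] := dyup_itv n tau0 t0.
- exact: dyup_cvg.
Qed.

(** With the time rounded by [dyup] the preimage of a set is a countable union of rectangles; right
    continuity gives the limit. *)
Lemma measurable_cpath_joint :
  measurable_fun setT (fun u : R * cpath => u.2 (Num.max 0 u.1)).
Proof.
apply: measurable_fun_rV => i; rewrite /rV_coord /comp.
pose f n (u : R * cpath) := u.2 (dyup 1 n (Num.max 0 u.1)).
apply: (@measurable_fun_cvg _ _ _ _ (fun n u => f n u ord0 i)); last first.
  by move=> u _; apply: cpath_dyup_cvg => //; rewrite le_max lexx.
move=> n; apply: (measurableT_comp (measurable_rV_coord i)).
move=> _ B mB; rewrite setTI.
pose A k : set R := (fun t => Num.max 0 t / 1 * 2 ^+ n) @^-1` [set` `[k%:R, k.+1%:R[].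
have -> : f n @^-1` B = \bigcup_k (A k `*` [set p : cpath | B (p (grid 1 n k.+1))]).
  apply/seteqP; split => [[t p] /= H|[t p] [k _ [/= h1 h2]]].
    exists (Num.truncn (Num.max 0 t / 1 * 2 ^+ n)) => //; split => //=.
    rewrite /A /= in_itv /=; apply: truncn_itv.
    by rewrite mulr_ge0 ?divr_ge0 ?exprn_ge0 // le_max lexx.
  move: h1; rewrite /A /= in_itv /= => h1.
  by rewrite /f /dyup /= (truncn_def h1).
apply: bigcup_measurable => k _; apply: measurableX.
  rewrite -[X in measurable X]setTI; apply: measurable_funM => //.
  apply: measurable_funM => //; exact: measurable_maxr.
have := measurable_eval (grid_ge0 n k.+1 ler01) measurableT mB.
by rewrite setTI.
Qed.

Section law.
Variables (tau : R) (tau0 : 0 < tau).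

Definition increments_in (n M : nat) (B : nat -> set 'rV[R]_d) : set cpath :=
  [set p : cpath | forall i, (i < M)%N -> B i (p (grid tau n i.+1) - p (grid tau n i))].

(** Events on one fixed dyadic level, so that two of them intersect in a third. *)
Definition rect (n : nat) : set (set cpath) := [set A : set cpath |
  exists M (B : nat -> set 'rV[R]_d), (forall i, measurable (B i)) /\ A = increments_in n M B].

Lemma rectT n : rect n setT.
Proof. by exists 0%N, (fun=> setT); split => //; apply/seteqP; split. Qed.

Lemma rectI n : setI_closed (rect n).
Proof.
move=> _ _ [M [B [mB ->]]] [M' [B' [mB' ->]]].
exists (maxn M M'), (fun i => (if (i < M)%N then B i else setT) `&`
  (if (i < M')%N then B' i else setT)); split.
  by move=> i; apply: measurableI; case: ifP.
apply/seteqP; split => p /=; rewrite /increments_in /=.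
  move=> [H1 H2] i iM; split; case: ifP => //; [exact: H1|exact: H2].
move=> H; split => i iM.
  have /H[] : (i < maxn M M')%N by rewrite leq_max iM.
  by rewrite iM.
have /H[] : (i < maxn M M')%N by rewrite leq_max iM orbT.
by rewrite iM.
Qed.

Lemma measurable_sub_eval (S : set (set cpath)) (t : R) :
  measurable_fun (setT : set (g_sigma_algebraType S)) (fun p : g_sigma_algebraType S => (p : cpath) t) ->
  forall B, measurable B -> <<s S >> [set p : cpath | B (p t)].
Proof. by move=> H B mB; have := H measurableT B mB; rewrite setTI. Qed.

Lemma rect_eval n k : measurable_fun (setT : set (g_sigma_algebraType (rect n)))
  (fun p : g_sigma_algebraType (rect n) => (p : cpath) (grid tau n k)).
Proof.
elim: k => [|k IH].
  have -> : (fun p : g_sigma_algebraType (rect n) => (p : cpath) (grid tau n 0)) = cst 0.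
    by apply/funext => p; rewrite grid0 cpath0.
  exact: measurable_cst.
have -> : (fun p : g_sigma_algebraType (rect n) => (p : cpath) (grid tau n k.+1)) =
    (fun p : g_sigma_algebraType (rect n) => (p : cpath) (grid tau n k) +
      ((p : cpath) (grid tau n k.+1) - (p : cpath) (grid tau n k))).
  by apply/funext => p; rewrite addrC subrK.
apply: measurable_rVD => //.
move=> _ B mB; rewrite setTI; apply: sub_sigma_algebra.
exists k.+1, (fun i => if i == k then B else setT); split.
  by move=> i; case: ifP.
apply/seteqP; split => p /=.
  by move=> H i ik; case: eqP => // ->.
by move=> /(_ k (ltnSn k)); rewrite eqxx.
Qed.

Lemma rect_sub (S : set (set cpath)) n :
  (forall k, measurable_fun (setT : set (g_sigma_algebraType S))
  (fun p : g_sigma_algebraType S => (p : cpath) (grid tau n k))) ->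
  rect n `<=` <<s S >>.
Proof.
move=> HS _ [M [B [mB ->]]].
have -> : increments_in n M B = \bigcap_(i in `I_M)
   [set p : cpath | B i (p (grid tau n i.+1) - p (grid tau n i))] by [].
apply: (@fin_bigcap_measurable _ (g_sigma_algebraType S)) => // i _.
have /(_ measurableT _ (mB i)) := measurable_rVB (HS i.+1) (HS i).
by rewrite setTI.
Qed.

Lemma rect_nondecr n m : (n <= m)%N -> <<s rect n >> `<=` <<s rect m >>.
Proof.
elim: m => [|m IH]; first by rewrite leqn0 => /eqP ->.
rewrite leq_eqVlt => /predU1P[->//|]; rewrite ltnS => /IH {IH} H.
apply: (subset_trans H); apply: smallest_sub; first exact: smallest_sigma_algebra.
apply: rect_sub => k; rewrite gridS; exact: rect_eval.
Qed.

Lemma rect_measurable n : rect n `<=` @measurable _ cpath.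
Proof. by apply: rect_sub => k; apply: measurable_eval; apply: grid_ge0; exact: ltW. Qed.

Variables (m1 m2 : {measure set cpath -> \bar R}) (n0 : nat).
Hypothesis m1fin : (m1 setT < +oo)%E.
Hypothesis m12 : forall n M (B : nat -> set 'rV[R]_d), (n0 <= n)%N -> (forall i, measurable (B i)) ->
  m1 (increments_in n M B) = m2 (increments_in n M B).

(** A pi-lambda argument applied twice: on the increments of one dyadic level, then on the union of
    the sigma-algebras of all levels from [n0] on, which is stable under intersection because they
    increase. This union generates, since evaluation at [t] is the limit of evaluations at
    [dyup]. *)
Lemma cpath_law_unique A : measurable A -> m1 A = m2 A.
Proof.
have m12n n : (n0 <= n)%N -> forall A, <<s rect n >> A -> m1 A = m2 A.
  move=> nn; apply: (@g_sigma_algebra_measure_unique _ _ _ (rect n) _ (fun=> setT)) => //.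
  - exact: rect_measurable.
  - by move=> _; exact: rectT.
  - by apply/seteqP; split => // x _; exists 0%N.
  - exact: rectI.
  - by move=> _ [M [B [mB ->]]]; exact: m12.
pose G : set (set cpath) := [set A | exists2 n, (n0 <= n)%N & <<s rect n >> A].
have GT : G setT by exists n0 => //; apply: sub_sigma_algebra; exact: rectT.
have GS n k : measurable_fun (setT : set (g_sigma_algebraType G))
    (fun p : g_sigma_algebraType G => (p : cpath) (grid tau n k)).
  move=> _ B mB; rewrite setTI; apply: sub_sigma_algebra.
  exists (maxn n0 n); first exact: leq_maxl.
  apply: (rect_nondecr (leq_maxr n0 n)).
  by apply: (@measurable_sub_eval (rect n)) => //; exact: rect_eval.
move=> mA.
apply: (@g_sigma_algebra_measure_unique _ _ _ G _ (fun=> setT)) => //.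
- move=> B [n _]; apply: smallest_sub; first exact: sigma_algebra_measurable.
  exact: rect_measurable.
- by apply/seteqP; split => // x _; exists 0%N.
- move=> B B' [n nn sB] [n' nn' sB']; exists (maxn n n').
    by rewrite leq_max nn.
  apply: (@measurableI _ (g_sigma_algebraType (rect (maxn n n')))).
    exact: rect_nondecr (leq_maxl _ _) _ sB.
  exact: rect_nondecr (leq_maxr _ _) _ sB'.
- by move=> B [n nn]; exact: m12n.
move: A mA; apply: smallest_sub; first exact: smallest_sigma_algebra.
move=> _ [t [B [t0 mB ->]]].
apply: (@measurable_sub_eval G) => //.
apply: measurable_fun_rV => i; rewrite /rV_coord /comp.
apply: (@measurable_fun_cvg _ _ _ _
  (fun n (p : g_sigma_algebraType G) => (p : cpath) (dyup tau n t) ord0 i)).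
  by move=> n; apply: (measurableT_comp (measurable_rV_coord i)); exact: GS.
by move=> p _; exact: cpath_dyup_cvg.
Qed.

End law.


Definition cat_fun (s : R) (p q : R -> 'rV[R]_d) : R -> 'rV[R]_d :=
  fun u => if u <= s then p u else p s + q (u - s).

Lemma cvg_right_shift (q : R -> 'rV[R]_d) s t (l : 'rV[R]_d) :
  q u @[u --> (t - s)^'+] --> l -> q (u - s) @[u --> t^'+] --> l.
Proof.
move=> H A lA; have /nbhs_right0P := H A lA.
rewrite /= => HA; apply/nbhs_right0P; apply: filterS HA => e /=.
by rewrite addrAC.
Qed.

Lemma is_cpath_cat s (p q : cpath) : 0 <= s -> is_cpath (cat_fun s p q).
Proof.
move=> s0; split.
- by rewrite /cat_fun s0 cpath0.
- move=> t t0; have [ts|st] := ltP t s.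
    have -> : cat_fun s p q t = p t by rewrite /cat_fun ltW.
    apply: (@cvg_trans _ (p u @[u --> t^'+])); last exact: cpath_rcont.
    apply: near_eq_cvg.
    have : \forall u \near t^'+, u < s by exact: nbhs_right_lt.
    by apply: filterS => u us; rewrite /cat_fun ltW.
  have -> : cat_fun s p q t = p s + q (t - s).
    rewrite /cat_fun; case: leP => // ts.
    have -> : t = s by apply/eqP; rewrite eq_le ts st.
    by rewrite subrr cpath0 addr0.
  apply: (@cvg_trans _ (p s + q (u - s) @[u --> t^'+])).
    apply: near_eq_cvg.
    have : \forall u \near t^'+, t < u by exact: nbhs_right_gt.
    by apply: filterS => u tu; rewrite /cat_fun leNgt (le_lt_trans st tu).
  apply: rV_cvg => i.
  have H : q (u - s) @[u --> t^'+] --> q (t - s).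
    by apply: cvg_right_shift; apply: cpath_rcont; rewrite subr_ge0.
  have Hi : q (u - s) ord0 i @[u --> t^'+] --> q (t - s) ord0 i by exact: cvg_rV.
  rewrite mxE; under eq_fun do rewrite mxE.
  by apply: cvgD; [exact: cvg_cst|exact: Hi].
- move=> t; have [M HM] := cpath_bounded p s; have [M' HM'] := cpath_bounded q (t - s).
  exists (M + Num.max 0 M') => u u0 ut; rewrite /cat_fun; case: (leP u s) => us.
    by apply: (le_trans (HM u u0 us)); rewrite lerDl le_max lexx.
  apply: (le_trans (ler_enormD _ _)); apply: lerD; first exact: HM.
  rewrite le_max HM' ?orbT //; first by rewrite subr_ge0 ltW.
  by rewrite lerD2r.
Qed.

Lemma max0_ge0 (s : R) : 0 <= Num.max 0 s.
Proof. by rewrite le_max lexx. Qed.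

(* Times before 0 are irrelevant; [Num.max 0 s] makes the function total. *)
Definition cat_path (s : R) (p q : cpath) : cpath :=
  Cpath (is_cpath_cat p q (s := Num.max 0 s) (max0_ge0 s)).

End cpath.
Arguments cpath : clear implicits.

(** * Laws with independent stationary increments *)

Section levy_law.
Context {R : realType} {d : nat}.
Implicit Types (p q : cpath R d) (s t h : R).
Local Open Scope ereal_scope.

Lemma measurable_cat_path s :
  measurable_fun setT (fun u : cpath R d * cpath R d => cat_path s u.1 u.2).
Proof.
apply: measurable_to_cpath => t t0 /=; rewrite /cat_fun.
have s0 := max0_ge0 s; case: (leP t (Num.max 0 s)%R) => ts.
  exact: (measurableT_comp (measurable_eval t0) measurable_fst).
apply: measurable_rVD.
  exact: (measurableT_comp (measurable_eval s0) measurable_fst).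
have ts0 : (0 <= t - Num.max 0 s)%R by rewrite subr_ge0 ltW.
exact: (measurableT_comp (measurable_eval ts0) measurable_snd).
Qed.

Lemma cat_pathE s p q u : (0 <= s)%R ->
  cat_path s p q u = if (u <= s)%R then p u else (p s + q (u - s))%R.
Proof. by move=> s0; rewrite /= /cat_fun max_r. Qed.

Lemma cat_pathl s p q u : (0 <= s)%R -> (u <= s)%R -> cat_path s p q u = p u.
Proof. by move=> s0 us; rewrite cat_pathE // us. Qed.

Lemma cat_pathr s p q u : (0 <= s)%R -> (0 <= u)%R ->
  cat_path s p q (s + u)%R = (p s + q u)%R.
Proof.
move=> s0; rewrite le_eqVlt => /predU1P[<-|u0].
  by rewrite addr0 cat_pathl // cpath0 addr0.
rewrite cat_pathE // leNgt ltrDl u0 /=; congr (_ + q _)%R.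
by rewrite addrAC subrr add0r.
Qed.

Variable PP : probability (cpath R d) R.

(** Independence and stationarity along equally spaced grids; by [cpath_law_unique] this determines
    the law from its one-time marginals. *)
Definition levy_law : Prop := forall tau n M (B : nat -> set 'rV[R]_d),
  (0 < tau)%R -> (forall i, measurable (B i)) ->
  PP (increments_in tau n M B) = \prod_(i < M) PP [set p : cpath R d | B i (p (grid tau n 1))].

Hypothesis HPP : levy_law.

Lemma measurable_increments tau n M B : (0 < tau)%R -> (forall i, measurable (B i)) ->
  measurable (increments_in tau n M B : set (cpath R d)).
Proof. by move=> t0 mB; apply: (@rect_measurable R d tau t0 n); exists M, B. Qed.

(** Both sides are measures on path space, compared on grids of span [s]: there the increments of
    the concatenated path are those of [p] up to time [s], followed by those of [q]. *)
Lemma markov_set s A : (0 < s)%R -> measurable A ->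
  PP A = (PP \x PP) [set u : cpath R d * cpath R d | A (cat_path s u.1 u.2)].
Proof.
move=> s0 mA.
apply: (@cpath_law_unique _ _ s s0 PP (pushforward (PP \x PP)
  (fun u : cpath R d * cpath R d => cat_path s u.1 u.2)) 0%N) => //.
- exact: measurable_cat_path.
- exact: (le_lt_trans (probability_le1 PP (@measurableT _ (cpath R d))) (ltry 1)).
move=> mcat n M B _ mB.
rewrite [LHS](HPP n M s0 mB) /pushforward; cbv beta.
(* The index of time [s] in the grid of level [n]; taking the span equal to [s] makes it a grid
   point at every level. *)
pose K := (2 ^ n)%N.
have gK : grid s n K = s.
  by rewrite /grid /K natrX mulfK // expf_neq0.
have gKD j : grid s n (K + j)%N = (s + grid s n j)%R.
  by rewrite -{2}gK /grid natrD mulrDr mulrDl.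
have g0 j := grid_ge0 n j (ltW s0).
have gle j : (j <= K)%N -> (grid s n j <= s)%R.
  move=> jK; rewrite -[leRHS]gK /grid ler_pM2r ?invr_gt0 ?exprn_gt0 // ler_pM2l //.
  by rewrite ler_nat.
have HE : (fun u : cpath R d * cpath R d => cat_path s u.1 u.2) @^-1` increments_in s n M B =
    increments_in s n (minn M K) B `*` increments_in s n (M - K) (fun j => B (K + j)%N).
  apply/seteqP; split => [[p q] /= H|[p q] [/= H1 H2] i iM].
    split=> i.
      rewrite ltn_min => /andP[iM iK]; have := H i iM.
      by rewrite !cat_pathl ?gle ?(ltW s0) // ltnW.
    move=> iMK; have := H (K + i)%N; rewrite -ltn_subRL => /(_ iMK).
    rewrite -addnS !gKD !cat_pathr ?(ltW s0) //.
    by rewrite opprD addrACA subrr add0r.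
  have [iK|Ki] := ltnP i K.
    rewrite !cat_pathl ?gle ?(ltW s0) // ?(ltnW iK) //.
    by apply: H1; rewrite ltn_min iM.
  rewrite -(subnKC Ki) -addnS !gKD !cat_pathr ?(ltW s0) //.
  rewrite opprD addrACA subrr add0r; apply: H2.
  by rewrite ltn_sub2r // (leq_ltn_trans Ki).
transitivity ((PP \x PP) (increments_in s n (minn M K) B `*`
    increments_in s n (M - K) (fun j => B (K + j)%N))); last by rewrite -HE.
rewrite product_measure1E; [|exact: measurable_increments|exact: measurable_increments].
rewrite [X in X * _]HPP // [X in _ * X]HPP //.
set F := fun i => PP [set p | B i (p (grid s n 1))].
have -> : \prod_(i < M) F i = \prod_(0 <= i < M) F i by rewrite big_mkord.
have -> : \prod_(i < minn M K) F i = \prod_(0 <= i < minn M K) F i by rewrite big_mkord.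
rewrite (big_cat_nat (n := minn M K)) ?geq_minl //=; congr (_ * _).
have -> : \prod_(i < M - K) F (K + i)%N = \prod_(0 <= i < M - K) F (K + i)%N.
  by rewrite big_mkord.
have [MK|KM] := leqP M K.
  by rewrite (eqP MK) !big_geq // leqnn.
by rewrite -{1}[K]add0n big_addn; apply: eq_bigr => i _; rewrite addnC.
Qed.

Lemma markov s (J : cpath R d -> \bar R) : (0 < s)%R -> measurable_fun setT J ->
  (forall p, 0 <= J p) ->
  \int[PP]_p J p = \int[PP]_p \int[PP]_q J (cat_path s p q).
Proof.
move=> s0 mJ J0.
transitivity (\int[pushforward (PP \x PP)
  (fun u : cpath R d * cpath R d => cat_path s u.1 u.2)]_p J p).
  apply: eq_measure_integral; first exact: measurable_cat_path.
  by move=> mcat A mA _; rewrite [LHS](markov_set s0 mA).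
rewrite ge0_integral_pushforward //; last exact: measurable_cat_path.
rewrite preimage_setT fubini_tonelli1 //; last by move=> u; exact: J0.
exact: (measurableT_comp mJ (measurable_cat_path s)).
Qed.

Hypothesis Hsym : forall t (B : set 'rV[R]_d), (0 <= t)%R -> measurable B ->
  PP [set p : cpath R d | B (p t)] = PP [set p : cpath R d | B (- p t)%R].

Lemma is_cpath_opp p : is_cpath (fun t => - p t)%R.
Proof.
split; first by rewrite cpath0 oppr0.
- move=> t t0; apply: rV_cvg => i; rewrite mxE; under eq_fun do rewrite mxE.
  by apply: cvgN; apply: cvg_rV; exact: cpath_rcont.
- by move=> t; have [M HM] := cpath_bounded p t; exists M => s s0 st; rewrite enormN HM.
Qed.

Definition opp_path p : cpath R d := Cpath (is_cpath_opp p).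

Lemma measurable_opp_path : measurable_fun setT opp_path.
Proof.
apply: measurable_to_cpath => t t0; apply: measurable_rVN; exact: measurable_eval.
Qed.

Lemma opp_path_law A : measurable A -> PP A = PP (opp_path @^-1` A).
Proof.
move=> mA.
apply: (@cpath_law_unique _ _ 1%R ltr01 PP (pushforward PP opp_path) 0%N) => //.
- exact: measurable_opp_path.
- exact: (le_lt_trans (probability_le1 PP (@measurableT _ (cpath R d))) (ltry 1)).
move=> mcat n M B _ mB; rewrite [LHS](HPP n M ltr01 mB) /pushforward; cbv beta.
have HE : opp_path @^-1` increments_in 1 n M B =
    increments_in 1 n M (fun i => [set x | B i (- x)%R]).
  by apply/seteqP; split => p /= H i iM; have := H i iM; rewrite /= -opprD.
transitivity (PP (increments_in 1 n M (fun i => [set x | B i (- x)%R]))); last by rewrite -HE.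
rewrite HPP //; last first.
  move=> i; rewrite -[X in measurable X]setTI.
  by apply: (measurable_rVN (f := id)) => //; exact: measurable_id.
by apply: eq_bigr => i _; rewrite Hsym //; exact: grid_ge0.
Qed.

End levy_law.

(** * Small-time estimates *)

(** The interface through which the profile is used from here on; its construction as a tail
    supremum no longer appears. *)
Record profile_spec (R : realType) (d : nat) (nu : 'rV[R]_d -> R)
    (N : {measure set 'rV[R]_d -> \bar R}) (w : 'rV[R]_d -> R) : Prop := ProfileSpec {
  ps_gt0 : forall x, 0 < w x;
  ps_meas : measurable_fun setT w;
  psN : forall x, w (- x) = w x;
  ps_nincr : forall x y, enorm x <= enorm y -> w y <= w x;
  ps_int : exists2 I : R, 0 < I & (\int[lebesgue_rV R d]_y (w y)%:E <= I%:E)%E;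
  ps_conv : forall b, 0 < b -> exists c C : R, [/\ 0 < c, 0 < C & forall x,
    ((c * w x)%:E <= \int[lebesgue_rV R d]_y (w y * gauss b (x - y))%:E <= (C * w x)%:E)%E];
  ps_jump : exists2 C : R, 0 < C & forall x,
    (\int[N]_(z in bigjump) (w (x + z))%:E <= (C * w x)%:E)%E;
  ps_gauss : forall b, 0 < b -> exists2 C : R, 0 < C & forall y, gauss b y <= C * w y;
  ps_gauss_jump : forall b, 0 < b -> exists c r : R, [/\ 0 < c, 0 < r & forall y,
    r <= enorm y -> ((c * w y)%:E <= \int[N]_(z in bigjump) (gauss b (y - z))%:E)%E];
  ps_decay : exists2 C : R, 0 < C & forall x, d%:R <= enorm x -> w x * enorm x <= C;
  ps_nu_le : forall z, 1 <= enorm z -> nu z <= w z;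
  ps_le_nu : exists2 C : R, 0 < C & forall z, 1 / 2 <= enorm z -> w z <= C * nu z }.

Lemma exists_profile (R : realType) (d : nat) (nu : 'rV[R]_d -> R)
    (N : {measure set 'rV[R]_d -> \bar R}) : (0 < d)%N ->
  measurable_fun setT nu -> (forall x, x != 0 -> 0 < nu x) ->
  (\int[N]_z (Num.min 1 (enorm z ^+ 2))%:E < +oo)%E ->
  (forall A, measurable A -> N A = (\int[lebesgue_rV R d]_(z in A) (nu z)%:E)%E) ->
  (forall r, 0 < r <= 1 / 2 -> exists2 C1 : R, 1 <= C1 & forall x y,
    r <= enorm y -> enorm y <= enorm x -> enorm x <= enorm y + 1 ->
    C1^-1 * nu y <= nu x <= C1 * nu y) ->
  (exists2 C2 : R, 1 <= C2 & forall x y,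
    1 / 2 <= enorm y -> enorm y <= enorm x -> nu x <= C2 * nu y) ->
  (exists2 C3 : R, 1 <= C3 & forall x y, 1 <= enorm (y - x) ->
    (\int[lebesgue_rV R d]_(z in
        [set z | (1 / 2 < enorm (z - x))%R /\ (1 / 2 < enorm (z - y))%R])
      (nu (x - z) * nu (z - y))%:E <= (C3 * nu (x - y))%:E)%E) ->
  exists w, profile_spec nu N w.
Proof.
move=> hd mnu nu0 Nfin NE A1 [C2 C21 A2] [C3 C31 A3].
have [C1 C11 {}A1] : exists2 C1 : R, 1 <= C1 & forall x y,
    1 / 2 <= enorm y -> enorm y <= enorm x -> enorm x <= enorm y + 1 ->
    C1^-1 * nu y <= nu x <= C1 * nu y.
  by apply: A1; lra.
exists (profile nu); split.
- by move=> x; apply: (profile_gt0 hd nu0 A2).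
- exact: (measurable_profile hd A2).
- exact: profileN.
- exact: (profile_nincr hd A2).
- exact: (profile_integrable hd mnu nu0 Nfin NE C21 A2).
- by move=> b; apply: (profile_conv hd nu0 C11 C21 A1 A2).
- exact: (profile_jump hd mnu nu0 Nfin NE C11 C21 C31 A1 A2 A3).
- by move=> b; apply: (gauss_le_profile hd nu0 C11 C21 A1 A2).
- by move=> b; apply: (gauss_jump_ge hd mnu nu0 NE C11 C21 A1 A2).
- exact: (profile_decay hd mnu nu0 Nfin NE C21 A2).
- exact: (nu_le_profile hd A2).
- by exists C2; [lra|exact: (profile_le_nu hd A2)].
Qed.

(** * Large jumps over a short time *)

Section big_jumps.
Context {R : realType} {d : nat}.
Variables (nu : 'rV[R]_d -> R) (N : {measure set 'rV[R]_d -> \bar R}) (A : 'M[R]_d).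
Hypothesis mnu : measurable_fun setT nu.
Hypothesis nu_gt0 : forall x, x != 0 -> 0 < nu x.
Hypothesis Nfin : (\int[N]_z (Num.min 1 (enorm z ^+ 2))%:E < +oo)%E.
Hypothesis NE : forall A, measurable A ->
  N A = (\int[lebesgue_rV R d]_(z in A) (nu z)%:E)%E.
Hypothesis Apsd : forall xi, 0 <= dotr (xi *m A) xi.
Implicit Types (a x y z : 'rV[R]_d) (b h t : R).

Lemma indic_bigjumpN z : \1_bigjump (- z) = \1_bigjump z :> R.
Proof.
rewrite !indicE; congr (_%:R); congr nat_of_bool.
by apply/idP/idP => /set_mem zb; apply/mem_set; move: zb; rewrite /bigjump /= enormN.
Qed.

Definition half_sum b a z : R := (gauss b (a + z) + gauss b (a - z)) / 2.

Definition big_half b a z : R := \1_bigjump z * half_sum b a z.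

Lemma half_sum_ge0 b a z : 0 <= half_sum b a z.
Proof. by rewrite divr_ge0 // addr_ge0 // gauss_ge0. Qed.

Lemma half_sum_le1 b a z : 0 <= b -> half_sum b a z <= 1.
Proof.
by move=> b0; have := gauss_le1 (a + z) b0; have := gauss_le1 (a - z) b0;
  rewrite /half_sum; lra.
Qed.

Lemma measurable_gauss_add b a : measurable_fun setT (fun z => gauss b (a + z)).
Proof.
apply: (measurableT_comp (measurable_gauss b)).
by apply: measurable_rVD => //; exact: measurable_id.
Qed.

Lemma measurable_half_sum b a : measurable_fun setT (half_sum b a).
Proof.
apply: measurable_funM => //; apply: measurable_funD; first exact: measurable_gauss_add.
exact: measurable_gauss_sub.
Qed.

Lemma measurable_big_half b a : measurable_fun setT (big_half b a).
Proof.
apply: measurable_funM; last exact: measurable_half_sum.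
by apply: measurable_indic; exact: measurable_bigjump.
Qed.

Lemma measurable_sdiff b a : measurable_fun setT (sdiff (gauss b) a).
Proof. by apply: measurable_funB => //; exact: measurable_half_sum. Qed.

Lemma big_half_bounds b a z : 0 <= b -> 0 <= big_half b a z <= 4 * trunc2 z.
Proof.
move=> b0; rewrite /big_half indicE; have [/set_mem zb|_] := boolP (z \in bigjump); last first.
  by rewrite mul0r lexx mulr_ge0 // trunc2_ge0.
rewrite mul1r half_sum_ge0 /= (le_trans (half_sum_le1 _ _ b0)) //.
exact: bigjump_le.
Qed.

(** Small jumps leave the second-order bound of [sdiff_gauss_le]; large ones leave only the term -
    gauss b a. Both decay in [a] like a Gaussian, so that what is far from the origin is due to
    large jumps. *)
Lemma sdiff_big_half b : 0 < b -> exists2 C : R, 0 < C & forall a z,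
  `|sdiff (gauss b) a z - big_half b a z| <= C * gauss (b / 2) a * trunc2 z.
Proof.
move=> b0; have [C C0 HC] := sdiff_gauss_le (d := d) b0.
exists (C + 4); first lra.
move=> a z; have g0 := gauss_ge0 (b / 2) a; have tz := trunc2_ge0 z.
rewrite /big_half indicE; have [/set_mem zb|/negP zb] := boolP (z \in bigjump).
  rewrite mul1r /sdiff -/(half_sum b a z) addrAC subrr sub0r normrN.
  rewrite ger0_norm ?gauss_ge0 //.
  have h1 : gauss b a <= gauss (b / 2) a by apply: le_gauss; lra.
  have h2 := bigjump_le zb.
  rewrite (le_trans h1) // !mulrDl.
  have : 0 <= C * gauss (b / 2) a * trunc2 z by rewrite !mulr_ge0 // ltW.
  have : gauss (b / 2) a <= gauss (b / 2) a * (4 * trunc2 z) by rewrite ler_peMr.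
  rewrite mul1r.
  lra.
have z1 : enorm z <= 1 / 2.
  by rewrite leNgt; apply/negP => zb'; apply: zb; rewrite inE.
rewrite mul0r subr0; apply: (le_trans (HC a z _)); first lra.
have tzE : trunc2 z = dotr z z.
  rewrite /trunc2 min_r // -sqr_enorm expr_le1 ?enorm_ge0 //; lra.
rewrite tzE -[leLHS]mulrA [_ * gauss _ _]mulrC mulrA.
rewrite !ler_wpM2r ?dotr_ge0 //; lra.
Qed.

Lemma cmul_trunc2_integrable (c : R) : N.-integrable setT (EFin \o (fun z => c * trunc2 z)).
Proof.
have := integrableZl measurableT c (trunc2_integrable Nfin).
exact: eq_integrable.
Qed.

Lemma big_half_integrable b a : 0 <= b -> N.-integrable setT (EFin \o big_half b a).
Proof.
move=> b0; apply: (integrable_le_fun (g := fun z => 4 * trunc2 z)).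
- exact: measurable_big_half.
- by move=> z; have /andP[h1 h2] := big_half_bounds a z b0; rewrite ger0_norm.
- exact: cmul_trunc2_integrable.
Qed.

(** The intensity of large jumps from [a], tested on [gauss b]. It is symmetrised because symmetry
    is known for the law of the process, not for [N]. *)
Definition jump_rate b a : R := Rintegral N setT (big_half b a).

Lemma sdiff_integrable b a : 0 < b -> N.-integrable setT (EFin \o sdiff (gauss b) a).
Proof.
move=> b0; have [C C0 HC] := sdiff_big_half b0.
apply: (integrable_le_fun (g := fun z => (C * gauss (b / 2) a + 4) * trunc2 z)).
- exact: measurable_sdiff.
- move=> z; have /andP[h1 h2] := big_half_bounds a z (ltW b0).
  have := HC a z; rewrite mulrDl.
  have := ler_normD (sdiff (gauss b) a z - big_half b a z) (big_half b a z).
  rewrite subrK (ger0_norm h1); lra.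
- exact: cmul_trunc2_integrable.
Qed.

Lemma jump_rate_sub b : 0 < b -> exists2 C : R, 0 < C & forall a,
  `|Rintegral N setT (sdiff (gauss b) a) - jump_rate b a| <= C * gauss (b / 2) a.
Proof.
move=> b0; have [C C0 HC] := sdiff_big_half b0.
have m0 := levy_mass_ge0 N.
exists (C * levy_mass N + 1); first by rewrite ltr_wpDl // mulr_ge0 // ltW.
move=> a; have g0 := gauss_ge0 (b / 2) a.
rewrite -RintegralB //; [|exact: sdiff_integrable|exact/big_half_integrable/ltW].
apply: (@le_trans _ _ (Rintegral N setT (fun z => C * gauss (b / 2) a * trunc2 z))).
  apply: normr_Rintegral_le => //; last exact: cmul_trunc2_integrable.
  - by apply: measurable_funB; [exact: measurable_sdiff|exact: measurable_big_half].
  - by move=> z; exact: HC.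
rewrite RintegralZl //; last exact: trunc2_integrable.
rewrite -/(levy_mass N); have -> : C * gauss (b / 2) a * levy_mass N =
   C * levy_mass N * gauss (b / 2) a by ring.
by rewrite ler_wpM2r //; lra.
Qed.

Section law.
Context {disp : measure_display} {Omega : measurableType disp}.
Variable P : probability Omega R.

Definition sym_charfun (Z : Omega -> 'rV[R]_d) h : Prop :=
  has_charfun N A P Z h /\ forall f : 'rV[R]_d -> R, measurable_fun setT f ->
    (exists M, forall x, `|f x| <= M) ->
    Rintegral P setT (fun w => f (Z w)) = Rintegral P setT (fun w => f (- Z w)).

Lemma Rintegral_prob_cst (c : R) : Rintegral P setT (fun=> c) = c.
Proof.
transitivity (fine (c%:E * P setT)%E); last by rewrite probability_setT mule1.
by rewrite /Rintegral integral_cst.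
Qed.

Lemma bounded_integrable (Z : Omega -> 'rV[R]_d) (f : 'rV[R]_d -> R) M :
  measurable_fun setT Z -> measurable_fun setT f -> (forall x, `|f x| <= M) ->
  P.-integrable setT (EFin \o (fun w => f (Z w))).
Proof.
move=> mZ mf fM; apply: (@probability_integrable_bounded _ _ _ _ _ M) => //.
exact: (measurableT_comp mf mZ).
Qed.

Lemma Rintegral_half (f g : Omega -> R) : P.-integrable setT (EFin \o f) ->
  P.-integrable setT (EFin \o g) ->
  Rintegral P setT (fun w => (f w + g w) / 2) =
  (Rintegral P setT f + Rintegral P setT g) / 2.
Proof.
move=> fi gi; rewrite RintegralZr ?RintegralD //.
by have := integrableD measurableT fi gi; exact: eq_integrable.
Qed.

Lemma Rintegral_half_cst (f g : Omega -> R) c : P.-integrable setT (EFin \o f) ->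
  P.-integrable setT (EFin \o g) ->
  Rintegral P setT (fun w => (f w + g w) / 2 - c) =
  Rintegral P setT (fun w => (f w + g w) / 2) - c.
Proof.
move=> fi gi; rewrite RintegralB ?Rintegral_prob_cst //.
  have := integrableZr measurableT 2^-1 (integrableD measurableT fi gi).
  exact: eq_integrable.
exact: finite_measure_integrable_cst.
Qed.

Lemma trunc2_le1 z : `|trunc2 z| <= 1.
Proof. by rewrite ger0_norm ?trunc2_ge0 // /trunc2 ge_min lexx. Qed.

Lemma normr_gauss_le1 b z : 0 <= b -> `|gauss b z| <= 1.
Proof. by move=> b0; rewrite ger0_norm ?gauss_ge0 ?gauss_le1. Qed.

(** The estimate for [gauss 1] at the origin bounds 1 - E exp(-|Z|^2) by a multiple of [h], and
    min(1, s) <= 2 (1 - exp(-s)). *)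
Lemma trunc2_moment : exists2 C : R, 0 < C & forall Z h, 0 < h <= 1 ->
  sym_charfun Z h -> Rintegral P setT (fun w => trunc2 (Z w)) <= C * h.
Proof.
have [C C0 HC] := key_gauss Nfin Apsd P ltr01.
have [C' C'0 HC'] := jump_rate_sub ltr01.
have m0 := levy_mass_ge0 N.
exists (2 * (2 * C + C' + 4 * levy_mass N)); first lra.
move=> Z h hh [cZ _]; have /andP[h0 h1] := hh.
have mZ : measurable_fun setT Z by case: cZ.
have H1 := HC Z h 0 hh cZ; have H2 := HC' 0.
have g00 b : gauss b (0 : 'rV[R]_d) = 1 by rewrite /gauss dotr0l mulr0 oppr0 expR0.
rewrite !g00 mulr1 in H1 H2.
have H3 : 0 <= jump_rate 1 0 <= 4 * levy_mass N.
  apply/andP; split.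
    by apply: Rintegral_ge0 => z _; have /andP[] := big_half_bounds 0 z ler01.
  rewrite /levy_mass -RintegralZl //; last exact: trunc2_integrable.
  apply: le_Rintegral => //; [exact: big_half_integrable|exact: cmul_trunc2_integrable|].
  by move=> z _; have /andP[] := big_half_bounds 0 z ler01.
set E := Rintegral P setT _ in H1.
have H4 : - (2 * C + C' + 4 * levy_mass N) <= (E - 1) / h.
  move: H1 H2; rewrite !ler_norml => /andP[H1 _] /andP[H2 _].
  have : C * (1 + h) <= 2 * C by nra.
  move: H3 => /andP[H3 _]; lra.
have H5 : 1 - E <= (2 * C + C' + 4 * levy_mass N) * h.
  have := ler_wpM2r (ltW h0) H4; rewrite divfK ?gt_eqF //; lra.
have H6 : Rintegral P setT (fun w => trunc2 (Z w)) <= 2 * (1 - E).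
  have -> : 2 * (1 - E) = Rintegral P setT (fun w => 2 * (1 - gauss 1 (0 + Z w))).
    have i1 : P.-integrable setT (EFin \o cst 1) by exact: finite_measure_integrable_cst.
    have i2 : P.-integrable setT (EFin \o (fun w => gauss 1 (0 + Z w))).
      apply: (bounded_integrable (f := fun z => gauss 1 (0 + z)) (M := 1)) => //.
        exact: measurable_gauss_add.
      by move=> z; exact: normr_gauss_le1.
    rewrite RintegralZl //; last first.
      have := integrableB measurableT i1 i2; exact: eq_integrable.
    rewrite RintegralB // Rintegral_prob_cst //.
  apply: le_Rintegral => //.
  - exact: (bounded_integrable mZ measurable_trunc2 trunc2_le1).
  - apply: (bounded_integrable (f := fun z => 2 * (1 - gauss 1 (0 + z))) (M := 2)) => //.
      apply: measurable_funM => //; apply: measurable_funB => //.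
      exact: measurable_gauss_add.
    move=> z; have := gauss_le1 (0 + z) (@ler01 R); have := gauss_ge0 1 (0 + z).
    by move=> *; rewrite ger0_norm; lra.
  move=> w _; rewrite add0r /gauss mul1r /trunc2; set s := dotr _ _.
  have s0 : 0 <= s := dotr_ge0 _.
  have e1 := expR_ge1Dx s; have e0 := expR_gt0 (- s).
  have ee : expR s * expR (- s) = 1 by exact: expRxMexpNx_1.
  have H : expR (- s) * (1 + s) <= 1.
    have : 0 <= expR (- s) * (expR s - (1 + s)).
      by rewrite mulr_ge0 ?subr_ge0 // ltW.
    by rewrite mulrBr [X in X - _]mulrC ee subr_ge0.
  by have [s1|s1] := leP 1 s; nra.
lra.
Qed.

(** The expectation over increments without a large jump is controlled on the side of the law: after
    symmetrisation it is bounded by the mean of [trunc2], times a Gaussian in [a]. Subtracting it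
    from [key_gauss] leaves the large jumps, with their intensity. *)
Lemma big_jump_law b : 0 < b -> exists2 C : R, 0 < C & forall Z h a, 0 < h <= 1 ->
  sym_charfun Z h ->
  `|Rintegral P setT (fun w => \1_bigjump (Z w) * gauss b (a + Z w)) - h * jump_rate b a|
    <= h * (C * (gauss (b / 2) a + h)) /\
  `|Rintegral P setT (fun w => gauss b (a + Z w)) - gauss b a -
    Rintegral P setT (fun w => \1_bigjump (Z w) * gauss b (a + Z w))| <=
    h * (C * gauss (b / 2) a).
Proof.
move=> b0; have b0' := ltW b0.
have [C1 C10 HC1] := key_gauss Nfin Apsd P b0.
have [C2 C20 HC2] := jump_rate_sub b0.
have [C3 C30 HC3] := sdiff_big_half b0.
have [C4 C40 HC4] := trunc2_moment.
have C34 : 0 < C3 * C4 by rewrite mulr_gt0.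
exists (C1 + C2 + C3 * C4); first lra.
move=> Z h a hh sZ; have /andP[h0 h1] := hh.
have [cZ symZ] := sZ; have mZ : measurable_fun setT Z by case: cZ.
have g0 := gauss_ge0 (b / 2) a.
have mI : measurable_fun setT (\1_bigjump : 'rV[R]_d -> R).
  by apply: measurable_indic; exact: measurable_bigjump.
have I01 z : `|\1_bigjump z * gauss b (a + z)| <= 1.
  rewrite normrM indicE; case: (_ \in _) => /=.
    by rewrite normr1 mul1r normr_gauss_le1.
  by rewrite normr0 mul0r.
have mbig : measurable_fun setT (fun z => \1_bigjump z * gauss b (a + z)).
  by apply: measurable_funM => //; exact: measurable_gauss_add.
have ig : P.-integrable setT (EFin \o (fun w => gauss b (a + Z w))).
  apply: (bounded_integrable (f := fun z => gauss b (a + z)) (M := 1)) => //.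
    exact: measurable_gauss_add.
  by move=> z; exact: normr_gauss_le1.
have ig' : P.-integrable setT (EFin \o (fun w => gauss b (a - Z w))).
  apply: (bounded_integrable (f := fun z => gauss b (a - z)) (M := 1)) => //.
    exact: measurable_gauss_sub.
  by move=> z; exact: normr_gauss_le1.
have ib := bounded_integrable mZ mbig I01.
have mbig' : measurable_fun setT (fun z => \1_bigjump z * gauss b (a - z)).
  by apply: measurable_funM => //; exact: measurable_gauss_sub.
have I01' z : `|\1_bigjump z * gauss b (a - z)| <= 1.
  rewrite normrM indicE; case: (_ \in _) => /=.
    by rewrite normr1 mul1r normr_gauss_le1.
  by rewrite normr0 mul0r.
have ib' := bounded_integrable mZ mbig' I01'.
pose E := Rintegral P setT (fun w => gauss b (a + Z w)).
pose B := Rintegral P setT (fun w => \1_bigjump (Z w) * gauss b (a + Z w)).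
have EE : E - gauss b a = Rintegral P setT (fun w => sdiff (gauss b) a (Z w)).
  have E' : E = Rintegral P setT (fun w => gauss b (a - Z w)).
    apply: (symZ (fun z => gauss b (a + z))); first exact: measurable_gauss_add.
    by exists 1 => z; exact: normr_gauss_le1.
  transitivity ((E + E) / 2 - gauss b a); first by field.
  by rewrite [X in (_ + X) / 2 - _]E' -(Rintegral_half ig ig') -Rintegral_half_cst.
have BE : B = Rintegral P setT (fun w => big_half b a (Z w)).
  have B' : B = Rintegral P setT (fun w => \1_bigjump (Z w) * gauss b (a - Z w)).
    rewrite /B (symZ (fun z => \1_bigjump z * gauss b (a + z))) //; last by exists 1.
    by apply: eq_Rintegral => w _; rewrite indic_bigjumpN.
  transitivity ((B + B) / 2); first by field.
  rewrite [X in (_ + X) / 2]B' -(Rintegral_half ib ib').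
  by apply: eq_Rintegral => w _; rewrite /big_half /half_sum mulrA mulrDr.
have H2 : `|E - gauss b a - B| <= h * (C3 * C4 * gauss (b / 2) a).
  have i1 : P.-integrable setT (EFin \o (fun w => sdiff (gauss b) a (Z w))).
    apply: (bounded_integrable mZ (measurable_sdiff b a) (M := 1)) => z.
    rewrite /sdiff -/(half_sum b a z).
    have := half_sum_le1 a z b0'; have := half_sum_ge0 b a z.
    have := gauss_le1 a b0'; have := gauss_ge0 b a.
    by rewrite ler_norml; lra.
  have i2 : P.-integrable setT (EFin \o (fun w => big_half b a (Z w))).
    apply: (bounded_integrable mZ (measurable_big_half b a) (M := 1)) => z.
    rewrite /big_half normrM indicE (ger0_norm (half_sum_ge0 _ _ _)).
    by case: (_ \in _); rewrite ?normr1 ?mul1r ?half_sum_le1 ?normr0 ?mul0r.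
  rewrite EE BE -(RintegralB measurableT i1 i2).
  apply: (@le_trans _ _ (Rintegral P setT (fun w => C3 * gauss (b / 2) a * trunc2 (Z w)))).
    apply: normr_Rintegral_le => //.
    - by apply: measurable_funB; [exact: (measurableT_comp (measurable_sdiff b a) mZ)|
        exact: (measurableT_comp (measurable_big_half b a) mZ)].
    - have it := bounded_integrable mZ measurable_trunc2 trunc2_le1.
      have := integrableZl measurableT (C3 * gauss (b / 2) a) it; exact: eq_integrable.
  rewrite RintegralZl //; last exact: (bounded_integrable mZ measurable_trunc2 trunc2_le1).
  have := HC4 Z h hh sZ => HT.
  apply: (@le_trans _ _ (C3 * gauss (b / 2) a * (C4 * h))).
    by rewrite ler_wpM2l // mulr_ge0 // ltW.
  rewrite le_eqVlt; apply/orP; left; apply/eqP; ring.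
split; last first.
  apply: (le_trans H2); rewrite ler_wpM2l ?(ltW h0) // ler_wpM2r //; lra.
have H1 := HC1 Z h a hh cZ; rewrite -/E in H1.
have H3 := HC2 a.
have HE : E - gauss b a = h * ((E - gauss b a) / h) by rewrite mulrC divfK // gt_eqF.
move: H1 H3; rewrite HE in H2.
set X := (E - gauss b a) / h in H2 *; set S := Rintegral N setT _.
set Jr := jump_rate b a; set g := gauss (b / 2) a in H2 g0 *.
rewrite -/B => H1 H3.
have -> : B - h * Jr = - (h * X - B) + h * ((X - S) + (S - Jr)) by ring.
apply: (le_trans (ler_normD _ _)); rewrite normrN normrM (ger0_norm (ltW h0)).
have H4 : `|X - S + (S - Jr)| <= C1 * (g + h) + C2 * g.
  by apply: (le_trans (ler_normD _ _)); exact: lerD.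
have H5 := ler_wpM2l (ltW h0) H4.
apply: (le_trans (lerD H2 H5)); rewrite -mulrDr ler_wpM2l ?(ltW h0) //.
have : 0 <= C2 * h by rewrite mulr_ge0 // ltW.
have : 0 <= C3 * C4 * h by rewrite mulr_ge0 // ltW.
lra.
Qed.

End law.

End big_jumps.

Lemma gauss_half2 {R : realType} {d : nat} (b : R) (z : 'rV[R]_d) :
  gauss b z = gauss (b / 2) z * gauss (b / 2) z.
Proof. by rewrite -gaussD -splitr. Qed.

Section nonneg_integral.
Context {R : realType} dT (T : measurableType dT) (mu : {measure set T -> \bar R}).
Variable D : set T.
Hypothesis mD : measurable D.
Implicit Types f g : T -> R.
Local Open Scope ereal_scope.

Lemma integralZ_EFin (k : R) f : (0 <= k)%R -> measurable_fun setT f ->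
  (forall x, 0 <= f x)%R ->
  \int[mu]_(x in D) (k * f x)%:E = k%:E * \int[mu]_(x in D) (f x)%:E.
Proof.
move=> k0 mf f0; rewrite -ge0_integralZl //.
  exact/measurable_funTS/measurable_EFinP.
by move=> x _; rewrite lee_fin.
Qed.

Lemma integralD_EFin f g : measurable_fun setT f -> (forall x, 0 <= f x)%R ->
  measurable_fun setT g -> (forall x, 0 <= g x)%R ->
  \int[mu]_(x in D) (f x + g x)%:E =
  \int[mu]_(x in D) (f x)%:E + \int[mu]_(x in D) (g x)%:E.
Proof.
move=> mf f0 mg g0; rewrite -ge0_integralD //.
- by move=> x _; rewrite lee_fin.
- exact/measurable_funTS/measurable_EFinP.
- by move=> x _; rewrite lee_fin.
- exact/measurable_funTS/measurable_EFinP.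
Qed.

Lemma le_integral_EFin f g : measurable_fun setT f -> (forall x, 0 <= f x)%R ->
  measurable_fun setT g -> (forall x, D x -> f x <= g x)%R ->
  \int[mu]_(x in D) (f x)%:E <= \int[mu]_(x in D) (g x)%:E.
Proof.
move=> mf f0 mg fg; apply: ge0_le_integral => //.
- by move=> x _; rewrite lee_fin.
- exact/measurable_funTS/measurable_EFinP.
- exact/measurable_funTS/measurable_EFinP.
Qed.

End nonneg_integral.

Section tonelli_curried.
Context {R : realType} d1 d2 (T1 : measurableType d1) (T2 : measurableType d2).
Variables (m1 : {sigma_finite_measure set T1 -> \bar R}).
Variables (m2 : {sigma_finite_measure set T2 -> \bar R}).
Variable f : T1 -> T2 -> \bar R.
Local Open Scope ereal_scope.
Hypothesis mf : measurable_fun setT (fun u : T1 * T2 => f u.1 u.2).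
Hypothesis f0 : forall x y, 0 <= f x y.

Lemma tonelli_swap : \int[m1]_x \int[m2]_y f x y = \int[m2]_y \int[m1]_x f x y.
Proof.
by apply: (@fubini_tonelli _ _ _ _ _ m1 m2 (fun u => f u.1 u.2)) => // u; exact: f0.
Qed.

Lemma measurable_tonelli : measurable_fun setT (fun x => \int[m2]_y f x y).
Proof.
apply: (@measurable_fun_fubini_tonelli_F _ _ _ _ _ m2 (fun u => f u.1 u.2)) => // u.
Qed.

End tonelli_curried.

(** The arithmetic of [return_prob_ge]: [E1] and [E2] are the means of [gauss 1] and [gauss (1 / 2)]
    over large increments, [j1] and [j2] the intensities, [I] the probability of landing in the
    ball, and [e] the small factor gained far out. *)
Lemma return_arith (R : realFieldType)
    (c1 C2 C3 C4 C5 e h wy j1 j2 g2 g4 E1 E2 I : R) :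
  0 < h -> 0 < C3 -> 0 < C4 -> 0 <= e -> e <= 1 -> 0 <= wy ->
  `|E1 - h * j1| <= h * (C3 * (g2 + h)) -> `|E2 - h * j2| <= h * (C4 * (g4 + h)) ->
  c1 * wy <= j1 -> j2 <= C2 * wy -> g4 <= C5 * wy -> g2 <= e * (C5 * wy) ->
  E1 <= I + e * E2 -> e * (C3 * C5 + C2 + C4 * C5) <= c1 / 2 ->
  h * (c1 / 2 * wy - (C3 + C4) * h) <= I.
Proof.
move=> h0 C30 C40 e0 e1 w0; rewrite !ler_norml => /andP[H1 _] /andP[_ H2] J1 J2 G4 G2 EI eK.
have T1 : C3 * g2 <= e * (C3 * C5 * wy).
  by apply: (le_trans (ler_wpM2l (ltW C30) G2)); rewrite mulrCA !mulrA.
have T2 : C4 * g4 <= C4 * C5 * wy by rewrite -mulrA ler_pM2l.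
have T3 : e * (C4 * h) <= C4 * h by rewrite ler_piMl // mulr_ge0 // ltW.
have T4 : e * (j2 + C4 * g4) <= e * ((C2 + C4 * C5) * wy).
  by rewrite ler_wpM2l // mulrDl lerD.
have T5 := ler_wpM2r w0 eK.
have T6 : e * E2 <= h * (e * (j2 + C4 * g4) + C4 * h).
  apply: (@le_trans _ _ (e * (h * j2 + h * (C4 * (g4 + h))))).
    by rewrite ler_wpM2l // -lerBlDl.
  rewrite -mulrDr mulrCA ler_pM2l // [C4 * (_ + _)]mulrDr addrA mulrDr lerD2l //.
have T7 : h * (c1 / 2 * wy) <= h * (j1 - C3 * g2 - e * (j2 + C4 * g4)).
  rewrite ler_pM2l //.
  have : e * (C3 * C5 + C2 + C4 * C5) * wy = e * (C3 * C5 * wy) + e * ((C2 + C4 * C5) * wy) by ring.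
  lra.
have -> : h * (c1 / 2 * wy - (C3 + C4) * h) = h * (c1 / 2 * wy) - h * (C3 * h) - h * (C4 * h) by ring.
have X1 : h * (j1 - C3 * g2 - e * (j2 + C4 * g4)) = h * j1 - h * (C3 * g2) - h * (e * (j2 + C4 * g4)) by ring.
rewrite X1 in T7; rewrite mulrDr in T6.
have X2 : h * (C3 * (g2 + h)) = h * (C3 * g2) + h * (C3 * h) by ring.
rewrite X2 in H1; lra.
Qed.

(** * The profile along the process *)

Section profile_law.
Context {R : realType} {d : nat}.
Variables (nu : 'rV[R]_d -> R) (N : {measure set 'rV[R]_d -> \bar R}) (A : 'M[R]_d).
Hypothesis mnu : measurable_fun setT nu.
Hypothesis nu_gt0 : forall x, x != 0 -> 0 < nu x.
Hypothesis Nfin : (\int[N]_z (Num.min 1 (enorm z ^+ 2))%:E < +oo)%E.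
Hypothesis NE : forall A, measurable A ->
  N A = (\int[lebesgue_rV R d]_(z in A) (nu z)%:E)%E.
Hypothesis Apsd : forall xi, 0 <= dotr (xi *m A) xi.
Variable w : 'rV[R]_d -> R.
Hypothesis ps : profile_spec nu N w.
Implicit Types (a x y z : 'rV[R]_d) (b h t : R).

Let leb := lebesgue_rV R d.
Local Open Scope ereal_scope.

Let w0 x : (0 <= w x)%R. Proof. exact/ltW/(ps_gt0 ps). Qed.

Let mb := @measurable_bigjump R d.

Definition big_nu z : R := (\1_bigjump z * nu z)%R.

Lemma big_nu_ge0 z : (0 <= big_nu z)%R.
Proof.
rewrite /big_nu indicE; have [/set_mem zb|_] := boolP (z \in bigjump); last by rewrite mul0r.
rewrite mul1r; apply/ltW/nu_gt0/eqP => z0; move: zb.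
by rewrite /bigjump /= z0 enorm0; lra.
Qed.

Lemma measurable_big_nu : measurable_fun setT big_nu.
Proof. by apply: measurable_funM => //; apply: measurable_indic. Qed.

Lemma integral_big_nu (f : 'rV[R]_d -> R) : (forall z, 0 <= f z)%R ->
  measurable_fun setT f ->
  \int[N]_(z in bigjump) (f z)%:E = \int[leb]_z (f z * big_nu z)%:E.
Proof.
move=> f0 mf; rewrite (integral_density mb mnu _ NE) //; last first.
- exact/measurable_EFinP.
- move=> z zb; apply/ltW/nu_gt0/eqP => z0; move: zb.
  by rewrite /bigjump /= z0 enorm0; lra.
rewrite integral_mkcond; apply: eq_integral => z _.
rewrite patchE /big_nu indicE; case: (z \in bigjump); first by rewrite mul1r.
by rewrite mul0r mulr0.
Qed.

Lemma measurable_w_shift x : measurable_fun setT (fun z => w (x + z)%R).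
Proof.
apply: (measurableT_comp (ps_meas ps)).
by apply: measurable_rVD => //; exact: measurable_id.
Qed.

Lemma measurable_w_shiftB x : measurable_fun setT (fun z => w (x - z)%R).
Proof.
apply: (measurableT_comp (ps_meas ps)).
by apply: measurable_rVB => //; exact: measurable_id.
Qed.

Definition half_sum_w x z : R := ((w (x + z) + w (x - z)) / 2)%R.

Lemma half_sum_w_ge0 x z : (0 <= half_sum_w x z)%R.
Proof. by rewrite divr_ge0 // addr_ge0. Qed.

Lemma measurable_half_sum_w x : measurable_fun setT (half_sum_w x).
Proof.
apply: measurable_funM => //; apply: measurable_funD; first exact: measurable_w_shift.
exact: measurable_w_shiftB.
Qed.

Lemma half_sum_w_jump : exists2 C : R, (0 < C)%R & forall x,
  \int[N]_(z in bigjump) (half_sum_w x z)%:E <= (C * w x)%:E.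
Proof.
have [C C0 HC] := ps_jump ps; exists C => // x.
have -> : \int[N]_(z in bigjump) (half_sum_w x z)%:E =
  \int[N]_(z in bigjump) (2^-1 * (w (x + z) + w (- x + z)))%:E.
  apply: eq_integral => z _; rewrite /half_sum_w mulrC; congr (_ * (_ + _))%:E.
  by rewrite -(psN ps) opprB addrC.
have m1 := measurable_w_shift x; have m2 := measurable_w_shift (- x).
rewrite integralZ_EFin //; [|exact: measurable_funD|by move=> z; rewrite addr_ge0].
rewrite integralD_EFin //.
apply: (@le_trans _ _ (2^-1%:E * ((C * w x)%:E + (C * w (- x)%R)%:E))).
  by rewrite lee_pmul2l //; apply: leeD.
by rewrite (psN ps) -EFinD -EFinM lee_fin le_eqVlt; apply/orP; left; apply/eqP; field.
Qed.

Lemma jump_rateE b a : (0 <= b)%R ->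
  (jump_rate N b a)%:E = \int[N]_(z in bigjump) (half_sum b a z)%:E.
Proof.
move=> b0; rewrite /jump_rate fineK; last first.
  by apply: (integrable_fin_num measurableT); exact: big_half_integrable.
rewrite [RHS]integral_mkcond; apply: eq_integral => z _.
rewrite patchE /big_half /= indicE; case: (z \in bigjump); first by rewrite mul1r.
by rewrite mul0r.
Qed.

Lemma jump_rate_ge0 b a : (0 <= jump_rate N b a)%R.
Proof.
apply: Rintegral_ge0 => z _; rewrite /big_half mulr_ge0 ?half_sum_ge0 // indicE.
Qed.

Lemma jump_rate_le b : (0 < b)%R -> exists2 C : R, (0 < C)%R & forall a,
  (jump_rate N b a <= C * w a)%R.
Proof.
move=> b0; have [C C0 HC] := half_sum_w_jump; have [C' C'0 HC'] := ps_gauss ps b0.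
exists (C' * C)%R; first by rewrite mulr_gt0.
move=> a; rewrite -lee_fin jump_rateE ?(ltW b0) //.
have mh := measurable_half_sum_w a; have h0 := half_sum_w_ge0 a.
apply: (@le_trans _ _ (\int[N]_(z in bigjump) (C' * half_sum_w a z)%:E)).
  apply: le_integral_EFin => //.
  - exact: measurable_half_sum.
  - by move=> z; rewrite half_sum_ge0.
  - exact: measurable_funM.
  move=> z _; rewrite /half_sum /half_sum_w mulrA.
  by rewrite ler_wpM2r ?invr_ge0 // mulrDr lerD.
rewrite integralZ_EFin ?(ltW C'0) //.
by rewrite -mulrA EFinM lee_pmul2l.
Qed.

Lemma jump_rate_ge b : (0 < b)%R -> exists c r : R, [/\ (0 < c)%R, (0 < r)%R & forall y,
  (r <= enorm y)%R -> (c * w y <= jump_rate N b y)%R].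
Proof.
move=> b0; have [c [r [c0 r0 H]]] := ps_gauss_jump ps b0.
exists (c / 2)%R, r; split => //; first by rewrite divr_gt0.
move=> y ry; rewrite -lee_fin jump_rateE ?(ltW b0) //.
have mg := measurable_gauss_sub b y.
apply: (@le_trans _ _ (\int[N]_(z in bigjump) (2^-1 * gauss b (y - z))%:E)); last first.
  apply: le_integral_EFin => //.
  - exact: measurable_funM.
  - by move=> z; rewrite mulr_ge0 ?gauss_ge0.
  - exact: measurable_half_sum.
  move=> z _; rewrite /half_sum [leRHS]mulrC.
  by rewrite ler_wpM2l ?invr_ge0 // lerDr gauss_ge0.
rewrite integralZ_EFin //; last by move=> z; exact: gauss_ge0.
have -> : (c / 2 * w y = 2^-1 * (c * w y))%R by ring.
by rewrite EFinM lee_pmul2l //; exact: H.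
Qed.

Lemma measurable_jump_rate b : (0 <= b)%R -> measurable_fun setT (jump_rate N b).
Proof.
move=> b0; apply/measurable_EFinP.
have -> : EFin \o jump_rate N b =
  fun a => \int[leb]_z (half_sum b a z * big_nu z)%:E.
  apply/funext => a /=; rewrite jump_rateE // integral_big_nu //.
    by move=> z; exact: half_sum_ge0.
  exact: measurable_half_sum.
pose f (a z : 'rV[R]_d) := (half_sum b a z * big_nu z)%:E.
apply: (measurable_tonelli leb (f := f)); last first.
  by move=> a z; rewrite lee_fin mulr_ge0 ?half_sum_ge0 ?big_nu_ge0.
apply/measurable_EFinP; apply: measurable_funM; last first.
  exact: (measurableT_comp measurable_big_nu measurable_snd).
apply: measurable_funM => //; apply: measurable_funD; apply: (measurableT_comp (measurable_gauss b)).
  by apply: measurable_rVD; [exact: measurable_fst|exact: measurable_snd].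
by apply: measurable_rVB; [exact: measurable_fst|exact: measurable_snd].
Qed.

(** Exchanging the integrals, the convolution with the Gaussian is taken first and returns [w] at x
    + z and x - z; the jump property of [w] then bounds the integral over [z]. *)
Lemma conv_jump b : (0 < b)%R -> exists2 C : R, (0 < C)%R & forall x,
  \int[leb]_y (w y * jump_rate N b (x - y))%:E <= (C * w x)%:E.
Proof.
move=> b0; have [C C0 HC] := half_sum_w_jump.
have [c [C' [c0 C'0 HC']]] := ps_conv ps b0.
have {}HC' x := (andP (HC' x)).2.
exists (C' * C)%R; first by rewrite mulr_gt0.
move=> x.
pose f (y z : 'rV[R]_d) := (w y * (half_sum b (x - y) z * big_nu z))%:E.
have f0 y z : 0 <= f y z.
  by rewrite lee_fin mulr_ge0 // mulr_ge0 ?half_sum_ge0 ?big_nu_ge0.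
have mf : measurable_fun setT (fun u : 'rV[R]_d * 'rV[R]_d => f u.1 u.2).
  apply/measurable_EFinP; apply: measurable_funM.
    exact: (measurableT_comp (ps_meas ps) measurable_fst).
  apply: measurable_funM; last exact: (measurableT_comp measurable_big_nu measurable_snd).
  have mx : measurable_fun setT (fun u : 'rV[R]_d * 'rV[R]_d => x - u.1)%R.
    by apply: measurable_rVB => //; exact: measurable_fst.
  apply: measurable_funM => //; apply: measurable_funD; apply: (measurableT_comp (measurable_gauss b)).
    by apply: measurable_rVD => //; exact: measurable_snd.
  by apply: measurable_rVB => //; exact: measurable_snd.
have -> : \int[leb]_y (w y * jump_rate N b (x - y))%:E = \int[leb]_y \int[leb]_z f y z.
  apply: eq_integral => y _; rewrite EFinM jump_rateE ?(ltW b0) //.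
  rewrite integral_big_nu; [|by move=> z; exact: half_sum_ge0|exact: measurable_half_sum].
  rewrite -integralZ_EFin //; first by apply: measurable_funM; [exact: measurable_half_sum|exact: measurable_big_nu].
  by move=> z; rewrite mulr_ge0 ?half_sum_ge0 ?big_nu_ge0.
have mhn : measurable_fun setT (fun z => half_sum_w x z * big_nu z)%R.
  by apply: measurable_funM; [exact: measurable_half_sum_w|exact: measurable_big_nu].
rewrite (tonelli_swap leb leb mf f0).
apply: (@le_trans _ _ (\int[leb]_z (C' * (half_sum_w x z * big_nu z))%:E)); last first.
  rewrite integralZ_EFin ?(ltW C'0) //; last first.
    by move=> z; rewrite mulr_ge0 ?half_sum_w_ge0 ?big_nu_ge0.
  rewrite -integral_big_nu; [|by move=> z; exact: half_sum_w_ge0|exact: measurable_half_sum_w].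
  by rewrite -mulrA EFinM lee_pmul2l.
apply: ge0_le_integral => //.
- by move=> z _; exact: integral_ge0.
- apply: (measurable_tonelli leb (f := fun z y => f y z)) => //.
  exact: (measurableT_comp mf (@measurable_swap _ _ _ _)).
- by apply/measurable_EFinP; exact: measurable_funM.
move=> z _; have nz := big_nu_ge0 z.
have mwg a : measurable_fun setT (fun y => w y * gauss b (a - y))%R.
  by apply: measurable_funM; [exact: (ps_meas ps)|exact: measurable_gauss_sub].
have wg0 a y : (0 <= w y * gauss b (a - y))%R by rewrite mulr_ge0 ?gauss_ge0.
have -> : \int[leb]_y f y z = \int[leb]_y (big_nu z / 2 *
   (w y * gauss b ((x + z) - y) + w y * gauss b ((x - z) - y)))%:E.
  apply: eq_integral => y _; rewrite /f /= /half_sum.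
  rewrite [(x - y + z)%R]addrAC [(x - y - z)%R]addrAC; congr EFin; ring.
rewrite integralZ_EFin //; [|by rewrite divr_ge0|exact: measurable_funD|by move=> y; rewrite addr_ge0].
rewrite integralD_EFin //.
apply: (@le_trans _ _ ((big_nu z / 2)%:E * ((C' * w (x + z))%:E + (C' * w (x - z))%:E))).
  by apply: lee_wpmul2l; [rewrite lee_fin divr_ge0|apply: leeD].
by rewrite -EFinD -!EFinM lee_fin le_eqVlt; apply/orP; left; apply/eqP; rewrite /half_sum_w; ring.
Qed.


Section increments.
Context {disp : measure_display} {Omega : measurableType disp}.
Variable P : probability Omega R.

Definition conv_w x : \bar R := \int[leb]_y (w y * gauss 1 (x - y))%:E.

(** The short-time estimate for [gauss 1] is integrated against [w]. The jump term is bounded by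
    [conv_jump], the Gaussian error by comparability of the convolution with [w], and the error h^2,
    which does not decay, by integrability of [w]. *)
Lemma conv_w_step : exists2 C : R, (0 < C)%R & forall Z h x, (0 < h <= 1)%R ->
  sym_charfun N A P Z h ->
  \int[P]_o conv_w (x + Z o)%R <= (1 + C * h)%:E * conv_w x + (C * h ^+ 2)%:E.
Proof.
have [C1 C10 H1] := conv_jump ltr01.
have [C2 C20 H2] := big_jump_law Nfin Apsd P ltr01.
have [c3 [C3 [c30 C30 H3]]] := ps_conv ps ltr01.
have [c4 [C4 [c40 C40 H4]]] := ps_conv ps (divr_gt0 ltr01 (ltr0n R 2)).
have [I I0 HI] := ps_int ps.
pose K := (C1 + 2 * C2 * C4)%R.
have K0 : (0 < K)%R by rewrite addr_gt0 // !mulr_gt0.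
exists (K / c3 + C2 * I)%R; first by rewrite addr_gt0 ?divr_gt0 ?mulr_gt0.
move=> Z h x hh sZ; have /andP[h0 h1] := hh.
have mZ : measurable_fun setT Z by case: sZ => -[].
have step a : (Rintegral P setT (fun o => gauss 1 (a + Z o)) <=
    gauss 1 a + h * jump_rate N 1 a + h * (2 * C2) * gauss (1 / 2) a + h ^+ 2 * C2)%R.
  have [] := H2 Z h a hh sZ; rewrite !ler_norml => /andP[_ e1] /andP[_ e2].
  have -> : (h ^+ 2 * C2 = h * (C2 * h))%R by ring.
  rewrite -[(h * (2 * C2) * _)%R]mulrA.
  move: e1 e2; rewrite mulrDr mulrDr; lra.
pose f o y := (w y * gauss 1 (x + Z o - y))%:E.
have f0 o y : 0 <= f o y by rewrite lee_fin mulr_ge0 ?gauss_ge0.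
have mf : measurable_fun setT (fun u : Omega * 'rV[R]_d => f u.1 u.2).
  apply/measurable_EFinP; apply: measurable_funM.
    exact: (measurableT_comp (ps_meas ps) measurable_snd).
  apply: (measurableT_comp (measurable_gauss 1)); apply: measurable_rVB; last exact: measurable_snd.
  by apply: measurable_rVD => //; exact: (measurableT_comp mZ measurable_fst).
rewrite (tonelli_swap P leb mf f0).
have mj : measurable_fun setT (fun y => jump_rate N 1 (x - y)).
  apply: (measurableT_comp (measurable_jump_rate ler01)).
  by apply: measurable_rVB => //; exact: measurable_id.
have mg b : measurable_fun setT (fun y => gauss b (x - y)) by exact: measurable_gauss_sub.
have mw := ps_meas ps.
have j0 y : (0 <= jump_rate N 1 (x - y))%R by exact: jump_rate_ge0.
apply: (@le_trans _ _ (\int[leb]_y ((w y * gauss 1 (x - y) + h * (w y * jump_rate N 1 (x - y))) +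
    (h * (2 * C2) * (w y * gauss (1 / 2) (x - y)) + h ^+ 2 * C2 * w y))%:E)).
  apply: ge0_le_integral => //.
  - by move=> y _; exact: integral_ge0.
  - apply: (measurable_tonelli P (f := fun y o => f o y)) => //.
    exact: (measurableT_comp mf (@measurable_swap _ _ _ _)).
  - apply/measurable_EFinP; apply: measurable_funD; apply: measurable_funD => //;
      by do ?[apply: measurable_funM => //].
  move=> y _.
  have -> : \int[P]_o f o y = (w y)%:E * (Rintegral P setT (fun o => gauss 1 ((x - y) + Z o)))%:E.
    have mgZ : measurable_fun setT (fun o => gauss 1 ((x - y) + Z o)).
      by apply: (measurableT_comp (measurable_gauss 1)); exact: measurable_rVD.
    rewrite fineK; last first.
      apply: (integrable_fin_num measurableT).
      apply: (@probability_integrable_bounded _ _ _ P _ 1%R mgZ) => o.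
      exact: normr_gauss_le1.
    transitivity (\int[P]_o (w y * gauss 1 ((x - y) + Z o))%:E).
      by apply: eq_integral => o _; rewrite /f addrAC.
    by apply: integralZ_EFin => // o; exact: gauss_ge0.
  rewrite -EFinM lee_fin; apply: (le_trans (ler_wpM2l (w0 y) (step _))).
  rewrite le_eqVlt; apply/orP; left; apply/eqP; ring.
have h0' := ltW h0; have hC : (0 <= h * (2 * C2))%R by rewrite !mulr_ge0 // ltW.
have hC' : (0 <= h ^+ 2 * C2)%R by rewrite !mulr_ge0 ?exprn_ge0 // ltW.
have g0 b y : (0 <= w y * gauss b (x - y))%R by rewrite mulr_ge0 ?gauss_ge0.
have wj y : (0 <= w y * jump_rate N 1 (x - y))%R by rewrite mulr_ge0.
have mwg b : measurable_fun setT (fun y => w y * gauss b (x - y))%R by exact: measurable_funM.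
have mwj : measurable_fun setT (fun y => w y * jump_rate N 1 (x - y))%R by exact: measurable_funM.
rewrite integralD_EFin //; [|by apply: measurable_funD => //; exact: measurable_funM
  |by move=> y; rewrite addr_ge0 // mulr_ge0
  |by apply: measurable_funD; exact: measurable_funM
  |by move=> y; rewrite addr_ge0 // mulr_ge0].
rewrite integralD_EFin //; [|exact: measurable_funM|by move=> y; rewrite mulr_ge0].
rewrite integralD_EFin //; [|exact: measurable_funM|by move=> y; rewrite mulr_ge0
  |exact: measurable_funM|by move=> y; rewrite mulr_ge0].
rewrite !integralZ_EFin //.
rewrite -/(conv_w x).
have cE : conv_w x \is a fin_num.
  rewrite ge0_fin_numE; last by apply: integral_ge0 => y _; rewrite lee_fin.
  by have /andP[_ H] := H3 x; apply: (le_lt_trans H); exact: ltry.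
have c3w : (w x <= fine (conv_w x) / c3)%R.
  rewrite ler_pdivlMr // mulrC -lee_fin fineK //.
  by have /andP[H _] := H3 x.
have G4 : \int[leb]_y (w y * gauss (1 / 2) (x - y))%:E <= (C4 * w x)%:E by have /andP[] := H4 x.
apply: (@le_trans _ _ ((conv_w x + h%:E * (C1 * w x)%:E) +
    ((h * (2 * C2))%:E * (C4 * w x)%:E + (h ^+ 2 * C2)%:E * I%:E))).
  apply: leeD; first by apply: leeD => //; apply: lee_wpmul2l.
  by apply: leeD; apply: lee_wpmul2l.
rewrite -(fineK cE) -!EFinM -!EFinD lee_fin.
have e : (h * (K * w x) <= h * (K * (fine (conv_w x) / c3)))%R.
  by rewrite ler_pM2l // ler_pM2l.
set F := fine _ in e *.
have F0 : (0 <= F)%R by apply: fine_ge0; apply: integral_ge0 => y _; rewrite lee_fin.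
have p1 : (0 <= C2 * I * h * F)%R by rewrite !mulr_ge0 // ltW.
have p2 : (0 <= K / c3 * h ^+ 2)%R by rewrite mulr_ge0 ?divr_ge0 ?exprn_ge0 // ltW.
have -> : (F + h * (C1 * w x) + (h * (2 * C2) * (C4 * w x) + h ^+ 2 * C2 * I) =
   F + h * (K * w x) + h ^+ 2 * C2 * I)%R by rewrite /K; ring.
have -> : ((1 + (K / c3 + C2 * I) * h) * F + (K / c3 + C2 * I) * h ^+ 2 =
  F + h * (K * (F / c3)) + C2 * I * h * F + (K / c3 * h ^+ 2) + h ^+ 2 * C2 * I)%R by ring.
lra.
Qed.

(** A single large jump brings the process back. The indicator of the ball is bounded below by gauss
    1 - e gauss (1 / 2) with [e] small for a large radius, and this difference has intensity at
    least c w(y). *)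
Lemma return_prob_ge : exists c C r0 : R, [/\ (0 < c)%R, (0 < C)%R & forall Z h y r,
  (r0 <= r)%R -> (r <= enorm y)%R -> (0 < h <= 1)%R -> sym_charfun N A P Z h ->
  ((h * (c * w y - C * h))%R%:E <= P [set o | eball 0%R r (y + Z o)%R])%E].
Proof.
Local Open Scope ring_scope.
have [c1 [r1 [c10 r10 H1]]] := jump_rate_ge ltr01.
have h2 : 0 < 1 / 2 :> R by rewrite divr_gt0.
have [C2 C20 H2] := jump_rate_le h2.
have [C3 C30 H3] := big_jump_law Nfin Apsd P ltr01.
have [C4 C40 H4] := big_jump_law Nfin Apsd P h2.
have h4 : 0 < 1 / 2 / 2 :> R by rewrite !divr_gt0.
have [C5 C50 H5] := ps_gauss ps h4.
pose K := C3 * C5 + C2 + C4 * C5.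
have K0 : 0 < K by rewrite !addr_gt0 // mulr_gt0.
(* This size gives e K <= c1 / 2 through exp(r^2 / 4) > r / 4 >= 2 K / c1. *)
pose r0 := Num.max r1 (8 * K / c1 + 1).
exists (c1 / 2), (C3 + C4), r0; split; [exact: divr_gt0|exact: addr_gt0|].
move=> Z h y r r0r ry hh sZ; have /andP[h0 h1] := hh.
have mZ : measurable_fun setT Z by case: sZ => -[].
have r1r : r1 <= r by apply: le_trans r0r; rewrite le_max lexx.
have r2r : 8 * K / c1 + 1 <= r by apply: le_trans r0r; rewrite le_max lexx orbT.
have q0 : 0 <= 8 * K / c1 by rewrite divr_ge0 ?mulr_ge0 // ltW.
have r00 : 0 < r by lra.
(* One factor serves twice: it dominates [gauss (1 / 2)] off the ball, which is at most exp(- r^2 /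
   2), and it is the bound of one of the two factors of gauss (1 / 2) y, the other being at most C5
   w(y). *)
pose e := expR (- (r ^+ 2 / 4)).
have e0 : 0 < e by exact: expR_gt0.
have eK : e * K <= c1 / 2.
  have : 1 + r ^+ 2 / 4 <= expR (r ^+ 2 / 4) by exact: expR_ge1Dx.
  have ee : expR (r ^+ 2 / 4) * e = 1 by exact: expRxMexpNx_1.
  have rr : r <= r ^+ 2 by rewrite expr2 ler_peMr ?(ltW r00) //; lra.
  have : 8 * K <= c1 * r.
    have : 8 * K / c1 <= r by lra.
    by rewrite ler_pdivrMr // mulrC [r * _]mulrC.
  move=> Kr er.
  have h3 : 2 * K <= c1 * expR (r ^+ 2 / 4).
    have : c1 * (r / 4) <= c1 * expR (r ^+ 2 / 4) by rewrite ler_pM2l //; lra.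
    lra.
  have := ler_wpM2r (ltW e0) h3; rewrite -[c1 * _ * e]mulrA ee; lra.
have e2e : expR (- (r ^+ 2 / 2)) <= e by rewrite ler_expR; have := sqr_ge0 r; lra.
have w0' := w0 y.
pose B : set Omega := [set o | eball 0 r (y + Z o)].
have mB : measurable B.
  rewrite -[X in measurable X]setTI.
  apply: (measurable_rVD (measurable_cst y) mZ) => //; exact: measurable_eball.
have PBE : P B = (Rintegral P setT (\1_B : Omega -> R))%:E.
  rewrite /Rintegral integral_indic // setIT fineK //.
  by rewrite ge0_fin_numE // (le_lt_trans (probability_le1 P mB)) // ltry.
rewrite PBE lee_fin.
pose E b := Rintegral P setT (fun o => \1_bigjump (Z o) * gauss b (y + Z o)).
have mI : measurable_fun setT (\1_bigjump : 'rV[R]_d -> R) by apply: measurable_indic.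
have iE b : 0 <= b -> P.-integrable setT (EFin \o (fun o => \1_bigjump (Z o) * gauss b (y + Z o))).
  move=> b0; apply: (bounded_integrable P (f := fun z => \1_bigjump z * gauss b (y + z)) (M := 1)) => //.
    by apply: measurable_funM => //; exact: measurable_gauss_add.
  move=> z; rewrite normrM indicE; case: (_ \in _) => /=.
    by rewrite normr1 mul1r normr_gauss_le1.
  by rewrite normr0 mul0r.
have iB : P.-integrable setT (EFin \o (\1_B : Omega -> R)).
  apply: (@probability_integrable_bounded _ _ _ _ _ 1) => //.
  by move=> o; rewrite indicE; case: (_ \in _); rewrite ?normr1 ?normr0.
have split : E 1 <= Rintegral P setT (\1_B : Omega -> R) + e * E (1 / 2).
  rewrite -RintegralZl //; last by apply: iE; lra.
  have iZ : P.-integrable setT (EFin \o (fun o => e * (\1_bigjump (Z o) * gauss (1 / 2) (y + Z o)))).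
    have := integrableZl measurableT e (iE (1 / 2) (ltW h2)); exact: eq_integrable.
  rewrite -RintegralD //; apply: le_Rintegral => //.
  - exact: iE.
  - by have := integrableD measurableT iB iZ; exact: eq_integrable.
  move=> o _; rewrite !indicE; set u := y + Z o.
  have g1 := gauss_le1 u (@ler01 R); have g0 := gauss_ge0 (1 / 2) u; have g0' := gauss_ge0 1 u.
  have GE : gauss 1 u = gauss (1 / 2) u * gauss (1 / 2) u by exact: gauss_half2.
  have GD : gauss (1 / 2) u = expR (- (1 / 2 * dotr u u)) by [].
  set G := gauss (1 / 2) u in g0 GE GD *.
  have [/set_mem ub|ub] := boolP (o \in B).
    case: (_ \in _); rewrite /= ?mul1r ?mul0r ?mulr0 ?addr0 //.
    by apply: (le_trans g1); rewrite lerDl mulr_ge0 // ltW.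
  rewrite add0r; case: (_ \in _); rewrite /= ?mul1r ?mul0r ?mulr0 //.
  have ru : r <= enorm u.
    rewrite leNgt; apply/negP => ur; move/negP: ub; apply; apply/mem_set.
    by rewrite /B /eball /= subr0.
  rewrite GE ler_wpM2r //; apply: le_trans e2e.
  rewrite GD ler_expR lerN2 -sqr_enorm.
  have re : r ^+ 2 <= enorm u ^+ 2 by rewrite ler_sqr ?nnegrE ?enorm_ge0 // ltW.
  by rewrite [leLHS]mulrC div1r ler_pM2l ?invr_gt0.
have [H3' _] := H3 Z h y hh sZ; have [H4' _] := H4 Z h y hh sZ.
have J1 : c1 * w y <= jump_rate N 1 y by apply: H1; exact: le_trans ry.
have J2 := H2 y.
have G4 := H5 y.
have G2 : gauss (1 / 2) y <= e * (C5 * w y).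
  rewrite gauss_half2; apply: ler_pM => //; [exact: gauss_ge0|exact: gauss_ge0|].
  rewrite /gauss ler_expR lerN2 -sqr_enorm.
  have re : r ^+ 2 <= enorm y ^+ 2 by rewrite ler_sqr ?nnegrE ?enorm_ge0 // ltW.
  have -> : 1 / 2 / 2 = 4^-1 :> R by field.
  by rewrite [leLHS]mulrC ler_pM2l ?invr_gt0.
have e1 : e <= 1 by rewrite -[leRHS]expR0 ler_expR oppr_le0 divr_ge0 ?sqr_ge0.
exact: (return_arith h0 C30 C40 (ltW e0) e1 w0' H3' H4' J1 J2 G4 G2 split eK).
Qed.

End increments.

End profile_law.

(** * Occupation integrals *)

Section lebesgue_shift.
Context {R : realType}.
Local Open Scope ereal_scope.
Notation leb1 := (@lebesgue_measure R).

Definition shift_by (c : R) : measurableTypeR R -> measurableTypeR R := fun s => (s - c)%R.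

Lemma measurable_shift_by (c : R) : measurable_fun setT (shift_by c).
Proof. by apply: measurable_funB. Qed.

Lemma shift_by_itv (c a b : R) :
  shift_by c @^-1` `]a, b]%classic = `](a + c)%R, (b + c)%R]%classic.
Proof.
by apply/seteqP; split => s; rewrite /shift_by /= !in_itv /= ltrBrDr lerBlDr.
Qed.

Lemma lebesgue_shift (c : R) (E : set R) : measurable E ->
  leb1 E = pushforward leb1 (shift_by c) E.
Proof.
move=> mE; apply: lebesgue_measure_unique => //=; first exact: measurable_shift_by.
move=> ms _ [[a b] _ <-].
rewrite /= /pushforward shift_by_itv !lebesgue_measure_itv /= !lte_fin ltrD2r.
by case: ifP => // _; rewrite -!EFinD; congr EFin; ring.
Qed.

Lemma integral_shift (f : R -> \bar R) (c a b : R) : measurable_fun setT f ->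
  (forall s, 0 <= f s) ->
  \int[leb1]_(s in `](a + c)%R, (b + c)%R]) f (s - c)%R = \int[leb1]_(s in `]a, b]) f s.
Proof.
move=> mf f0.
transitivity (\int[pushforward leb1 (shift_by c)]_(s in `]a, b]) f s).
  rewrite ge0_integral_pushforward ?shift_by_itv //; first exact: measurable_shift_by.
  by apply: measurable_funTS.
apply/esym/eq_measure_integral; first exact: measurable_shift_by.
by move=> ms A mA _; exact: lebesgue_shift.
Qed.

End lebesgue_shift.

Lemma measurable_expeR (R : realType) : measurable_fun setT (@expeR R).
Proof.
have -> : @expeR R = fun x => if x == +oo%E then +oo%E else
    if x == -oo%E then 0%E else (expR (fine x))%:E.
  by apply/funext => -[].
have ms (c : \bar R) : measurable_fun setT (fun x : \bar R => x == c).
  apply: (measurable_fun_bool true); rewrite setTI.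
  have -> : (fun x : \bar R => x == c) @^-1` [set true] = [set c].
    apply/seteqP; split => x /= H; first exact/eqP.
    by rewrite H eqxx.
  exact: emeasurable_set1.
apply: measurable_fun_ifT => //; apply: measurable_fun_ifT => //.
apply/measurable_EFinP; apply: measurableT_comp => //; exact: measurable_fine.
Qed.

Section occupation.
Context {R : realType} {d : nat}.
Implicit Types (x y : 'rV[R]_d) (p q : cpath R d) (s t : R) (g : 'rV[R]_d -> R).
Local Open Scope ereal_scope.
Notation leb1 := (@lebesgue_measure R).

Definition occ g x t p : \bar R := \int[leb1]_(s in `[0%R, t]) (g (x + p s)%R)%:E.

Lemma measurable_eval_fun t : (0 <= t)%R ->
  measurable_fun setT (fun u : 'rV[R]_d * cpath R d => u.1 + u.2 t)%R.
Proof.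
move=> t0; apply: measurable_rVD; first exact: measurable_fst.
exact: (measurableT_comp (measurable_eval t0) measurable_snd).
Qed.

Lemma occE g x t p : occ g x t p = \int[leb1]_(s in `[0%R, t]) (g (x + p (Num.max 0 s))%R)%:E.
Proof.
by apply: eq_integral => s /set_mem; rewrite /= in_itv /= => /andP[s0 _]; rewrite max_r.
Qed.

Section nonneg.
Variable g : 'rV[R]_d -> R.
Hypotheses (mg : measurable_fun setT g) (g0 : forall x, (0 <= g x)%R).

Lemma occ_ge0 x t p : 0 <= occ g x t p.
Proof. by apply: integral_ge0 => s _; rewrite lee_fin. Qed.

Lemma measurable_along x p : measurable_fun setT (fun s => (g (x + p (Num.max 0 s))%R)%:E).
Proof.
apply/measurable_EFinP; apply: (measurableT_comp mg); apply: measurable_rVD => //.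
have h : measurable_fun setT (fun s : R => (s, p)) by exact: pair2_measurable.
exact: (measurableT_comp measurable_cpath_joint h).
Qed.

Lemma measurable_occ t : measurable_fun setT (fun u : 'rV[R]_d * cpath R d => occ g u.1 t u.2).
Proof.
pose f (u : 'rV[R]_d * cpath R d) (s : R) :=
  (\1_(`[0%R, t]%classic : set R) s * g (u.1 + u.2 (Num.max 0 s)))%:E.
have -> : (fun u : 'rV[R]_d * cpath R d => occ g u.1 t u.2) = fun u => \int[leb1]_s f u s.
  apply/funext => u; rewrite occE [LHS]integral_mkcond; apply: eq_integral => s _.
  rewrite patchE /f indicE; case: (_ \in _); first by rewrite mul1r.
  by rewrite mul0r.
apply: (measurable_tonelli leb1 (f := f)); last first.
  by move=> u s; rewrite lee_fin mulr_ge0.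
apply/measurable_EFinP; apply: measurable_funM.
  apply: (measurableT_comp _ measurable_snd).
  exact: measurable_indic.
apply: (measurableT_comp mg); apply: measurable_rVD.
  exact: (measurableT_comp measurable_fst measurable_fst).
pose sw (v : ('rV[R]_d * cpath R d) * R) := (v.2, v.1.2).
have msw : measurable_fun setT sw.
  apply/measurable_fun_pairP; split; first exact: measurable_snd.
  exact: (measurableT_comp measurable_snd measurable_fst).
exact: (measurableT_comp measurable_cpath_joint msw).
Qed.

Lemma measurable_occ_path x t : measurable_fun setT (occ g x t).
Proof. exact: (measurableT_comp (measurable_occ t) (pair1_measurable x)). Qed.

Lemma occ0 x p : occ g x 0 p = 0.
Proof. by rewrite /occ set_itv1 integral_set1. Qed.

Lemma occ_le x s t p : (s <= t)%R -> occ g x s p <= occ g x t p.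
Proof.
move=> st; rewrite !occE; apply: ge0_subset_integral => //.
- by apply: measurable_funTS; exact: measurable_along.
- by move=> u _; rewrite lee_fin.
- by move=> u; rewrite /= !in_itv /= => /andP[-> us]; exact: le_trans st.
Qed.

Lemma occ_cat x s t p q : (0 <= s)%R -> (0 <= t)%R ->
  occ g x (s + t) (cat_path s p q) = occ g x s p + occ g (x + p s) t q.
Proof.
move=> s0 t0.
have e : `[0%R, (s + t)%R]%classic = `[0%R, s]%classic `|` `]s, (s + t)%R]%classic :> set R.
  apply/seteqP; split => u /=; rewrite !in_itv /=.
    by move=> /andP[u0 ut]; case: (leP u s) => us; [left; rewrite u0|right].
  move=> [/andP[-> us]|/andP[su ->]] /=; first by apply: (le_trans us); rewrite lerDl.
  by rewrite andbT (le_trans s0) // ltW.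
rewrite occE e ge0_integral_setU //; last 3 first.
- by apply: measurable_funTS; exact: measurable_along.
- by move=> u _; rewrite lee_fin.
- apply/disj_setPS => u [/=]; rewrite !in_itv /= => /andP[_ us] /andP[su _].
  by have := lt_le_trans su us; rewrite ltxx.
congr (_ + _).
  apply: eq_integral => u /set_mem uI.
  have /andP[u0 us] : (0 <= u <= s)%R by move: uI; rewrite /= in_itv.
  have -> : Num.max 0%R u = u by exact: max_r.
  by rewrite cat_pathl.
transitivity (\int[leb1]_(u in `](0 + s)%R, (t + s)%R])
    (g (x + p s + q (Num.max 0 (u - s)))%R)%:E).
  rewrite add0r [(t + s)%R]addrC; apply: eq_integral => u /set_mem uI.
  have /andP[su ut] : (s < u <= s + t)%R by move: uI; rewrite /= in_itv.
  have u0 : (0 <= u - s)%R by rewrite subr_ge0 ltW.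
  have u0' : (0 <= u)%R by rewrite (le_trans s0) // ltW.
  have -> : Num.max 0%R u = u by exact: max_r.
  have -> : Num.max 0%R (u - s)%R = (u - s)%R by exact: max_r.
  by rewrite -{1}[u](subrK s) [(u - s + s)%R]addrC cat_pathr // addrA.
rewrite (integral_shift (f := fun u => (g (x + p s + q (Num.max 0 u))%R)%:E)); last 2 first.
- exact: measurable_along.
- by move=> u; rewrite lee_fin.
rewrite integral_itv_obnd_cbnd; first by rewrite occE.
by apply: measurable_funTS; exact: measurable_along.
Qed.

Lemma occZ (c : R) x t p : (0 <= c)%R -> occ (fun y => c * g y)%R x t p = c%:E * occ g x t p.
Proof.
move=> c0; rewrite !occE -ge0_integralZl //.
- by apply: measurable_funTS; exact: measurable_along.
- by move=> s _; rewrite lee_fin.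
Qed.

Lemma occ_le_bound (m : R) x t p : (0 <= t)%R -> (forall y, g y <= m)%R ->
  occ g x t p <= (m * t)%:E.
Proof.
move=> t0 gm; rewrite occE.
have m0 : (0 <= m)%R by apply: le_trans (gm 0%R).
apply: (@le_trans _ _ (\int[leb1]_(s in `[0%R, t]) (cst m%:E s))).
  apply: ge0_le_integral => //.
  - by move=> s _; rewrite lee_fin.
  - by apply: measurable_funTS; exact: measurable_along.
  - by move=> s _; rewrite lee_fin.
rewrite integral_cst //= lebesgue_measure_itv /= lte_fin.
case: ltP => [_|t0']; first by rewrite -EFinD subr0 -EFinM.
by rewrite mule0 lee_fin mulr_ge0.
Qed.

End nonneg.

Lemma le_occ g g' x t p : measurable_fun setT g -> measurable_fun setT g' ->
  (forall y, 0 <= g y)%R -> (forall y, g y <= g' y)%R -> occ g x t p <= occ g' x t p.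
Proof.
move=> mg mg' g0 gg'; rewrite !occE; apply: ge0_le_integral => //.
- by move=> s _; rewrite lee_fin.
- by apply: measurable_funTS; exact: measurable_along.
- by apply: measurable_funTS; exact: measurable_along.
- by move=> s _; rewrite lee_fin.
Qed.

Lemma occD g g' x t p : measurable_fun setT g -> measurable_fun setT g' ->
  (forall y, 0 <= g y)%R -> (forall y, 0 <= g' y)%R ->
  occ (fun y => g y + g' y)%R x t p = occ g x t p + occ g' x t p.
Proof.
move=> mg mg' g0 g0'; rewrite !occE -ge0_integralD //.
- by move=> s _; rewrite lee_fin.
- by apply: measurable_funTS; exact: measurable_along.
- by move=> s _; rewrite lee_fin.
- by apply: measurable_funTS; exact: measurable_along.
Qed.

End occupation.

Section transition.
Context {R : realType} {d : nat}.
Variable PP : probability (cpath R d) R.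
Hypothesis HPP : levy_law PP.
Implicit Types (x y : 'rV[R]_d) (p q : cpath R d) (s t : R).
Local Open Scope ereal_scope.

Lemma measurable_value (Phi : 'rV[R]_d -> cpath R d -> \bar R) :
  measurable_fun setT (fun u : 'rV[R]_d * cpath R d => Phi u.1 u.2) ->
  (forall x p, 0 <= Phi x p) ->
  measurable_fun setT (fun x => \int[PP]_p Phi x p).
Proof. exact: measurable_tonelli. Qed.

Lemma measurable_value_at s (f : 'rV[R]_d -> \bar R) : (0 <= s)%R ->
  measurable_fun setT f ->
  measurable_fun setT (fun u : 'rV[R]_d * cpath R d => f (u.1 + u.2 s)%R).
Proof. by move=> s0 mf; exact: (measurableT_comp mf (measurable_eval_fun s0)). Qed.

Lemma measurable_value_at_path s (f : 'rV[R]_d -> \bar R) x : (0 <= s)%R ->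
  measurable_fun setT f -> measurable_fun setT (fun p : cpath R d => f (x + p s)%R).
Proof.
by move=> s0 mf; exact: (measurableT_comp (measurable_value_at s0 mf) (pair1_measurable x)).
Qed.

End transition.

Section sup_limits.
Context {R : realType}.
Local Open Scope ereal_scope.

Lemma le_integral_sup dT (T : measurableType dT) (mu : {measure set T -> \bar R}) (D : set T)
    (f_ : nat -> T -> \bar R) (f : T -> \bar R) (c : \bar R) : measurable D ->
  (forall n, measurable_fun D (f_ n)) -> (forall n x, 0 <= f_ n x) ->
  (forall x n m, (n <= m)%N -> f_ n x <= f_ m x) ->
  measurable_fun D f -> (forall x, 0 <= f x) ->
  (forall x, D x -> f x <= ereal_sup (range (f_^~ x))) ->
  (forall n, \int[mu]_(x in D) f_ n x <= c) -> \int[mu]_(x in D) f x <= c.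
Proof.
move=> mD mf_ f_0 nd mf f0 fs fc.
have ndh x : {homo f_^~ x : n m / (n <= m)%N >-> n <= m} by move=> n m; exact: nd.
have limE x : limn (f_^~ x) = ereal_sup (range (f_^~ x)).
  by apply: cvg_lim => //; exact: ereal_nondecreasing_cvgn.
have mlim : measurable_fun D (fun x => limn (f_^~ x)).
  apply: (emeasurable_fun_cvg f_) => // x Dx.
  by rewrite limE; exact: ereal_nondecreasing_cvgn.
apply: (@le_trans _ _ (\int[mu]_(x in D) limn (f_^~ x))).
  apply: ge0_le_integral => // x Dx; rewrite limE; exact: fs.
rewrite monotone_convergence //; apply: lime_le; last exact: nearW.
apply/cvg_ex; eexists; apply: ereal_nondecreasing_cvgn => n m nm.
by apply: ge0_le_integral => // x Dx; exact: nd.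
Qed.

(** Continuity of the exponential from below, through its inverse [lne]; the value +oo is
    covered. *)
Lemma le_expeR_sup (a_ : nat -> \bar R) (a : \bar R) :
  a <= ereal_sup (range a_) -> expeR a <= ereal_sup (range (fun n => expeR (a_ n))).
Proof.
move=> aS; set S := ereal_sup (range (fun n => expeR (a_ n))).
have le n : expeR (a_ n) <= S by apply: ereal_sup_ubound; exists n.
have S0 : 0 <= S by apply: le_trans (le 0%N); exact: expeR_ge0.
have SK : expeR (lne S) = S by apply: lneK; rewrite in_itv /= S0 leey.
rewrite -SK lee_expeR (le_trans aS) //; apply: ge_ereal_sup => _ [n _ <-].
by rewrite -lee_expeR SK.
Qed.

End sup_limits.

Lemma integral_prob_cst {R : realType} dT (T : measurableType dT) (P : probability T R)
  (c : \bar R) : (\int[P]_x c = c)%E.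
Proof.
transitivity (c * P setT)%E; first by rewrite integral_cst.
by rewrite probability_setT mule1.
Qed.

(** * Growth of expectations and Khasminskii's lemma *)

Section markov_values.
Context {R : realType} {d : nat}.
Variable PP : probability (cpath R d) R.
Hypothesis HPP : levy_law PP.
Implicit Types (x y : 'rV[R]_d) (p q : cpath R d) (s t : R).
Local Open Scope ereal_scope.

Lemma markov_at s t (f : 'rV[R]_d -> \bar R) x : (0 < s)%R -> (0 <= t)%R ->
  measurable_fun setT f -> (forall y, 0 <= f y) ->
  \int[PP]_p f (x + p (s + t))%R = \int[PP]_p \int[PP]_q f (x + p s + q t)%R.
Proof.
move=> s0 t0 mf f0.
have mJ : measurable_fun setT (fun p : cpath R d => f (x + p (s + t)%R)%R).
  by apply: measurable_value_at_path => //; rewrite addr_ge0 // ltW.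
rewrite (markov HPP s0 mJ (fun p => f0 _)).
apply: eq_integral => p _; apply: eq_integral => q _.
by rewrite cat_pathr ?(ltW s0) // addrA.
Qed.

Lemma integral_path_cst (c : R) : \int[PP]_p c%:E = c%:E.
Proof. exact: integral_prob_cst. Qed.

Lemma integral_affine (a b : R) (f : cpath R d -> \bar R) : (0 <= a)%R -> (0 <= b)%R ->
  measurable_fun setT f -> (forall p, 0 <= f p) ->
  \int[PP]_p (a%:E * f p + b%:E) = a%:E * \int[PP]_p f p + b%:E.
Proof.
move=> a0 b0 mf f0; rewrite ge0_integralD //.
- by rewrite ge0_integralZl // integral_path_cst.
- by move=> p _; rewrite mule_ge0.
- exact: measurable_funeM.
Qed.

Lemma affine_steps (F : 'rV[R]_d -> \bar R) C : measurable_fun setT F ->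
  (forall x, 0 <= F x) -> (forall x, F x \is a fin_num) -> (0 < C)%R ->
  (forall h x, (0 < h <= 1)%R ->
    \int[PP]_p F (x + p h)%R <= (1 + C * h)%:E * F x + (C * h ^+ 2)%:E) ->
  forall h k x, (0 < h <= 1)%R -> \int[PP]_p F (x + p (k%:R * h))%R <=
    ((1 + C * h) ^+ k)%:E * F x + (C * h ^+ 2 * k%:R * (1 + C * h) ^+ k)%:E.
Proof.
move=> mF F0 Ffin C0 HC h k x hh; have /andP[h0 h1] := hh; have h0' := ltW h0.
have c1 : (1 <= 1 + C * h)%R by rewrite lerDl mulr_ge0 // ltW.
have c0 : (0 <= 1 + C * h)%R by apply: le_trans c1.
elim: k x => [|k IH] x.
  rewrite mulr0 !mul0r expr0 mul1e adde0; under eq_integral do rewrite cpath0 addr0.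
  by rewrite -(fineK (Ffin x)) integral_path_cst.
have -> : (k.+1%:R * h = h + k%:R * h)%R by rewrite -natr1 mulrDl mul1r addrC.
rewrite markov_at ?mulr_ge0 //.
apply: (@le_trans _ _ (\int[PP]_p (((1 + C * h) ^+ k)%:E * F (x + p h)%R +
    (C * h ^+ 2 * k%:R * (1 + C * h) ^+ k)%:E))).
  apply: ge0_le_integral => //.
  - by move=> p _; exact: integral_ge0.
  - pose f y := \int[PP]_q F (y + q (k%:R * h))%R.
    apply: (measurable_value_at_path (f := f)) => //.
    apply: (measurable_value PP (Phi := fun y q => F (y + q (k%:R * h))%R)) => //.
    by apply: measurable_value_at => //; rewrite mulr_ge0.
  - apply: emeasurable_funD => //; apply: measurable_funeM.
    exact: measurable_value_at_path.
rewrite integral_affine ?exprn_ge0 //; last 2 first.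
- by rewrite !mulr_ge0 ?exprn_ge0 // ltW.
- exact: measurable_value_at_path.
have H := HC h x hh.
apply: (@le_trans _ _ (((1 + C * h) ^+ k)%:E * ((1 + C * h)%:E * F x + (C * h ^+ 2)%:E) +
    (C * h ^+ 2 * k%:R * (1 + C * h) ^+ k)%:E)).
  by rewrite leeD2r // lee_wpmul2l // lee_fin exprn_ge0.
rewrite ge0_muleDr ?mule_ge0 ?lee_fin ?mulr_ge0 ?exprn_ge0 //; last exact: ltW.
rewrite muleA -EFinM -exprSr -addeA -EFinM -EFinD leeD2l // lee_fin [((1 + C * h) ^+ k.+1)%R]exprSr -natr1.
set a := ((1 + C * h) ^+ k)%R; have a0 : (0 <= a)%R by rewrite exprn_ge0.
have e1 : (C * h ^+ 2 * (k%:R + 1) * (a * (1 + C * h)) =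
  a * (C * h ^+ 2) + C * h ^+ 2 * k%:R * a + (C * h) * (C * h ^+ 2 * (k%:R + 1) * a))%R by ring.
have C0' := ltW C0; rewrite e1 lerDl; apply: mulr_ge0; first exact: mulr_ge0.
apply: mulr_ge0 => //; apply: mulr_ge0; last exact: addr_ge0.
by apply: mulr_ge0 => //; exact: exprn_ge0.
Qed.

(** A discrete Gronwall argument with [n] steps of length t / n: the local errors C h^2 accumulate
    to at most C t^2 exp(C t) / n, which vanishes. *)
Lemma affine_growth (F : 'rV[R]_d -> \bar R) C : measurable_fun setT F ->
  (forall x, 0 <= F x) -> (forall x, F x \is a fin_num) -> (0 < C)%R ->
  (forall h x, (0 < h <= 1)%R ->
    \int[PP]_p F (x + p h)%R <= (1 + C * h)%:E * F x + (C * h ^+ 2)%:E) ->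
  forall t x, (0 <= t)%R -> \int[PP]_p F (x + p t)%R <= (expR (C * t))%:E * F x.
Proof.
move=> mF F0 Ffin C0 HC t x t0; have HS := affine_steps mF F0 Ffin C0 HC.
apply/lee_addgt0Pr => e e0.
have q0 : (0 <= C * t ^+ 2 * expR (C * t) / e)%R.
  by rewrite divr_ge0 ?mulr_ge0 ?exprn_ge0 ?expR_ge0 // ltW.
have [->|t0'] := eqVneq t 0%R.
  under eq_integral do rewrite cpath0 addr0.
  rewrite mulr0 expR0 mul1e.
  by rewrite -(fineK (Ffin x)) integral_path_cst -EFinD lee_fin lerDl ltW.
have tp : (0 < t)%R by rewrite lt_neqAle eq_sym t0'.
(* The first term makes the step at most 1, the second makes the accumulated error at most [e]. *)
pose n := (Num.truncn (t + C * t ^+ 2 * expR (C * t) / e)).+1.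
have nn : (t + C * t ^+ 2 * expR (C * t) / e < n%:R)%R.
  by have /andP[] := truncn_itv (addr_ge0 t0 q0).
have n0 : (0 < n%:R :> R)%R by rewrite ltr0n.
pose h := (t / n%:R)%R.
have hh : (0 < h <= 1)%R.
  rewrite divr_gt0 //= ler_pdivrMr // mul1r; apply/ltW/le_lt_trans/nn.
  by rewrite lerDl.
have nh : (n%:R * h = t)%R by rewrite /h mulrC divfK // gt_eqF.
have := HS h n x hh; rewrite nh => /le_trans; apply.
have eb : ((1 + C * h) ^+ n <= expR (C * t))%R.
  have -> : (C * t = n%:R * (C * h))%R by rewrite mulrCA nh.
  rewrite expRM_natl lerXn2r ?nnegrE ?expR_ge0 ?expR_ge1Dx //.
  by rewrite addr_ge0 ?mulr_ge0 // ltW // (andP hh).1.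
apply: leeD; first by apply: lee_wpmul2r => //; rewrite lee_fin.
rewrite lee_fin.
have -> : (C * h ^+ 2 * n%:R = C * t ^+ 2 / n%:R)%R.
  apply: (canRL (mulfK _)); first by rewrite gt_eqF.
  by rewrite -nh; ring.
apply: (@le_trans _ _ (C * t ^+ 2 / n%:R * expR (C * t))%R).
  by apply: ler_wpM2l => //; rewrite divr_ge0 ?mulr_ge0 ?exprn_ge0 // ltW.
rewrite mulrAC ler_pdivrMr // [leRHS]mulrC -ler_pdivrMr //; apply/ltW/le_lt_trans/nn.
by rewrite lerDr.
Qed.

Section heat.
Variables (nu : 'rV[R]_d -> R) (N : {measure set 'rV[R]_d -> \bar R}) (A : 'M[R]_d).
Hypothesis mnu : measurable_fun setT nu.
Hypothesis nu_gt0 : forall x, x != 0%R -> (0 < nu x)%R.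
Hypothesis Nfin : \int[N]_z (Num.min 1 (enorm z ^+ 2))%R%:E < +oo.
Hypothesis NE : forall A, measurable A ->
  N A = \int[lebesgue_rV R d]_(z in A) (nu z)%:E.
Hypothesis Apsd : forall xi, (0 <= dotr (xi *m A) xi)%R.
Variable w : 'rV[R]_d -> R.
Hypothesis ps : profile_spec nu N w.
Hypothesis Hchar : forall h, (0 < h <= 1)%R -> sym_charfun N A PP (fun p : cpath R d => p h) h.

Let conv := conv_w w.

Let conv_ge0 x : 0 <= conv x.
Proof. by apply: integral_ge0 => y _; rewrite lee_fin mulr_ge0 ?gauss_ge0 ?(ltW (ps_gt0 ps _)). Qed.

Let mconv : measurable_fun setT conv.
Proof.
apply: (measurable_tonelli (lebesgue_rV R d) (f := fun x y => (w y * gauss 1 (x - y))%:E)).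
  apply/measurable_EFinP; apply: measurable_funM.
    exact: (measurableT_comp (ps_meas ps) measurable_snd).
  apply: (measurableT_comp (measurable_gauss 1)).
  by apply: measurable_rVB; [exact: measurable_fst|exact: measurable_snd].
by move=> x y; rewrite lee_fin mulr_ge0 ?gauss_ge0 ?(ltW (ps_gt0 ps _)).
Qed.

(* The convolution of [w] with a Gaussian is comparable to [w], and one step of
   length [h] multiplies it by at most [1 + C * h] up to an error [C * h ^+ 2]. *)
Lemma heat_w : exists2 C : R, (0 < C)%R & forall t x, (0 <= t)%R ->
  \int[PP]_p (w (x + p t))%:E <= (C * expR (C * t) * w x)%:E.
Proof.
have [C C0 HC] := conv_w_step mnu nu_gt0 Nfin NE Apsd ps PP.
have [c [c' [c0 c'0 Hc]]] := ps_conv ps ltr01.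
have cfin y : conv y \is a fin_num.
  rewrite ge0_fin_numE //; have /andP[_ H'] := Hc y; apply: (le_lt_trans H'); exact: ltry.
have [F [mF F0 heatF Hc']] : exists F : 'rV[R]_d -> \bar R, [/\ measurable_fun setT F,
    (forall x, 0 <= F x),
    (forall t x, (0 <= t)%R -> \int[PP]_p F (x + p t)%R <= (expR (C * t))%:E * F x) &
    (forall x, (c * w x)%:E <= F x <= (c' * w x)%:E)].
  exists conv; split => //.
  exact: (affine_growth mconv conv_ge0 cfin C0 (fun h y hh => HC _ h y hh (Hchar hh))).
have D0 : (0 < c' / c)%R by rewrite divr_gt0.
exists (c' / c + C)%R; first by rewrite addr_gt0.
move=> t x t0; have wx := ps_gt0 ps x.
have mw : measurable_fun setT (EFin \o w) by apply/measurable_EFinP; exact: ps_meas ps.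
have w_F y : (w y)%:E <= (c^-1)%:E * F y.
  have /andP[H _] := Hc' y; apply: le_trans (lee_wpmul2l _ H).
    by rewrite -EFinM mulrA mulVf ?gt_eqF // mul1r.
  by rewrite lee_fin invr_ge0 ltW.
apply: (@le_trans _ _ (\int[PP]_p ((c^-1)%:E * F (x + p t)%R))).
  apply: ge0_le_integral => //.
  - by move=> p _; rewrite lee_fin ltW // (ps_gt0 ps).
  - exact: (measurable_value_at_path (f := EFin \o w)).
  - by apply: measurable_funeM; exact: measurable_value_at_path.
rewrite ge0_integralZl //; last 2 first.
- exact: measurable_value_at_path.
- by rewrite lee_fin invr_ge0 ltW.
have /andP[_ Hx] := Hc' x.
apply: (@le_trans _ _ ((c^-1)%:E * ((expR (C * t))%:E * (c' * w x)%:E))).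
  apply: lee_wpmul2l; first by rewrite lee_fin invr_ge0 ltW.
  apply: (le_trans (heatF _ x t0)); apply: lee_wpmul2l => //.
rewrite -!EFinM lee_fin mulrA mulrA ler_wpM2r ?(ltW wx) //.
have -> : (c^-1 * expR (C * t) * c' = c' / c * expR (C * t))%R by ring.
apply: ler_pM; rewrite ?(ltW D0) ?expR_ge0 //; first by rewrite lerDl ltW.
by rewrite ler_expR ler_wpM2r // lerDr ltW.
Qed.

End heat.

Section khasminskii.

Lemma measurable_exp_occ (g : 'rV[R]_d -> R) t : measurable_fun setT g ->
  (forall y, (0 <= g y)%R) ->
  measurable_fun setT (fun u : 'rV[R]_d * cpath R d => expeR (occ g u.1 t u.2)).
Proof.
by move=> mg g0; exact: (measurableT_comp (@measurable_expeR R) (measurable_occ mg g0 t)).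
Qed.

Lemma measurable_exp_occ_path (g : 'rV[R]_d -> R) x t : measurable_fun setT g ->
  (forall y, (0 <= g y)%R) -> measurable_fun setT (fun p => expeR (occ g x t p)).
Proof.
by move=> mg g0; exact: (measurableT_comp (@measurable_expeR R) (measurable_occ_path mg g0 x t)).
Qed.

Lemma exp_occ_cat (g : 'rV[R]_d -> R) x s t : measurable_fun setT g ->
  (forall y, (0 <= g y)%R) -> (0 < s)%R -> (0 <= t)%R ->
  \int[PP]_p expeR (occ g x (s + t) p) =
  \int[PP]_p (expeR (occ g x s p) * \int[PP]_q expeR (occ g (x + p s)%R t q)).
Proof.
move=> mg g0 s0 t0; rewrite (markov HPP s0) //; last first.
- by move=> p; exact: expeR_ge0.
- exact: measurable_exp_occ_path.
apply: eq_integral => p _; rewrite -ge0_integralZl ?expeR_ge0 //; last 2 first.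
- exact: measurable_exp_occ_path.
- by move=> q _; exact: expeR_ge0.
by apply: eq_integral => q _; rewrite occ_cat ?(ltW s0) // expeRD.
Qed.

Lemma occ_mean_cat (g : 'rV[R]_d -> R) x s t : measurable_fun setT g ->
  (forall y, (0 <= g y)%R) -> (0 < s)%R -> (0 <= t)%R ->
  \int[PP]_p occ g x (s + t) p =
  \int[PP]_p (occ g x s p + \int[PP]_q occ g (x + p s)%R t q).
Proof.
move=> mg g0 s0 t0; rewrite (markov HPP s0) //; last first.
- by move=> p; exact: occ_ge0.
- exact: measurable_occ_path.
apply: eq_integral => p _.
under eq_integral do rewrite occ_cat ?(ltW s0) //.
rewrite ge0_integralD //; last 3 first.
- by move=> q _; exact: occ_ge0.
- by move=> q _; exact: occ_ge0.
- exact: measurable_occ_path.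
by rewrite integral_prob_cst.
Qed.

(** exp(a) <= 1 + 2 a for a <= 1/2; the bound [S] replaces [u] in the correction only, so that the
    main term can be iterated. *)
Lemma exp_mul_le (a S : R) (u : \bar R) : (0 <= a <= 1 / 2)%R -> 0 <= u -> u <= S%:E ->
  (expR a)%:E * u <= u + (2 * S * a)%:E.
Proof.
move=> /andP[a0 a1] u0 uS.
have ufin : u \is a fin_num by rewrite ge0_fin_numE // (le_lt_trans uS) // ltry.
rewrite -(fineK ufin) in u0 uS *; set v := fine u in u0 uS *.
rewrite !lee_fin in u0 uS; rewrite -EFinM -EFinD lee_fin.
have := expR_ge1Dx (- a)%R; have ea := expR_gt0 a.
have ee : (expR a * expR (- a) = 1)%R by exact: expRxMexpNx_1.
move=> H; have h1 : (expR a * (1 - a) <= 1)%R.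
  by rewrite -[leRHS]ee ler_pM2l.
have h2 : (expR a <= 1 + 2 * a)%R by nra.
have h3 : (a * v <= a * S)%R by rewrite ler_wpM2l.
have h4 := ler_wpM2r u0 h2; lra.
Qed.

(** Khasminskii's lemma along a grid so fine that each step contributes at most 1/2 to the exponent.
    Expanding step by step, the supremum s of the exponential moments satisfies s <= 1 + 2 s / 8,
    hence s <= 2; boundedness of [g] makes s finite beforehand. *)
Lemma khasminskii_bounded (g : 'rV[R]_d -> R) (m tau : R) : measurable_fun setT g ->
  (forall y, 0 <= g y <= m)%R -> (0 < tau)%R ->
  (forall x, \int[PP]_p occ g x tau p <= (1 / 8)%:E) ->
  forall x, \int[PP]_p expeR (occ g x tau p) <= 2%:E.
Proof.
move=> mg gm tau0 Hocc.
have g0 y : (0 <= g y)%R by have /andP[] := gm y.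
have gm' y : (g y <= m)%R by have /andP[] := gm y.
have m0 : (0 <= m)%R by apply: le_trans (gm' 0%R).
pose n := (Num.truncn (2 * (m * tau))%R).+1.
have mt0 : (0 <= 2 * (m * tau))%R by rewrite !mulr_ge0 // ltW.
have n1 : (2 * (m * tau) < n%:R)%R by have /andP[] := truncn_itv mt0.
have n0 : (0 < n%:R :> R)%R by rewrite ltr0n.
pose h := (tau / n%:R)%R.
have h0 : (0 < h)%R by rewrite divr_gt0.
have nh : (n%:R * h = tau)%R by rewrite /h mulrC divfK // gt_eqF.
have mh : (m * h <= 1 / 2)%R.
  by rewrite /h mulrA ler_pdivrMr //; lra.
pose u k x := \int[PP]_p expeR (occ g x (k%:R * h) p).
have u0 k x : 0 <= u k x by apply: integral_ge0 => p _; exact: expeR_ge0.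
have uub x : u n x <= (expR (m * tau))%:E.
  rewrite /u nh -(integral_path_cst (expR (m * tau))); apply: ge0_le_integral => //.
  - by move=> p _; exact: expeR_ge0.
  - exact: measurable_exp_occ_path.
  - move=> p _; rewrite (_ : (expR _)%:E = expeR (m * tau)%:E) // lee_expeR.
    by apply: occ_le_bound => //; exact: ltW.
pose S := ereal_sup (range (u n)).
have uS x : u n x <= S by apply: ereal_sup_ubound; exists x.
have S0 : 0 <= S by apply: le_trans (uS 0%R).
have SE : S \is a fin_num.
  rewrite ge0_fin_numE //; apply: (@le_lt_trans _ _ (expR (m * tau))%:E); last exact: ltry.
  by apply: ge_ereal_sup => _ [x _ <-].
rewrite -(fineK SE) in S0 uS; set s := fine S in S0 uS; rewrite lee_fin in S0.
have ukS k x : (k <= n)%N -> u k x <= s%:E.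
  move=> kn; apply: le_trans (uS x); apply: ge0_le_integral => //.
  - by move=> p _; exact: expeR_ge0.
  - exact: measurable_exp_occ_path.
  - exact: measurable_exp_occ_path.
  - move=> p _; rewrite lee_expeR; apply: occ_le => //.
    by rewrite ler_wpM2r ?ler_nat // ltW.
have claim k x : (k <= n)%N ->
    u k x <= 1 + (2 * s)%:E * \int[PP]_p occ g x (k%:R * h) p.
  elim: k x => [|k IH] x kn.
    rewrite /u !mul0r; under eq_integral do rewrite occ0 expeR0.
    rewrite (integral_path_cst 1) leeDl // mule_ge0 ?lee_fin ?mulr_ge0 //.
    by apply: integral_ge0 => p _; exact: occ_ge0.
  have kh : (k.+1%:R * h = h + k%:R * h)%R by rewrite -natr1 mulrDl mul1r addrC.
  have k0 : (0 <= k%:R * h)%R by rewrite mulr_ge0 // ltW.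
  rewrite /u kh exp_occ_cat // occ_mean_cat //.
  have mI : measurable_fun setT (fun y => \int[PP]_q occ g y (k%:R * h) q).
    apply: (measurable_value PP (Phi := fun y q => occ g y (k%:R * h) q)).
      exact: measurable_occ.
    by move=> y q; exact: occ_ge0.
  have mu' : measurable_fun setT (u k).
    apply: (measurable_value PP (Phi := fun y q => expeR (occ g y (k%:R * h) q))).
      exact: measurable_exp_occ.
    by move=> y q; exact: expeR_ge0.
  have I0 y : 0 <= \int[PP]_q occ g y (k%:R * h) q.
    by apply: integral_ge0 => q _; exact: occ_ge0.
  have mf : measurable_fun setT (fun p : cpath R d =>
      occ g x h p + \int[PP]_q occ g (x + p h)%R (k%:R * h) q).
    apply: emeasurable_funD; first exact: measurable_occ_path.
    by apply: (measurable_value_at_path x (ltW h0) mI).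
  apply: (@le_trans _ _ (\int[PP]_p ((2 * s)%:E * (occ g x h p +
      \int[PP]_q occ g (x + p h)%R (k%:R * h) q) + 1%:E))); last first.
    rewrite integral_affine ?mulr_ge0 //; first by rewrite addeC.
    by move=> p; rewrite adde_ge0 // occ_ge0.
  apply: ge0_le_integral => //.
  - by move=> p _; apply: mule_ge0; [exact: expeR_ge0|exact: u0].
  - apply: emeasurable_funM; first exact: measurable_exp_occ_path.
    by apply: (measurable_value_at_path x (ltW h0) mu').
  - by apply: emeasurable_funD => //; exact: measurable_funeM.
  move=> p _; have oh := occ_le_bound mg g0 x p (ltW h0) gm'.
  have o0 := occ_ge0 g0 x h p.
  have oE : occ g x h p \is a fin_num by rewrite ge0_fin_numE // (le_lt_trans oh) // ltry.
  rewrite -(fineK oE) in oh o0 *; set a := fine _ in oh o0 *.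
  rewrite !lee_fin in oh o0.
  apply: (le_trans (exp_mul_le (S := s) _ (u0 k _) (ukS _ _ (ltnW kn)))).
    by rewrite o0 (le_trans oh).
  apply: (le_trans (leeD2r _ (IH _ (ltnW kn)))).
  set J := \int[PP]_q _.
  have -> : (2 * s)%:E * (a%:E + J) = (2 * s * a)%:E + (2 * s)%:E * J.
    by rewrite ge0_muleDr // ?lee_fin // I0.
  by rewrite -addeA addeC [X in X + 1]addeC.
have sle : (s <= 1 + s / 4)%R.
  rewrite -lee_fin /s (fineK SE); apply: ge_ereal_sup => _ [x _ <-].
  apply: (le_trans (claim n x (leqnn n))); rewrite nh.
  apply: (@le_trans _ _ (1 + (2 * s)%:E * (1 / 8)%:E)).
    by apply: leeD2l => //; apply: lee_wpmul2l; rewrite ?lee_fin ?mulr_ge0.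
  have -> : 1 + (2 * s)%:E * (1 / 8)%:E = (1 + 2 * s * (1 / 8))%R%:E by [].
  rewrite lee_fin -/s; lra.
by move=> x; rewrite -nh; apply: (le_trans (uS x)); rewrite lee_fin; lra.
Qed.

(** The bound of the bounded case is independent of [m], so the truncations min(g, m) increase to
    [g] under both the time integral and the expectation. *)
Lemma khasminskii (g : 'rV[R]_d -> R) (tau : R) : measurable_fun setT g ->
  (forall y, 0 <= g y)%R -> (0 < tau)%R ->
  (forall x, \int[PP]_p occ g x tau p <= (1 / 8)%:E) ->
  forall x, \int[PP]_p expeR (occ g x tau p) <= 2%:E.
Proof.
move=> mg g0 tau0 Hocc x.
pose gm (m : nat) y := Num.min (g y) m%:R.
have mgm m : measurable_fun setT (gm m) by exact: measurable_minr.
have gm0 m y : (0 <= gm m y)%R by rewrite le_min g0 /=.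
have nd m m' y : (m <= m')%N -> (gm m y <= gm m' y)%R.
  by move=> mm; rewrite /gm le_min ge_min lexx /= ge_min ler_nat mm orbT.
apply: (@le_integral_sup _ _ _ PP setT (fun m p => expeR (occ (gm m) x tau p))) => //.
- by move=> m; exact: measurable_exp_occ_path.
- by move=> m p; exact: expeR_ge0.
- move=> p m m' mm; rewrite lee_expeR; apply: le_occ => // y; exact: nd.
- exact: measurable_exp_occ_path.
- by move=> p; exact: expeR_ge0.
- move=> p _; apply: le_expeR_sup; rewrite occE.
  apply: (@le_integral_sup _ _ _ lebesgue_measure `[0%R, tau]%classic
    (fun m s => (gm m (x + p (Num.max 0 s))%R)%:E)) => //.
  + by move=> m; apply: measurable_funTS; exact: measurable_along.
  + by move=> m s; rewrite lee_fin.
  + by move=> s m m' mm; rewrite lee_fin nd.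
  + by apply: measurable_funTS; exact: measurable_along.
  + by move=> s; rewrite lee_fin.
  + move=> s _; set y := (x + _)%R.
    apply: ereal_sup_ubound; exists (Num.truncn (g y)).+1 => //=.
    congr EFin; rewrite /gm min_l //.
    by have /andP[_ /ltW] := truncn_itv (g0 y).
  + by move=> m; rewrite -occE; apply: ereal_sup_ubound; exists m.
- move=> m; apply: (khasminskii_bounded (m := m%:R)) => //.
    by move=> y; rewrite gm0 /gm ge_min lexx orbT.
  move=> y; apply: le_trans (Hocc y); apply: ge0_le_integral => //.
  + by move=> p _; exact: occ_ge0.
  + exact: measurable_occ_path.
  + exact: measurable_occ_path.
  + by move=> p _; apply: le_occ => // z; rewrite /gm ge_min lexx.
Qed.

(** Blocks of length [tau]: by the Markov property each one costs a factor 2. *)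
Lemma khasminskii_all (g : 'rV[R]_d -> R) (tau : R) : measurable_fun setT g ->
  (forall y, 0 <= g y)%R -> (0 < tau)%R ->
  (forall x, \int[PP]_p occ g x tau p <= (1 / 8)%:E) ->
  forall t, exists2 K : R, (1 <= K)%R & forall s x, (s <= t)%R ->
    \int[PP]_p expeR (occ g x s p) <= K%:E.
Proof.
move=> mg g0 tau0 Hocc t.
have H k x : \int[PP]_p expeR (occ g x (k.+1%:R * tau) p) <= (2 ^+ k.+1)%:E.
  elim: k x => [|k IH] x; first by rewrite mul1r expr1; exact: khasminskii.
  have kh : (k.+2%:R * tau = tau + k.+1%:R * tau)%R by rewrite -natr1 mulrDl mul1r addrC.
  have k0 : (0 <= k.+1%:R * tau)%R by rewrite mulr_ge0 // ltW.
  rewrite kh exp_occ_cat //.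
  apply: (@le_trans _ _ (\int[PP]_p ((2 ^+ k.+1)%:E * expeR (occ g x tau p)))).
    apply: ge0_le_integral => //.
    - move=> p _; rewrite mule_ge0 ?expeR_ge0 //.
      by apply: integral_ge0 => q _; exact: expeR_ge0.
    - apply: emeasurable_funM; first exact: measurable_exp_occ_path.
      apply: (measurable_value_at_path x (ltW tau0)
        (f := fun y => \int[PP]_q expeR (occ g y (k.+1%:R * tau) q))).
      apply: (measurable_value PP (Phi := fun y q => expeR (occ g y (k.+1%:R * tau) q))).
        exact: measurable_exp_occ.
      by move=> y q; exact: expeR_ge0.
    - by apply: measurable_funeM; exact: measurable_exp_occ_path.
    - by move=> p _; rewrite muleC; apply: lee_wpmul2r => //; exact: expeR_ge0.
  rewrite ge0_integralZl //; last 2 first.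
  - exact: measurable_exp_occ_path.
  - by move=> p _; exact: expeR_ge0.
  apply: (@le_trans _ _ ((2 ^+ k.+1)%:E * 2%:E)); last by rewrite -EFinM -exprSr.
  by apply: lee_wpmul2l; [rewrite lee_fin exprn_ge0|exact: khasminskii].
pose k := Num.truncn (Num.max 0 t / tau)%R.
exists (2 ^+ k.+1)%R; first by rewrite exprn_ege1 // ler1n.
move=> s x st; apply: le_trans (H k x); apply: ge0_le_integral => //.
- by move=> p _; exact: expeR_ge0.
- exact: measurable_exp_occ_path.
- exact: measurable_exp_occ_path.
- move=> p _; rewrite lee_expeR; apply: occ_le => //.
  have q0 : (0 <= Num.max 0 t / tau)%R by rewrite divr_ge0 ?max0_ge0 // ltW.
  have /andP[_ hk] := truncn_itv q0.
  apply: (@le_trans _ _ (Num.max 0 t)%R).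
    by rewrite le_max st orbT.
  by rewrite -ler_pdivrMr // ltW.
Qed.

End khasminskii.

End markov_values.

(** * The Feynman-Kac semigroup on path space *)

Section feynman_kac_paths.
Context {R : realType} {d : nat}.
Variable PP : probability (cpath R d) R.
Hypothesis HPP : levy_law PP.
Variable V : 'rV[R]_d -> R.
Hypothesis mV : measurable_fun setT V.
Implicit Types (x y : 'rV[R]_d) (p q : cpath R d) (s t h : R).
Implicit Types f g : 'rV[R]_d -> \bar R.
Local Open Scope ereal_scope.

Definition vpos y : R := Num.max (V y) 0%R.
Definition vneg y : R := Num.max (- V y)%R 0%R.

Lemma vpos_ge0 y : (0 <= vpos y)%R. Proof. by rewrite le_max lexx orbT. Qed.
Lemma vneg_ge0 y : (0 <= vneg y)%R. Proof. by rewrite le_max lexx orbT. Qed.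

Lemma measurable_vpos : measurable_fun setT vpos.
Proof. exact: measurable_maxr. Qed.

Lemma measurable_vneg : measurable_fun setT vneg.
Proof. by apply: measurable_maxr => //; exact: measurable_funN. Qed.

Hint Resolve vpos_ge0 vneg_ge0 measurable_vpos measurable_vneg : core.

(** Two factors instead of the exponential of a difference, so that the weight is defined also if
    both occupation integrals are infinite. It agrees with the original weight where the negative
    one is finite. *)
Definition MF x t p : \bar R := expeR (- occ vpos x t p) * expeR (occ vneg x t p).

Lemma MF_ge0 x t p : 0 <= MF x t p.
Proof. by rewrite mule_ge0 // expeR_ge0. Qed.

Hint Resolve MF_ge0 : core.

Lemma measurable_MF t : measurable_fun setT (fun u : 'rV[R]_d * cpath R d => MF u.1 t u.2).
Proof.
apply: emeasurable_funM; last exact: measurable_exp_occ.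
apply: (measurableT_comp (@measurable_expeR R)).
by apply: measurableT_comp => //; exact: measurable_occ.
Qed.

Lemma measurable_MF_path x t : measurable_fun setT (MF x t).
Proof. exact: (measurableT_comp (measurable_MF t) (pair1_measurable x)). Qed.

Lemma MF0 x p : MF x 0 p = 1.
Proof. by rewrite /MF !occ0 oppe0 expeR0 mule1. Qed.

Lemma MF_cat x s t p q : (0 <= s)%R -> (0 <= t)%R ->
  MF x (s + t) (cat_path s p q) = MF x s p * MF (x + p s)%R t q.
Proof.
move=> s0 t0; rewrite /MF !occ_cat // expeRD.
rewrite oppeD; last by apply: ge0_adde_def; rewrite inE occ_ge0.
by rewrite expeRD muleACA.
Qed.

Lemma MF_le x t p : MF x t p <= expeR (occ vneg x t p).
Proof.
rewrite -[leRHS]mul1e; apply: lee_wpmul2r; first exact: expeR_ge0.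
by rewrite -(@expeR0 R) lee_expeR oppe_le0 occ_ge0.
Qed.

Definition FK t f x : \bar R := \int[PP]_p (MF x t p * f (x + p t)%R).

Section operators.

Lemma FK_ge0 t f x : (forall y, 0 <= f y) -> 0 <= FK t f x.
Proof. by move=> f0; apply: integral_ge0 => p _; rewrite mule_ge0. Qed.

Lemma measurable_FK_integrand t f : (0 <= t)%R -> measurable_fun setT f ->
  measurable_fun setT (fun u : 'rV[R]_d * cpath R d => MF u.1 t u.2 * f (u.1 + u.2 t)%R).
Proof.
move=> t0 mf; apply: emeasurable_funM; first exact: measurable_MF.
exact: measurable_value_at.
Qed.

Lemma measurable_FK_path t f x : (0 <= t)%R -> measurable_fun setT f ->
  measurable_fun setT (fun p => MF x t p * f (x + p t)%R).
Proof.
move=> t0 mf; exact: (measurableT_comp (measurable_FK_integrand t0 mf) (pair1_measurable x)).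
Qed.

Lemma measurable_FK t f : (0 <= t)%R -> measurable_fun setT f -> (forall y, 0 <= f y) ->
  measurable_fun setT (FK t f).
Proof.
move=> t0 mf f0.
apply: (measurable_value PP (Phi := fun x p => MF x t p * f (x + p t)%R)).
  exact: measurable_FK_integrand.
by move=> x p; rewrite mule_ge0.
Qed.

Lemma le_FK t f g x : (0 <= t)%R -> measurable_fun setT f -> (forall y, 0 <= f y) ->
  measurable_fun setT g -> (forall y, f y <= g y) -> FK t f x <= FK t g x.
Proof.
move=> t0 mf f0 mg fg; apply: ge0_le_integral => //.
- by move=> p _; rewrite mule_ge0.
- exact: measurable_FK_path.
- exact: measurable_FK_path.
- by move=> p _; apply: lee_wpmul2l.
Qed.

Lemma FKD t f g x : (0 <= t)%R -> measurable_fun setT f -> (forall y, 0 <= f y) ->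
  measurable_fun setT g -> (forall y, 0 <= g y) ->
  FK t (fun y => f y + g y) x = FK t f x + FK t g x.
Proof.
move=> t0 mf f0 mg g0; rewrite /FK -ge0_integralD //.
- by apply: eq_integral => p _; rewrite ge0_muleDr.
- by move=> p _; rewrite mule_ge0.
- exact: measurable_FK_path.
- by move=> p _; rewrite mule_ge0.
- exact: measurable_FK_path.
Qed.

Lemma FKZ t (k : R) f x : (0 <= t)%R -> (0 <= k)%R -> measurable_fun setT f ->
  (forall y, 0 <= f y) -> FK t (fun y => k%:E * f y) x = k%:E * FK t f x.
Proof.
move=> t0 k0 mf f0; rewrite /FK -ge0_integralZl //.
- by apply: eq_integral => p _; rewrite muleCA.
- exact: measurable_FK_path.
- by move=> p _; rewrite mule_ge0.
Qed.

Lemma FK_cat s t f x : (0 < s)%R -> (0 <= t)%R -> measurable_fun setT f ->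
  (forall y, 0 <= f y) -> FK (s + t) f x = FK s (FK t f) x.
Proof.
move=> s0 t0 mf f0.
have st0 : (0 <= s + t)%R by rewrite addr_ge0 // ltW.
rewrite /FK (markov HPP s0 (measurable_FK_path x st0 mf)); last first.
  by move=> p; rewrite mule_ge0.
apply: eq_integral => p _; rewrite -ge0_integralZl //; last 2 first.
- exact: measurable_FK_path.
- by move=> q _; rewrite mule_ge0.
apply: eq_integral => q _; cbv beta.
by rewrite MF_cat ?(ltW s0) // cat_pathr ?(ltW s0) // -muleA addrA.
Qed.

Lemma FK_le_exp t x : FK t (fun=> 1) x <= \int[PP]_p expeR (occ vneg x t p).
Proof.
apply: ge0_le_integral => //.
- by move=> p _; rewrite mule_ge0.
- have -> : (fun p => MF x t p * 1) = MF x t by apply/funext => p; rewrite mule1.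
  exact: measurable_MF_path.
- exact: measurable_exp_occ_path.
- by move=> p _; rewrite mule1 MF_le.
Qed.

End operators.

Section killed_in_ball.
Variable r : R.
Let B : set 'rV[R]_d := eball 0 r.
Let mB : measurable B := measurable_eball 0 r.

Definition ind_ball y : \bar R := (\1_B y)%:E.

Definition out f y : \bar R := (\1_(~` B) y)%:E * f y.

Lemma ind_ball_ge0 y : 0 <= ind_ball y.
Proof. by rewrite lee_fin. Qed.

Lemma measurable_ind_ball : measurable_fun setT ind_ball.
Proof. by apply/measurable_EFinP. Qed.

Lemma out_ge0 f y : (forall y, 0 <= f y) -> 0 <= out f y.
Proof. by move=> f0; rewrite mule_ge0 // lee_fin. Qed.

Lemma measurable_out f : measurable_fun setT f -> measurable_fun setT (out f).
Proof.
move=> mf; apply: emeasurable_funM => //; apply/measurable_EFinP.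
by apply: measurable_indic; exact: measurableC.
Qed.

Lemma in_ballE y : B y -> (ind_ball y = 1) * (forall f, out f y = 0).
Proof.
move=> By; rewrite /ind_ball /out !indicE mem_set //; split => // f.
by rewrite memNset ?mul0e //; move=> /(_ By).
Qed.

Lemma out_ballE y : ~ B y -> (ind_ball y = 0) * (forall f, out f y = f y).
Proof.
move=> By; rewrite /ind_ball /out !indicE memNset //; split=> // f.
by rewrite mem_set // mul1e.
Qed.

Hint Resolve ind_ball_ge0 measurable_ind_ball : core.

Variable h : R.
Hypothesis h0 : (0 < h)%R.
Let h0' := ltW h0.

(** The value of collecting [a] at the start of each of [k] steps and [c] at the end, with the
    process killed at its first positive grid time in the ball. This recursion replaces a stopping
    time; note that the starting point itself is not tested. *)
Fixpoint vfun (a c : 'rV[R]_d -> \bar R) (k : nat) : 'rV[R]_d -> \bar R :=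
  if k is k'.+1 then fun x => a x + FK h (out (vfun a c k')) x else c.

Lemma vfun0 a c x : vfun a c 0 x = c x. Proof. by []. Qed.

Lemma vfunS a c k x : vfun a c k.+1 x = a x + FK h (out (vfun a c k)) x.
Proof. by []. Qed.

Arguments vfun : simpl never.

Lemma vfun_ge0 a c k x : (forall y, 0 <= a y) -> (forall y, 0 <= c y) -> 0 <= vfun a c k x.
Proof.
move=> a0 c0; elim: k x => [|k IH] x //; rewrite vfunS adde_ge0 // FK_ge0 // => y.
exact: out_ge0.
Qed.

Lemma measurable_vfun a c k : measurable_fun setT a -> measurable_fun setT c ->
  (forall y, 0 <= a y) -> (forall y, 0 <= c y) -> measurable_fun setT (vfun a c k).
Proof.
move=> ma mc a0 c0; elim: k => [|k IH] //; apply: emeasurable_funD => //.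
apply: measurable_FK => //; first exact: measurable_out.
by move=> y; apply: out_ge0 => z; exact: vfun_ge0.
Qed.

(** The weight of the paths with a positive grid time in the ball among the first [k], where the
    Feynman-Kac factor runs up to the first such time. *)
Definition hit_sum := vfun (FK h ind_ball) (fun=> 0).

Let mhit k : measurable_fun setT (hit_sum k).
Proof. by apply: measurable_vfun => //; [exact: measurable_FK|move=> y; exact: FK_ge0]. Qed.

Let hit_ge0 k y : 0 <= hit_sum k y.
Proof. by apply: vfun_ge0 => // z; exact: FK_ge0. Qed.

(** Optional stopping of the eigenfunction along the grid: at the entrance into the ball the value 1
    is at most c phi. As [lam] may have either sign, the elapsed time is charged at rate |lam|. *)
Lemma hit_sum_le (phi : 'rV[R]_d -> R) (lam c : R) :
  measurable_fun setT phi -> (forall y, 0 <= phi y)%R -> (0 <= c)%R ->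
  (forall y, B y -> 1 <= c * phi y)%R ->
  (forall x, FK h (EFin \o phi) x = (expR (- lam * h) * phi x)%:E) ->
  forall k x, hit_sum k x <= (c * expR (`|lam| * (k%:R * h)) * phi x)%:E.
Proof.
move=> mphi phi0 c0 cphi eig; elim=> [|k IH] x.
  by rewrite /hit_sum vfun0 lee_fin !mulr_ge0 ?expR_ge0.
pose K := (c * expR (`|lam| * (k%:R * h)))%R.
have K0 : (0 <= K)%R by rewrite mulr_ge0 ?expR_ge0.
have cK : (c <= K)%R.
  by rewrite ler_peMr // -[leLHS]expR0 ler_expR !mulr_ge0.
have mE : measurable_fun setT (EFin \o phi) by exact/measurable_EFinP.
have mout : measurable_fun setT (out (hit_sum k)) by exact: measurable_out.
have out0 y : 0 <= out (hit_sum k) y by exact: out_ge0.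
rewrite /hit_sum vfunS -/hit_sum -FKD //.
apply: (@le_trans _ _ (FK h (fun y => K%:E * (EFin \o phi) y) x)).
  apply: le_FK => //.
  - exact: emeasurable_funD.
  - by move=> y; rewrite adde_ge0.
  - exact: measurable_funeM.
  move=> y; have [By|By] := pselect (B y).
    rewrite !(in_ballE By) adde0 -EFinM lee_fin (le_trans (cphi y By)) //.
    exact: ler_wpM2r.
  by rewrite !(out_ballE By) add0e -EFinM IH.
rewrite FKZ // eig -EFinM lee_fin.
rewrite mulrA ler_wpM2r // /K -mulrA ler_wpM2l // -expRD ler_expR.
have : (- lam * h <= `|lam| * h)%R by rewrite ler_wpM2r // -normrN ler_norm.
rewrite -natr1; lra.
Qed.

(** Decomposition at the first positive grid time in the ball; from then on the remaining semigroup
    is bounded by [K]. *)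
Lemma FK1_le_hit (K t0 : R) : (1 <= K)%R ->
  (forall t x, (t <= t0)%R -> FK t (fun=> 1) x <= K%:E) ->
  forall k x, (k%:R * h <= t0)%R ->
  FK (k%:R * h) (fun=> 1) x <= vfun (fun=> 0) (fun=> 1) k x + K%:E * hit_sum k x.
Proof.
move=> K1 HK; have K0 : (0 <= K)%R by apply: le_trans K1.
elim=> [|k IH] x kt.
  rewrite /FK mul0r; under eq_integral do rewrite MF0 mule1.
  by rewrite integral_prob_cst /hit_sum !vfun0 mule0 adde0.
have k0 : (0 <= k%:R * h)%R by rewrite mulr_ge0.
have kh : (k.+1%:R * h = h + k%:R * h)%R by rewrite -natr1 mulrDl mul1r addrC.
have kt' : (k%:R * h <= t0)%R by apply: le_trans kt; rewrite kh lerDr.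
rewrite kh FK_cat // /hit_sum !vfunS -/hit_sum add0e; set q := vfun _ _ k.
have q0 y : 0 <= q y by exact: vfun_ge0.
have mq : measurable_fun setT q by apply: measurable_vfun => //; exact: measurable_cst.
have mqo := measurable_out mq; have mho := measurable_out (mhit k).
have qo0 y : 0 <= out q y by exact: out_ge0.
have ho0 y : 0 <= out (hit_sum k) y by exact: out_ge0.
have mS : measurable_fun setT (fun y => ind_ball y + out (hit_sum k) y).
  exact: emeasurable_funD.
have S0 y : 0 <= ind_ball y + out (hit_sum k) y by rewrite adde_ge0.
have mKS : measurable_fun setT (fun y => K%:E * (ind_ball y + out (hit_sum k) y)).
  exact: measurable_funeM.
rewrite -FKD // -FKZ // -FKD // ?mule_ge0 //; last by move=> y; rewrite mule_ge0.
apply: le_FK => //.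
- by apply: measurable_FK => //; exact: measurable_cst.
- by move=> y; exact: FK_ge0.
- exact: emeasurable_funD.
move=> y; have [By|By] := pselect (B y).
  rewrite !(in_ballE By) add0e adde0 mule1; exact: HK.
by rewrite !(out_ballE By) add0e; exact: IH.
Qed.

Variables (w : 'rV[R]_d -> R) (mw : measurable_fun setT w) (w0 : forall y, (0 <= w y)%R).

Definition ball_prob x : \bar R := \int[PP]_p ind_ball (x + p h)%R.
Definition w_sum := vfun (EFin \o w) (fun=> 0).
Definition one_sum := vfun (fun=> 1) (fun=> 0).
(** The variant of [hit_sum] in which the step that enters the ball carries no weight. The estimate
    of the return probability concerns the process without potential, hence this form. *)
Definition hit_sum' := vfun ball_prob (fun=> 0).

Let bp0 x : 0 <= ball_prob x. Proof. exact: integral_ge0. Qed.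

Let mbp : measurable_fun setT ball_prob.
Proof.
apply: (measurable_value PP (Phi := fun x p => ind_ball (x + p h)%R)) => //.
exact: measurable_value_at.
Qed.

Let mEw : measurable_fun setT (EFin \o w). Proof. exact/measurable_EFinP. Qed.
Let Ew0 y : 0 <= (EFin \o w) y. Proof. by rewrite lee_fin. Qed.

Let mw_sum k : measurable_fun setT (w_sum k).
Proof. by apply: measurable_vfun => //; exact: measurable_cst. Qed.
Let w_sum0 k y : 0 <= w_sum k y. Proof. exact: vfun_ge0. Qed.
Let mone k : measurable_fun setT (one_sum k).
Proof. by apply: measurable_vfun => //; exact: measurable_cst. Qed.
Let one0 k y : 0 <= one_sum k y. Proof. exact: vfun_ge0. Qed.
Let mhit' k : measurable_fun setT (hit_sum' k).
Proof. by apply: measurable_vfun => //; exact: measurable_cst. Qed.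
Let hit'0 k y : 0 <= hit_sum' k y. Proof. exact: vfun_ge0. Qed.

(** The lower bound for the probability of returning in one step, summed along the paths that have
    not returned; its error C h^2 is collected once per step by [one_sum]. *)
Lemma w_sum_le (c C : R) : (0 <= c)%R -> (0 <= C)%R ->
  (forall y, ~ B y -> (h * (c * w y - C * h))%:E <= ball_prob y) ->
  forall k x, ~ B x ->
  (c * h)%:E * w_sum k x <= hit_sum' k x + (C * h ^+ 2)%:E * one_sum k x.
Proof.
move=> c0 C0 HL; have ch0 : (0 <= c * h)%R by rewrite mulr_ge0.
have Ch0 : (0 <= C * h ^+ 2)%R by rewrite mulr_ge0 // exprn_ge0.
elim=> [|k IH] x Bx; first by rewrite /w_sum /hit_sum' /one_sum !vfun0 !mule0 adde0.
rewrite /w_sum /hit_sum' /one_sum !vfunS -/w_sum -/one_sum -/hit_sum'.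
have mo g : measurable_fun setT g -> measurable_fun setT (out g) by exact: measurable_out.
have oo g y : (forall z, 0 <= g z) -> 0 <= out g y by exact: out_ge0.
have FK0 g : (forall z, 0 <= g z) -> 0 <= FK h (out g) x.
  by move=> g0; apply: FK_ge0 => y; exact: oo.
rewrite ge0_muleDr ?Ew0 ?FK0 // [(C * h ^+ 2)%:E * _]ge0_muleDr ?FK0 // mule1.
rewrite addeACA; apply: leeD.
  have := HL x Bx.
  have -> : (h * (c * w x - C * h) = c * h * w x - C * h ^+ 2)%R by ring.
  by rewrite EFinB leeBlDr.
rewrite -!FKZ //; [|exact: mo|by move=> y; exact: oo|exact: mo|by move=> y; exact: oo].
rewrite -FKD //; [|exact: mo|by move=> y; exact: oo|by apply: measurable_funeM; exact: mo
  |by move=> y; rewrite mule_ge0 // oo].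
apply: le_FK => //.
- by apply: measurable_funeM; exact: mo.
- by move=> y; rewrite mule_ge0 // oo.
- by apply: emeasurable_funD; [exact: mo|apply: measurable_funeM; exact: mo].
move=> y; have [By|By] := pselect (B y); first by rewrite !(in_ballE By) !mule0 adde0.
by rewrite !(out_ballE By); exact: IH.
Qed.

Lemma one_sum_le k x : one_sum k x <= k%:R%:E * \int[PP]_p expeR (occ vneg x (k%:R * h) p).
Proof.
elim: k x => [|k IH] x; first by rewrite /one_sum vfun0 mul0e.
rewrite /one_sum vfunS -/one_sum.
have k0 : (0 <= k%:R * h)%R by rewrite mulr_ge0.
have kh : (k.+1%:R * h = h + k%:R * h)%R by rewrite -natr1 mulrDl mul1r addrC.
pose u y := \int[PP]_q expeR (occ vneg y (k%:R * h) q).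
have u0 y : 0 <= u y by apply: integral_ge0 => q _; exact: expeR_ge0.
have mu : measurable_fun setT u.
  apply: (measurable_value PP (Phi := fun y q => expeR (occ vneg y (k%:R * h) q))).
    exact: measurable_exp_occ.
  by move=> y q; exact: expeR_ge0.
set U := \int[PP]_p expeR (occ vneg x (k.+1%:R * h) p).
have U1 : 1 <= U.
  rewrite -(integral_prob_cst PP 1); apply: ge0_le_integral => //.
    exact: measurable_exp_occ_path.
  by move=> p _; rewrite -(@expeR0 R) lee_expeR occ_ge0.
rewrite -natr1 EFinD ge0_muleDl // mul1e addeC leeD //.
have -> : k%:R%:E * U = \int[PP]_p (k%:R%:E * (expeR (occ vneg x h p) * u (x + p h)%R)).
  rewrite /U kh exp_occ_cat // -/u ge0_integralZl //.
  - apply: emeasurable_funM; first exact: measurable_exp_occ_path.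
    by apply: measurable_value_at_path.
  - by move=> p _; apply: mule_ge0; [exact: expeR_ge0|exact: u0].
apply: ge0_le_integral => //.
- by move=> p _; rewrite mule_ge0 // out_ge0.
- by apply: measurable_FK_path => //; exact: measurable_out.
- apply: measurable_funeM; apply: emeasurable_funM; first exact: measurable_exp_occ_path.
  by apply: measurable_value_at_path.
move=> p _; rewrite [leRHS]muleCA; apply: (@le_trans _ _ (expeR (occ vneg x h p) * out (one_sum k) (x + p h)%R)).
  by apply: lee_wpmul2r; [exact: out_ge0|exact: MF_le].
apply: lee_wpmul2l; first exact: expeR_ge0.
have [By|By] := pselect (B (x + p h)%R); last by rewrite (out_ballE By); exact: IH.
rewrite (in_ballE By); apply: mule_ge0; last exact: u0.
by rewrite lee_fin ler0n.
Qed.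

Variables (m : R) (m0 : (0 <= m)%R).

Definition vexc y : R := Num.max (vpos y - m)%R 0%R.

Lemma vexc_ge0 y : (0 <= vexc y)%R. Proof. by rewrite le_max lexx orbT. Qed.

Lemma measurable_vexc : measurable_fun setT vexc.
Proof. by apply: measurable_maxr => //; exact: measurable_funB. Qed.

Hint Resolve vexc_ge0 measurable_vexc : core.

Lemma occ_vpos_le x p : occ vpos x h p <= (m * h)%:E + occ vexc x h p.
Proof.
apply: (@le_trans _ _ (occ (fun y => m + vexc y)%R x h p)).
  apply: le_occ => //; first exact: measurable_funD.
  by move=> y; rewrite -lerBlDl le_max lexx.
rewrite (occD (g := fun=> m)) // leeD2r //.
exact: (occ_le_bound (g := fun=> m)).
Qed.

(** A bound for the loss when the weight is dropped on one step: the positive part of [V] is at most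
    [m] plus its excess over [m], and the excess on one step is at most that on all of [0, t]. *)
Definition osc t x p : \bar R :=
  expeR (occ vneg x t p) * mine 1 ((m * h)%:E + occ vexc x t p).

Lemma osc_ge0 t x p : 0 <= osc t x p.
Proof.
rewrite mule_ge0 ?expeR_ge0 // le_min; apply/andP; split => //.
by rewrite adde_ge0 ?occ_ge0 // lee_fin mulr_ge0.
Qed.

Lemma measurable_osc t : measurable_fun setT (fun u : 'rV[R]_d * cpath R d => osc t u.1 u.2).
Proof.
apply: emeasurable_funM; first exact: measurable_exp_occ.
apply: measurable_mine => //; apply: emeasurable_funD => //; exact: measurable_occ.
Qed.

Lemma measurable_osc_path t x : measurable_fun setT (osc t x).
Proof. exact: (measurableT_comp (measurable_osc t) (pair1_measurable x)). Qed.

(** The two sums differ on a single step of each path, the one that enters the ball. Hence the loss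
    is one expectation of [osc], not multiplied by the number of steps. *)
Lemma hit_sum'_le k x : hit_sum' k x <= hit_sum k x + \int[PP]_p osc (k%:R * h) x p.
Proof.
elim: k x => [|k IH] x.
  by rewrite /hit_sum' /hit_sum !vfun0 add0e; apply: integral_ge0 => p _; exact: osc_ge0.
have k0 : (0 <= k%:R * h)%R by rewrite mulr_ge0.
have kh : (k.+1%:R * h = h + k%:R * h)%R by rewrite -natr1 mulrDl mul1r addrC.
rewrite /hit_sum' /hit_sum !vfunS -/hit_sum -/hit_sum'.
pose D y := \int[PP]_q osc (k%:R * h) y q.
have D0 y : 0 <= D y by apply: integral_ge0 => q _; exact: osc_ge0.
have mD : measurable_fun setT D.
  apply: (measurable_value PP (Phi := osc (k%:R * h))); first exact: measurable_osc.
  by move=> y q; exact: osc_ge0.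
have mo g : measurable_fun setT g -> measurable_fun setT (out g) by exact: measurable_out.
have oo g y : (forall z, 0 <= g z) -> 0 <= out g y by exact: out_ge0.
apply: (@le_trans _ _ (ball_prob x + (FK h (out (hit_sum k)) x + FK h (out D) x))).
  apply: leeD2l; rewrite -FKD //; [|exact: mo|by move=> y; exact: oo|exact: mo|by move=> y; exact: oo].
  apply: le_FK => //; [exact: mo|by move=> y; exact: oo|by apply: emeasurable_funD; exact: mo|].
  move=> y; have [By|By] := pselect (B y); first by rewrite !(in_ballE By) adde0.
  by rewrite !(out_ballE By); exact: IH.
rewrite [leLHS]addeCA -[leRHS]addeA [leRHS]addeCA; apply: leeD2l.
set J := \int[PP]_p osc _ x p.
suff : ball_prob x + FK h (out D) x <= FK h ind_ball x + J.
  by [].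
rewrite /J kh (markov HPP h0 (measurable_osc_path _ x)); last by move=> p; exact: osc_ge0.
have mJ : measurable_fun setT (fun p => \int[PP]_q osc (h + k%:R * h) x (cat_path h p q)).
  apply: (measurable_tonelli PP (f := fun p q => osc (h + k%:R * h) x (cat_path h p q))).
    exact: (measurableT_comp (measurable_osc_path _ x) (measurable_cat_path h)).
  by move=> p q; exact: osc_ge0.
have J0 p : 0 <= \int[PP]_q osc (h + k%:R * h) x (cat_path h p q).
  by apply: integral_ge0 => q _; exact: osc_ge0.
have mi : measurable_fun setT (fun p : cpath R d => ind_ball (x + p h)%R).
  exact: measurable_value_at_path.
have A0 p : 0 <= MF x h p * out D (x + p h)%R by rewrite mule_ge0 // oo.
have mA : measurable_fun setT (fun p => MF x h p * out D (x + p h)%R).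
  by apply: measurable_FK_path => //; exact: mo.
have B0 p : 0 <= MF x h p * ind_ball (x + p h)%R by rewrite mule_ge0.
have mB' : measurable_fun setT (fun p => MF x h p * ind_ball (x + p h)%R).
  exact: measurable_FK_path.
rewrite /ball_prob /FK -!ge0_integralD //.
apply: ge0_le_integral => //.
- by move=> p _; exact: adde_ge0.
- exact: emeasurable_funD.
- exact: emeasurable_funD.
move=> p _; set y := (x + p h)%R.
have [By|By] := pselect (B y).
  rewrite !(in_ballE By) mule0 adde0 mule1.
  set a := (m * h)%:E + occ vexc x h p.
  have a0 : 0 <= a by rewrite adde_ge0 ?occ_ge0 // lee_fin mulr_ge0.
  have J1 : mine 1 a <= \int[PP]_q osc (h + k%:R * h) x (cat_path h p q).
    rewrite -(integral_prob_cst PP (mine 1 a)); apply: ge0_le_integral => //.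
    - by move=> q _; rewrite le_min a0 lee_fin ler01.
    - apply: (measurableT_comp (measurable_osc_path _ x)).
      exact: (measurableT_comp (measurable_cat_path h) (pair1_measurable p)).
    move=> q _; rewrite /osc -[leLHS]mul1e; apply: lee_pmul => //.
    - by rewrite le_min a0 lee_fin ler01.
    - by rewrite -(@expeR0 R) lee_expeR occ_ge0.
    rewrite le_min ge_min lexx /= ge_min; apply/orP; right.
    by rewrite leeD2l // occ_cat // leeDl // occ_ge0.
  apply: le_trans (leeD2l _ J1).
  have M1 : 1 - a <= MF x h p.
    apply: (@le_trans _ _ (expeR (- a))); first exact: expeR_ge1Dx.
    rewrite -[leLHS]mule1; apply: lee_pmul; rewrite ?expeR_ge0 //.
      by rewrite lee_expeR leeN2; exact: occ_vpos_le.
    by rewrite -(@expeR0 R) lee_expeR occ_ge0.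
  have [a1|a1] := leP 1 a; first by rewrite leeDr.
  have afin : a \is a fin_num by rewrite ge0_fin_numE // (lt_trans a1) // ltry.
  by rewrite -leeBlDr.
rewrite !(out_ballE By) mule0 !add0e.
apply: (@le_trans _ _ (expeR (occ vneg x h p) * D y)).
  by apply: lee_wpmul2r => //; exact: MF_le.
rewrite -ge0_integralZl ?expeR_ge0 //; last 2 first.
- exact: measurable_osc_path.
- by move=> q _; exact: osc_ge0.
apply: ge0_le_integral => //.
- by move=> q _; rewrite mule_ge0 ?expeR_ge0 // osc_ge0.
- by apply: measurable_funeM; exact: measurable_osc_path.
- apply: (measurableT_comp (measurable_osc_path _ x)).
  exact: (measurableT_comp (measurable_cat_path h) (pair1_measurable p)).
move=> q _; rewrite /osc muleA -expeRD -occ_cat //.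
apply: lee_wpmul2l; first exact: expeR_ge0.
rewrite le_min ge_min lexx /= ge_min; apply/orP; right.
by rewrite leeD2l // occ_cat // leeDr // occ_ge0.
Qed.

End killed_in_ball.

End feynman_kac_paths.

Section closed_events.
Context {R : realType} {d : nat}.
Implicit Types (x y : 'rV[R]_d) (p q : cpath R d) (s t h : R).
Variable f : 'rV[R]_d -> R.
Hypotheses (cf : continuous f) (mf : measurable_fun setT f).

(** Half open in time: a violation before [t] is, by right continuity, seen at a dyadic time still
    before [t], which makes the event a countable intersection. *)
Definition staying t : set ('rV[R]_d * cpath R d) :=
  [set u : 'rV[R]_d * cpath R d | forall s, 0 <= s -> s < t -> 0 <= f (u.1 + u.2 s)].

Lemma stay_dense t x p : 0 < t ->
  (forall n k, (k < 2 ^ n)%N -> 0 <= f (x + p (grid t n k))) ->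
  forall s, 0 <= s -> s < t -> 0 <= f (x + p s).
Proof.
move=> t0 H s s0 st; rewrite leNgt; apply/negP => neg.
have cp : p (dyup t n s) @[n --> \oo] --> p s.
  by apply: rV_cvg => i; exact: cpath_dyup_cvg.
have cx : (x + p (dyup t n s)) @[n --> \oo] --> x + p s.
  by apply: cvgD => //; exact: cvg_cst.
have cfx : f (x + p (dyup t n s)) @[n --> \oo] --> f (x + p s).
  by apply: (cvg_comp _ _ cx); exact: cf.
have [n _ Hn] : \forall n \near \oo, f (x + p (dyup t n s)) < 0 /\ dyup t n s < t.
  near=> n; split; near: n; first exact: (cvgr_lt _ cfx).
  exact: (cvgr_lt _ (dyup_cvg t0 s0)).
have [fn dn] := Hn n (leqnn n); move: fn; rewrite ltNge => /negP; apply.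
apply: H; rewrite -(ltr_nat R) natrX.
by move: dn; rewrite /dyup /grid ltr_pdivrMr ?exprn_gt0 // ltr_pM2l.
Unshelve. all: end_near. Qed.

Lemma stayingE t : 0 < t -> staying t = \bigcap_n \bigcap_(k in `I_(2 ^ n))
  [set u : 'rV[R]_d * cpath R d | 0 <= f (u.1 + u.2 (grid t n k))].
Proof.
move=> t0; apply/seteqP; split => [[x p] H n _ k /= kn|[x p] H s s0 st].
  apply: H; first exact/grid_ge0/ltW.
  rewrite /grid ltr_pdivrMr ?exprn_gt0 // ltr_pM2l //.
  by rewrite -natrX ltr_nat.
by apply: (stay_dense t0) => // n k kn; exact: (H n I k kn).
Qed.

Lemma measurable_staying t : 0 < t -> measurable (staying t).
Proof.
move=> t0; rewrite stayingE //; apply: bigcapT_measurable => n.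
apply: bigcap_measurableType => k _; rewrite -[X in measurable X]setTI.
have g0 : 0 <= grid t n k by exact/grid_ge0/ltW.
have mg := measurableT_comp mf (measurable_eval_fun (R := R) (d := d) g0).
have -> : [set u : 'rV[R]_d * cpath R d | 0 <= f (u.1 + u.2 (grid t n k))] =
   (fun u : 'rV[R]_d * cpath R d => f (u.1 + u.2 (grid t n k))) @^-1` `[0%R, +oo[%classic.
  by apply/seteqP; split => u /=; rewrite in_itv /= andbT.
exact: mg.
Qed.

End closed_events.

Lemma notin_eball (R : realType) (d : nat) (r : R) (y : 'rV[R]_d) :
  ~ eball 0 r y <-> 0 <= enorm y - r.
Proof.
rewrite /eball /= subr0 subr_ge0; split => [/negP|h]; first by rewrite -leNgt.
by apply/negP; rewrite -leNgt.
Qed.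

Section occupation_bounds.
Context {R : realType} {d : nat}.
Implicit Types (x y : 'rV[R]_d) (p : cpath R d) (s t : R) (g : 'rV[R]_d -> R).
Local Open Scope ereal_scope.

(** The right end point is a null set; events such as [staying] give no information at time [t]. *)
Lemma occ_itvco g x t p : measurable_fun setT g ->
  occ g x t p = \int[@lebesgue_measure R]_(s in `[0%R, t[) (g (x + p (Num.max 0 s))%R)%:E.
Proof.
move=> mg; rewrite occE integral_itv_bndo_bndc //.
by apply: measurable_funTS; exact: measurable_along.
Qed.

Lemma occ_ge g x t p (c : R) : measurable_fun setT g -> (forall y, 0 <= g y)%R ->
  (0 <= c)%R -> (0 <= t)%R -> (forall s, 0 <= s -> s < t -> c <= g (x + p s))%R ->
  (c * t)%:E <= occ g x t p.
Proof.
move=> mg g0 c0 t0 H; rewrite occ_itvco //.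
apply: (@le_trans _ _ (\int[@lebesgue_measure R]_(s in `[0%R, t[) (cst c%:E s))).
  rewrite integral_cst //= lebesgue_measure_itv /= lte_fin.
  case: ltP => [_|t0']; first by rewrite -EFinD subr0 -EFinM.
  by rewrite mule0 lee_fin mulr_ge0_le0.
apply: ge0_le_integral => //.
- by apply: measurable_funTS; exact: measurable_along.
- move=> s; rewrite /= in_itv /= => /andP[s0 st]; rewrite lee_fin.
  have -> : Num.max 0%R s = s by exact: max_r.
  exact: H.
Qed.

Lemma occ_eq0 g x t p : measurable_fun setT g ->
  (forall s, 0 <= s -> s < t -> g (x + p s) = 0)%R -> occ g x t p = 0.
Proof.
move=> mg H; rewrite occ_itvco //; apply: integral0_eq => s.
rewrite /= in_itv /= => /andP[s0 st].
have -> : Num.max 0%R s = s by exact: max_r.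
by rewrite H.
Qed.

Lemma occ_mean_le (PP : probability (cpath R d) R) g x t (c : R) :
  measurable_fun setT g -> (forall y, 0 <= g y)%R -> (0 <= c)%R -> (0 <= t)%R ->
  (forall s, (0 <= s <= t)%R -> \int[PP]_p (g (x + p s)%R)%:E <= c%:E) ->
  \int[PP]_p occ g x t p <= (c * t)%:E.
Proof.
move=> mg g0 c0 t0 H.
pose f p s := (\1_(`[0%R, t]%classic : set R) s * g (x + p (Num.max 0 s)))%:E.
have f0 p s : 0 <= f p s by rewrite lee_fin mulr_ge0.
have mf : measurable_fun setT (fun u : cpath R d * R => f u.1 u.2).
  apply/measurable_EFinP; apply: measurable_funM.
    by apply: (measurableT_comp _ measurable_snd); exact: measurable_indic.
  apply: (measurableT_comp mg); apply: measurable_rVD => //.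
  exact: (measurableT_comp measurable_cpath_joint (@measurable_swap _ _ _ _)).
have -> : \int[PP]_p occ g x t p = \int[PP]_p \int[@lebesgue_measure R]_s f p s.
  apply: eq_integral => p _; rewrite occE integral_mkcond; apply: eq_integral => s _.
  rewrite patchE /f indicE; case: (_ \in _); first by rewrite mul1r.
  by rewrite mul0r.
rewrite (tonelli_swap PP (@lebesgue_measure R) mf f0).
apply: (@le_trans _ _ (\int[@lebesgue_measure R]_(s in `[0%R, t]) (cst c%:E s))).
  rewrite [leRHS]integral_mkcond; apply: ge0_le_integral => //.
  - by move=> s _; exact: integral_ge0.
  - apply: (measurable_tonelli PP (f := fun s p => f p s)) => //.
    exact: (measurableT_comp mf (@measurable_swap _ _ _ _)).
  - by apply/measurable_restrict => //; exact: measurable_funTS.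
  move=> s _; rewrite patchE /f indicE.
  case: ifPn => [/set_mem|_]; last by rewrite integral0_eq // => p _; rewrite mul0r.
  rewrite /= in_itv /= => /andP[s0 st].
  have -> : Num.max 0%R s = s by exact: max_r.
  by under eq_integral do rewrite mul1r; apply: H; rewrite s0.
rewrite integral_cst //= lebesgue_measure_itv /= lte_fin.
case: ltP => [_|t0']; first by rewrite -EFinD subr0 -EFinM.
by rewrite mule0 lee_fin mulr_ge0.
Qed.

End occupation_bounds.

(** * Paths that avoid a ball *)

Section survival.
Context {R : realType} {d : nat}.
Variable PP : probability (cpath R d) R.
Hypothesis HPP : levy_law PP.
Variable V : 'rV[R]_d -> R.
Hypothesis mV : measurable_fun setT V.
Variable r : R.
Implicit Types (x y : 'rV[R]_d) (p q : cpath R d) (s t h : R).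
Implicit Types f g : 'rV[R]_d -> \bar R.
Local Open Scope ereal_scope.
Let B : set 'rV[R]_d := eball 0 r.
Local Notation FKV := (FK PP V).
Local Notation MFV := (MF V).
Local Notation vp := (vpos V).
Local Notation vn := (vneg V).
Local Notation outr := (out r).

Let mvpos : measurable_fun setT vp. Proof. exact: measurable_vpos. Qed.
Let mvneg : measurable_fun setT vn. Proof. exact: measurable_vneg. Qed.
Let vpos0 y : (0 <= vp y)%R. Proof. exact: vpos_ge0. Qed.
Let MF_ge0' x t p : 0 <= MFV x t p. Proof. exact: MF_ge0. Qed.

Definition avoid t : set ('rV[R]_d * cpath R d) := staying (fun y => enorm y - r)%R t.

Lemma measurable_avoid t : (0 < t)%R -> measurable (avoid t).
Proof.
apply: measurable_staying.
  move=> y; have cy : enorm z @[z --> y] --> enorm y by exact: (@continuous_enorm R d).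
  by apply: (cvgB cy); exact: cvg_cst.
by apply: measurable_funB => //; exact: measurable_enorm.
Qed.

Definition avoid_ind t x p : \bar R := (\1_(avoid t) (x, p))%:E.

Lemma avoid_ind_ge0 t x p : 0 <= avoid_ind t x p.
Proof. by rewrite lee_fin. Qed.

Lemma measurable_avoid_ind t : (0 < t)%R ->
  measurable_fun setT (fun u : 'rV[R]_d * cpath R d => avoid_ind t u.1 u.2).
Proof.
move=> t0; have -> : (fun u : 'rV[R]_d * cpath R d => avoid_ind t u.1 u.2) =
   EFin \o \1_(avoid t) by apply/funext => -[x p].
by apply/measurable_EFinP; apply: measurable_indic; exact: measurable_avoid.
Qed.

Definition survival t x : \bar R := \int[PP]_p (MFV x t p * avoid_ind t x p).

Lemma survival_ge0 t x : 0 <= survival t x.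
Proof. by apply: integral_ge0 => p _; rewrite mule_ge0 // avoid_ind_ge0. Qed.

Lemma measurable_survival_integrand t : (0 < t)%R ->
  measurable_fun setT (fun u : 'rV[R]_d * cpath R d => MFV u.1 t u.2 * avoid_ind t u.1 u.2).
Proof.
move=> t0; apply: emeasurable_funM; first exact: measurable_MF.
exact: measurable_avoid_ind.
Qed.

Lemma measurable_survival_path t x : (0 < t)%R ->
  measurable_fun setT (fun p => MFV x t p * avoid_ind t x p).
Proof.
move=> t0; exact: (measurableT_comp (measurable_survival_integrand t0) (pair1_measurable x)).
Qed.

Lemma measurable_survival t : (0 < t)%R -> measurable_fun setT (survival t).
Proof.
move=> t0; apply: (measurable_value PP (Phi := fun x p => MFV x t p * avoid_ind t x p)).
  exact: measurable_survival_integrand.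
by move=> x p; rewrite mule_ge0 // avoid_ind_ge0.
Qed.

Lemma survival_cat s t x : (0 < s)%R -> (0 < t)%R ->
  survival (s + t) x <= FKV s (outr (survival t)) x.
Proof.
move=> s0 t0; have st0 : (0 < s + t)%R by rewrite addr_gt0.
have s0' := ltW s0; have t0' := ltW t0.
rewrite /survival (markov HPP s0 (measurable_survival_path x st0)); last first.
  by move=> p; rewrite mule_ge0 // avoid_ind_ge0.
apply: ge0_le_integral => //.
- by move=> p _; apply: integral_ge0 => q _; rewrite mule_ge0 // avoid_ind_ge0.
- apply: (measurable_tonelli PP (f := fun p q => MFV x (s + t) (cat_path s p q) *
    avoid_ind (s + t) x (cat_path s p q))).
    exact: (measurableT_comp (measurable_survival_path x st0) (measurable_cat_path s)).
  by move=> p q; rewrite mule_ge0 // avoid_ind_ge0.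
- by apply: measurable_FK_path => //; apply: measurable_out; exact: measurable_survival.
move=> p _; have avc q : avoid (s + t) (x, cat_path s p q) ->
    ~ B (x + p s)%R /\ avoid t ((x + p s)%R, q).
  move=> av; split.
    apply/notin_eball; have := av s s0'; rewrite /= ltrDl => /(_ t0).
    by rewrite -/(cat_path s p q s) -[cat_fun _ p q s]/(cat_path s p q s) cat_pathl.
  move=> u u0 ut /=; have := av (s + u)%R; rewrite addr_ge0 // ltrD2l => /(_ isT ut) /=.
  by rewrite -[cat_fun _ p q _]/(cat_path s p q (s + u)%R) cat_pathr // addrA.
apply: (@le_trans _ _ (\int[PP]_q (MFV x s p * outr (fun y => MFV y t q * avoid_ind t y q) (x + p s)%R))).
  apply: ge0_le_integral => //.
  - by move=> q _; rewrite mule_ge0 // avoid_ind_ge0.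
  - apply: (measurableT_comp (measurable_survival_path x st0)).
    exact: (measurableT_comp (measurable_cat_path s) (pair1_measurable p)).
  - apply: measurable_funeM; apply: emeasurable_funM => //.
    exact: measurable_survival_path.
  move=> q _; rewrite MF_cat // -muleA; apply: lee_wpmul2l => //.
  have [av|av] := pselect (avoid (s + t) (x, cat_path s p q)).
    have [nB av'] := avc q av; rewrite (out_ballE nB).
    by rewrite /avoid_ind !indicE !mem_set.
  by rewrite /avoid_ind indicE memNset // mule0 out_ge0 // => y; rewrite mule_ge0 // avoid_ind_ge0.
rewrite ge0_integralZl //; last 2 first.
- apply: emeasurable_funM => //; exact: measurable_survival_path.
- by move=> q _; apply: out_ge0 => y; rewrite mule_ge0 // avoid_ind_ge0.
apply: lee_wpmul2l => //; rewrite /out ge0_integralZl //.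
- exact: measurable_survival_path.
- by move=> q _; rewrite mule_ge0 // avoid_ind_ge0.
Qed.

Section profile_bound.
Variables (w : 'rV[R]_d -> R) (tau Cw : R).
Hypotheses (mw : measurable_fun setT w) (w0 : forall y, (0 <= w y)%R).
Hypotheses (tau0 : (0 < tau)%R) (Cw0 : (0 <= Cw)%R).
Hypothesis heat : forall s x, (0 <= s <= tau)%R ->
  \int[PP]_p (w (x + p s))%:E <= (Cw * w x)%:E.
Hypothesis V_ge0 : forall y, ~ B y -> (0 <= V y)%R.
Hypothesis V_big : forall y, ~ B y -> (expR (- (tau * V y)) <= w y)%R.

(* Jensen's inequality for the exponential of the average of [- tau * V] over
   [0, tau], through the tangent line of [expR] at the average. *)
Lemma survival_path_le t x p : (tau <= t)%R -> avoid t (x, p) ->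
  tau%:E * MFV x t p <= occ w x tau p.
Proof.
move=> taut av.
have nB s : (0 <= s -> s < t -> ~ B (x + p s))%R.
  by move=> s0 st; apply/notin_eball; exact: av.
have n0 : occ vn x t p = 0.
  apply: occ_eq0 => // s s0 st; rewrite /vneg max_r //.
  by rewrite oppr_le0; apply: V_ge0; exact: nB.
have oI : occ vp x tau p <= occ vp x t p by exact: occ_le.
have M1 : MFV x t p <= expeR (- occ vp x tau p).
  by rewrite /MF n0 expeR0 mule1 lee_expeR leeN2.
apply: (@le_trans _ _ (tau%:E * expeR (- occ vp x tau p))).
  by apply: lee_wpmul2l => //; rewrite lee_fin ltW.
have [E|] := eqVneq (occ vp x tau p) +oo.
  by rewrite E /= mule0; exact: occ_ge0.
rewrite -ltey => Ifin.
have I0 := occ_ge0 vpos0 x tau p.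
have IE : occ vp x tau p \is a fin_num by rewrite ge0_fin_numE.
rewrite -(fineK IE) in I0 *; set J := fine _ in I0 *; rewrite lee_fin in I0.
set k := (expR (- J) * tau)%R.
have k0 : (0 <= k)%R by rewrite mulr_ge0 ?expR_ge0 // ltW.
have mkv : measurable_fun setT (fun y => k * vp y)%R by exact: measurable_funM.
have H : (expR (- J) * (1 + J) * tau)%:E <= occ (fun y => w y + k * vp y)%R x tau p.
  apply: occ_ge => //.
  - exact: measurable_funD.
  - by move=> y; rewrite addr_ge0 // mulr_ge0.
  - by rewrite mulr_ge0 ?expR_ge0 // addr_ge0.
  - exact: ltW.
  move=> s s0 st; have st' : (s < t)%R by exact: lt_le_trans taut.
  have vE : vp (x + p s)%R = V (x + p s)%R by apply: max_l; exact/V_ge0/nB.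
  rewrite vE; have := V_big (nB s s0 st'); set v := V _ => wv.
  have e1 : (expR (- J) * (1 + (J - tau * v)) <= expR (- (tau * v)))%R.
    have -> : expR (- (tau * v)) = (expR (- J) * expR (J - tau * v))%R.
      by rewrite -expRD; congr expR; ring.
    by rewrite ler_pM2l ?expR_gt0 // expR_ge1Dx.
  rewrite -lerBlDr; apply: le_trans wv; apply: le_trans e1.
  by rewrite le_eqVlt; apply/orP; left; apply/eqP; rewrite /k; ring.
rewrite occD // in H; last by move=> y; rewrite mulr_ge0.
rewrite occZ // -(fineK IE) -/J -EFinM -leeBlDr // in H.
rewrite -EFinB in H; apply: le_trans H; rewrite -[expeR _]/((expR (- J))%:E) -EFinM lee_fin.
by rewrite le_eqVlt; apply/orP; left; apply/eqP; rewrite /k; ring.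
Qed.

(** The pathwise bound involves the average of [w] over the times in [0, tau]; its mean is
    controlled at every one of these times by the heat bound. *)
Lemma survival_le t x : (tau <= t)%R -> survival t x <= (Cw * w x)%:E.
Proof.
move=> taut; have t0 : (0 < t)%R by exact: lt_le_trans taut.
have H : \int[PP]_p (tau%:E * (MFV x t p * avoid_ind t x p)) <= (Cw * w x * tau)%:E.
  apply: (@le_trans _ _ (\int[PP]_p occ w x tau p)).
    apply: ge0_le_integral => //.
    - move=> p _; apply: mule_ge0; first by rewrite lee_fin ltW.
      by apply: mule_ge0 => //; exact: avoid_ind_ge0.
    - by apply: measurable_funeM; exact: measurable_survival_path.
    - exact: measurable_occ_path.
    move=> p _; have [av|av] := pselect (avoid t (x, p)).
      by rewrite /avoid_ind indicE mem_set // mule1; exact: survival_path_le.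
    by rewrite /avoid_ind indicE memNset // !mule0; exact: occ_ge0.
  apply: occ_mean_le => //; [by rewrite mulr_ge0|exact: ltW|].
  by move=> s hs; exact: heat.
rewrite ge0_integralZl // in H; last 3 first.
- exact: measurable_survival_path.
- by move=> p _; rewrite mule_ge0 // avoid_ind_ge0.
- by rewrite lee_fin ltW.
move: H; rewrite [(Cw * w x * tau)%R]mulrC [X in _ <= X]EFinM.
by rewrite lee_pmul2l.
Qed.

(** The window in which [survival_le] is applied may begin at any of the first [k] grid times, time
    0 included. Adding the [k] bounds produces the sum of [w] along the grid, which can be compared
    with a hitting probability. *)
Lemma survival_sum_le h t k x : (0 < h)%R -> (tau <= t)%R ->
  k%:R%:E * survival (k%:R * h + t) x <= Cw%:E * w_sum PP V r h w k x.
Proof.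
move=> h0 taut; have t0 : (0 < t)%R by exact: lt_le_trans taut.
have mEw : measurable_fun setT (EFin \o w) by exact/measurable_EFinP.
have mws j : measurable_fun setT (w_sum PP V r h w j).
  by apply: measurable_vfun.
have ws0 j y : 0 <= w_sum PP V r h w j y.
  by apply: vfun_ge0 => // z; rewrite lee_fin.
elim: k x => [|k IH] x; first by rewrite mul0e mule_ge0 // lee_fin.
have kt0 : (0 < k%:R * h + t)%R by rewrite ltr_wpDl // mulr_ge0 // ltW.
have -> : (k.+1%:R * h + t = h + (k%:R * h + t))%R by rewrite -natr1; ring.
rewrite -natr1 EFinD ge0_muleDl ?lee_fin // mul1e /w_sum vfunS -/(w_sum PP V r h w k).
rewrite [Cw%:E * (_ + _)]ge0_muleDr; last 2 first.
- by rewrite lee_fin.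
- by apply: FK_ge0 => y; exact: out_ge0.
rewrite addeC; apply: leeD.
  rewrite -EFinM; apply: survival_le; apply: (le_trans taut).
  by rewrite addrA lerDr addr_ge0 ?mulr_ge0 // ltW.
apply: (@le_trans _ _ (k%:R%:E * FKV h (outr (survival (k%:R * h + t))) x)).
  by apply: lee_wpmul2l; [rewrite lee_fin|exact: survival_cat].
have h0' := ltW h0.
have so0 y : 0 <= outr (survival (k%:R * h + t)) y.
  by apply: out_ge0 => z; exact: survival_ge0.
have mso : measurable_fun setT (outr (survival (k%:R * h + t))).
  by apply: measurable_out; exact: measurable_survival.
have wo0 y : 0 <= outr (w_sum PP V r h w k) y by exact: out_ge0.
have mwo : measurable_fun setT (outr (w_sum PP V r h w k)) by exact: measurable_out.
rewrite -!FKZ //.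
apply: le_FK => //.
- exact: measurable_funeM.
- by move=> y; rewrite mule_ge0 // lee_fin.
- exact: measurable_funeM.
move=> y; have [By|By] := pselect (B y).
  by rewrite !(in_ballE By) !mule0.
by rewrite !(out_ballE By); exact: IH.
Qed.

End profile_bound.

Section grid_survival.
Variable h : R.
Hypothesis h0 : (0 < h)%R.

(** Time 0 is left out, in accordance with [vfun], which tests the position only after a step. *)
Definition grid_avoid k : set ('rV[R]_d * cpath R d) :=
  [set u : 'rV[R]_d * cpath R d | forall j, (0 < j <= k)%N -> ~ B (u.1 + u.2 (j%:R * h))%R].

Lemma measurable_grid_avoid k : measurable (grid_avoid k).
Proof.
have -> : grid_avoid k = \bigcap_(j in [set j | (0 < j <= k)%N])
   [set u : 'rV[R]_d * cpath R d | ~ B (u.1 + u.2 (j%:R * h))%R] by [].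
apply: bigcap_measurableType => j _; rewrite -[X in measurable X]setTI.
have j0 : (0 <= j%:R * h)%R by rewrite mulr_ge0 // ltW.
have mC : measurable (~` B) by apply: measurableC; exact: measurable_eball.
exact: (measurable_eval_fun (R := R) (d := d) j0 measurableT mC).
Qed.

Definition grid_ind k x p : \bar R := (\1_(grid_avoid k) (x, p))%:E.

Lemma grid_ind_ge0 k x p : 0 <= grid_ind k x p.
Proof. by rewrite lee_fin. Qed.

Lemma measurable_grid_ind_path k x : measurable_fun setT (grid_ind k x).
Proof.
apply/measurable_EFinP.
have mI : measurable_fun setT (\1_(grid_avoid k) : 'rV[R]_d * cpath R d -> R).
  by apply: measurable_indic; exact: measurable_grid_avoid.
exact: (measurableT_comp mI (pair1_measurable x)).
Qed.

Lemma measurable_grid_path k t x : measurable_fun setT (fun p => MFV x t p * grid_ind k x p).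
Proof.
apply: emeasurable_funM; first exact: measurable_MF_path.
exact: measurable_grid_ind_path.
Qed.

Lemma grid_survival_le k x : vfun PP V r h (fun=> 0) (fun=> 1) k x <=
  \int[PP]_p (MFV x (k%:R * h) p * grid_ind k x p).
Proof.
elim: k x => [|k IH] x.
  rewrite vfun0 mul0r -[leLHS](integral_prob_cst PP 1); apply: ge0_le_integral => //.
    exact: measurable_grid_path.
  move=> p _; rewrite MF0 mul1e /grid_ind indicE mem_set // => j.
  by case: j.
have k0 : (0 <= k%:R * h)%R by rewrite mulr_ge0 // ltW.
have kh : (k.+1%:R * h = h + k%:R * h)%R by rewrite -natr1 mulrDl mul1r addrC.
have h0' := ltW h0.
rewrite vfunS add0e (markov HPP h0 (measurable_grid_path _ _ x)); last first.
  by move=> p; rewrite mule_ge0 // grid_ind_ge0.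
have v0 y : 0 <= vfun PP V r h (fun=> 0) (fun=> 1) k y by exact: vfun_ge0.
apply: ge0_le_integral => //.
- by move=> p _; apply: mule_ge0 => //; exact: out_ge0.
- apply: measurable_FK_path => //; apply: measurable_out.
  by apply: measurable_vfun.
- apply: (measurable_tonelli PP (f := fun p q => MFV x (k.+1%:R * h) (cat_path h p q) *
    grid_ind k.+1 x (cat_path h p q))).
    exact: (measurableT_comp (measurable_grid_path _ _ x) (measurable_cat_path h)).
  by move=> p q; rewrite mule_ge0 // grid_ind_ge0.
move=> p _; have [By|By] := pselect (B (x + p h)%R).
  rewrite (in_ballE By) mule0; apply: integral_ge0 => q _.
  by rewrite mule_ge0 // grid_ind_ge0.
rewrite (out_ballE By).
apply: (@le_trans _ _ (MFV x h p * \int[PP]_q (MFV (x + p h)%R (k%:R * h) q * grid_ind k (x + p h)%R q))).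
  by apply: lee_wpmul2l.
rewrite -ge0_integralZl //; last 2 first.
- exact: measurable_grid_path.
- by move=> q _; rewrite mule_ge0 // grid_ind_ge0.
apply: ge0_le_integral => //.
- move=> q _; apply: mule_ge0 => //; apply: mule_ge0 => //; exact: grid_ind_ge0.
- by apply: measurable_funeM; exact: measurable_grid_path.
- apply: (measurableT_comp (measurable_grid_path _ _ x)).
  exact: (measurableT_comp (measurable_cat_path h) (pair1_measurable p)).
move=> q _; rewrite kh MF_cat // -[leRHS]muleA; apply: lee_wpmul2l => //.
apply: lee_wpmul2l => //.
have [av|av] := pselect (grid_avoid k ((x + p h)%R, q)); last first.
  by rewrite {1}/grid_ind indicE memNset // grid_ind_ge0.
have av' : grid_avoid k.+1 (x, cat_path h p q).
  move=> [//|[|j]] /= jk.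
    by rewrite -[cat_fun _ p q _]/(cat_path h p q (1 * h)%R) mul1r cat_pathl.
  have jh : (j.+2%:R * h = h + j.+1%:R * h)%R by rewrite -natr1 mulrDl mul1r addrC.
  rewrite -[cat_fun _ p q _]/(cat_path h p q (j.+2%:R * h)%R) jh cat_pathr //.
    by rewrite addrA; exact: (av j.+1).
  by rewrite mulr_ge0.
by rewrite /grid_ind !indicE !mem_set.
Qed.

End grid_survival.

End survival.

Lemma exists_dyadic_step (R : realType) (t e : R) : 0 < t -> 0 < e ->
  exists n, t / 2 ^+ n.+1 <= e.
Proof.
move=> t0 e0; pose n := Num.truncn (t / e).
have q0 : 0 <= t / e by rewrite divr_ge0 // ltW.
have /andP[_ hn] := truncn_itv q0.
exists n; rewrite ler_pdivrMr ?exprn_gt0 // mulrC -ler_pdivrMr //.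
apply: (le_trans (ltW hn)); rewrite -natrX ler_nat; exact/ltnW/ltn_expl.
Qed.

Lemma cvg_integral_dom (R : realType) dT (T : measurableType dT)
    (mu : {measure set T -> \bar R}) (D : set T) (f_ : nat -> T -> \bar R) (f g : T -> \bar R) :
  measurable D -> (forall n, measurable_fun D (f_ n)) -> measurable_fun D f ->
  {ae mu, forall x, D x -> f_ n x @[n --> \oo] --> f x} -> mu.-integrable D g ->
  (forall n x, `|f_ n x| <= g x)%E ->
  (\int[mu]_(x in D) f_ n x)%E @[n --> \oo] --> (\int[mu]_(x in D) f x)%E.
Proof.
move=> mD mf_ mf cf ig dom.
by have [] := dominated_convergence mD mf_ mf cf ig (aeW _ (fun x n _ => dom n x)).
Qed.

(** * Domination of the semigroup by the ground state *)

Section domination_paths.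
Context {R : realType} {d : nat}.
Variable PP : probability (cpath R d) R.
Hypothesis HPP : levy_law PP.
Variable V : 'rV[R]_d -> R.
Hypothesis mV : measurable_fun setT V.
Implicit Types (x y : 'rV[R]_d) (p q : cpath R d) (s t h : R).
Local Open Scope ereal_scope.
Local Notation FKV := (FK PP V).
Local Notation MFV := (MF V).
Local Notation vp := (vpos V).
Local Notation vn := (vneg V).
Local Notation leb1 := (@lebesgue_measure R).

Let mvp : measurable_fun setT vp. Proof. exact: measurable_vpos. Qed.
Let mvn : measurable_fun setT vn. Proof. exact: measurable_vneg. Qed.
Let vp0 y : (0 <= vp y)%R. Proof. exact: vpos_ge0. Qed.
Let vn0 y : (0 <= vn y)%R. Proof. exact: vneg_ge0. Qed.
Let mexc m : measurable_fun setT (vexc V m). Proof. exact: measurable_vexc. Qed.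
Let exc0 m y : (0 <= vexc V m y)%R. Proof. exact: vexc_ge0. Qed.

Lemma occ_vexc_cvg x t p : occ vp x t p < +oo ->
  occ (vexc V m%:R) x t p @[m --> \oo] --> 0.
Proof.
move=> fin.
pose f m s := (vexc V m%:R (x + p (Num.max 0 s))%R)%:E.
pose g s := (vp (x + p (Num.max 0 s))%R)%:E.
have mf m : measurable_fun `[0%R, t] (f m).
  by apply: measurable_funTS; exact: measurable_along.
have ig : leb1.-integrable `[0%R, t] g.
  apply/integrableP; split; first by apply: measurable_funTS; exact: measurable_along.
  by under eq_integral do rewrite /g gee0_abs ?lee_fin //; rewrite -occE.
have cf s : f m s @[m --> \oo] --> (cst 0 s : \bar R).
  apply: cvg_near_cst; near=> m; rewrite /f /cst; congr EFin; rewrite /vexc max_r //.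
  rewrite subr_le0; near: m; exact: nbhs_infty_ger.
have H := @cvg_integral_dom R _ _ leb1 `[0%R, t]%classic f (cst 0) g.
have {}H : \int[leb1]_(s in `[0%R, t]) f m s @[m --> \oo] --> \int[leb1]_(s in `[0%R, t]) cst 0 s.
  apply: H => //; first by apply: aeW => s _; exact: cf.
  move=> m s; rewrite /f /g gee0_abs ?lee_fin // ge_max vp0 andbT.
  by rewrite lerBlDr lerDl.
by rewrite integral0 in H; under eq_fun do rewrite occE.
Unshelve. all: end_near. Qed.

Definition osc_tail m x t p : \bar R := expeR (occ vn x t p) * mine 1 (occ (vexc V m) x t p).

Lemma osc_tail_ge0 m x t p : 0 <= osc_tail m x t p.
Proof.
by rewrite mule_ge0 ?expeR_ge0 // le_min occ_ge0 // lee_fin ler01.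
Qed.

Lemma measurable_osc_tail m x t : measurable_fun setT (osc_tail m x t).
Proof.
apply: emeasurable_funM; first exact: measurable_exp_occ_path.
by apply: measurable_mine => //; exact: measurable_occ_path.
Qed.

Lemma exp_occ_integrable x t (K : R) : \int[PP]_p expeR (occ vn x t p) <= K%:E ->
  PP.-integrable setT (fun p => expeR (occ vn x t p)).
Proof.
move=> HK; apply/integrableP; split; first exact: measurable_exp_occ_path.
under eq_integral do rewrite gee0_abs ?expeR_ge0 //.
by apply: (le_lt_trans HK); exact: ltry.
Qed.

(** Dominated convergence in [m], with the exponential moment of the negative part as majorant.
    Thanks to the minimum with 1, almost sure finiteness of the positive occupation is enough. *)
Lemma osc_tail_small x t (K e : R) : \int[PP]_p expeR (occ vn x t p) <= K%:E ->
  {ae PP, forall p, occ vp x t p < +oo} -> (0 < e)%R ->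
  exists m : nat, \int[PP]_p osc_tail m%:R x t p <= e%:E.
Proof.
move=> HK fin e0; have ig := exp_occ_integrable HK.
have cv : \int[PP]_p osc_tail m%:R x t p @[m --> \oo] --> 0.
  have aecv : {ae PP, forall p, setT p -> osc_tail m%:R x t p @[m --> \oo] --> (cst 0 p : \bar R)}.
    have aefin := integrable_ae measurableT ig.
    apply: filterS2 fin aefin => p fp ep _.
    have {}ep := ep I.
    apply: (@squeeze_cvge _ _ _ _ (cst 0) _ (fun m => expeR (occ vn x t p) * occ (vexc V m%:R) x t p)).
    - apply: nearW => m; rewrite osc_tail_ge0 /=; apply: lee_wpmul2l; first exact: expeR_ge0.
      by rewrite ge_min lexx orbT.
    - exact: cvg_cst.
    - by rewrite -[X in _ --> X](mule0 (expeR (occ vn x t p))); apply: cvgeZl => //; exact: occ_vexc_cvg.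
  rewrite -[X in _ --> X](integral0 PP setT).
  apply: (cvg_integral_dom (g := fun p => expeR (occ vn x t p))) => //.
    by move=> m; exact: measurable_osc_tail.
  move=> m p; rewrite gee0_abs ?osc_tail_ge0 // -[leRHS]mule1.
  by apply: lee_wpmul2l; [exact: expeR_ge0|rewrite ge_min lexx].
have /fine_cvgP[fin0 cv0] := cv.
have [m _ Hm] : \forall m \near \oo, (\int[PP]_p osc_tail m%:R x t p \is a fin_num) /\
   (fine (\int[PP]_p osc_tail m%:R x t p) < e)%R.
  near=> m; split; near: m => //; exact: (cvgr_lt _ cv0).
have [f1 f2] := Hm m (leqnn m).
by exists m; rewrite -(fineK f1) lee_fin ltW.
Unshelve. all: end_near. Qed.

(** min(1, a + u) <= a + min(1, u): the part due to the level [m] is proportional to [h]. *)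
Lemma osc_le_tail m h t x (K : R) : (0 < h)%R -> \int[PP]_p expeR (occ vn x t p) <= K%:E ->
  \int[PP]_p osc V h m%:R t x p <= (m%:R * h * K)%:E + \int[PP]_p osc_tail m%:R x t p.
Proof.
move=> h0 HK.
have mh0 : (0 <= m%:R * h)%R by rewrite mulr_ge0 // ltW.
apply: (@le_trans _ _ (\int[PP]_p ((m%:R * h)%:E * expeR (occ vn x t p) + osc_tail m%:R x t p))).
  apply: ge0_le_integral => //.
  - by move=> p _; apply: osc_ge0.
  - exact: measurable_osc_path.
  - apply: emeasurable_funD; last exact: measurable_osc_tail.
    by apply: measurable_funeM; exact: measurable_exp_occ_path.
  move=> p _; rewrite /osc /osc_tail [_%:E * expeR _]muleC -ge0_muleDr; last 2 first.
  - by rewrite lee_fin.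
  - by rewrite le_min occ_ge0 // lee_fin ler01.
  apply: lee_wpmul2l; first exact: expeR_ge0.
  have [q1|q1] := leP 1 (occ (vexc V m%:R) x t p).
    by apply: (@le_trans _ _ 1); [rewrite ge_min lexx|rewrite leeDr // lee_fin].
  by rewrite ge_min lexx orbT.
rewrite ge0_integralD //; last 4 first.
- by move=> p _; rewrite mule_ge0 ?expeR_ge0 // lee_fin.
- by apply: measurable_funeM; exact: measurable_exp_occ_path.
- by move=> p _; exact: osc_tail_ge0.
- exact: measurable_osc_tail.
rewrite leeD2r // ge0_integralZl //; last 2 first.
- exact: measurable_exp_occ_path.
- by move=> p _; exact: expeR_ge0.
by rewrite [leRHS]EFinM; apply: lee_wpmul2l; rewrite ?lee_fin.
Qed.

Variables (r t0 : R).
Hypothesis t0_gt0 : (0 < t0)%R.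
Let B : set 'rV[R]_d := eball 0 r.

Lemma grid_step j n : (j%:R * (t0 / 2 ^+ n) = grid t0 n j)%R.
Proof. by rewrite /grid mulrCA mulrA. Qed.

(** The events of avoiding the ball along dyadic grids decrease to that of avoiding it at all times
    before [t0], so a bound along every grid passes to the limit. Time 0 is settled by the position
    of [x]. *)
Lemma FK1_le_survival x (K D : R) : ~ B x -> \int[PP]_p expeR (occ vn x t0 p) <= K%:E ->
  (0 <= D)%R ->
  (forall n, FKV t0 (fun=> 1) x <=
    \int[PP]_p (MFV x t0 p * grid_ind r (t0 / 2 ^+ n) (2 ^ n) x p) + D%:E) ->
  FKV t0 (fun=> 1) x <= survival PP V r t0 x + D%:E.
Proof.
move=> Bx HK D0 H.
have st0 n : (0 < t0 / 2 ^+ n)%R by rewrite divr_gt0 // exprn_gt0.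
pose S n : set (cpath R d) := [set p | grid_avoid r (t0 / 2 ^+ n) (2 ^ n) (x, p)].
have SS n : S n.+1 `<=` S n.
  move=> p Sp j /andP[j0 jn] /=; rewrite grid_step gridS -grid_step.
  by apply: Sp; rewrite double_gt0 j0 expnS mul2n leq_double.
have SS' n m : (n <= m)%N -> S m `<=` S n.
  move=> /subnK <-; elim: (m - n)%N => [//|k IH]; rewrite addSn.
  exact: (subset_trans (SS _)).
pose F n p := MFV x t0 p * grid_ind r (t0 / 2 ^+ n) (2 ^ n) x p.
pose G p := MFV x t0 p * (\1_(\bigcap_n S n) p)%:E.
have mS n : measurable (S n).
  rewrite -[X in measurable X]setTI.
  by apply: (pair1_measurable x) => //; exact: measurable_grid_avoid.
have mG : measurable_fun setT G.
  apply: emeasurable_funM; first exact: measurable_MF_path.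
  by apply/measurable_EFinP; apply: measurable_indic; exact: bigcapT_measurable.
have FE n p : F n p = MFV x t0 p * (\1_(S n) p)%:E.
  by rewrite /F /grid_ind !indicE; congr (_ * _%:R%:E); congr nat_of_bool; apply/idP/idP => /set_mem ?; apply/mem_set.
have cF p : F n p @[n --> \oo] --> G p.
  have [Gp|nGp] := pselect ((\bigcap_n S n) p).
    have -> : F^~ p = cst (G p); last exact: cvg_cst.
    apply/funext => n; rewrite FE /G !indicE !mem_set //; exact: Gp.
  have [k nSk] : exists k, ~ S k p.
    by apply: contrapT => /forallNP H'; apply: nGp => n _; exact: contrapT (H' n).
  apply: cvg_near_cst; near=> n; rewrite FE /G !indicE memNset; last first.
    by move=> Sn; apply: nSk; apply: (SS' k n) => //; near: n; exact: nbhs_infty_ge.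
  by rewrite memNset.
have cI : \int[PP]_p F n p @[n --> \oo] --> \int[PP]_p G p.
  apply: (cvg_integral_dom (g := fun p => expeR (occ vn x t0 p))) => //.
  - by move=> n; exact: measurable_grid_path.
  - by apply: aeW => p _; exact: cF.
  - exact: exp_occ_integrable HK.
  move=> n p; rewrite gee0_abs; last by apply: mule_ge0; [exact: MF_ge0|exact: grid_ind_ge0].
  apply: (@le_trans _ _ (MFV x t0 p * 1)); last by rewrite mule1 MF_le.
  apply: lee_wpmul2l; first exact: MF_ge0.
  by rewrite lee_fin indicE; case: (_ \in _).
have GS : \int[PP]_p G p <= survival PP V r t0 x.
  apply: ge0_le_integral => //.
  - by move=> p _; rewrite mule_ge0 ?MF_ge0 // lee_fin.
  - exact: measurable_survival_path.
  move=> p _; apply: lee_wpmul2l; first exact: MF_ge0.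
  have [Gp|nGp] := pselect ((\bigcap_n S n) p); last first.
    by rewrite indicE memNset // avoid_ind_ge0.
  rewrite /avoid_ind !indicE !mem_set //.
  apply: stay_dense => //.
    move=> y; have cy : enorm z @[z --> y] --> enorm y by exact: (@continuous_enorm R d).
    by apply: (cvgB cy); exact: cvg_cst.
  move=> n k kn /=; apply/notin_eball; have [->|k0] := posnP k.
    by rewrite grid0 cpath0 addr0.
  by have := Gp n I k; rewrite k0 ltnW // grid_step; exact.
apply: le_trans (leeD2r _ GS).
apply: (@cvge_to_ge _ \oo _ _ (fun n => \int[PP]_p F n p + D%:E)).
  by apply: cvgeD => //; [rewrite fin_num_adde_defl|exact: cvg_cst].
exact: nearW.
Unshelve. all: end_near. Qed.

Variables (w phi : 'rV[R]_d -> R) (c C Cw K lam c1 : R).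
Hypotheses (mw : measurable_fun setT w) (w0 : forall y, (0 <= w y)%R).
Hypotheses (c0 : (0 < c)%R) (C0 : (0 <= C)%R) (Cw0 : (0 <= Cw)%R) (K1 : (1 <= K)%R).
Hypothesis heat : forall s x, (0 <= s <= t0 / 2)%R ->
  \int[PP]_p (w (x + p s))%:E <= (Cw * w x)%:E.
Hypothesis return_prob : forall h y, (0 < h <= 1)%R -> ~ B y ->
  (h * (c * w y - C * h))%:E <= \int[PP]_p ind_ball r (y + p h)%R.
Hypothesis V_ge0 : forall y, ~ B y -> (0 <= V y)%R.
Hypothesis V_big : forall y, ~ B y -> (expR (- (t0 / 2 * V y)) <= w y)%R.
Hypothesis HK : forall s x, (s <= t0)%R -> \int[PP]_p expeR (occ vn x s p) <= K%:E.
Hypothesis Hfin : forall x, {ae PP, forall p, occ vp x t0 p < +oo}.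
Hypotheses (mphi : measurable_fun setT phi) (phi0 : forall y, (0 < phi y)%R).
Hypothesis eig : forall t x, (0 < t)%R ->
  FKV t (EFin \o phi) x = (expR (- lam * t) * phi x)%:E.
Hypotheses (c10 : (0 <= c1)%R) (c1phi : forall y, B y -> (1 <= c1 * phi y)%R).

Let A := (c1 * expR (`|lam| * t0))%R.

Let K0 : (0 <= K)%R. Proof. by apply: le_trans K1. Qed.

Let A0 : (0 <= A)%R. Proof. by rewrite mulr_ge0 ?expR_ge0. Qed.

Let hit_le h k x : (0 < h)%R -> (k%:R * h <= t0)%R -> hit_sum PP V r h k x <= (A * phi x)%:E.
Proof.
move=> h0 kh.
apply: (@le_trans _ _ (c1 * expR (`|lam| * (k%:R * h)) * phi x)%:E).
  apply: (hit_sum_le mV h0 mphi) => //; first by move=> y; exact: ltW.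
  by move=> y; exact: eig.
rewrite lee_fin ler_wpM2r ?(ltW (phi0 x)) // ler_wpM2l // ler_expR ler_wpM2l //.
Qed.

(** With j = t0 / (2 h) windows in the first half, j survival is at most Cw times the sum of [w]
    along the grid; c h times this sum is at most [hit_sum'] plus small terms, hence at most A
    phi(x) plus errors. The product c h j is c t0 / 2, and the errors vanish as [h] tends to 0 for
    the given [x]. *)
Lemma survival_bound x : ~ B x ->
  (c * (t0 / 2))%:E * survival PP V r t0 x <= (Cw * (A * phi x))%:E.
Proof.
move=> Bx; apply/lee_addgt0Pr => e e0.
have D0 : (0 < 2 * (Cw + 1))%R by rewrite mulr_gt0 // ltr_wpDl.
have tau0 : (0 < t0 / 2)%R by rewrite divr_gt0.
have taut : (t0 / 2 <= t0)%R by lra.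
have e1 : (0 < e / (2 * (Cw + 1)))%R by rewrite divr_gt0.
have fin2 : {ae PP, forall p, occ vp x (t0 / 2) p < +oo}.
  by apply: filterS (Hfin x) => p; apply: le_lt_trans; exact: occ_le.
(* The level [m] is fixed first, making the tail small; only then is [h] chosen, against m K and the
   error of the return probability. *)
have [m Hm] := osc_tail_small (HK x taut) fin2 e1.
pose L := (m%:R * K + C * (t0 / 2) * K)%R.
have L0 : (0 <= L)%R by rewrite addr_ge0 // ?mulr_ge0 // ltW.
have e2 : (0 < Num.min 1 (e / (2 * (Cw + 1) * (L + 1))))%R.
  by rewrite lt_min ltr01 /= divr_gt0 // mulr_gt0 // ltr_wpDl.
have [n] := exists_dyadic_step t0_gt0 e2.
set h := (t0 / _)%R; rewrite le_min => /andP[h1 h2].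
have h0 : (0 < h)%R by rewrite divr_gt0 // exprn_gt0.
pose j := (2 ^ n)%N.
have jh : (j%:R * h = t0 / 2)%R.
  rewrite /h /j natrX exprS invfM mulrCA [(2^-1 * _)%R]mulrC !mulrA.
  by rewrite mulfK // expf_neq0.
have hL : (L * h <= e / (2 * (Cw + 1)))%R.
  apply: (@le_trans _ _ ((L + 1) * h)%R); first by rewrite ler_wpM2r ?(ltW h0) // lerDl.
  apply: (le_trans (ler_wpM2l _ h2)); first by rewrite addr_ge0.
  rewrite le_eqVlt; apply/orP; left; apply/eqP; field.
  by rewrite !gt_eqF // ltr_wpDl.
have I1 : j%:R%:E * survival PP V r t0 x <= Cw%:E * w_sum PP V r h w j x.
  have := survival_sum_le HPP mV mw w0 tau0 Cw0 heat V_ge0 V_big j x h0 (lexx (t0 / 2)%R).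
  by rewrite jh -splitr.
have I2 : (c * h)%:E * w_sum PP V r h w j x <=
    hit_sum' PP V r h j x + (C * h ^+ 2)%:E * one_sum PP V r h j x.
  apply: w_sum_le => //; first exact: ltW.
  by move=> y By; apply: return_prob => //; rewrite h0 h1.
have I3 := hit_sum'_le HPP mV r h0 (ler0n R m) j x; rewrite jh in I3.
have I4 : hit_sum PP V r h j x <= (A * phi x)%:E by apply: hit_le => //; rewrite jh.
have I5 : one_sum PP V r h j x <= (j%:R * K)%:E.
  apply: (le_trans (one_sum_le HPP mV r h0 j x)); rewrite jh EFinM.
  by apply: lee_wpmul2l; [rewrite lee_fin|exact: HK].
have I6 := osc_le_tail m h0 (HK x taut).
have I7 : (c * h)%:E * w_sum PP V r h w j x <=
    (A * phi x + (m%:R * h * K + e / (2 * (Cw + 1))) + C * h ^+ 2 * (j%:R * K))%:E.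
  apply: (le_trans I2); rewrite EFinD; apply: leeD.
    apply: (le_trans I3); rewrite EFinD; apply: leeD => //.
    by apply: (le_trans I6); rewrite EFinD leeD2l.
  by rewrite [leRHS]EFinM; apply: lee_wpmul2l => //; rewrite lee_fin mulr_ge0 // exprn_ge0 // ltW.
have ch0 : (0 <= c * h)%R by rewrite mulr_ge0 // ltW.
rewrite -jh mulrA.
have -> : (c * j%:R * h)%R%:E * survival PP V r t0 x = (c * h)%:E * (j%:R%:E * survival PP V r t0 x).
  by rewrite muleA -EFinM mulrAC.
apply: (le_trans (lee_wpmul2l _ I1)); first by rewrite lee_fin.
rewrite muleCA; apply: (le_trans (lee_wpmul2l _ I7)); first by rewrite lee_fin.
rewrite -EFinM -EFinD lee_fin.
have -> : (C * h ^+ 2 * (j%:R * K) = C * (j%:R * h) * K * h)%R by ring.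
rewrite jh.
have -> : (A * phi x + (m%:R * h * K + e / (2 * (Cw + 1))) + C * (t0 / 2) * K * h =
   A * phi x + (L * h + e / (2 * (Cw + 1))))%R by rewrite /L; ring.
rewrite mulrDr lerD2l.
apply: (@le_trans _ _ (Cw * (e / (2 * (Cw + 1)) + e / (2 * (Cw + 1))))%R).
  by rewrite ler_wpM2l // lerD2r.
have -> : (e / (2 * (Cw + 1)) + e / (2 * (Cw + 1)) = e / (Cw + 1))%R.
  by field; rewrite gt_eqF // ltr_wpDl.
by rewrite mulrA ler_pdivrMr ?ltr_wpDl // mulrDr mulr1 mulrC lerDl ltW.
Qed.

(** Off the ball the survival term and the hitting term are each bounded by [phi]; in the ball [phi]
    is bounded below and the semigroup bounded above. *)
Lemma domination_paths : exists2 D : R, (0 < D)%R &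
  forall x, FKV t0 (fun=> 1) x <= (D * phi x)%:E.
Proof.
have ct0 : (0 < c * (t0 / 2))%R by rewrite mulr_gt0 // divr_gt0.
exists (Cw * A / (c * (t0 / 2)) + K * A + K * c1 + 1)%R.
  rewrite ltr_wpDl // !addr_ge0 ?mulr_ge0 //; first by rewrite invr_ge0 ltW.
move=> x; have ph0 := phi0 x.
have FK_le s y : (s <= t0)%R -> FKV s (fun=> 1) y <= K%:E.
  by move=> st; apply: (le_trans (FK_le_exp PP mV s y)); exact: HK.
have p1 : (0 <= Cw * A / (c * (t0 / 2)) * phi x)%R.
  by rewrite !mulr_ge0 ?invr_ge0 // ltW.
have p2 : (0 <= K * A * phi x)%R by rewrite !mulr_ge0 // ltW.
have p3 : (0 <= K * c1 * phi x)%R by rewrite !mulr_ge0 // ltW.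
have [Bx|Bx] := pselect (B x).
  apply: (le_trans (FK_le t0 x (lexx _))); rewrite lee_fin !mulrDl mul1r.
  have : (K <= K * c1 * phi x)%R by rewrite -mulrA ler_peMr // c1phi.
  lra.
have D0 : (0 <= K * (A * phi x))%R by rewrite mulrA.
apply: (@le_trans _ _ (survival PP V r t0 x + (K * (A * phi x))%:E)).
  apply: (FK1_le_survival Bx (HK x (lexx t0)) D0) => n.
  have h0 : (0 < t0 / 2 ^+ n)%R by rewrite divr_gt0 // exprn_gt0.
  have nh : ((2 ^ n)%:R * (t0 / 2 ^+ n) = t0)%R.
    by rewrite natrX mulrC divfK // expf_neq0.
  have := FK1_le_hit HPP mV r h0 K1 FK_le (k := (2 ^ n)%N) x; rewrite nh => /(_ (lexx _)).
  move=> /le_trans; apply; apply: leeD.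
    by have := grid_survival_le HPP mV r h0 (2 ^ n)%N x; rewrite nh.
  rewrite [X in _ <= X]EFinM; apply: lee_wpmul2l; first by rewrite lee_fin.
  by apply: hit_le => //; rewrite nh.
have Sb : survival PP V r t0 x <= (Cw * (A * phi x) / (c * (t0 / 2)))%:E.
  by rewrite EFinM muleC -lee_pdivrMl // ?invr_gt0 // -?lee_pdivrMl // invrK survival_bound.
apply: (le_trans (leeD2r _ Sb)); rewrite -EFinD lee_fin !mulrDl mul1r.
have -> : (Cw * (A * phi x) / (c * (t0 / 2)) = Cw * A / (c * (t0 / 2)) * phi x)%R by ring.
rewrite [(K * (A * phi x))%R]mulrA; lra.
Qed.

End domination_paths.

(** * Hitting a ball *)

Section path_probability.
Context {R : realType} {d : nat}.
Variable PP : probability (cpath R d) R.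
Hypothesis HPP : levy_law PP.
Implicit Types (x y : 'rV[R]_d) (p q : cpath R d) (s t : R).
Implicit Types A : set ('rV[R]_d * cpath R d).
Local Open Scope ereal_scope.

Definition ind A x p : \bar R := (\1_A (x, p))%:E.

Definition prob A x : \bar R := \int[PP]_p ind A x p.

Lemma ind_ge0 A x p : 0 <= ind A x p. Proof. by rewrite lee_fin. Qed.

Lemma ind1 A x p : A (x, p) -> ind A x p = 1.
Proof. by move=> Ap; rewrite /ind indicE mem_set. Qed.

Lemma ind0 A x p : ~ A (x, p) -> ind A x p = 0.
Proof. by move=> Ap; rewrite /ind indicE memNset. Qed.

Lemma prob_ge0 A x : 0 <= prob A x.
Proof. by apply: integral_ge0 => p _; exact: ind_ge0. Qed.

Lemma measurable_ind A : measurable A ->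
  measurable_fun setT (fun u : 'rV[R]_d * cpath R d => ind A u.1 u.2).
Proof.
move=> mA; have -> : (fun u : 'rV[R]_d * cpath R d => ind A u.1 u.2) = EFin \o \1_A.
  by apply/funext => -[x p].
by apply/measurable_EFinP; exact: measurable_indic.
Qed.

Lemma measurable_ind_path A x : measurable A -> measurable_fun setT (ind A x).
Proof. by move=> mA; exact: (measurableT_comp (measurable_ind mA) (pair1_measurable x)). Qed.

Lemma measurable_prob A : measurable A -> measurable_fun setT (prob A).
Proof.
move=> mA; apply: (measurable_value PP (Phi := ind A)); first exact: measurable_ind.
exact: ind_ge0.
Qed.

Lemma measurable_section A x : measurable A -> measurable [set p | A (x, p)].
Proof.
by move=> mA; rewrite -[X in measurable X]setTI; apply: (pair1_measurable x).
Qed.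

Lemma probE A x : measurable A -> prob A x = PP [set p | A (x, p)].
Proof.
move=> mA; transitivity (PP ([set p | A (x, p)] `&` setT)); last by rewrite setIT.
rewrite -integral_indic //; last exact: measurable_section.
Qed.

Lemma prob_le1 A x : measurable A -> prob A x <= 1.
Proof. by move=> mA; rewrite probE //; apply: probability_le1; exact: measurable_section. Qed.

Lemma le_prob A A' x y : measurable A -> measurable A' ->
  (forall p, A (x, p) -> A' (y, p)) -> prob A x <= prob A' y.
Proof.
move=> mA mA' AA; apply: ge0_le_integral => //.
- by move=> p _; exact: ind_ge0.
- exact: measurable_ind_path.
- exact: measurable_ind_path.
move=> p _; have [Ap|Ap] := pselect (A (x, p)); first by rewrite !ind1 //; exact: AA.
by rewrite (ind0 Ap) ind_ge0.
Qed.

Lemma prob_markov A s x : (0 < s)%R -> measurable A ->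
  prob A x = \int[PP]_p \int[PP]_q ind A x (cat_path s p q).
Proof.
move=> s0 mA; rewrite /prob (markov HPP s0 (measurable_ind_path x mA)) //.
by move=> p; exact: ind_ge0.
Qed.

Let measurable_cat_ind A s x : measurable A ->
  measurable_fun setT (fun p => \int[PP]_q ind A x (cat_path s p q)).
Proof.
move=> mA; apply: (measurable_tonelli PP (f := fun p q => ind A x (cat_path s p q))).
  exact: (measurableT_comp (measurable_ind_path x mA) (measurable_cat_path s)).
by move=> p q; exact: ind_ge0.
Qed.

Let measurable_cat_ind_path A s x p : measurable A ->
  measurable_fun setT (fun q => ind A x (cat_path s p q)).
Proof.
move=> mA; apply: (measurableT_comp (measurable_ind_path x mA)).
exact: (measurableT_comp (measurable_cat_path s) (pair1_measurable p)).
Qed.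

Lemma prob_le_markov A A1 A2 s x : (0 < s)%R -> measurable A -> measurable A1 ->
  measurable A2 ->
  (forall p q, A (x, cat_path s p q) -> A1 (x, p) /\ A2 ((x + p s)%R, q)) ->
  prob A x <= \int[PP]_p (ind A1 x p * prob A2 (x + p s)%R).
Proof.
move=> s0 mA mA1 mA2 H; rewrite (prob_markov x s0 mA).
apply: ge0_le_integral => //.
- by move=> p _; apply: integral_ge0 => q _; exact: ind_ge0.
- exact: measurable_cat_ind.
- apply: emeasurable_funM; first exact: measurable_ind_path.
  exact: (measurable_value_at_path x (ltW s0) (measurable_prob mA2)).
move=> p _; have [Ap|Ap] := pselect (A1 (x, p)); last first.
  rewrite (ind0 Ap) mul0e integral0_eq // => q _.
  by rewrite ind0 // => /H[].
rewrite (ind1 Ap) mul1e; apply: ge0_le_integral => //.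
- by move=> q _; exact: ind_ge0.
- exact: measurable_cat_ind_path.
- exact: measurable_ind_path.
move=> q _; have [Aq|Aq] := pselect (A (x, cat_path s p q)).
  by rewrite !ind1 //; have [] := H p q Aq.
by rewrite (ind0 Aq) ind_ge0.
Qed.

Lemma prob_ge_markov A A1 A2 s x : (0 < s)%R -> measurable A -> measurable A1 ->
  measurable A2 ->
  (forall p q, A1 (x, p) -> A2 ((x + p s)%R, q) -> A (x, cat_path s p q)) ->
  \int[PP]_p (ind A1 x p * prob A2 (x + p s)%R) <= prob A x.
Proof.
move=> s0 mA mA1 mA2 H; rewrite (prob_markov x s0 mA).
apply: ge0_le_integral => //.
- by move=> p _; rewrite mule_ge0 ?ind_ge0 ?prob_ge0.
- apply: emeasurable_funM; first exact: measurable_ind_path.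
  exact: (measurable_value_at_path x (ltW s0) (measurable_prob mA2)).
- exact: measurable_cat_ind.
move=> p _; have [Ap|Ap] := pselect (A1 (x, p)); last first.
  by rewrite (ind0 Ap) mul0e; apply: integral_ge0 => q _; exact: ind_ge0.
rewrite (ind1 Ap) mul1e; apply: ge0_le_integral => //.
- by move=> q _; exact: ind_ge0.
- exact: measurable_ind_path.
- exact: measurable_cat_ind_path.
move=> q _; have [Aq|Aq] := pselect (A2 ((x + p s)%R, q)).
  by rewrite !ind1 //; exact: H.
by rewrite (ind0 Aq) ind_ge0.
Qed.

Lemma measurable_ball_at t (D : set 'rV[R]_d) : (0 <= t)%R -> measurable D ->
  measurable [set u : 'rV[R]_d * cpath R d | D (u.1 + u.2 t)%R].
Proof.
move=> t0 mD; rewrite -[X in measurable X]setTI.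
exact: (measurable_eval_fun (R := R) (d := d) t0).
Qed.

End path_probability.

Section hitting.
Context {R : realType} {d : nat}.
Variable PP : probability (cpath R d) R.
Hypothesis HPP : levy_law PP.
Implicit Types (x y : 'rV[R]_d) (p q : cpath R d) (s t : R).
Local Open Scope ereal_scope.
Variables (r h : R).
Hypothesis h0 : (0 < h)%R.
Hypothesis small_time : forall u, (0 <= u <= h)%R ->
  (1 / 2)%:E <= PP [set p : cpath R d | eball 0%R 1%R (p u)].
Let B : set 'rV[R]_d := eball 0 r.

Definition grid_hit (de : R) k : set ('rV[R]_d * cpath R d) :=
  [set u : 'rV[R]_d * cpath R d | exists2 j, (j <= k)%N & B (u.1 + u.2 (j%:R * de))%R].

Definition near_ball (t : R) : set ('rV[R]_d * cpath R d) :=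
  [set u : 'rV[R]_d * cpath R d | eball 0%R (r + 1)%R (u.1 + u.2 t)%R].

Lemma measurable_grid_hit de k : (0 <= de)%R -> measurable (grid_hit de k).
Proof.
move=> de0; have -> : grid_hit de k = \bigcup_(j in [set j | (j <= k)%N])
   [set u : 'rV[R]_d * cpath R d | B (u.1 + u.2 (j%:R * de))%R] by [].
apply: bigcup_measurable => j _; apply: measurable_ball_at; first by rewrite mulr_ge0.
exact: measurable_eball.
Qed.

Lemma measurable_near_ball t : (0 <= t)%R -> measurable (near_ball t).
Proof. by move=> t0; apply: measurable_ball_at => //; exact: measurable_eball. Qed.

(* Maximal inequality: a path in the ball at some grid time is, with conditional
   probability at least 1/2, within distance 1 of the ball at the last time. *)
Lemma grid_hit_le de k x : (0 < de)%R -> (k%:R * de <= h)%R ->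
  prob PP (grid_hit de k) x <= 2%:E * prob PP (near_ball (k%:R * de)) x.
Proof.
move=> de0; have de0' := ltW de0.
have k0 j : (0 <= j%:R * de)%R by rewrite mulr_ge0.
have mh j : measurable (grid_hit de j) by exact: measurable_grid_hit.
have mn j : measurable (near_ball (j%:R * de)) by exact: measurable_near_ball.
have inB y j : B y -> (j%:R * de <= h)%R -> prob PP (grid_hit de j) y <=
    2%:E * prob PP (near_ball (j%:R * de)) y.
  move=> By kh; have H := small_time (u := (j%:R * de)%R); rewrite k0 kh in H.
  apply: (@le_trans _ _ (2%:E * (1 / 2)%:E)).
    apply: (@le_trans _ _ 1); first exact: prob_le1.
    have -> : 2%:E * (1 / 2)%:E = (2 * (1 / 2))%R%:E :> \bar R by [].
    by rewrite lee_fin; lra.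
  apply: lee_wpmul2l => //; apply: (le_trans (H isT)); rewrite probE //.
  apply: le_measure; rewrite ?inE.
  - rewrite -[X in measurable X]setTI; apply: (measurable_eval (k0 j)) => //.
    exact: measurable_eball.
  - exact: measurable_section.
  - move=> p; rewrite /near_ball /= => hp; move: By hp; rewrite /B /eball /= !subr0 => By hp.
    have := ler_enormD y (p (j%:R * de)%R); lra.
elim: k x => [|k IH] x kh; have [Bx|Bx] := pselect (B x); try exact: inB.
  rewrite /prob integral0_eq ?mule_ge0 ?prob_ge0 // => p _; apply: ind0 => -[j].
  by rewrite leqn0 => /eqP -> /=; rewrite mul0r cpath0 addr0.
have kE : (k.+1%:R * de = de + k%:R * de)%R by rewrite -natr1 mulrDl mul1r addrC.
have kh' : (k%:R * de <= h)%R by apply: le_trans kh; rewrite kE lerDr.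
apply: (@le_trans _ _ (\int[PP]_p (ind setT x p * prob PP (grid_hit de k) (x + p de)%R))).
  apply: prob_le_markov => // p q [j jk Bj]; split => //; move: jk Bj; rewrite -[_.2]/(cat_path de p q) -[_.1]/x.
  case: j => [|j] jk Bj.
    by exfalso; apply: Bx; move: Bj; rewrite mul0r cat_pathl // cpath0 addr0.
  exists j => //; move: Bj.
  have -> : (j.+1%:R * de = de + j%:R * de)%R by rewrite -natr1 mulrDl mul1r addrC.
  by rewrite cat_pathr // addrA.
apply: (@le_trans _ _ (2%:E * \int[PP]_p (ind setT x p * prob PP (near_ball (k%:R * de)) (x + p de)%R))).
  have mI j (A : nat -> set ('rV[R]_d * cpath R d)) : measurable (A j) ->
      measurable_fun setT (fun p => ind setT x p * prob PP (A j) (x + p de)%R).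
    move=> mA; apply: emeasurable_funM; first exact: measurable_ind_path.
    exact: (measurable_value_at_path x de0' (measurable_prob PP mA)).
  rewrite -ge0_integralZl //; last 2 first.
  - exact: (mI k (fun k => near_ball (k%:R * de))).
  - by move=> p _; rewrite mule_ge0 ?ind_ge0 ?prob_ge0.
  apply: ge0_le_integral => //.
  - by move=> p _; rewrite mule_ge0 ?ind_ge0 ?prob_ge0.
  - exact: (mI k (grid_hit de)).
  - by apply: measurable_funeM; exact: (mI k (fun k => near_ball (k%:R * de))).
  move=> p _; rewrite muleCA; apply: lee_wpmul2l; first exact: ind_ge0.
  exact: IH.
apply: lee_wpmul2l => //; apply: prob_ge_markov => // p q _.
rewrite /near_ball /= kE.
by rewrite -[cat_fun _ p q _]/(cat_path de p q (de + k%:R * de)%R) cat_pathr // addrA.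
Qed.

Definition hits : set ('rV[R]_d * cpath R d) := ~` avoid r h.

Lemma measurable_hits : measurable hits.
Proof. by apply: measurableC; exact: measurable_avoid. Qed.

(** The ball is open, so a path that enters it before time [h] does so at a dyadic time; the grid
    events increase to the hitting event and the maximal inequality is uniform over the grids. *)
Lemma hits_le x : prob PP hits x <= 2%:E * prob PP (near_ball h) x.
Proof.
have hn0 n : (0 < h / 2 ^+ n)%R by rewrite divr_gt0 // exprn_gt0.
have mg n : measurable (grid_hit (h / 2 ^+ n) (2 ^ n)) by apply: measurable_grid_hit; exact: ltW.
have nh n : ((2 ^ n)%:R * (h / 2 ^+ n) = h)%R.
  by rewrite natrX mulrC divfK // expf_neq0.
have gS n u : grid_hit (h / 2 ^+ n) (2 ^ n) u -> grid_hit (h / 2 ^+ n.+1) (2 ^ n.+1) u.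
  move=> [j jn Bj]; exists j.*2; first by rewrite expnS mul2n leq_double.
  by rewrite grid_step -gridS -grid_step.
have gSS n m u : (n <= m)%N -> grid_hit (h / 2 ^+ n) (2 ^ n) u -> grid_hit (h / 2 ^+ m) (2 ^ m) u.
  by move=> /subnK <-; elim: (m - n)%N => [//|k IH] /IH; rewrite addSn; exact: gS.
apply: (@le_integral_sup _ _ _ PP setT (fun n p => ind (grid_hit (h / 2 ^+ n) (2 ^ n)) x p)) => //.
- by move=> n; exact: measurable_ind_path.
- by move=> n p; exact: ind_ge0.
- move=> p n m nm; have [Ap|Ap] := pselect (grid_hit (h / 2 ^+ n) (2 ^ n) (x, p)).
    by rewrite !ind1 //; exact: gSS Ap.
  by rewrite (ind0 Ap) ind_ge0.
- by apply: measurable_ind_path; exact: measurable_hits.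
- by move=> p; exact: ind_ge0.
- move=> p _; have [Ap|Ap] := pselect (hits (x, p)); last first.
    by rewrite (ind0 Ap) le_ereal_sup_tmp //; exists (ind (grid_hit (h / 2 ^+ 0) (2 ^ 0)) x p); [exists 0%N|exact: ind_ge0].
  have [n An] : exists n, grid_hit (h / 2 ^+ n) (2 ^ n) (x, p).
    apply: contrapT => /forallNP H; apply: Ap => s s0 sh /=.
    apply: (@stay_dense R d (fun y => enorm y - r)%R _ h x p h0) => //.
      move=> y; have cy : enorm z @[z --> y] --> enorm y by exact: (@continuous_enorm R d).
      by apply: (cvgB cy); exact: cvg_cst.
    move=> n k kn; apply/notin_eball => Bk; apply: (H n).
    by exists k; [exact: ltnW|rewrite grid_step].
  rewrite (ind1 Ap) -(ind1 An); apply: ereal_sup_ubound; exists n => //.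
- move=> n; have := grid_hit_le (k := (2 ^ n)%N) x (hn0 n); rewrite nh; apply.
  exact: lexx.
Qed.

End hitting.

(** * Decay of the ground state *)

Section ground_state_decay.
Context {R : realType} {d : nat}.
Variable PP : probability (cpath R d) R.
Hypothesis HPP : levy_law PP.
Variable V : 'rV[R]_d -> R.
Hypothesis mV : measurable_fun setT V.
Implicit Types (x y : 'rV[R]_d) (p q : cpath R d) (s t : R).
Local Open Scope ereal_scope.
Local Notation FKV := (FK PP V).
Local Notation MFV := (MF V).
Local Notation vp := (vpos V).
Local Notation vn := (vneg V).

Let mvp : measurable_fun setT vp. Proof. exact: measurable_vpos. Qed.
Let mvn : measurable_fun setT vn. Proof. exact: measurable_vneg. Qed.
Let vp0 y : (0 <= vp y)%R. Proof. exact: vpos_ge0. Qed.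
Let vn0 y : (0 <= vn y)%R. Proof. exact: vneg_ge0. Qed.

Variables (w phi : 'rV[R]_d -> R) (h Cw K F lam : R).
Hypothesis h0 : (0 < h)%R.
Hypothesis small_time : forall u, (0 <= u <= h)%R ->
  (1 / 2)%:E <= PP [set p : cpath R d | eball 0%R 1%R (p u)].
Hypotheses (mw : measurable_fun setT w) (w0 : forall y, (0 < w y)%R).
Hypothesis w_low : forall r, exists2 m : R, (0 < m)%R & forall y, eball 0%R r y -> (m <= w y)%R.
Hypothesis Cw0 : (0 <= Cw)%R.
Hypothesis heat : forall x, \int[PP]_p (w (x + p h))%:E <= (Cw * w x)%:E.
Hypothesis K0 : (0 <= K)%R.
Hypothesis HK : forall x, \int[PP]_p expeR (occ (fun y => 4 * vn y)%R x h p) <= K%:E.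
Hypothesis conf : forall M, exists r, forall y, ~ eball 0%R r y -> (M <= V y)%R.
Hypotheses (mphi : measurable_fun setT phi) (phi0 : forall y, (0 < phi y)%R).
Hypothesis phiF : forall y, (phi y <= F)%R.
Hypothesis eig : forall x, FKV h (EFin \o phi) x = (expR (- lam * h) * phi x)%:E.

Definition root4 x : R := Num.sqrt (Num.sqrt (w x)).

Local Notation v := root4.

Lemma root4_gt0 x : (0 < v x)%R.
Proof. by rewrite !sqrtr_gt0. Qed.

Lemma root4X x : (v x ^+ 4 = w x)%R.
Proof.
rewrite -[4%N]/(2 * 2)%N exprM sqr_sqrtr ?sqrtr_ge0 // sqr_sqrtr //; exact: ltW.
Qed.

Lemma measurable_root4 : measurable_fun setT v.
Proof.
have ms : measurable_fun setT (@Num.sqrt R).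
  by apply: continuous_measurable_fun; exact: sqrt_continuous.
exact: (measurableT_comp ms (measurableT_comp ms mw)).
Qed.

Let v3_ge0 x : (0 <= v x ^+ 3)%R. Proof. by rewrite exprn_ge0 // ltW // root4_gt0. Qed.

Let mv3 : measurable_fun setT (fun x => v x ^+ 3)%R.
Proof. by apply: measurable_funX; exact: measurable_root4. Qed.

Let mat (f : 'rV[R]_d -> R) x : measurable_fun setT f ->
  measurable_fun setT (fun p : cpath R d => (f (x + p h)%R)%:E).
Proof.
move=> mf; apply: (measurable_value_at_path (f := EFin \o f)); first exact: ltW.
exact/measurable_EFinP.
Qed.

(** Taken at b = v(x), it bounds w^(3/4) by an affine function of [w], and so transfers the heat
    bound from [w] to [v ^+ 3] as Jensen's inequality would. *)
Lemma cube_le (a b : R) : (0 < a -> 0 < b -> a ^+ 3 <= b ^+ 3 + a ^+ 4 / b)%R.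
Proof.
move=> a0 b0; have [ab|ba] := leP a b.
  apply: (@le_trans _ _ (b ^+ 3)%R); first by rewrite lerXn2r ?nnegrE // ltW.
  by rewrite lerDl divr_ge0 ?exprn_ge0 // ltW.
apply: (@le_trans _ _ (a ^+ 4 / b)%R); last by rewrite lerDr exprn_ge0 // ltW.
by rewrite ler_pdivlMr // [(a ^+ 4)%R]exprSr ler_pM2l ?exprn_gt0 // ltW.
Qed.

Lemma heat_v3 x : \int[PP]_p (v (x + p h)%R ^+ 3)%:E <= ((1 + Cw) * v x ^+ 3)%:E.
Proof.
have vx := root4_gt0 x.
have iv0 : (0 <= (v x)^-1)%R by rewrite invr_ge0 ltW.
apply: (@le_trans _ _ (\int[PP]_p (((v x)^-1)%:E * (w (x + p h)%R)%:E + (v x ^+ 3)%:E))).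
  apply: ge0_le_integral => //.
  - by move=> p _; rewrite lee_fin.
  - exact: (mat x mv3).
  - by apply: emeasurable_funD => //; apply: measurable_funeM; exact: mat.
  - move=> p _; rewrite -EFinM -EFinD lee_fin [leRHS]addrC -root4X [((v x)^-1 * _)%R]mulrC.
    by apply: cube_le => //; exact: root4_gt0.
rewrite integral_affine //; last 2 first.
- exact: mat.
- by move=> p; rewrite lee_fin ltW.
apply: (@le_trans _ _ (((v x)^-1)%:E * (Cw * w x)%:E + (v x ^+ 3)%:E)).
  by rewrite leeD2r //; apply: lee_wpmul2l.
rewrite -EFinM -EFinD lee_fin -root4X.
have -> : ((v x)^-1 * (Cw * v x ^+ 4) = Cw * v x ^+ 3)%R.
  by field; rewrite gt_eqF.
by rewrite mulrDl mul1r addrC.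
Qed.

(** After the maximal inequality, Markov's inequality for w(X_h), since [w] is bounded below on the
    enlarged ball. *)
Lemma hits_w r : exists2 C : R, (0 < C)%R & forall x, prob PP (hits r h) x <= (C * w x)%:E.
Proof.
have [m m0 Hm] := w_low (r + 1)%R.
exists (2 * (m^-1 * Cw) + 1)%R.
  by rewrite ltr_wpDl // !mulr_ge0 // invr_ge0 ltW.
move=> x; apply: (le_trans (hits_le HPP r h0 small_time x)).
have mn : measurable (near_ball (R := R) (d := d) r h) by apply: measurable_near_ball; exact: ltW.
apply: (@le_trans _ _ (2%:E * ((m^-1)%:E * (Cw * w x)%:E))).
  apply: lee_wpmul2l => //.
  apply: (@le_trans _ _ ((m^-1)%:E * \int[PP]_p (w (x + p h)%R)%:E)); last first.
    by apply: lee_wpmul2l => //; rewrite lee_fin invr_ge0 ltW.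
  have im0 : 0 <= (m^-1)%:E by rewrite lee_fin invr_ge0 ltW.
  rewrite -ge0_integralZl //; last 2 first.
  - exact: mat.
  - by move=> p _; rewrite lee_fin ltW.
  apply: ge0_le_integral => //.
  - by move=> p _; exact: ind_ge0.
  - exact: measurable_ind_path.
  - by apply: measurable_funeM; exact: mat.
  move=> p _; have [Np|Np] := pselect (near_ball r h (x, p)).
    by rewrite ind1 // -EFinM lee_fin mulrC ler_pdivlMr // mul1r; exact: Hm.
  by rewrite ind0 // -EFinM lee_fin mulr_ge0 ?invr_ge0 // ltW.
have -> : 2%:E * ((m^-1)%:E * (Cw * w x)%:E) = (2 * (m^-1 * (Cw * w x)))%R%:E by [].
have -> : (2 * (m^-1 * (Cw * w x)) = 2 * (m^-1 * Cw) * w x)%R by ring.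
by rewrite lee_fin [leRHS]mulrDl mul1r lerDl ltW.
Qed.

(* Applied with [b := v x]: the event of hitting the ball, whose probability is
   of order [w x = v x ^+ 4], then contributes [O(v x ^+ 3)] in spite of the
   exponential weight. *)
Lemma exp4_le (a : \bar R) (b : R) : 0 <= a -> (0 < b)%R ->
  expeR a <= (b^-1)%:E + (b ^+ 3)%:E * expeR (4%:E * a).
Proof.
case: a => [a||] // a0 b0; last first.
  by rewrite mulry gtr0_sg // mul1e /= mulry gtr0_sg ?exprn_gt0 // mul1e addey // leey.
have -> : 4%:E * a%:E = (4 * a)%R%:E :> \bar R by [].
rewrite /= -EFinM -EFinD lee_fin.
have -> : expR (4 * a) = (expR a ^+ 4)%R by rewrite expRM_natl.
have := expR_gt0 a; set e := expR a => e0.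
have [eb|be] := leP (e * b)%R 1%R.
  rewrite -[leLHS]addr0 lerD ?mulr_ge0 ?exprn_ge0 // ?(ltW e0) ?(ltW b0) //.
  by rewrite -[leRHS]mul1r ler_pdivlMr.
apply: (@le_trans _ _ (b ^+ 3 * e ^+ 4)%R); last by rewrite lerDr invr_ge0 ltW.
rewrite [(e ^+ 4)%R]exprSr mulrA -exprMn ler_peMl ?(ltW e0) //.
by rewrite exprn_ege1 // mulrC ltW.
Qed.

Lemma decay_step M r : (0 <= M)%R -> (forall y, ~ eball 0%R r y -> (M <= V y)%R) ->
  exists2 C : R, (0 < C)%R & forall x, (expR (- lam * h) * phi x)%:E <=
    (expR (- (M * h)))%:E * \int[PP]_p (phi (x + p h)%R)%:E + (C * v x ^+ 3)%:E.
Proof.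
move=> M0 VM; have [C C0 HC] := hits_w r.
have F0 : (0 < F)%R by apply: lt_le_trans (phiF 0%R); exact: phi0.
exists (F * (C + K))%R; first by rewrite mulr_gt0 // ltr_wpDr.
move=> x; rewrite -eig; have vx := root4_gt0 x.
have h0' := ltW h0.
have mhits : measurable (hits (R := R) (d := d) r h) by exact: measurable_hits.
have m4 : measurable_fun setT (fun y => 4 * vn y)%R by exact: measurable_funM.
have v4 y : (0 <= 4 * vn y)%R by rewrite mulr_ge0.
have e0 := expR_ge0 (- (M * h))%R.
pose T p := (v x)^-1%:E * ind (hits r h) x p + (v x ^+ 3)%:E * expeR (occ (fun y => 4 * vn y)%R x h p).
have iv0 : 0 <= (v x)^-1%:E by rewrite lee_fin invr_ge0 ltW.
have v30 : 0 <= (v x ^+ 3)%:E by rewrite lee_fin.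
have mi : measurable_fun setT (ind (hits r h) x) by exact: measurable_ind_path.
have me : measurable_fun setT (fun p => expeR (occ (fun y => 4 * vn y)%R x h p)).
  exact: measurable_exp_occ_path.
have T0 p : 0 <= T p.
  by rewrite adde_ge0 // mule_ge0 ?ind_ge0 ?expeR_ge0.
have mT : measurable_fun setT T.
  by apply: emeasurable_funD; exact: measurable_funeM.
have mph : measurable_fun setT (fun p : cpath R d => (phi (x + p h)%R)%:E) by exact: mat.
have ph0 p : 0 <= (phi (x + p h)%R)%:E by rewrite lee_fin ltW.
apply: (@le_trans _ _ (\int[PP]_p ((expR (- (M * h)))%:E * (phi (x + p h)%R)%:E + F%:E * T p))).
  apply: ge0_le_integral => //.
  - by move=> p _; apply: mule_ge0; [exact: MF_ge0|rewrite lee_fin ltW].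
  - apply: measurable_FK_path => //; exact/measurable_EFinP.
  - by apply: emeasurable_funD; exact: measurable_funeM.
  move=> p _ /=; have [Hp|Hp] := pselect (hits r h (x, p)).
    rewrite -[leLHS]add0e; apply: leeD; first by rewrite mule_ge0 // lee_fin.
    apply: (@le_trans _ _ (expeR (occ vn x h p) * F%:E)).
      apply: lee_pmul; rewrite ?MF_ge0 ?MF_le ?lee_fin //; exact: ltW.
    rewrite muleC; apply: lee_wpmul2l; first by rewrite lee_fin ltW.
    by rewrite /T ind1 // mule1 occZ //; apply: exp4_le => //; exact: occ_ge0.
  rewrite -[leLHS]adde0; apply: leeD; last by rewrite mule_ge0 // lee_fin ltW.
  apply: lee_wpmul2r => //.
  have av : avoid r h (x, p) by apply: contrapT.
  have nB s : (0 <= s -> s < h -> ~ eball 0 r (x + p s))%R.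
    by move=> s0 sh; apply/notin_eball; exact: av.
  have n0 : occ vn x h p = 0.
    apply: occ_eq0 => // s s0 sh; rewrite /vneg max_r // oppr_le0.
    by apply: (le_trans M0); apply: VM; exact: nB.
  rewrite /MF n0 expeR0 mule1 -[(expR _)%:E]/(expeR (- (M * h))%R%:E) lee_expeR.
  rewrite EFinN leeN2; apply: occ_ge => // s s0 sh.
  by apply: (le_trans (VM _ (nB s s0 sh))); rewrite le_max lexx.
have F0' : 0 <= F%:E by rewrite lee_fin ltW.
rewrite ge0_integralD //; last 4 first.
- by move=> p _; rewrite mule_ge0 // lee_fin.
- exact: measurable_funeM.
- by move=> p _; rewrite mule_ge0.
- exact: measurable_funeM.
rewrite ge0_integralZl // leeD2l // ge0_integralZl //.
rewrite /T ge0_integralD //; last 4 first.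
- by move=> p _; rewrite mule_ge0 ?ind_ge0.
- exact: measurable_funeM.
- by move=> p _; rewrite mule_ge0 ?expeR_ge0.
- exact: measurable_funeM.
rewrite ge0_integralZl //; last by move=> p _; exact: ind_ge0.
rewrite ge0_integralZl //; last by move=> p _; exact: expeR_ge0.
apply: (@le_trans _ _ (F%:E * ((v x)^-1%:E * (C * w x)%:E + (v x ^+ 3)%:E * K%:E))).
  apply: lee_wpmul2l => //; apply: leeD; apply: lee_wpmul2l => //; exact: HC.
have -> : F%:E * ((v x)^-1%:E * (C * w x)%:E + (v x ^+ 3)%:E * K%:E) =
    (F * ((v x)^-1 * (C * w x) + v x ^+ 3 * K))%R%:E by [].
rewrite lee_fin -root4X.
have -> : ((v x)^-1 * (C * v x ^+ 4) = C * v x ^+ 3)%R by field; rewrite gt_eqF.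
by rewrite le_eqVlt; apply/orP; left; apply/eqP; ring.
Qed.

(** [decay_step] is iterated at a fixed [h]: the bound 2 D v^3 reproduces itself, while the trivial
    bound [F] is halved each time. *)
Lemma ground_state_decay : exists2 C : R, (0 < C)%R & forall x, (phi x <= C * v x ^+ 3)%R.
Proof.
have F0 : (0 < F)%R by apply: lt_le_trans (phiF 0%R); exact: phi0.
pose L := (2 * (1 + Cw))%R.
have L2 : (2 <= L)%R by rewrite /L mulrDr mulr1 lerDl mulr_ge0.
have L0 : (0 < L)%R by lra.
(* So large that one step contracts by 1 / L: the factor 1 + Cw of [L] makes up for the growth of
   [v ^+ 3] along the process, and the factor 2 leaves room for the iteration. *)
pose M := (Num.max 0 (lam + ln L / h))%R.
have M0 : (0 <= M)%R by rewrite le_max lexx.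
have [r Hr] := conf M.
have [C C0 HC] := decay_step M0 Hr.
pose th := (expR (lam * h) * expR (- (M * h)))%R.
have th0 : (0 <= th)%R by rewrite mulr_ge0 ?expR_ge0.
have thL : (th * L <= 1)%R.
  rewrite /th -expRD -ler_pdivlMr // div1r -[leRHS]lnK ?posrE ?invr_gt0 // ler_expR lnV ?posrE //.
  have : (lam + ln L / h <= M)%R by rewrite le_max lexx orbT.
  rewrite -lerBrDl ler_pdivrMr // mulrBl; lra.
have th2 : (th <= 1 / 2)%R.
  have : (th * 2 <= th * L)%R by rewrite ler_wpM2l.
  lra.
pose D := (expR (lam * h) * C)%R.
have D0 : (0 < D)%R by rewrite mulr_gt0 // expR_gt0.
have mph x : measurable_fun setT (fun p : cpath R d => (phi (x + p h)%R)%:E) by exact: mat.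
have step x : (phi x)%:E <= th%:E * \int[PP]_p (phi (x + p h)%R)%:E + (D * v x ^+ 3)%:E.
  have ee : (expR (lam * h) * expR (- lam * h) = 1)%R by rewrite mulNr expRxMexpNx_1.
  have -> : phi x = (expR (lam * h) * (expR (- lam * h) * phi x))%R by rewrite mulrA ee mul1r.
  rewrite EFinM; apply: le_trans (lee_wpmul2l _ (HC x)) _; first by rewrite lee_fin expR_ge0.
  rewrite ge0_muleDr; last 2 first.
  - by rewrite mule_ge0 ?lee_fin ?expR_ge0 //; apply: integral_ge0 => p _; rewrite lee_fin ltW.
  - by rewrite lee_fin mulr_ge0 // ltW.
  by rewrite muleA -!EFinM mulrA.
exists (2 * D)%R; first by rewrite mulr_gt0.
have claim n x : (phi x <= 2 * D * v x ^+ 3 + F / 2 ^+ n)%R.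
  elim: n x => [|n IH] x.
    rewrite expr0 divr1; apply: (le_trans (phiF x)); rewrite lerDr.
    by apply: mulr_ge0 => //; apply: mulr_ge0 => //; exact: ltW.
  have Fn : (0 <= F / 2 ^+ n)%R by rewrite divr_ge0 ?exprn_ge0 // ltW.
  have D2 : (0 <= 2 * D)%R by rewrite mulr_ge0 // ltW.
  rewrite -lee_fin; apply: (le_trans (step x)).
  have H : \int[PP]_p (phi (x + p h)%R)%:E <= (2 * D * ((1 + Cw) * v x ^+ 3) + F / 2 ^+ n)%:E.
    apply: (@le_trans _ _ (\int[PP]_p ((2 * D)%:E * (v (x + p h)%R ^+ 3)%:E + (F / 2 ^+ n)%:E))).
      apply: ge0_le_integral => //.
      - by move=> p _; rewrite lee_fin ltW.
      - by apply: emeasurable_funD => //; apply: measurable_funeM; exact: (mat x mv3).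
      - by move=> p _; rewrite -EFinM -EFinD lee_fin.
    rewrite integral_affine //; last 2 first.
    - exact: (mat x mv3).
    - by move=> p; rewrite lee_fin.
    rewrite [leRHS]EFinD; apply: leeD => //; rewrite [leRHS]EFinM; apply: lee_wpmul2l; rewrite ?lee_fin //; exact: heat_v3.
  apply: (@le_trans _ _ (th%:E * (2 * D * ((1 + Cw) * v x ^+ 3) + F / 2 ^+ n)%:E + (D * v x ^+ 3)%:E)).
    by rewrite leeD2r //; apply: lee_wpmul2l; rewrite ?lee_fin.
  rewrite -EFinM -EFinD lee_fin.
  have -> : (th * (2 * D * ((1 + Cw) * v x ^+ 3) + F / 2 ^+ n) = th * L * (D * v x ^+ 3) + th * (F / 2 ^+ n))%R.
    by rewrite /L; ring.
  have Dv : (0 <= D * v x ^+ 3)%R by rewrite mulr_ge0 // ltW.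
  have h1 := ler_wpM2r Dv thL; have h2 := ler_wpM2r Fn th2.
  have -> : (F / 2 ^+ n.+1 = 1 / 2 * (F / 2 ^+ n))%R by rewrite exprS invfM; ring.
  lra.
move=> x; apply/ler_addgt0Pr => e e0.
have [n Hn] := exists_dyadic_step F0 e0.
by apply: (le_trans (claim n.+1 x)); rewrite lerD2l.
Qed.

End ground_state_decay.

(** * Staying in a small ball *)

Lemma measure_gt0_cover (R : realType) dT (T : measurableType dT)
    (m : {measure set T -> \bar R}) (F : nat -> set T) (E : set T) :
  (forall n, measurable (F n)) -> measurable E -> E `<=` \bigcup_n F n -> (0 < m E)%E ->
  exists n, (0 < m (F n))%E.
Proof.
move=> mF mE EF mE0; apply: contrapT => /forallNP H.
have N n : m.-negligible (F n).
  apply/negligibleP => //; apply/eqP; rewrite eq_le measure_ge0 andbT leNgt.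
  by apply/negP; exact: H.
have /negligibleP : m.-negligible E.
  by apply: negligibleS EF _; exact: negligible_bigcup.
by move=> /(_ mE) E0; move: mE0; rewrite E0 ltxx.
Qed.

Section small_ball.
Context {R : realType} {d : nat}.
Variable PP : probability (cpath R d) R.
Hypothesis HPP : levy_law PP.
Hypothesis Hsym : forall (t : R) (B : set 'rV[R]_d), (0 <= t)%R -> measurable B ->
  PP [set p : cpath R d | B (p t)] = PP [set p : cpath R d | B (- p t)%R].
Implicit Types (x y : 'rV[R]_d) (p q : cpath R d) (s t h e : R).

Definition stay e t : set ('rV[R]_d * cpath R d) := staying (fun y => e - enorm y) t.

Lemma stayP e t x p : stay e t (x, p) <-> forall s, 0 <= s -> s < t -> enorm (x + p s) <= e.
Proof. by split => H s s0 st; move: (H s s0 st); rewrite /= subr_ge0. Qed.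

Lemma measurable_stay e t : 0 < t -> measurable (stay e t).
Proof.
apply: measurable_staying.
  move=> y; have cy : enorm z @[z --> y] --> enorm y by exact: (@continuous_enorm R d).
  exact: (cvgB (cvg_cst e) cy).
by apply: measurable_funB => //; exact: measurable_enorm.
Qed.

(** By right continuity at 0 every path stays in the ball for some dyadic time; countably many
    events cover the path space, so one has positive probability. *)
Lemma stay_initially e t : 0 < e -> 0 < t -> exists n, (0 < prob PP (stay e (t / 2 ^+ n)) 0)%E.
Proof.
move=> e0 t0; have tn n : 0 < t / 2 ^+ n by rewrite divr_gt0 ?exprn_gt0.
have ms n : measurable [set p : cpath R d | stay e (t / 2 ^+ n) (0, p)].
  by apply: measurable_section; exact: measurable_stay.
have [n Hn] : exists n, (0 < PP [set p : cpath R d | stay e (t / 2 ^+ n) (0%R, p)])%E.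
  apply: (measure_gt0_cover (m := PP) ms measurableT); last first.
    by apply: (lt_le_trans lte01); rewrite le_eqVlt; apply/orP; left; apply/eqP/esym; exact: probability_setT.
  move=> p _; have := @cpath_rcont R d p 0 (lexx 0); rewrite cpath0 => cp.
  have ce : enorm (p s) @[s --> 0^'+] --> (0 : R).
    have : enorm (p s) @[s --> 0^'+] --> enorm (0 : 'rV[R]_d).
      by apply: (continuous_cvg _ _ cp); exact: (@continuous_enorm R d).
    by rewrite enorm0.
  have : \forall s \near 0^'+, enorm (p s) < e.
    by move/cvgrPdist_lt : ce => /(_ _ e0); apply: filterS => s; rewrite sub0r normrN ger0_norm ?sqrtr_ge0.
  move=> /nbhs_right0P [de /= de0 Hde].
  have [n hn] : exists n, t / 2 ^+ n.+1 <= de / 2 by apply: exists_dyadic_step => //; rewrite divr_gt0.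
  exists n.+1 => //=; apply/stayP => s s0 st; rewrite add0r.
  move: s0; rewrite le_eqVlt => /predU1P[<-|s0]; first by rewrite cpath0 enorm0 ltW.
  apply: ltW; rewrite -[s]add0r; apply: (Hde s) => //=; rewrite sub0r normrN gtr0_norm //; lra.
by exists n; rewrite probE //; exact: measurable_stay.
Qed.

Definition cell e (m : 'rV[int]_d) : set 'rV[R]_d :=
  [set v | forall i, (m ord0 i)%:~R * e <= v ord0 i < (m ord0 i + 1)%:~R * e].

Lemma measurable_cell e m : measurable (cell e m).
Proof.
have -> : cell e m = \big[setI/setT]_(i < d)
     (rV_coord i @^-1` `[(m ord0 i)%:~R * e, (m ord0 i + 1)%:~R * e[%classic).
  rewrite -bigcap_seq; apply/seteqP; split => v /= H i.
    by move=> _; rewrite /rV_coord /= in_itv /=; exact: H.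
  by have := H i; rewrite /= mem_index_enum in_itv /= => /(_ isT).
apply: bigsetI_measurable => i _; rewrite -[X in measurable X]setTI.
exact: measurable_rV_coord.
Qed.

Lemma exists_cell e v : 0 < e -> exists m, cell e m v.
Proof.
move=> e0; exists (\row_i Num.floor (v ord0 i / e)) => i; rewrite mxE.
have := floor_itv (v ord0 i / e).
by rewrite ler_pdivlMr // ltr_pdivrMr.
Qed.

Lemma cell_dist e m u v : cell e m u -> cell e m v -> enorm (u - v) <= d%:R * e.
Proof.
move=> Hu Hv; apply: (le_trans (enorm_le_sum _)).
have -> : d%:R * e = \sum_(i < d) e by rewrite sumr_const card_ord mulr_natl.
apply: ler_sum => i _; rewrite !mxE ler_norml.
have := Hu i; have := Hv i; rewrite intrD mulrDl mul1r => /andP[? ?] /andP[? ?]; lra.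
Qed.

Definition loop h e e1 : set ('rV[R]_d * cpath R d) :=
  stay e h `&` [set u : 'rV[R]_d * cpath R d | [set y | enorm y <= e1] (u.1 + u.2 h)].

Lemma measurable_loop h e e1 : 0 < h -> measurable (loop h e e1).
Proof.
move=> h0; apply: measurableI; first exact: measurable_stay.
apply: measurable_ball_at; first exact: ltW.
have -> : [set y : 'rV[R]_d | enorm y <= e1] = (@enorm R d) @^-1` `]-oo, e1]%classic.
  by apply/seteqP; split => y /=; rewrite in_itv.
by rewrite -[X in measurable X]setTI; apply: measurable_enorm.
Qed.

(* Two independent copies of the path landing in the same small cell at time
   [h / 2], the second one reflected, make up a path that is back near its
   starting point at time [h]. *)
Lemma loop_prob h e e1 : 0 < h -> 0 < e1 -> (0 < prob PP (stay e h) 0)%E ->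
  (0 < prob PP (loop h (2 * e) e1) 0)%E.
Proof.
move=> h0 e10; have h2 : 0 < h / 2 by rewrite divr_gt0.
have h2' := ltW h2; have hE : h = h / 2 + h / 2 by rewrite -splitr.
have d0 : 0 < (d%:R + 1 : R) by rewrite ltr_wpDl.
pose a := e1 / (d%:R + 1); have a0 : 0 < a by rewrite divr_gt0.
have da : d%:R * a <= e1.
  by rewrite /a mulrCA ger_pMr // ler_pdivrMr // mul1r lerDl.
have ms := measurable_stay e h0.
pose E m := stay e h `&` [set u : 'rV[R]_d * cpath R d | cell a m (u.1 + u.2 (h / 2))].
have mE m : measurable (E m).
  by apply: measurableI => //; apply: measurable_ball_at => //; exact: measurable_cell.
rewrite probE // => s0.
pose F k : set (cpath R d) := if unpickle k is Some m then [set p | E m (0, p)] else set0.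
have [k] : exists k, (0 < PP (F k))%E.
  apply: (measure_gt0_cover _ (measurable_section 0 ms)) s0.
    by move=> k; rewrite /F; case: unpickle => [m|//]; exact: measurable_section.
  move=> p sp; have [m Hm] := exists_cell (0 + p (h / 2)) a0.
  by exists (pickle m) => //; rewrite /F pickleK.
rewrite /F; case: unpickle => [m|]; last by rewrite measure0 ltxx.
rewrite -probE //; set c := prob PP (E m) 0 => c0.
pose E' : set ('rV[R]_d * cpath R d) := [set u | E m (0, opp_path u.2)].
have mopp : measurable_fun setT (fun u : 'rV[R]_d * cpath R d => (0 : 'rV[R]_d, opp_path u.2)).
  apply/measurable_fun_pairP; split; first exact: measurable_cst.
  exact: (measurableT_comp (@measurable_opp_path R d) measurable_snd).
have mE' : measurable E'.
  by rewrite -[X in measurable X]setTI; apply: mopp.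
have cE' y : prob PP E' y = c.
  rewrite /c !probE //; apply/esym/(opp_path_law HPP Hsym); exact: measurable_section.
apply: (@lt_le_trans _ _ (\int[PP]_p (ind (E m) 0%R p * prob PP E' (0 + p (h / 2))%R))%E).
  under eq_integral do rewrite cE'.
  rewrite ge0_integralZr //.
  - by rewrite -/(prob PP (E m) 0) mule_gt0.
  - exact: measurable_ind_path.
  - by move=> p _; exact: ind_ge0.
  - exact: ltW.
apply: (prob_ge_markov HPP) => //; first exact: measurable_loop.
move=> p q [/stayP sp cp] [/stayP sq cq]; split.
  apply/stayP => s s0' sh; rewrite add0r.
  have e0 : 0 <= e by apply: le_trans (sp 0 (lexx _) h0); exact: sqrtr_ge0.
  have [sh2|hs2] := leP s (h / 2).
    rewrite cat_pathl //; have := sp s s0' sh; rewrite add0r; lra.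
  have -> : s = h / 2 + (s - h / 2) by rewrite addrC subrK.
  rewrite cat_pathr ?subr_ge0 // ?(ltW hs2) //; apply: (le_trans (ler_enormD _ _)).
  have := sp (h / 2) h2' (ltac:(lra)); have := sq (s - h / 2) (ltac:(lra)) (ltac:(lra)).
  rewrite !add0r [opp_path q _]/= enormN; lra.
rewrite /= -[cat_fun _ p q h]/(cat_path (h / 2) p q h) [X in cat_path _ _ _ X]hE.
rewrite cat_pathr //.
move: cp cq; rewrite /= !add0r => cp cq.
by rewrite -[q _]opprK; apply: le_trans da; exact: cell_dist cp cq.
Qed.

(** The time is cut into [2 ^ n] pieces so short that [loop_prob] applies. Independent loops, each
    ending close to its start, are concatenated; their drifts add up to at most e / 2 and each
    excursion adds at most e / 2. *)
Lemma stay_prob_gt0 e t : 0 < e -> 0 < t ->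
  exists2 c : R, 0 < c & (c%:E <= prob PP (stay e t) 0)%E.
Proof.
move=> e0 t0; have e4 : 0 < e / 4 by rewrite divr_gt0.
have [n Hn] := stay_initially e4 t0.
set h := t / 2 ^+ n in Hn; have h0 : 0 < h by rewrite divr_gt0 ?exprn_gt0.
have N0 : 0 < (2 ^+ n : R) by rewrite exprn_gt0.
(* The drift allowed to one loop, so that all [2 ^ n] of them together move by at most e / 2. *)
pose e1 := e / 2 / 2 ^+ n; have e10 : 0 < e1 by rewrite !divr_gt0.
have := loop_prob h0 e10 Hn; set q := prob PP _ 0 => q0.
have ml := measurable_loop (2 * (e / 4)) e1 h0.
have qfin : q \is a fin_num.
  by rewrite ge0_fin_numE ?prob_ge0 //; apply: le_lt_trans (ltry 1); exact: prob_le1.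
pose c := fine q; have c0 : 0 < c by rewrite fine_gt0 // q0 ltey_eq qfin.
have qc : q = c%:E by rewrite fineK.
pose L := [set u : 'rV[R]_d * cpath R d | loop h (2 * (e / 4)) e1 (0, u.2)].
have mL : measurable L.
  have m0 : measurable_fun setT (fun u : 'rV[R]_d * cpath R d => (0 : 'rV[R]_d, u.2)).
    by apply/measurable_fun_pairP; split; [exact: measurable_cst|exact: measurable_snd].
  by rewrite -[X in measurable X]setTI; apply: m0.
have Lc y : prob PP L y = c%:E by rewrite -qc /q !probE.
have kh k : 0 < k.+1%:R * h by rewrite mulr_gt0.
have Lstay y p s : enorm y <= e / 2 -> L (y, p) -> 0 <= s -> s < h -> enorm (y + p s) <= e.
  move=> y2 [/stayP sp _] s0 sh; apply: (le_trans (ler_enormD _ _)).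
  have := sp s s0 sh; rewrite add0r; lra.
have claim k y : enorm y <= e / 2 - k%:R * e1 ->
    ((c ^+ k.+1)%:E <= prob PP (stay e (k.+1%:R * h)) y)%E.
  elim: k y => [|k IH] y yk.
    rewrite expr1 -(Lc y) mul1r; apply: le_prob => //.
    - exact: measurable_stay.
    - move=> p Lp; apply/stayP => s s0 sh; apply: Lstay => //.
      by move: yk; rewrite mul0r subr0.
  have ke : k.+1%:R * e1 = k%:R * e1 + e1 by rewrite -natr1 mulrDl mul1r.
  have ke0 : 0 <= k%:R * e1 by rewrite mulr_ge0 // ltW.
  apply: (@le_trans _ _ (\int[PP]_p (ind L y p * prob PP (stay e (k.+1%:R * h)%R) (y + p h)%R))%E).
    apply: (@le_trans _ _ (\int[PP]_p (ind L y p * (c ^+ k.+1)%:E))%E).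
      rewrite ge0_integralZr //.
      - by rewrite -/(prob PP L y) Lc -EFinM -exprS.
      - exact: measurable_ind_path.
      - by move=> p _; exact: ind_ge0.
      - by rewrite lee_fin exprn_ge0 // ltW.
    apply: ge0_le_integral => //.
    - by move=> p _; rewrite mule_ge0 ?ind_ge0 // lee_fin exprn_ge0 // ltW.
    - by apply: emeasurable_funM => //; exact: measurable_ind_path.
    - apply: emeasurable_funM; first exact: measurable_ind_path.
      apply: (measurable_value_at_path y (ltW h0)).
      by apply: measurable_prob; exact: measurable_stay.
    move=> p _; have [Lp|Lp] := pselect (L (y, p)); last by rewrite ind0 // !mul0e.
    rewrite ind1 // !mul1e; apply: IH.
    apply: (le_trans (ler_enormD _ _)); move: Lp => [_ /=]; rewrite add0r; lra.
  apply: (prob_ge_markov HPP) => //.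
  - exact: measurable_stay.
  - exact: measurable_stay.
  move=> p r Lp /stayP sr; apply/stayP => s s0 sk.
  have [sh|hs] := ltP s h.
    by rewrite cat_pathl ?(ltW h0) ?(ltW sh) //; apply: Lstay => //; lra.
  have -> : s = h + (s - h) by rewrite addrC subrK.
  rewrite cat_pathr ?subr_ge0 // ?(ltW h0) // addrA; apply: sr; first by rewrite subr_ge0.
  by rewrite ltrBlDl; move: sk; rewrite -[k.+2%:R]natr1 mulrDl mul1r addrC.
exists (c ^+ (2 ^ n)); first by rewrite exprn_gt0.
have nE : (2 ^ n = (2 ^ n).-1.+1)%N by rewrite prednK // expn_gt0.
have -> : t = (2 ^ n)%:R * h by rewrite natrX mulrC /h divfK // gt_eqF.
rewrite nE; apply: claim; rewrite enorm0 subr_ge0.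
apply: (@le_trans _ _ ((2 ^ n)%:R * e1)).
  by rewrite ler_pM2r // ler_nat leq_pred.
by rewrite natrX mulrC /e1 divfK // gt_eqF.
Qed.

End small_ball.

Section lower_bound.
Context {R : realType} {d : nat}.
Variable PP : probability (cpath R d) R.
Variable V : 'rV[R]_d -> R.
Hypothesis mV : measurable_fun setT V.
Implicit Types (x y : 'rV[R]_d) (p q : cpath R d) (s t h e : R).
Local Open Scope ereal_scope.

Lemma occ_le_cst (g : 'rV[R]_d -> R) x t p (c : R) : measurable_fun setT g -> (forall y, 0 <= g y)%R ->
  (0 <= c)%R -> (0 <= t)%R -> (forall s, 0 <= s -> s < t -> g (x + p s) <= c)%R ->
  occ g x t p <= (c * t)%:E.
Proof.
move=> mg g0 c0 t0 H; rewrite occ_itvco //.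
apply: (@le_trans _ _ (\int[@lebesgue_measure R]_(s in `[0%R, t[) (cst c%:E s))).
  apply: ge0_le_integral => //.
  - by move=> s _; rewrite lee_fin.
  - by apply: measurable_funTS; exact: measurable_along.
  - move=> s; rewrite /= in_itv /= => /andP[s0 st]; rewrite lee_fin.
    have -> : Num.max 0%R s = s by exact: max_r.
    exact: H.
rewrite integral_cst //= lebesgue_measure_itv /= lte_fin.
case: ltP => [_|t0']; first by rewrite -EFinD subr0 -EFinM.
by rewrite mule0 lee_fin mulr_ge0.
Qed.

(** Only paths with increments in the closed ball are kept; on them the positive part of [V] is at
    most [S], and the factor of the negative part is at least 1. *)
Lemma FK1_ge_stay x e t (S : R) : (0 < t)%R -> (0 <= S)%R ->
  (forall y, (enorm y <= e)%R -> (V (x + y) <= S)%R) ->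
  (expR (- (S * t)))%:E * prob PP (stay e t) 0%R <= FK PP V t (fun=> 1) x.
Proof.
move=> t0 S0 VS; have ms := measurable_stay (d := d) e t0.
have t0' := ltW t0.
have e0 : 0 <= (expR (- (S * t)))%:E by rewrite lee_fin expR_ge0.
rewrite /prob -ge0_integralZl //; last 2 first.
- exact: measurable_ind_path.
- by move=> p _; exact: ind_ge0.
apply: ge0_le_integral => //.
- by move=> p _; rewrite mule_ge0 ?ind_ge0.
- by apply: measurable_funeM; exact: measurable_ind_path.
- by apply: emeasurable_funM => //; exact: measurable_MF_path.
move=> p _; have [/stayP sp|sp] := pselect (stay e t (0%R, p)); last first.
  by rewrite ind0 // mule0 mule1; exact: MF_ge0.
rewrite ind1; last exact/stayP.
rewrite !mule1 /MF -[leLHS]mule1; apply: lee_pmul => //.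
- rewrite -[(expR _)%:E]/(expeR (- (S * t))%R%:E) lee_expeR EFinN leeN2.
  apply: occ_le_cst => //; first exact: measurable_vpos.
  + by move=> y; exact: vpos_ge0.
  + move=> s s0 st; rewrite /vpos ge_max S0 andbT; apply: VS.
    by have := sp s s0 st; rewrite add0r.
- rewrite -(@expeR0 R) lee_expeR; apply: occ_ge0 => y; exact: vneg_ge0.
Qed.

End lower_bound.

(** * From the process to its law on path space *)

Section null_sets.
Import HBNNSimple.
Context {R : realType} {dT : measure_display} {T : measurableType dT}.
Variable mu : {measure set T -> \bar R}.
Implicit Types A N : set T.
Local Open Scope ereal_scope.

(* The integral of a nonnegative function is a supremum over simple functions,
   so that null sets may be discarded without measurability. *)
Lemma le_integral_off_null (f g : T -> \bar R) N : (forall x, 0 <= f x) -> (forall x, 0 <= g x) ->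
  measurable N -> mu N = 0 -> (forall x, ~ N x -> f x <= g x) ->
  \int[mu]_x f x <= \int[mu]_x g x.
Proof.
move=> f0 g0 mN N0 fg; have mC := measurableC mN.
have step (h : {nnsfun T >-> R}) : (forall x, (h x)%:E <= f x) ->
    \int[mu]_x (h x)%:E <= \int[mu]_x g x.
  move=> hf; pose k := mul_nnsfun h (indic_nnsfun R mC).
  have h0 x : 0 <= (h x)%:E by rewrite lee_fin; exact: fun_ge0.
  have mh : measurable_fun setT (fun x => (h x)%:E) by exact/measurable_EFinP.
  have kE x : (k x)%:E = ((fun x => (h x)%:E) \_ (~` N)) x.
    have -> : k x = (h x * \1_(~` N) x)%R by [].
    rewrite patchE indicE; case: (x \in _); first by rewrite mulr1.
    by rewrite mulr0.
  rewrite (ge0_negligible_integral mN measurableT mh _ N0) // setTD integral_mkcond.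
  under eq_integral do rewrite -kE.
  rewrite integralT_nnsfun [leRHS]ge0_integralE //; apply: ereal_sup_ubound; exists k => // x.
  rewrite kE patch_setT patchE; case: ifPn => [/set_mem xN|_]; last exact: g0.
  exact: le_trans (hf x) (fg x xN).
rewrite [leLHS]ge0_integralE //; apply: ge_ereal_sup => _ /= [h hf <-].
rewrite -integralT_nnsfun; apply: step => x.
by have := hf x; rewrite patch_setT.
Qed.

Lemma integral_off_null (f g : T -> \bar R) N : (forall x, 0 <= f x) -> (forall x, 0 <= g x) ->
  measurable N -> mu N = 0 -> (forall x, ~ N x -> f x = g x) ->
  \int[mu]_x f x = \int[mu]_x g x.
Proof.
by move=> f0 g0 mN N0 fg; apply/eqP; rewrite eq_le; apply/andP; split;
  apply: (le_integral_off_null _ _ mN N0) => // x /fg ->.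
Qed.

Lemma measure_off_null A B N : measurable A -> measurable B -> measurable N -> mu N = 0 ->
  (forall x, ~ N x -> A x <-> B x) -> mu A = mu B.
Proof.
move=> mA mB mN N0 AB; rewrite -[A]setIT -[B]setIT -!integral_indic //.
apply: (integral_off_null _ _ mN N0) => [x|x|x /AB ABx]; rewrite ?lee_fin //.
by rewrite !indicE; congr (_%:R%:E); congr nat_of_bool; apply/idP/idP => /set_mem ?;
  apply/mem_set/ABx.
Qed.

End null_sets.

Section same_law.
Context {R : realType} {d1 d2 d3 : measure_display}.
Context {T1 : measurableType d1} {T2 : measurableType d2} {E : measurableType d3}.
Variables (P1 : probability T1 R) (P2 : probability T2 R).
Local Open Scope ereal_scope.

Lemma Rintegral_same_law (Z1 : T1 -> E) (Z2 : T2 -> E) (f : E -> R) M :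
  measurable_fun setT Z1 -> measurable_fun setT Z2 ->
  (forall B, measurable B -> P1 [set w | B (Z1 w)] = P2 [set w | B (Z2 w)]) ->
  measurable_fun setT f -> (forall x, `|f x| <= M)%R ->
  Rintegral P1 setT (fun w => f (Z1 w)) = Rintegral P2 setT (fun w => f (Z2 w)).
Proof.
move=> mZ1 mZ2 PE mf fM; rewrite /Rintegral; congr fine.
have mEf : measurable_fun setT (EFin \o f) by exact/measurable_EFinP.
have i1 : P1.-integrable setT ((EFin \o f) \o Z1).
  apply: (@probability_integrable_bounded _ _ _ _ (f \o Z1) M) => //.
    exact: (measurableT_comp mf mZ1).
  by move=> x; exact: fM.
have i2 : P2.-integrable setT ((EFin \o f) \o Z2).
  apply: (@probability_integrable_bounded _ _ _ _ (f \o Z2) M) => //.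
    exact: (measurableT_comp mf mZ2).
  by move=> x; exact: fM.
have := integral_pushforward mZ1 mEf i1 measurableT.
have := integral_pushforward mZ2 mEf i2 measurableT.
rewrite !preimage_setT => <- <-; apply: eq_measure_integral => // B mB _.
exact: PE.
Qed.

End same_law.

Section locally_bounded.
Context {R : realType} {d : nat}.

(** Compactness of the time interval: near a time, the right limit bounds the path on one side and
    the left limit on the other. At time 0 the left side consists of negative times, which the claim
    excludes. *)
Lemma cadlag_bounded (g : R -> 'rV[R]_d) : cadlag g ->
  forall t, exists M, forall s, 0 <= s -> s <= t -> enorm (g s) <= M.
Proof.
move=> [gr gl] t.
have ce (F : set_system R) (FF : Filter F) (l : 'rV[R]_d) : g s @[s --> F] --> l ->
    \forall s \near F, enorm (g s) < enorm l + 1.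
  move=> gl'; have : enorm (g s) @[s --> F] --> enorm l.
    by apply: (continuous_cvg _ _ gl'); exact: (@continuous_enorm R d).
  by move/cvgrPdist_lt => /(_ 1 ltr01); apply: filterS => s; rewrite distrC ltr_norml; lra.
have /compact_near_coveringP H := @segment_compact R 0 t.
have [M [_ HM]] : \forall M \near +oo, `[0, t]%classic `<=` (fun s => 0 <= s -> enorm (g s) <= M).
  apply: H => x; rewrite /= in_itv /= => /andP[x0 xt].
  have [M1 HM1] : exists M1, \forall s \near x, 0 <= s -> enorm (g s) <= M1.
    have gx := ce _ _ _ (gr x x0).
    have [L HL] : exists L, \forall s \near x^'-, 0 <= s -> enorm (g s) < L.
      move: x0; rewrite le_eqVlt => /predU1P[<-|x0].
        exists 0; near=> s => s0; exfalso; suff : s < 0 by lra.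
        by near: s; exact: nbhs_left_lt.
      have /cvg_ex[l Hl] := gl x x0; exists (enorm l + 1).
      by apply: filterS (ce _ _ _ Hl).
    exists (Num.max (enorm (g x)) (Num.max (enorm (g x) + 1) L)).
    have {}gx : \forall s \near x, x < s -> enorm (g s) < enorm (g x) + 1 by exact: gx.
    have {}HL : \forall s \near x, s < x -> 0 <= s -> enorm (g s) < L by exact: HL.
    near=> s => s0.
    have xs : x < s -> enorm (g s) < enorm (g x) + 1 by near: s.
    have sx : s < x -> 0 <= s -> enorm (g s) < L by near: s.
    rewrite !le_max; case: (ltgtP s x) => [/sx/(_ s0)/ltW ->|/xs/ltW ->|->].
    - by rewrite !orbT.
    - by rewrite orbT.
    - by rewrite lexx.
  near=> s M => s0.
  have sM : 0 <= s -> enorm (g s) <= M1 by near: s.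
  have MM : M1 <= M by near: M; apply: nbhs_pinfty_ge; exact: num_real.
  exact: (le_trans (sM s0)).
exists (`|M| + 1) => s s0 st; apply: (HM (`|M| + 1)) => //=.
  by have := ler_norm M; lra.
by rewrite in_itv /= s0.
Unshelve. all: by end_near.
Qed.

End locally_bounded.

Section path_law.
Context {R : realType} {d : nat} {disp : measure_display}.
Context {Omega : measurableType disp} (P : probability Omega R).
Variable X : R -> Omega -> 'rV[R]_d.
Hypothesis hX : levy_process P X.
Implicit Types (s t : R).
Local Open Scope ereal_scope.

Lemma exists_path_law :
  exists (PP : probability (cpath R d) R) (path : Omega -> cpath R d) (N : set Omega),
  [/\ measurable_fun setT path, measurable N, P N = 0,
    (forall A, measurable A -> PP A = P (path @^-1` A)) &
    forall w, ~ N w -> forall t, (0 <= t)%R -> path w t = X t w].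
Proof.
have [N [mN N0 HN]] : {ae P, forall w, X 0 w = 0%R /\ cadlag (X ^~ w)}.
  by apply: filterS2 (levy_start hX) (levy_cadlag hX).
have good w : ~ N w -> X 0 w = 0%R /\ cadlag (X ^~ w).
  by move=> Nw; apply: contrapT => H; apply: Nw; exact: HN.
have good_path w : ~ N w -> is_cpath (X ^~ w).
  move=> /good[Xw0 cX]; split; [exact: Xw0|exact: cX.1|exact: cadlag_bounded].
(* On the exceptional null set the path is replaced by the zero path, so that the map into path
   space is defined everywhere. *)
pose path w : cpath R d := if pselect (N w) is right Nw then Cpath (good_path w Nw)
  else Cpath (@is_cpath0 R d).
have pathE w t : path w t = if w \in N then 0%R else X t w.
  rewrite /path; case: pselect => Nw; first by rewrite mem_set.
  by rewrite memNset.
have mpath : measurable_fun setT path.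
  apply: measurable_to_cpath => t t0.
  have -> : (fun w => path w t) = fun w => if w \in N then 0%R else X t w.
    by apply/funext => w; exact: pathE.
  apply: measurable_fun_ifT.
  - by apply: (@measurable_fun_bool _ _ _ _ true); rewrite setTI (_ : _ @^-1` _ = N) //;
      apply/seteqP; split => w /= => [/set_mem|/mem_set].
  - exact: measurable_cst.
  - exact: (levy_measurable hX).
pose f : {mfun Omega >-> cpath R d} := mfun_Sub (mem_set mpath).
exists (distribution P f), path, N; split => //.
by move=> w Nw t t0; rewrite pathE memNset.
Qed.

Variables (PP : probability (cpath R d) R) (path : Omega -> cpath R d) (N : set Omega).
Hypotheses (mpath : measurable_fun setT path) (mN : measurable N) (N0 : P N = 0).
Hypothesis PPE : forall A, measurable A -> PP A = P (path @^-1` A).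
Hypothesis pathE : forall w, ~ N w -> forall t, (0 <= t)%R -> path w t = X t w.

Lemma PP_eval (t : R) B : (0 <= t)%R -> measurable B ->
  PP [set p : cpath R d | B (p t)] = P [set w | B (X t w)].
Proof.
move=> t0 mB; have mE : measurable [set p : cpath R d | B (p t)].
  by rewrite -[X in measurable X]setTI; exact: (measurable_eval t0).
rewrite PPE //; apply: (measure_off_null _ _ mN N0).
- by rewrite -[X in measurable X]setTI; exact: mpath.
- by rewrite -[X in measurable X]setTI; exact: (levy_measurable hX).
- by move=> w Nw; rewrite /preimage /= pathE.
Qed.

Lemma PP_levy_law : levy_law PP.
Proof.
move=> tau n M B tau0 mB.
have g0 k : (0 <= grid tau n k)%R by apply: grid_ge0; exact: ltW.
have gS k : (grid tau n k <= grid tau n k.+1)%R.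
  by rewrite /grid ler_pM2r ?invr_gt0 ?exprn_gt0 // ler_pM2l // ler_nat.
have gB k : (grid tau n k.+1 - grid tau n k = grid tau n 1)%R.
  by rewrite /grid -mulrBl -mulrBr -natrB // subSnn.
have mX k : measurable_fun setT (X (grid tau n k)) by exact: (levy_measurable hX).
have mI k : measurable [set w | B k (X (grid tau n k.+1) w - X (grid tau n k) w)%R].
  by rewrite -[X in measurable X]setTI; apply: (measurable_rVB (mX k.+1) (mX k)).
transitivity (P (\bigcap_(i in `I_M) [set w | B i (X (grid tau n i.+1) w - X (grid tau n i) w)%R])).
  rewrite PPE; last exact: measurable_increments.
  apply: (measure_off_null _ _ mN N0).
  - by rewrite -[X in measurable X]setTI; apply: mpath => //; exact: measurable_increments.
  - by apply: bigcap_measurableType => i _; exact: mI.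
  - move=> w Nw; rewrite /preimage /increments_in /bigcap /=.
    by split => H i iM; have := H i iM; rewrite ?pathE.
rewrite (levy_independent hX) //; apply: eq_bigr => i _.
by rewrite (levy_stationary hX) // gB PP_eval.
Qed.

Hypothesis sym : symmetric_process P X.

Lemma PP_sym (t : R) B : (0 <= t)%R -> measurable B ->
  PP [set p : cpath R d | B (p t)] = PP [set p : cpath R d | B (- p t)%R].
Proof.
move=> t0 mB; rewrite PP_eval // sym // (PP_eval t0 (B := [set y | B (- y)%R])) //.
rewrite -[X in measurable X]setTI.
by apply: (measurable_rVN (f := id)) => //; exact: measurable_id.
Qed.

Lemma PP_charfun (L : {measure set 'rV[R]_d -> \bar R}) (b : 'rV[R]_d) (A : 'M[R]_d) (h : R) :
  (forall (t : R) (xi : 'rV[R]_d), (0 <= t)%R ->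
    let rePsi := (- (dotr (xi *m A) xi / 2)
                 - Rintegral L setT (fun z => 1 - cos (dotr xi z)))%R in
    let imPsi := (dotr b xi + Rintegral L setT
        (fun z => sin (dotr xi z) - dotr xi z * \1_(eball 0 1) z))%R in
    Rintegral P setT (fun w => cos (dotr xi (X t w))) =
      (expR (t * rePsi) * cos (t * imPsi))%R /\
    Rintegral P setT (fun w => sin (dotr xi (X t w))) =
      (expR (t * rePsi) * sin (t * imPsi))%R) ->
  (0 <= h)%R -> sym_charfun L A PP (fun p : cpath R d => p h) h.
Proof.
Local Open Scope ring_scope.
move=> HL h0.
have mev (t : R) : 0 <= t -> measurable_fun setT (fun p : cpath R d => p t).
  by move=> t0; exact: measurable_eval.
have mneg (t : R) : 0 <= t -> measurable_fun setT (fun p : cpath R d => - p t).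
  by move=> t0; apply: measurable_rVN; exact: mev.
have symI (t : R) (f : 'rV[R]_d -> R) : 0 <= t -> measurable_fun setT f ->
    (exists M, forall x, `|f x| <= M) ->
    Rintegral PP setT (fun p => f (p t)) = Rintegral PP setT (fun p => f (- p t)).
  move=> t0 mf [M fM]; apply: (Rintegral_same_law (M := M)) => //.
  - exact: mev.
  - exact: mneg.
  - by move=> B mB; exact: PP_sym.
have tr (t : R) (f : 'rV[R]_d -> R) : 0 <= t -> measurable_fun setT f ->
    (exists M, forall x, `|f x| <= M) ->
    Rintegral PP setT (fun p => f (p t)) = Rintegral P setT (fun w => f (X t w)).
  move=> t0 mf [M fM]; apply: (Rintegral_same_law (M := M)) => //.
  - exact: mev.
  - exact: (levy_measurable hX).
  - by move=> B mB; exact: PP_eval.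
have mcos xi : measurable_fun setT (fun y : 'rV[R]_d => cos (dotr xi y)).
  apply: (measurableT_comp _ (measurable_dotr xi)).
  by apply: continuous_measurable_fun; exact: continuous_cos.
have msin xi : measurable_fun setT (fun y : 'rV[R]_d => sin (dotr xi y)).
  apply: (measurableT_comp _ (measurable_dotr xi)).
  by apply: continuous_measurable_fun; exact: continuous_sin.
have bcos xi : exists M, forall y : 'rV[R]_d, `|cos (dotr xi y)| <= M.
  by exists 1 => y; rewrite ler_norml cos_geN1 cos_le1.
have bsin xi : exists M, forall y : 'rV[R]_d, `|sin (dotr xi y)| <= M.
  by exists 1 => y; rewrite ler_norml sin_geN1 sin_le1.
have sin0 (t : R) xi : 0 <= t -> Rintegral PP setT (fun p => sin (dotr xi (p t))) = 0.
  move=> t0; have := symI t (fun y => sin (dotr xi y)) t0 (msin xi) (bsin xi).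
  under [in X in _ = X -> _]eq_Rintegral do rewrite dotrNr sinN.
  rewrite -[X in _ = X -> _]/(Rintegral PP setT (fun p : cpath R d => - sin (dotr xi (p t)))).
  have -> : Rintegral PP setT (fun p : cpath R d => - sin (dotr xi (p t))) =
      - Rintegral PP setT (fun p : cpath R d => sin (dotr xi (p t))).
    rewrite -mulN1r -RintegralZl //; last first.
      by have [M HM] := bsin xi; exact: (bounded_integrable PP (mev t t0) (msin xi) HM).
    by apply: eq_Rintegral => p _; rewrite mulN1r.
  lra.
split; last by move=> f mf fM; exact: symI.
split; [exact: mev| |by move=> xi; exact: sin0].
move=> xi; rewrite (tr h (fun y => cos (dotr xi y))) //.
have [-> _] := HL h xi h0; set im := dotr b xi + _.
(* By symmetry the mean of the sine vanishes also at time h / 2, where the exponential factor does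
   not. Doubling the angle gives cos(h im) = 1, and the phase of the drift disappears without being
   computed. *)
have im0 : sin (h / 2 * im) = 0.
  have h2 : 0 <= h / 2 by rewrite divr_ge0.
  have [_] := HL (h / 2) xi h2; rewrite -(tr _ (fun y => sin (dotr xi y))) // sin0 // -/im.
  by move/esym/eqP; rewrite mulf_eq0 gt_eqF ?expR_gt0 //= => /eqP.
have -> : h * im = h / 2 * im + h / 2 * im by rewrite -mulrDl -splitr.
rewrite cosD im0 mulr0 subr0 -expr2.
have := cos2Dsin2 (h / 2 * im); rewrite im0 expr0n /= addr0 => ->.
by rewrite mulr1 /psi -opprD mulrN.
Qed.

Section functionals.
Local Open Scope ereal_scope.
Variable V : 'rV[R]_d -> R.
Hypothesis mV : measurable_fun setT V.

Lemma occ_path x t w : ~ N w ->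
  forall g : 'rV[R]_d -> R,
  \int[lebesgue_measure]_(s in `[0%R, t]) (g (x + X s w)%R)%:E = occ g x t (path w).
Proof.
move=> Nw g; apply: eq_integral => s /set_mem /=; rewrite in_itv /= => /andP[s0 _].
by rewrite pathE.
Qed.

Lemma integral_path (F : cpath R d -> \bar R) : measurable_fun setT F -> (forall p, 0 <= F p) ->
  \int[PP]_p F p = \int[P]_w F (path w).
Proof.
move=> mF F0.
transitivity (\int[pushforward P path]_p F p).
  by apply: eq_measure_integral => // A mA _; exact: PPE.
by rewrite ge0_integral_pushforward.
Qed.

Lemma integral_occ_path (g : 'rV[R]_d -> R) x t : measurable_fun setT g -> (forall y, 0 <= g y)%R ->
  \int[P]_w \int[lebesgue_measure]_(s in `[0%R, t]) (g (x + X s w)%R)%:E =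
  \int[PP]_p occ g x t p.
Proof.
move=> mg g0; rewrite integral_path; last 2 first.
- exact: measurable_occ_path.
- by move=> p; exact: occ_ge0.
apply: (integral_off_null _ _ mN N0).
- by move=> w; apply: integral_ge0 => s _; rewrite lee_fin.
- by move=> w; exact: occ_ge0.
- by move=> w Nw; exact: occ_path.
Qed.

(** The integral of [V] along a path is the difference of two occupations, and its exponential
    splits once the negative one is finite. The remaining paths form a null set, which is discarded
    together with the one where [path] differs from [X]. *)
Lemma feynman_kacE (f : 'rV[R]_d -> R) x t : (0 <= t)%R -> measurable_fun setT f -> (forall y, 0 <= f y)%R ->
  {ae PP, forall p, occ (vneg V) x t p < +oo} ->
  feynman_kac P X V t f x = FK PP V t (EFin \o f) x.
Proof.
move=> t0 mf f0 [A [mA A0 HA]].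
rewrite /FK integral_path; last 2 first.
- by apply: measurable_FK_path => //; exact/measurable_EFinP.
- by move=> p; apply: mule_ge0; [exact: MF_ge0|rewrite lee_fin].
have mNA : measurable (N `|` path @^-1` A).
  by apply: measurableU => //; rewrite -[X in measurable X]setTI; exact: mpath.
apply: (integral_off_null _ _ mNA).
- by move=> w; apply: mule_ge0; [exact: expeR_ge0|rewrite lee_fin].
- by move=> w; apply: mule_ge0; [exact: MF_ge0|rewrite lee_fin].
- apply/eqP; rewrite eq_le measure_ge0 andbT; apply: (le_trans (measureU2 _ _ _)) => //.
    by rewrite -[X in measurable X]setTI; exact: mpath.
  have PA0 : P (path @^-1` A) = 0 by rewrite -PPE.
  rewrite -[leRHS]adde0; apply: leeD; rewrite le_eqVlt; apply/orP; left; apply/eqP.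
    exact: N0.
  exact: PA0.
- move=> w /not_orP[Nw Aw]; rewrite /= pathE //; congr (_ * _).
  have fin : occ (vneg V) x t (path w) < +oo by apply: contrapT => H; apply: Aw; exact: HA.
  rewrite (occ_path x t Nw V) /occ integralE.
  have -> : \int[lebesgue_measure]_(s in `[0%R, t]) (fun s => (V (x + path w s)%R)%:E)^\+ s =
      occ (vpos V) x t (path w).
    by apply: eq_integral => s _; rewrite funeposE /vpos -EFin_max.
  have -> : \int[lebesgue_measure]_(s in `[0%R, t]) (fun s => (V (x + path w s)%R)%:E)^\- s =
      occ (vneg V) x t (path w).
    by apply: eq_integral => s _; rewrite funenegE /vneg -EFin_max.
  have finm : occ (vneg V) x t (path w) \is a fin_num.
    by rewrite ge0_fin_numE //; apply: occ_ge0 => y; exact: vneg_ge0.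
  rewrite fin_num_oppeB // expeRD.
  by rewrite /MF; congr (_ * _).
Qed.

End functionals.

End path_law.

(** * Ground state domination and the growth of the potential *)

(** The Euclidean ball lies in a compact cube, on which a positive continuous function is bounded
    away from 0. *)
Lemma continuous_gt0_ball (R : realType) (d : nat) (phi : 'rV[R]_d -> R) (r : R) :
  continuous phi -> (forall y, 0 < phi y) ->
  exists2 c, 0 <= c & forall y, eball 0 r y -> 1 <= c * phi y.
Proof.
move=> cphi phi0.
have cube : compact [set v : 'rV[R]_d | forall i, `[- r, r]%classic (v ord0 i)].
  by apply: (rV_compact (A := fun=> `[- r, r]%classic)) => i; exact: segment_compact.
have /compact_near_coveringP H := cube.
have [M [_ HM]] : \forall M \near +oo,
    [set v : 'rV[R]_d | forall i, `[- r, r]%classic (v ord0 i)] `<=` (fun y => 1 <= M * phi y).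
  apply: H => y _.
  have y2 : 0 < phi y / 2 by rewrite divr_gt0.
  have ny : \forall z \near y, phi y / 2 < phi z.
    have /cvgrPdist_lt/(_ _ y2) := cphi y; apply: filterS => z.
    by rewrite ltr_norml => /andP[_]; lra.
  near=> z M.
  have pz : phi y / 2 < phi z by near: z.
  have pM : (phi y / 2)^-1 <= M by near: M; apply: nbhs_pinfty_ge; exact: num_real.
  have M0 : 0 <= M by apply: le_trans pM; rewrite invr_ge0 ltW.
  apply: (@le_trans _ _ (M * (phi y / 2))); last by rewrite ler_wpM2l // ltW.
  by rewrite -ler_pdivrMr // div1r.
exists (`|M| + 1); first by rewrite addr_ge0.
move=> y; rewrite /eball /= subr0 => yr; apply: (HM (`|M| + 1)).
  by have := ler_norm M; lra.
move=> i; rewrite /= in_itv /= -ler_norml; apply: le_trans (ltW yr).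
exact: coord_le_enorm.
Unshelve. all: by end_near.
Qed.

Section path_level.
Context {R : realType} {d : nat} (hd : (0 < d)%N).
Variable PP : probability (cpath R d) R.
Hypothesis HPP : levy_law PP.
Hypothesis Hsym : forall (t : R) (B : set 'rV[R]_d), 0 <= t -> measurable B ->
  PP [set p : cpath R d | B (p t)] = PP [set p : cpath R d | B (- p t)].
Variables (nu : 'rV[R]_d -> R) (N : {measure set 'rV[R]_d -> \bar R}) (A : 'M[R]_d).
Hypothesis mnu : measurable_fun setT nu.
Hypothesis nu_gt0 : forall x, x != 0 -> 0 < nu x.
Hypothesis Nfin : (\int[N]_z (Num.min 1 (enorm z ^+ 2))%:E < +oo)%E.
Hypothesis NE : forall A, measurable A ->
  N A = (\int[lebesgue_rV R d]_(z in A) (nu z)%:E)%E.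
Hypothesis Apsd : forall xi, 0 <= dotr (xi *m A) xi.
Variable w : 'rV[R]_d -> R.
Hypothesis ps : profile_spec nu N w.
Hypothesis Hchar : forall h, 0 < h <= 1 -> sym_charfun N A PP (fun p : cpath R d => p h) h.
Variable V : 'rV[R]_d -> R.
Hypothesis mV : measurable_fun setT V.
Implicit Types (x y : 'rV[R]_d) (p : cpath R d) (s t r : R).

Let mvp : measurable_fun setT (vpos V). Proof. exact: measurable_vpos. Qed.
Let mvn : measurable_fun setT (vneg V). Proof. exact: measurable_vneg. Qed.
Let vp0 y : 0 <= vpos V y. Proof. exact: vpos_ge0. Qed.
Let vn0 y : 0 <= vneg V y. Proof. exact: vneg_ge0. Qed.
Let w0 x : 0 < w x. Proof. exact: (ps_gt0 ps). Qed.

(** Chebyshev's inequality for min(1, |X_u|^2), whose mean is at most C u. *)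
Lemma small_time_prob : exists2 h : R, 0 < h <= 1 & forall u, 0 <= u <= h ->
  ((1 / 2)%:E <= PP [set p : cpath R d | eball 0 1 (p u)])%E.
Proof.
have [C C0 HC] := trunc2_moment Nfin Apsd PP.
pose h := Num.min 1 (2 * C)^-1.
have h0 : 0 < h by rewrite lt_min ltr01 invr_gt0 mulr_gt0.
have h1 : h <= 1 by rewrite ge_min lexx.
exists h; rewrite ?h0 // => u /andP[u0 uh].
have mb : measurable [set p : cpath R d | eball 0 1 (p u)].
  by rewrite -[X in measurable X]setTI; apply: measurable_eval => //; exact: measurable_eball.
move: u0 uh; rewrite le_eqVlt => /predU1P[<-|u0] uh.
  rewrite (_ : [set p : cpath R d | _] = setT).
    apply: (@le_trans _ _ 1%E); first by rewrite lee_fin; lra.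
    by rewrite le_eqVlt; apply/orP; left; apply/eqP/esym; exact: probability_setT.
  by apply/seteqP; split => // p _; rewrite /eball /= cpath0 subr0 enorm0.
have u1 : 0 < u <= 1 by rewrite u0 (le_trans uh).
have uC : C * u <= 1 / 2.
  apply: (@le_trans _ _ (C * (2 * C)^-1)); last by rewrite invfM mulrCA divff ?gt_eqF // mulr1 div1r.
  by rewrite ler_pM2l // (le_trans uh) // ge_min lexx orbT.
have mu : measurable_fun setT (fun p : cpath R d => p u) by apply: measurable_eval; exact: ltW.
have ti : PP.-integrable setT (EFin \o (fun p : cpath R d => trunc2 (p u))).
  by apply: (bounded_integrable PP mu (M := 1)); [exact: measurable_trunc2|exact: trunc2_le1].
have oi : PP.-integrable setT (EFin \o (fun=> 1 : R) : cpath R d -> \bar R).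
  by apply: (bounded_integrable PP mu (f := fun=> 1) (M := 1)) => // y; rewrite normr1.
pose g p := 1 - trunc2 (p u : 'rV[R]_d).
have gi : PP.-integrable setT (EFin \o g).
  by have := integrableB measurableT oi ti; exact: eq_integrable.
apply: (@le_trans _ _ (Rintegral PP setT g)%:E).
  rewrite lee_fin RintegralB // Rintegral_prob_cst.
  have := HC _ _ u1 (Hchar u1); lra.
rewrite /Rintegral fineK; last exact: integrable_fin_num.
rewrite -[X in PP X]setIT -integral_indic //; apply: ge0_le_integral => //.
- by move=> p _; rewrite lee_fin subr_ge0 /trunc2 ge_min lexx.
- by have /integrableP[] := gi.
- by apply/measurable_EFinP; exact: measurable_indic.
move=> p _; rewrite lee_fin indicE /g; case: (boolP (p \in _)) => [_|/negP pb].
  by rewrite gerBl trunc2_ge0.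
rewrite subr_le0 /trunc2 le_min lexx /= -sqr_enorm -[leLHS](expr1n _ 2).
rewrite lerXn2r ?nnegrE ?sqrtr_ge0 // leNgt; apply/negP => pe; apply: pb.
by apply/mem_set; rewrite /eball /= subr0.
Qed.

Lemma profile_low r : exists2 m : R, 0 < m & forall y, eball 0 r y -> m <= w y.
Proof.
have [x xr] := exists_enorm (R := R) hd (normr_ge0 r).
exists (w x) => // y; rewrite /eball /= subr0 => yr; apply: (ps_nincr ps).
by rewrite xr; apply: (le_trans (ltW yr)); exact: ler_norm.
Qed.

(** Quantifies the decay of the density: it is below 1, with a logarithm of known sign, once |x|
    exceeds [C], and it beats any fixed constant far out. *)
Lemma nu_small : exists2 C : R, 0 < C & forall x, 1 + d%:R <= enorm x ->
  0 < nu x /\ nu x * enorm x <= C.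
Proof.
have [C C0 HC] := ps_decay ps; exists C => // x x1.
have d0 : 0 <= d%:R :> R by [].
split; first by apply: nu_gt0; apply/eqP => x0; move: x1; rewrite x0 enorm0; lra.
have x0 : 0 <= enorm x by exact: sqrtr_ge0.
apply: le_trans (HC x _); last by lra.
by rewrite ler_wpM2r // (ps_nu_le ps) //; lra.
Qed.

Lemma heat_profile t : exists2 C : R, 0 < C & forall s x, 0 <= s <= t ->
  (\int[PP]_p (w (x + p s))%:E <= (C * w x)%:E)%E.
Proof.
have [C C0 HC] := heat_w HPP mnu nu_gt0 Nfin NE Apsd ps Hchar.
exists (C * expR (C * t)); first by rewrite mulr_gt0 ?expR_gt0.
move=> s x /andP[s0 st]; apply: (le_trans (HC s x s0)); rewrite lee_fin ler_pM2r //.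
by rewrite ler_pM2l // ler_expR ler_pM2l.
Qed.

Hypothesis conf : forall M, exists r, forall x, r <= enorm x -> M <= V x.
Variable tau : R.
Hypothesis tau0 : 0 < tau.
Hypothesis Hneg : forall x, (\int[PP]_p occ (vneg V) x tau p <= (1 / 32)%:E)%E.
Hypothesis Hloc : forall r, 0 < r -> exists2 t : R, 0 < t & forall x,
  (\int[PP]_p occ (fun y => vpos V y * \1_(eball 0 r) y)%R x t p <= (1 / 8)%:E)%E.

Lemma exp_moment_fin (g : 'rV[R]_d -> R) x t (K : R) : measurable_fun setT g ->
  (forall y, 0 <= g y) -> (\int[PP]_p expeR (occ g x t p) <= K%:E)%E ->
  {ae PP, forall p, (occ g x t p < +oo)%E}.
Proof.
move=> mg g0 HK.
have ig : PP.-integrable setT (fun p => expeR (occ g x t p)).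
  apply/integrableP; split; first exact: measurable_exp_occ_path.
  under eq_integral do rewrite gee0_abs ?expeR_ge0 //.
  by apply: (le_lt_trans HK); rewrite ltry.
have := integrable_ae measurableT ig; apply: filterS => p /(_ I).
by case: (occ g x t p) => [a||] //= _; rewrite ltry.
Qed.

Lemma occ_vneg_fin x t : {ae PP, forall p, (occ (vneg V) x t p < +oo)%E}.
Proof.
have H8 y : (\int[PP]_p occ (vneg V) y tau p <= (1 / 8)%:E)%E.
  by apply: (le_trans (Hneg y)); rewrite lee_fin; lra.
have [K K1 HK] := khasminskii_all HPP mvn vn0 tau0 H8 t.
exact: (exp_moment_fin mvn vn0 (HK t x (lexx t))).
Qed.

(** The positive part is in the Kato class only locally. A path is bounded up to time [t], so it
    sees [V] cut off to some ball of integer radius, and countably many null sets are removed. *)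
Lemma occ_vpos_fin x t : {ae PP, forall p, (occ (vpos V) x t p < +oo)%E}.
Proof.
have ms n : measurable_fun setT (fun y => vpos V y * \1_(eball 0 n.+1%:R) y).
  by apply: measurable_funM => //; apply: measurable_indic; exact: measurable_eball.
have s0 n y : 0 <= vpos V y * \1_(eball 0 n.+1%:R) y by rewrite mulr_ge0.
have H n : {ae PP, forall p, (occ (fun y => vpos V y * \1_(eball 0 n.+1%:R) y)%R x t p < +oo)%E}.
  have [u u0 Hu] := Hloc (ltr0Sn R n).
  have [K K1 HK] := khasminskii_all HPP (ms n) (s0 n) u0 Hu t.
  exact: (exp_moment_fin (ms n) (s0 n) (HK t x (lexx t))).
apply: filterS (ae_foralln H) => p Hp.
have [M HM] := cpath_bounded p t.
pose n := Num.truncn (enorm x + M).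
suff <- : occ (fun y => vpos V y * \1_(eball 0 n.+1%:R) y)%R x t p = occ (vpos V) x t p by exact: Hp.
apply: eq_integral => s /set_mem /=; rewrite in_itv /= => /andP[s1 s2].
rewrite indicE mem_set ?mulr1 // /eball /= subr0.
have b := HM s s1 s2; have := ler_enormD x (p s); have := sqrtr_ge0 (dotr x x).
have := sqrtr_ge0 (dotr (p s) (p s)); rewrite -/(enorm _) -/(enorm _) => h1 h2 h3.
apply: (@le_lt_trans _ _ (enorm x + M)); first lra.
by have /andP[] := truncn_itv (ltac:(lra) : 0 <= enorm x + M).
Qed.

Variables (phi : 'rV[R]_d -> R) (F lam : R).
Hypotheses (mphi : measurable_fun setT phi) (phi0 : forall y, 0 < phi y).
Hypothesis phiF : forall y, phi y <= F.
Hypothesis cphi : continuous phi.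
Hypothesis eig : forall t x, 0 < t ->
  FK PP V t (EFin \o phi) x = (expR (- lam * t) * phi x)%:E.

Lemma decay_paths : exists2 C : R, 0 < C & forall x, phi x <= C * root4 w x ^+ 3.
Proof.
have [h /andP[h0 h1] Hh] := small_time_prob.
have [Cw Cw0 HCw] := heat_profile h.
(* The fourth exponential moment is required by [exp4_le]; the 1/32 in [Hneg] is a quarter of the
   threshold 1/8 of Khasminskii's lemma. *)
have m4 : measurable_fun setT (fun y => 4 * vneg V y) by exact: measurable_funM.
have v4 y : 0 <= 4 * vneg V y by rewrite mulr_ge0.
have H8 x : (\int[PP]_p occ (fun y => 4 * vneg V y)%R x tau p <= (1 / 8)%:E)%E.
  under eq_integral do rewrite occZ //.
  rewrite ge0_integralZl //; last 2 first.
  - exact: measurable_occ_path.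
  - by move=> p _; exact: occ_ge0.
  apply: (@le_trans _ _ (4%:E * (1 / 32)%:E)%E); first exact: lee_wpmul2l.
  by rewrite -EFinM lee_fin; lra.
have [K K1 HK] := khasminskii_all HPP m4 v4 tau0 H8 h.
apply: (ground_state_decay HPP mV h0 Hh (ps_meas ps) w0 profile_low (ltW Cw0) (K := K) (F := F) (lam := lam)) => //.
- by move=> x; apply: HCw; rewrite lexx ltW.
- exact: le_trans K1.
- by move=> x; exact: HK.
- move=> M; have [r Hr] := conf M; exists r => y /notin_eball; rewrite subr_ge0; exact: Hr.
- by move=> x; exact: eig.
Qed.

Lemma domination_of_potential_ge (c r0 : R) : 0 < c ->
  (forall x, r0 <= enorm x -> nu x < 1 -> c * `|ln (nu x)| <= V x) ->
  exists2 D : R, 0 < D & forall x, (FK PP V (4 / c) (fun=> 1) x <= (D * phi x)%:E)%E.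
Proof.
move=> c0 HV; have t0 : 0 < 4 / c by rewrite divr_gt0.
have [c' [C' [r1 [c'0 C'0 Hret]]]] := return_prob_ge Nfin Apsd ps PP.
have [Cn Cn0 Hn] := nu_small; have [r2 Hr2] := conf 0.
(* Beyond this radius hold the hypothesis on [V], the return estimate and V >= 0; the bound Cn + 1
   enforces nu < 1. *)
pose r := Num.max (Num.max r0 r1) (Num.max r2 (Num.max (1 + d%:R) (Cn + 1))).
have rout y : ~ eball 0 r y -> [/\ r0 <= enorm y, r1 <= r, r <= enorm y, r2 <= enorm y &
    (1 + d%:R <= enorm y) && (Cn < enorm y)].
  move/notin_eball; rewrite subr_ge0 => ry.
  have /andP[/andP[h1 h2] /andP[h3 /andP[h4 h5]]] : ((r0 <= enorm y) && (r1 <= enorm y)) &&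
      ((r2 <= enorm y) && ((1 + d%:R <= enorm y) && (Cn + 1 <= enorm y))).
    by move: ry; rewrite /r !ge_max.
  split => //; first by rewrite !le_max lexx orbT.
  by rewrite h4 /=; lra.
have nu1 y : ~ eball 0 r y -> 0 < nu y < 1.
  move=> /rout[_ _ _ _ /andP[y1 y2]]; have [n0 nC] := Hn y y1.
  rewrite n0 ltNge; apply/negP => n1.
  have : enorm y <= nu y * enorm y by rewrite ler_peMl //; exact: sqrtr_ge0.
  lra.
have [Cw Cw0 HCw] := heat_profile (4 / c / 2).
have H8 y : (\int[PP]_p occ (vneg V) y tau p <= (1 / 8)%:E)%E.
  by apply: (le_trans (Hneg y)); rewrite lee_fin; lra.
have [K K1 HK] := khasminskii_all HPP mvn vn0 tau0 H8 (4 / c).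
have [c1 c10 Hc1] := continuous_gt0_ball r cphi phi0.
apply: (domination_paths HPP mV (r := r) t0 (w := w) (c := c') (C := C') (Cw := Cw) (K := K) (lam := lam) (c1 := c1)) => //.
- exact: (ps_meas ps).
- by move=> y; exact: ltW.
- exact: ltW.
- exact: ltW.
- move=> h y hh yB; have [_ r1r ry _ _] := rout y yB.
  apply: (le_trans (Hret _ h y r r1r ry hh (Hchar hh))).
  rewrite /ind_ball.
  have mb : measurable [set p : cpath R d | eball 0 r (y + p h)].
    rewrite -[X in measurable X]setTI.
    apply: (measurable_rVD (measurable_cst y) (measurable_eval _)) => //; last exact: measurable_eball.
    by apply: ltW; case/andP: hh.
  by rewrite -[X in (PP X <= _)%E]setIT -integral_indic.
- by move=> y /rout[_ _ _ y2 _]; exact: Hr2.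
- move=> y yB; have [y0 _ _ _ /andP[y1 _]] := rout y yB.
  have /andP[n0 n1] := nu1 y yB.
  have l0 : ln (nu y) < 0 by rewrite ln_lt0 // n0.
  have := HV y y0 n1; rewrite ltr0_norm // => Vy.
  apply: (@le_trans _ _ (nu y)); last first.
    by apply: (ps_nu_le ps); have : 0 <= d%:R :> R by []; lra.
  rewrite -[leRHS]lnK ?posrE // ler_expR lerNl.
  apply: (@le_trans _ _ (4 / c / 2 * (c * - ln (nu y)))); last by rewrite ler_pM2l // divr_gt0.
  (* Half of t0 times the lower bound of [V] is 2 |log nu|; as nu < 1, this exceeds |log nu|, so the
     exponential is at most nu, which is at most [w]. *)
  have -> : 4 / c / 2 * (c * - ln (nu y)) = 2 * - ln (nu y) by field; rewrite gt_eqF.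
  lra.
- by move=> x; exact: occ_vpos_fin.
Qed.

Lemma potential_ge_of_domination (t0 D eps : R) : 0 < t0 -> 0 < D ->
  (forall x, (FK PP V t0 (fun=> 1) x <= (D * phi x)%:E)%E) -> 0 < eps ->
  exists2 r : R, 0 < r & forall x, r <= enorm x ->
    ((1 / (2 * t0))%:E <=
       ereal_sup [set (V y)%:E | y in eball x eps] / (`|ln (nu x)|)%:E)%E.
Proof.
(* The closed ball of radius eps / 2, in which the path stays, lies in the open ball over which the
   supremum is taken. *)
move=> t00 D0 HD eps0; have e2 : 0 < eps / 2 by rewrite divr_gt0.
have [p0 p00 Hp0] := stay_prob_gt0 HPP Hsym e2 t00.
have [C C0 HC] := decay_paths; have [C' C'0 HC'] := ps_le_nu ps.
have [Cn Cn0 Hn] := nu_small; have [r1 Hr1] := conf 0.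
pose K := (D * C) ^+ 4 * C' ^+ 3.
have K0 : 0 < K by rewrite mulr_gt0 // exprn_gt0 // mulr_gt0.
(* The last entry is made to contradict [H8], the others give V >= 0 and nu < 1. *)
pose r := Num.max (Num.max r1 (1 + d%:R)) (Num.max (Cn + 1) (K * Cn / p0 ^+ 4 + 1)).
have d0 : 0 <= d%:R :> R by [].
exists r; first by rewrite !lt_max; apply/orP; left; apply/orP; right; lra.
move=> x; rewrite !ge_max => /andP[/andP[xr1 x1] /andP[xCn xK]].
have [n0 nC] := Hn x x1.
have ex0 : 0 < enorm x by lra.
have n1 : nu x < 1.
  rewrite ltNge; apply/negP => n1; have : enorm x <= nu x * enorm x by rewrite ler_peMl // ltW.
  lra.
have l0 : ln (nu x) < 0 by rewrite ln_lt0 // n0.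
have al0 : 0 < `|ln (nu x)| by rewrite normr_gt0 lt_eqF.
have Vx : 0 <= V x by exact: Hr1.
set E := ereal_sup _.
have EV y : eball x eps y -> ((V y)%:E <= E)%E by move=> yb; apply: ereal_sup_ubound; exists y.
have xb : eball x eps x by rewrite /eball /= subrr enorm0.
rewrite inver gt_eqF //.
case: (E) EV => [S||] EV; last 2 first.
- by rewrite gt0_mulye ?leey // lte_fin invr_gt0.
- by have := EV x xb; rewrite leeNy_eq.
rewrite -EFinM lee_fin leNgt; apply/negP; rewrite ltr_pdivrMr // => Slt.
have {}EV y : enorm y <= eps / 2 -> V (x + y) <= S.
  move=> ye; rewrite -lee_fin; apply: EV; rewrite /eball /= [x + y]addrC addrK; lra.
have S0 : 0 <= S.
  by apply: (le_trans Vx); rewrite -[x in V x]addr0; apply: EV; rewrite enorm0 ltW.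
have := FK1_ge_stay PP mV t00 S0 EV => H1.
pose e := expR (- (S * t0)); have e0 : 0 < e by exact: expR_gt0.
have H2 : e * p0 <= D * phi x.
  rewrite -lee_fin; apply: le_trans (HD x); apply: le_trans H1.
  by rewrite EFinM; apply: lee_wpmul2l => //; rewrite lee_fin ltW.
have v0 : 0 < root4 w x by exact: root4_gt0.
have H3 : e * p0 <= D * C * root4 w x ^+ 3.
  by apply: (le_trans H2); rewrite -mulrA ler_pM2l.
have H4 : (e * p0) ^+ 4 <= (D * C) ^+ 4 * w x ^+ 3.
  have -> : (D * C) ^+ 4 * w x ^+ 3 = (D * C * root4 w x ^+ 3) ^+ 4.
    by rewrite -(root4X w0 x) [RHS]exprMn -!exprM.
  rewrite lerXn2r // nnegrE; first by rewrite mulr_ge0 // ltW.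
  by rewrite !mulr_ge0 ?exprn_ge0 // ltW.
have H5 : (e * p0) ^+ 4 <= K * nu x ^+ 3.
  apply: (le_trans H4); rewrite /K -mulrA ler_pM2l ?exprn_gt0 ?mulr_gt0 // -exprMn.
  rewrite lerXn2r ?nnegrE ?(ltW (w0 _)) //; first by rewrite mulr_ge0 // ltW.
  by apply: HC'; lra.
(* Negating the claim gives S t0 < |log nu| / 2, that is e > nu^(1/2). Against [H5], of order nu^3,
   one power of [nu] is left over. *)
have H6 : nu x ^+ 2 < e ^+ 4.
  have -> : e ^+ 4 = expR (4 * - (S * t0)) by rewrite expRM_natl.
  have -> : nu x ^+ 2 = expR (2 * ln (nu x)) by rewrite expRM_natl lnK.
  rewrite ltr_expR.
  have : S * t0 < 1 / (2 * t0) * `|ln (nu x)| * t0 by rewrite ltr_pM2r.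
  have -> : 1 / (2 * t0) * `|ln (nu x)| * t0 = `|ln (nu x)| / 2 by field; rewrite gt_eqF.
  rewrite ltr0_norm //; lra.
have H7 : p0 ^+ 4 <= K * nu x.
  have p4 : 0 < p0 ^+ 4 by rewrite exprn_gt0.
  have n2 : 0 < nu x ^+ 2 by rewrite exprn_gt0.
  have : nu x ^+ 2 * p0 ^+ 4 <= nu x ^+ 2 * (K * nu x).
    apply: (@le_trans _ _ (e ^+ 4 * p0 ^+ 4)); first by rewrite ler_pM2r // ltW.
    rewrite -exprMn; apply: (le_trans H5); rewrite exprSr mulrCA mulrA.
    by rewrite le_eqVlt; apply/orP; left; apply/eqP; ring.
  by rewrite ler_pM2l.
(* Since nu(x) |x| is bounded, the power of [nu] left over bounds |x|. *)
have H8 : p0 ^+ 4 * enorm x <= K * Cn.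
  apply: (@le_trans _ _ (K * nu x * enorm x)); first by rewrite ler_pM2r.
  by rewrite -mulrA ler_pM2l.
move: xK; rewrite -lerBrDr ler_pdivrMr ?exprn_gt0 // mulrBl mul1r [enorm x * _]mulrC.
have : 0 < p0 ^+ 4 by rewrite exprn_gt0.
lra.
Qed.

End path_level.

Lemma kato_small (R : realType) (d : nat) (disp : measure_display)
    (Omega : measurableType disp) (P : probability Omega R) (X : R -> Omega -> 'rV[R]_d)
    (g : 'rV[R]_d -> R) (e : R) : kato P X g -> (forall y, 0 <= g y) -> 0 < e ->
  exists2 t : R, 0 < t & forall x,
  (\int[P]_w \int[lebesgue_measure]_(s in `[0%R, t]) (g (x + X s w)%R)%:E <= e%:E)%E.
Proof.
move=> [mg cg] g0 e0.
have /nbhs_right0P[de /= de0 Hde] := cg _ (@open_ereal_lt' R 0%E e%:E e0).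
have de2 : 0 < de / 2 by rewrite divr_gt0.
exists (de / 2) => // x.
have := Hde (de / 2); rewrite /= sub0r normrN gtr0_norm // add0r => /(_ _ de2) H.
apply: ltW; apply: le_lt_trans (H _); last by lra.
apply: ereal_sup_ubound; exists x; first by [].
apply: eq_integral => w _; apply: eq_integral => s _.
by rewrite ger0_norm.
Qed.

Theorem theorem2p6 (R : realType) (d : nat) (hd : (0 < d)%N)
    (disp : measure_display) (Omega : measurableType disp)
    (P : probability Omega R) (X : R -> Omega -> 'rV[R]_d)
    (nu V : 'rV[R]_d -> R)
    (hX : regular_jump_levy P X nu)
    (hV : kato_potential P X V) (hVc : confining V)
    (lam : nat -> R) (phi : nat -> 'rV[R]_d -> R)
    (hphi : is_eigenbasis P X V lam phi) :
  (forall C13 : R, 0 < C13 ->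
     (exists2 r : R, 0 < r & forall x, r <= enorm x ->
        (C13%:E <= (V x)%:E / (`|ln (nu x)|)%:E)%E) ->
     gsd P X V (phi 0%N) (4 / C13)) /\
  (forall t0 : R, 0 < t0 -> gsd P X V (phi 0%N) t0 ->
     forall eps : R, 0 < eps <= 1 ->
     exists2 r : R, 0 < r & forall x, r <= enorm x ->
       ((1 / (2 * t0))%:E <=
          ereal_sup [set (V y)%:E | y in eball x eps] / (`|ln (nu x)|)%:E)%E).
Proof.
have [levy A1 _ _] := hX; have [mV kn kp] := hV.
have [mnu nu0 [N [_ Nfin [b [A [_ Apsd HL]]]] NE]] := A1_density A1.
have [w ps] := exists_profile hd mnu nu0 Nfin NE (A1_comparable A1)
  (A1_almost_decreasing A1) (A1_direct_jump A1).
have [PP [path [M [mpath mM M0 PPE pathE]]]] := exists_path_law levy.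
have HPP := PP_levy_law levy mpath mM M0 PPE pathE.
have sym := A1_symmetric A1.
have Hsym := PP_sym levy mpath mM M0 PPE pathE sym.
have Hchar h : 0 < h <= 1 -> sym_charfun N A PP (fun p : cpath R d => p h) h.
  by move=> /andP[/ltW h0 _]; apply: (PP_charfun levy mpath mM M0 PPE pathE sym HL h0).
have occE' := integral_occ_path mpath mM M0 PPE pathE.
(* The value 1/32 leaves room for four times the negative part in Khasminskii's lemma. *)
have [tau tau0 Hneg'] := kato_small kn (vneg_ge0 V) (ltac:(lra) : 0 < 1 / 32 :> R).
have Hneg x : (\int[PP]_p occ (vneg V) x tau p <= (1 / 32)%:E)%E.
  by rewrite -(occE' _ x tau (measurable_vneg mV) (vneg_ge0 V)); exact: Hneg'.
have Hloc r : 0 < r -> exists2 t : R, 0 < t & forall x,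
    (\int[PP]_p occ (fun y => vpos V y * \1_(eball 0 r) y)%R x t p <= (1 / 8)%:E)%E.
  move=> r0; have g0 y : 0 <= vpos V y * \1_(eball 0 r) y by rewrite mulr_ge0 ?vpos_ge0.
  have [t t0 Ht] := kato_small (kp.2 0 r r0) g0 (ltac:(lra) : 0 < 1 / 8 :> R).
  have mg : measurable_fun setT (fun y => vpos V y * \1_(eball 0 r) y).
    apply: measurable_funM; first exact: measurable_vpos.
    by apply: measurable_indic; exact: measurable_eball.
  by exists t => // x; rewrite -(occE' _ x t mg g0); exact: Ht.
have cphi : continuous (phi 0%N) by exact: (eigen_continuous hphi).
have [F phiF] := eigen_bounded hphi 0%N.
have phi0 := eigen_ground_gt0 hphi.
have mphi : measurable_fun setT (phi 0%N).
  by have /sub_Lfun_mfun := eigen_L2 hphi 0%N; rewrite inE.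
have fkE := feynman_kacE mpath mM M0 PPE pathE mV.
have fin x t : {ae PP, forall p, (occ (vneg V) x t p < +oo)%E}.
  exact: (occ_vneg_fin HPP mV tau0 Hneg).
have fk1 x t : 0 < t -> feynman_kac P X V t (cst 1) x = FK PP V t (fun=> 1%E) x.
  by move=> t0; rewrite fkE //; exact: ltW.
have eig t x : 0 < t -> FK PP V t (EFin \o phi 0%N) x = (expR (- lam 0%N * t) * phi 0%N x)%:E.
  move=> t0; rewrite -fkE //; [exact: (eigenE hphi)|exact: ltW|by move=> y; exact: ltW].
have phiF' y : phi 0%N y <= F by apply: le_trans (phiF y); exact: ler_norm.
split=> [c c0 [r r0 Hr]|t0 t00 [D D0 HD] eps /andP[eps0 _]].
  (* For nu(x) < 1 the logarithm is nonzero, so the extended quotient in the hypothesis is an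
     ordinary one and can be cleared. *)
  have HV x : r <= enorm x -> nu x < 1 -> c * `|ln (nu x)| <= V x.
    move=> rx n1; have := Hr x rx.
    have n0 : 0 < nu x.
      by apply: nu0; apply/eqP => x0; move: rx; rewrite x0 enorm0; lra.
    have l0 : 0 < `|ln (nu x)| by rewrite normr_gt0 lt_eqF // ln_lt0 // n0.
    by rewrite inver gt_eqF // -EFinM lee_fin ler_pdivlMr.
  have [D D0 HD] := domination_of_potential_ge HPP mnu nu0 Nfin NE Apsd ps Hchar mV hVc tau0 Hneg Hloc
    mphi phi0 cphi eig c0 HV.
  by exists D => // x; rewrite fk1 // divr_gt0.
apply: (potential_ge_of_domination hd HPP Hsym mnu nu0 Nfin NE Apsd ps Hchar mV hVc tau0 Hneg
  mphi phi0 phiF' eig t00 D0 _ eps0).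
by move=> x; rewrite -fk1.
Qed.
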